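(* Let $(f_n)_{n\in\overline{\mathsf N}}$ be a family of centered Gaussian processes as in the context (with $f_\infty$ non-zero and stationary), let $\nu_n$ be the zeros counting measures defined there, and assume that hypotheses $H_1(q)$ and $H_2(q)$ of the context are satisfied for all $q\ge1$. Assume that either $\mathsf N=\{1,2,3,\dots\}$, or $\mathsf N=(0,+\infty)$ and $f_n=f_\infty$ (on $nU$) for all $n\in(0,+\infty)$. Then, almost surely, for the vague topology on measures on $U$, $$\lim_{n\to+\infty}\frac1n\nu_n=\gamma_1\,\nu_\infty,$$ where $\nu_\infty$ is the Lebesgue measure on $U$ and $\gamma_1=\frac1\pi\sqrt{\frac{-r_\infty''(0)}{r_\infty(0)}}$.
   Context: Setting. $U$ is a non-empty open interval of $\mathbb R$ or of the one-dimensional torus $\mathbb T=\mathbb R/\ell\mathbb Z$ ($\ell>0$ fixed; $U=\mathbb T$ is allowed), with canonical distance $|\cdot|$. For $0<n<\infty$, $nU$ is the dilated interval, in $\mathbb R$ or in $n\mathbb T=\mathbb R/n\ell\mathbb Z$; by convention $(+\infty)U=\mathbb R$. $\mathsf N$ is an unbounded subset of $(0,+\infty)$ and $\overline{\mathsf N}=\mathsf N\cup\{+\infty\}$. All processes are defined on a common probability space. For each $n\in\overline{\mathsf N}$, $f_n$ is a centered Gaussian process on $nU$, and $f_\infty$ is a non-zero stationary centered Gaussian process on $\mathbb R$. Write $r_n(s,t)=\mathbb E[f_n(s)f_n(t)]$, $r_n^{(u,v)}(s,t)=\mathbb E[f_n^{(u)}(s)f_n^{(v)}(t)]$, and $r_\infty(s-t)=r_\infty(s,t)$.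 $H_1(q)$: the processes $f_n$, $n\in\overline{\mathsf N}$, are of class $\mathcal C^q$, and there is a uniformly continuous function $\psi$ on $U$, bounded below and above by positive constants, such that for all $u,v\le q$, uniformly for $x\in U$ and locally uniformly for $s,t\in\mathbb R$ (with $nx+s,nx+t\in nU$), $\lim_{n\to+\infty}r_n^{(u,v)}(nx+s,nx+t)=\psi(x)\,r_\infty^{(u,v)}(s,t)$. $H_2(q)$: there is a function $g:\mathbb R\to\mathbb R$, even, bounded and tending to zero at infinity, such that for all $u,v\le q$, $n\in\overline{\mathsf N}$ and $s,t\in nU$, $|r_n^{(u,v)}(s,t)|\le g(s-t)$ (in the torus case $g(s-t)$ means $g$ evaluated at the distance $|s-t|$), and for some constant $\omega>0$ the function $g_\omega(x)=\sup_{|u|\le\omega}g(x+u)$ is in $L^2(\mathbb R)$. Zeros. For $n\in\mathsf N$, $Z_n=\{x\in U: f_n(nx)=0\}$ and $\nu_n=\sum_{x\in Z_n}\delta_x$. Vague convergence means convergence of integrals against every continuous compactly supported function on $U$. *)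

(* Defs.v *)
From HB Require Import structures.
From mathcomp Require Export all_boot all_order all_algebra.
From mathcomp Require Export all_classical all_reals all_analysis.
Set Implicit Arguments.
Unset Strict Implicit.
Unset Printing Implicit Defensive.
Import Order.TTheory GRing.Theory Num.Theory.
Export numFieldNormedType.Exports.
Local Open Scope classical_set_scope.
Local Open Scope ring_scope.

(* The line and the circles are treated uniformly as the quotient R/pZ with
   p >= 0, the line being R/0Z. Points of R/pZ are represented by real numbers,
   subsets of R/pZ by p-periodic subsets of R, and functions on R/pZ by
   p-periodic functions. *)
Section quotient.
Context {R : realType}.
Implicit Types (p : R) (n : \bar R) (A : set R).

(* The preimage in R of the image of A in R/pZ. Open intervals of R/pZ, the
   whole circle included, are the images of open intervals of R. *)
Definition saturate p A : set R := [set x | exists k : int, A (x + k%:~R * p)].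

(* One representative of every point of R/pZ. *)
Definition fundamental_domain p : set R := [set x | p = 0 \/ 0 <= x < p].

Definition quotient_dist p (x y : R) : R :=
  inf [set `|x - y + k%:~R * p| | k in [set: int]].

Definition dilate n A : set R :=
  match n with
  | EFin r => [set r * x | x in A]
  | +oo%E => setT
  | -oo%E => set0
  end.

(* n(R/pZ) = R/(np)Z for finite n, and R for n = +oo. *)
Definition dilated_period n p : R := if n is EFin r then r * p else 0.

Definition add_infty (N : set R) : set (\bar R) := (EFin @` N) `|` [set +oo%E].

Definition unif_continuous_on p A (h : R -> R) :=
  forall e : R, 0 < e -> exists2 delta : R, 0 < delta &
    forall x y, A x -> A y -> quotient_dist p x y < delta -> `|h x - h y| < e.

(* Continuous functions with compact support in the open set of R/pZ whose
   preimage in R is U, extended by zero. *)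
Definition test_function p (U : set R) (phi : R -> R) :=
  [/\ continuous phi,
      forall x, phi (x + p) = phi x &
      exists K : set R, [/\ compact K, K `<=` U &
        forall x, phi x != 0 -> saturate p K x]].

End quotient.

Definition of_class {R : realType} (q : nat) (A : set R) (h : R -> R) :=
  (forall u, (u < q)%N -> forall s, A s -> derivable (derive1n u h) s 1) /\
  (forall s, A s -> {for s, continuous (derive1n q h)}).

Section processes.
Context {R : realType} {d : measure_display} {Omega : measurableType d}.
Variable P : probability Omega R.
Implicit Types (A : set R) (X : R -> Omega -> R).

(* The variance may vanish, in which case the law is a Dirac mass at 0. *)
Definition centered_gaussian_law (Y : Omega -> R) :=
  (forall B : set R, measurable B -> P (Y @^-1` B) = \d_(0 : R) B) \/
  (exists2 sigma : R, 0 < sigma &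
    forall B : set R, measurable B -> P (Y @^-1` B) = normal_prob 0 sigma B).

(* Centered Gaussian process on the subset of R/pZ with preimage A in R. *)
Definition centered_gaussian_process (p : R) A X :=
  [/\ forall s, A s -> measurable_fun setT (X s),
      forall s w, A s -> X (s + p) w = X s w &
      forall (k : nat) (s a : 'I_k -> R), (forall i, A (s i)) ->
        centered_gaussian_law (fun w => \sum_(i < k) a i * X (s i) w)].

Definition stationary X :=
  forall (h : R) (k : nat) (s : k.-tuple R) (B : set (k.-tuple R)),
    measurable B ->
    P [set w | B (map_tuple (fun t => X (t + h) w) s)] =
    P [set w | B (map_tuple (fun t => X t w) s)].

Definition non_zero X := exists s, ~ (\forall w \ae P, X s w = 0).

Definition derivative_process (u : nat) X (s : R) (w : Omega) : R :=
  derive1n u (X^~ w) s.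

Definition covariance_deriv X (u v : nat) (s t : R) : R :=
  fine 'E_P[fun w => derivative_process u X s w * derivative_process v X t w].

Definition reduced_covariance X (x : R) : R := covariance_deriv X 0 0 x 0.

Definition gamma1 X : R :=
  pi^-1 * Num.sqrt (- derive1n 2 (reduced_covariance X) 0 / reduced_covariance X 0).

(* In H1 and H2, U is the preimage in R of a subset of R/pZ and f n is a
   process on the n-fold dilation of this subset. *)
Definition H1 (p : R) (U N : set R) (f : \bar R -> R -> Omega -> R) (q : nat) :=
  (forall n, add_infty N n ->
    \forall w \ae P, of_class q (dilate n U) ((f n)^~ w)) /\
  exists psi : R -> R,
    [/\ unif_continuous_on p U psi,
        exists m M : R, 0 < m /\ forall x, U x -> m <= psi x <= M &
        forall u v, (u <= q)%N -> (v <= q)%N ->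
        forall a e : R, 0 < e -> \forall n \near within N (pinfty_nbhs R),
        forall x s t, U x -> `|s| <= a -> `|t| <= a ->
          dilate n%:E U (n * x + s) -> dilate n%:E U (n * x + t) ->
          `|covariance_deriv (f n%:E) u v (n * x + s) (n * x + t)
            - psi x * covariance_deriv (f +oo%E) u v s t| <= e].

Definition local_sup (g : R -> R) (omega x : R) : R :=
  sup [set g (x + u) | u in [set u | `|u| <= omega]].

Definition H2 (p : R) (U N : set R) (f : \bar R -> R -> Omega -> R) (q : nat) :=
  exists g : R -> R,
    [/\ forall x, g (- x) = g x,
        exists M, forall x, `|g x| <= M,
        g x @[x --> +oo] --> 0 /\ g x @[x --> -oo] --> 0,
        forall u v n s t, (u <= q)%N -> (v <= q)%N -> add_infty N n ->
          dilate n U s -> dilate n U t ->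
          `|covariance_deriv (f n) u v s t|
            <= g (quotient_dist (dilated_period n p) s t) &
        exists2 omega : R, 0 < omega &
          local_sup g omega \in Lfun (@lebesgue_measure R) 2%:E].

End processes.

Section dirac_sum.
Local Open Scope ereal_scope.
Context {d : measure_display} {T : measurableType d} {R : realType}.
Variable Z : set T.

Definition dirac_sum (A : set T) : \bar R := \esum_(x in Z) \d_x A.

Let dirac_sum0 : dirac_sum set0 = 0.
Proof. by apply: esum1 => x _; rewrite measure0. Qed.

Let dirac_sum_ge0 A : 0 <= dirac_sum A.
Proof. by apply: esum_ge0 => x _; exact: measure_ge0. Qed.

Let dirac_sum_sigma_additive : semi_sigma_additive dirac_sum.
Proof.
move=> F mF tF mU.
have -> : dirac_sum (\bigcup_n F n) = \sum_(0 <= n <oo) dirac_sum (F n).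
  rewrite nneseries_esumT; last by move=> n; exact: dirac_sum_ge0.
  transitivity (\esum_(x in Z) \esum_(n in [set: nat]) (\d_x (F n) : \bar R)).
    apply: eq_esum => x _.
    rewrite -nneseries_esumT; last by move=> n; exact: measure_ge0.
    apply/esym/cvg_lim => //.
    exact: measure_semi_sigma_additive.
  rewrite /dirac_sum !esum_esum; do ?by move=> *; exact: measure_ge0.
  rewrite (reindex_esum ([set: nat] `*` Z) _ (fun k => (k.2, k.1)))//.
  split.
  - by move=> [n x] [].
  - by move=> [n x] [m y] _ _ [-> ->].
  - by move=> [x n] [Zx _]; exists (n, x).
by apply: is_cvg_nneseries => n _ _; exact: dirac_sum_ge0.
Qed.

HB.instance Definition _ := isMeasure.Build d T R dirac_sum
  dirac_sum0 dirac_sum_ge0 dirac_sum_sigma_additive.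

End dirac_sum.

Section zeros.
Context {R : realType}.

(* Zeros in R/pZ are counted once, through their representative in the
   fundamental domain. *)
Definition zeros (p : R) (U : set R) (n : R) (h : R -> R) : set R :=
  [set x | [/\ U x, fundamental_domain p x & h (n * x) = 0]].

Definition zeros_measure (p : R) (U : set R) (n : R) (h : R -> R)
    : {measure set R -> \bar R} :=
  dirac_sum (zeros p U n h).

Definition lebesgue_integral_on (p : R) (U : set R) (phi : R -> R) : \bar R :=
  (\int[lebesgue_measure]_(x in U `&` fundamental_domain p) (phi x)%:E)%E.

End zeros.

(* Main.v *)
(* On a short interval [a, b] of I the number of zeros of f_n(n x) is compared with
   the number of sign changes of f_n along a grid of n k^5 cells of step
   h = (b - a) / k^5, where k is the integer part of n^(1/80). In a cell whose end
   values exceed k^(-9) in absolute value, a bound on f_n'' forces at most one zero;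
   in any other cell Rolle's theorem and a bound on a high derivative bound the number
   of zeros. Replacing the sign by the smooth x / sqrt (1 + x^2) at scale k^(-9), the
   count becomes a Lipschitz functional of the Gaussian vector of grid values, up to a
   sum of bumps 1 / (1 + x^2) at the same scale. The moments of its fluctuations are
   bounded by the Maurey-Pisier rotation argument in terms of the sum of |Cov|, which is
   small because g_omega is square integrable, so Borel-Cantelli applies. The
   expectation is computed by E[sg X sg Y] = 1 - 2 acos(rho) / pi, and H1 gives
   acos(rho) / h -> sqrt (- r''(0) / r(0)) uniformly over the grid.
   Rational intervals suffice for the almost sure statement; monotonicity of counts
   then gives all intervals and, when f_n = f_oo, all real n. Vague convergence follows
   by Riemann sums over translates of cells into I. *)

Require Import Defs.
From HB Require Import structures.
From mathcomp Require Import measurable_realfun ring lra zify.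
Set Implicit Arguments.
Unset Strict Implicit.
Unset Printing Implicit Defensive.
Import Order.TTheory GRing.Theory Num.Theory.
Local Open Scope classical_set_scope.
Local Open Scope ring_scope.

(** * Real-valued expectations *)

Section expectation.
Context {R : realType} {d : measure_display} {T : measurableType d}.
Variable P : probability T R.
Implicit Types (X Y Z : T -> R) (A : set T).

(** The hypotheses describe Gaussian vectors only through linear combinations, so joint densities
    are avoided: laws are compared on the class [tcl] of bounded iterated limits of trigonometric
    polynomials, which contains the sign and its smoothing by explicit constructions. The sign is
    not Lipschitz, so concentration is available for the smoothed count only, and the bumps measure
    what smoothing loses. The exponents answer competing demands. The threshold [k^(-9)] is the
    square of the step times the typical bound [k] on the second derivative. It must lie far below
    the step, for cells with small end values to be rare, while the Lipschitz constant [k^9] must be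
    beaten by the decay of correlations, for which [n >= k^80] leaves room. Rolle's theorem is used
    with the derivative of order [81], so that its failure has probability of order [n^(-2)] even
    after a union over all cells. Derivatives of the given processes exist only almost surely and
    need not be measurable, so each process is first set to zero on a null event. On a circle,
    intervals of at most half a period make the quotient distance the ordinary one. *)

Definition itg X := P.-integrable setT (EFin \o X).
Definition Ex X : R := (\int[P]_w X w)%R.

Lemma ExE X : itg X -> (Ex X)%:E = (\int[P]_w (X w)%:E)%E.
Proof. by move=> iX; rewrite /Ex /Rintegral fineK//; exact: integrable_fin_num. Qed.

Lemma itg_measurable X : itg X -> measurable_fun setT X.
Proof. by move=> /measurable_int /measurable_EFinP. Qed.

Lemma itg_le X Y : measurable_fun setT X -> itg Y -> (forall w, `|X w| <= Y w) ->
  itg X.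
Proof.
move=> mX iY XY; apply: (le_integrable measurableT _ _ iY).
  exact/measurable_EFinP.
move=> w _ /=; rewrite lee_fin; apply: (le_trans (XY w)).
by rewrite ler_norm.
Qed.

Lemma itg_cst (c : R) : itg (fun=> c).
Proof. exact: finite_measure_integrable_cst. Qed.

Lemma itg_bounded X (M : R) : measurable_fun setT X -> (forall w, `|X w| <= M) ->
  itg X.
Proof. by move=> mX; apply: itg_le => //; exact: itg_cst. Qed.

Lemma itgD X Y : itg X -> itg Y -> itg (fun w => X w + Y w).
Proof. by move=> iX iY; have := integrableD measurableT iX iY. Qed.

Lemma itgZ (c : R) X : itg X -> itg (fun w => c * X w).
Proof. by move=> iX; have := integrableZl measurableT c iX. Qed.

Lemma itgN X : itg X -> itg (fun w => - X w).
Proof. by move=> /(integrableN). Qed.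

Lemma itgB X Y : itg X -> itg Y -> itg (fun w => X w - Y w).
Proof. by move=> iX iY; apply: itgD => //; exact: itgN. Qed.

Lemma itg_norm X : itg X -> itg (fun w => `|X w|).
Proof. by move=> iX; exact: (integrable_norm iX). Qed.

Lemma itg_sum (I : Type) (s : seq I) (X : I -> T -> R) :
  (forall i, itg (X i)) -> itg (fun w => \sum_(i <- s) X i w).
Proof.
move=> iX; elim: s => [|i s IH].
  by under eq_fun do rewrite big_nil; exact: itg_cst.
by under eq_fun do rewrite big_cons; exact: itgD.
Qed.

Lemma eq_Ex X Y : (forall w, X w = Y w) -> Ex X = Ex Y.
Proof. by move=> /funext ->. Qed.

Lemma ExD X Y : itg X -> itg Y -> Ex (fun w => X w + Y w) = Ex X + Ex Y.
Proof. by move=> iX iY; exact: RintegralD. Qed.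

Lemma ExB X Y : itg X -> itg Y -> Ex (fun w => X w - Y w) = Ex X - Ex Y.
Proof. by move=> iX iY; exact: RintegralB. Qed.

Lemma ExZ (c : R) X : itg X -> Ex (fun w => c * X w) = c * Ex X.
Proof. by move=> iX; exact: RintegralZl. Qed.

Lemma ExN X : itg X -> Ex (fun w => - X w) = - Ex X.
Proof.
by move=> iX; under eq_Ex do rewrite -mulN1r; rewrite ExZ// mulN1r.
Qed.

Lemma Ex_cst (c : R) : Ex (fun=> c) = c.
Proof. by rewrite /Ex Rintegral_cst//= probability_setT mulr1. Qed.

Lemma Ex_le X Y : itg X -> itg Y -> (forall w, X w <= Y w) -> Ex X <= Ex Y.
Proof. by move=> iX iY XY; apply: le_Rintegral. Qed.

Lemma Ex_ge0 X : (forall w, 0 <= X w) -> 0 <= Ex X.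
Proof. by move=> X0; apply: Rintegral_ge0. Qed.

Lemma Ex_norm_le X : itg X -> `|Ex X| <= Ex (fun w => `|X w|).
Proof. exact: le_normr_Rintegral. Qed.

Lemma Ex_sum (I : Type) (s : seq I) (X : I -> T -> R) :
  (forall i, itg (X i)) ->
  Ex (fun w => \sum_(i <- s) X i w) = \sum_(i <- s) Ex (X i).
Proof.
move=> iX; elim: s => [|i s IH].
  by under eq_Ex do rewrite big_nil; rewrite Ex_cst big_nil.
under eq_Ex do rewrite big_cons.
by rewrite ExD// ?IH ?big_cons//; exact: itg_sum.
Qed.

Lemma Ex_dct (X : nat -> T -> R) X0 Y :
  (forall n, measurable_fun setT (X n)) -> itg Y ->
  (forall n w, `|X n w| <= Y w) ->
  (forall w, X ^~ w @ \oo --> X0 w) ->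
  itg X0 /\ (fun n => Ex (X n)) @ \oo --> Ex X0.
Proof.
move=> mX iY XY XX0.
have mX0 : measurable_fun setT X0.
  by apply: (@measurable_fun_cvg _ _ _ _ X) => // w _; exact: XX0.
have [] := @dominated_convergence _ T R P setT measurableT
  (fun n => EFin \o X n) (EFin \o X0) (EFin \o Y).
- by move=> n; exact/measurable_EFinP.
- exact/measurable_EFinP.
- by apply: aeW => w _; apply: cvg_EFin; [exact: nearW|exact: XX0].
- exact: iY.
- by apply: aeW => w n _ /=; rewrite lee_fin.
move=> iX0 _ /= h; split=> //.
rewrite /Ex /Rintegral; apply: fine_cvg.
by rewrite fineK//; exact: integrable_fin_num.
Qed.

Lemma Ex_fatou (X : nat -> T -> R) X0 (C : nat -> R) (c : R) :
  (forall n, itg (X n)) -> (forall n w, 0 <= X n w) ->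
  (forall w, X ^~ w @ \oo --> X0 w) ->
  (forall n, Ex (X n) <= C n) -> C @ \oo --> c ->
  itg X0 /\ Ex X0 <= c.
Proof.
move=> iX X_ge0 XX0 XC Cc.
have mX n : measurable_fun setT (X n) by exact: itg_measurable.
have mX0 : measurable_fun setT X0.
  by apply: (@measurable_fun_cvg _ _ _ _ X) => // w _; exact: XX0.
have X0_ge0 w : 0 <= X0 w.
  by rewrite -(cvg_lim _ (XX0 w))//; apply: limr_ge; [apply/cvg_ex; exists (X0 w)|exact: nearW].
have /= := @fatou _ T R P setT measurableT (fun n => EFin \o X n).
move=> /(_ (fun n => proj2 (measurable_EFinP _ _) (mX n))).
have p0 : forall n (x : T), [set: T] x -> (0 <= (X n x)%:E)%E by move=> n x _; rewrite lee_fin.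
move=> /(_ p0).
rewrite [X in (X <= _)%E -> _](_ : _ = \int[P]_w (X0 w)%:E)%E; last first.
  apply: eq_integral => w _; rewrite is_cvg_limn_einfE//.
    by apply/cvg_lim => //; apply: cvg_EFin; [exact: nearW|exact: XX0].
  by apply/cvg_ex; exists (X0 w)%:E; apply: cvg_EFin; [exact: nearW|exact: XX0].
move=> h.
have {}h : (\int[P]_w (X0 w)%:E <= c%:E)%E.
  apply: (le_trans h).
  rewrite (_ : c%:E = limn_einf (EFin \o C)).
    rewrite !limn_einf_lim; apply: lee_lim; [exact: is_cvg_einfs|exact: is_cvg_einfs|].
    apply: nearW => n; rewrite /einfs /=.
    apply: le_ereal_inf_tmp => _ [k nk <-].
    apply: (@le_trans _ _ (\int[P]_x (X k x)%:E)%E).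
      by apply: ereal_inf_lbound; exists k.
    by rewrite -ExE// lee_fin.
  rewrite is_cvg_limn_einfE.
    by apply/esym/cvg_lim => //; apply: cvg_EFin; [exact: nearW|exact: Cc].
  by apply/cvg_ex; exists c%:E; apply: cvg_EFin; [exact: nearW|exact: Cc].
have iX0 : itg X0.
  apply/integrableP; split; first exact/measurable_EFinP.
  under eq_integral do rewrite /= ger0_norm//.
  by apply: le_lt_trans h _; rewrite ltry.
by split => //; rewrite -lee_fin ExE.
Qed.

End expectation.

Section moments.
Context {R : realType} {d : measure_display} {T : measurableType d}.
Variable P : probability T R.
Implicit Types (X Y Z : T -> R) (A : set T).
Local Notation itg := (itg P).
Local Notation Ex := (Ex P).

Lemma probability_le_Ex A X (a : R) : measurable A -> itg X -> 0 < a ->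
  (forall w, 0 <= X w) -> (forall w, A w -> a <= X w) ->
  (P A <= (Ex X / a)%:E)%E.
Proof.
move=> mA iX a0 X0 aX.
have iA : itg (\1_A : T -> R).
  by apply: (@itg_bounded _ _ _ _ _ 1) => // w; rewrite ger0_norm// indicE; case: (_ \in _).
have -> : P A = (Ex (\1_A : T -> R))%:E.
  by rewrite ExE//= integral_indic// setIT.
rewrite lee_fin ler_pdivlMr// mulrC -ExZ//; apply: Ex_le => //; first exact: itgZ.
move=> w; rewrite indicE; case: (boolP (w \in A)) => [/set_mem|_]; rewrite ?mulr1 ?mulr0//.
exact: aX.
Qed.

(** Measurability of [X] is recorded separately because it does not follow from integrability of
    [X ^+ 2]. *)
Definition sqi X := measurable_fun setT X /\ itg (fun w => X w ^+ 2).

Lemma sqi_itg X : sqi X -> itg X.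
Proof.
move=> [mX iX]; apply: (@itg_le _ _ _ _ _ (fun w => 1 + X w ^+ 2)) => //.
  by apply: itgD => //; exact: itg_cst.
move=> w; rewrite ler_norml; apply/andP; split; nra.
Qed.

Lemma sqi_itgM X Y : sqi X -> sqi Y -> itg (fun w => X w * Y w).
Proof.
move=> [mX iX] [mY iY].
apply: (@itg_le _ _ _ _ _ (fun w => X w ^+ 2 + Y w ^+ 2)) => //.
- exact: measurable_funM.
- exact: itgD.
move=> w; rewrite ler_norml; apply/andP; split; nra.
Qed.

Lemma sqi_bounded X (M : R) : measurable_fun setT X -> (forall w, `|X w| <= M) -> sqi X.
Proof.
move=> mX XM; split=> //; apply: (@itg_bounded _ _ _ _ _ (M ^+ 2)).
  exact: measurable_funX.
by move=> w; rewrite normrX lerXn2r// ?nnegrE// (le_trans _ (XM w)).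
Qed.

Lemma sqi_cst (c : R) : sqi (fun=> c).
Proof. exact: (@sqi_bounded _ `|c|). Qed.

Lemma sqiZ (c : R) X : sqi X -> sqi (fun w => c * X w).
Proof.
move=> [mX iX]; split; first exact: measurable_funM.
by under eq_fun do rewrite exprMn; exact: itgZ.
Qed.

Lemma sqiD X Y : sqi X -> sqi Y -> sqi (fun w => X w + Y w).
Proof.
move=> sX sY; have [mX iX] := sX; have [mY iY] := sY; split; first exact: measurable_funD.
under eq_fun do rewrite sqrrD mulr2n.
have i1 := sqi_itgM sX sY.
by apply: itgD => //; apply: itgD => //; exact: itgD.
Qed.

Lemma sqiN X : sqi X -> sqi (fun w => - X w).
Proof. by move=> sX; under eq_fun do rewrite -mulN1r; exact: sqiZ. Qed.

Lemma sqiB X Y : sqi X -> sqi Y -> sqi (fun w => X w - Y w).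
Proof. by move=> sX sY; apply: sqiD => //; exact: sqiN. Qed.

Lemma Ex_CS X Y : sqi X -> sqi Y ->
  Ex (fun w => X w * Y w) ^+ 2 <= Ex (fun w => X w ^+ 2) * Ex (fun w => Y w ^+ 2).
Proof.
move=> sX sY; have [mX iX] := sX; have [mY iY] := sY; have iXY := sqi_itgM sX sY.
set a := Ex (fun w => X w ^+ 2); set b := Ex _; set c := Ex (fun w => Y w ^+ 2).
have h t : 0 <= a + 2 * t * b + t ^+ 2 * c.
  rewrite /a /b /c -ExZ// -ExZ// -ExD//; last by exact: itgZ.
  rewrite -ExD; [|apply: itgD => //; exact: itgZ|exact: itgZ].
  by apply: Ex_ge0 => w; have := sqr_ge0 (X w + t * Y w); lra.
have a0 : 0 <= a by apply: Ex_ge0 => w; exact: sqr_ge0.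
have c0 : 0 <= c by apply: Ex_ge0 => w; exact: sqr_ge0.
have [c_eq0|c_neq0] := eqVneq c 0.
  rewrite c_eq0 mulr0; have [->|bn0] := eqVneq b 0; first by rewrite expr0n.
  (* With [c = 0] the quadratic is affine in [t], and this [t] gives it the impossible value
     [-1]. *)
  have := h (- (a + 1) / (2 * b)); rewrite c_eq0 mulr0 addr0.
  rewrite (_ : 2 * _ * b = - (a + 1)); last by field.
  by lra.
have := h (- b / c).
rewrite (_ : _ + _ + _ = (a * c - b ^+ 2) / c); last by field.
by rewrite pmulr_lge0 ?subr_ge0// invr_gt0 lt0r c_neq0.
Qed.

Lemma Ex_sqr_le X : sqi X -> Ex X ^+ 2 <= Ex (fun w => X w ^+ 2).
Proof.
move=> sX; have := Ex_CS sX (sqi_cst 1).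
by under eq_Ex do rewrite mulr1; rewrite expr1n Ex_cst mulr1.
Qed.

(* Vitali's convergence theorem under a bound on second moments: [y <= min(y, A) + y^2 / A]. *)
Lemma Ex_cvg_sqi (X : nat -> T -> R) X0 (C : R) :
  (forall n, sqi (X n)) -> (forall n, Ex (fun w => X n w ^+ 2) <= C) ->
  (forall w, X ^~ w @ \oo --> X0 w) ->
  [/\ sqi X0, Ex (fun w => X0 w ^+ 2) <= C & (fun n => Ex (X n)) @ \oo --> Ex X0].
Proof.
move=> sX XC XX0.
have mX n : measurable_fun setT (X n) by exact: (sX n).1.
have mX0 : measurable_fun setT X0.
  by apply: (@measurable_fun_cvg _ _ _ _ X) => // w _; exact: XX0.
have [iX0 X0C] : itg (fun w => X0 w ^+ 2) /\ Ex (fun w => X0 w ^+ 2) <= C.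
  apply: (@Ex_fatou _ _ _ _ (fun n w => X n w ^+ 2) _ (fun=> C)) => //.
  - by move=> n; exact: (sX n).2.
  - by move=> n w; exact: sqr_ge0.
  - by move=> w; under eq_fun do rewrite expr2; rewrite expr2; apply: cvgM.
  - exact: cvg_cst.
have sX0 : sqi X0 by [].
split=> //.
have C0 : 0 <= C by apply: le_trans X0C; apply: Ex_ge0 => w; exact: sqr_ge0.
pose Y n w := `|X n w - X0 w|.
have sD n : sqi (fun w => X n w - X0 w) by exact: sqiB.
have iY2 n : itg (fun w => Y n w ^+ 2).
  by rewrite /Y; under eq_fun do rewrite real_normK ?num_real//; exact: (sD n).2.
have Y2C n : Ex (fun w => Y n w ^+ 2) <= 4 * C.
  apply: (@le_trans _ _ (Ex (fun w => 2 * X n w ^+ 2 + 2 * X0 w ^+ 2))).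
    apply: Ex_le => //.
      by apply: itgD; apply: itgZ => //; exact: (sX n).2.
    by move=> w; rewrite /Y real_normK ?num_real//; have := sqr_ge0 (X n w + X0 w); lra.
  rewrite ExD; [|apply: itgZ; exact: (sX n).2|exact: itgZ].
  rewrite !ExZ//; last exact: (sX n).2.
  by have := XC n; lra.
have mY n : measurable_fun setT (Y n).
  by apply: measurableT_comp => //; exact: (sD n).1.
apply/cvgrPdist_le => e e0.
(* The second moment of [Y n] is at most [4 * C], so at this level the tail term is at most [e / 2];
   the [+ 1] keeps [A] positive when [C = 0]. *)
pose A := 8 * (C + 1) / e.
have A0 : 0 < A by rewrite divr_gt0// mulr_gt0//; lra.
have [_ hmin] : itg (fun=> 0) /\
    (fun n => Ex (fun w => Num.min (Y n w) A)) @ \oo --> Ex (fun=> (0 : R)).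
  apply: (@Ex_dct _ _ _ _ _ _ (fun=> A)).
  - by move=> n; apply: measurable_minr => //; exact: measurable_cst.
  - exact: itg_cst.
  - move=> n w; rewrite ger0_norm; first by rewrite ge_min lexx orbT.
    by rewrite le_min normr_ge0 ltW.
  move=> w; apply: (@squeeze_cvgr _ _ _ _ (fun=> 0) (Y ^~ w)).
  - by apply: nearW => n; rewrite le_min normr_ge0 (ltW A0) ge_min lexx.
  - exact: cvg_cst.
  - by apply/norm_cvg0P; rewrite -(subrr (X0 w)); apply: cvgB => //; exact: cvg_cst.
move/cvgrPdist_le : hmin => /(_ (e / 2)).
rewrite Ex_cst => /(_ _)[|N _ hN]; first by lra.
exists N => // n /hN /=; rewrite sub0r normrN => hn.
have imin : itg (fun w => Num.min (Y n w) A).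
  apply: (@itg_bounded _ _ _ _ _ A).
    by apply: measurable_minr => //; exact: measurable_cst.
  move=> w; rewrite ger0_norm; first by rewrite ge_min lexx orbT.
  by rewrite le_min normr_ge0 ltW.
rewrite distrC -ExB; [|exact: sqi_itg|exact: sqi_itg].
apply: (le_trans (Ex_norm_le (sqi_itg (sD n)))).
apply: (@le_trans _ _ (Ex (fun w => Num.min (Y n w) A + A^-1 * Y n w ^+ 2))).
  apply: Ex_le; first by apply: itg_norm; exact: sqi_itg.
    by apply: itgD => //; exact: itgZ.
  move=> w; rewrite -/(Y n w); have Y0 : 0 <= Y n w by exact: normr_ge0.
  have [YA|AY] := leP (Y n w) A.
    by rewrite lerDl mulr_ge0 ?sqr_ge0// invr_ge0 ltW.
  have : Y n w <= A^-1 * Y n w ^+ 2; last by lra.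
  by rewrite expr2 mulrA ler_peMl// mulrC ler_pdivlMr// mul1r ltW.
rewrite ExD//; last exact: itgZ.
rewrite ExZ//.
have h1 : A^-1 * Ex (fun w => Y n w ^+ 2) <= e / 2.
  apply: (@le_trans _ _ (A^-1 * (4 * C))); first by rewrite ler_pM2l ?invr_gt0.
  rewrite mulrC ler_pdivrMr// /A.
  rewrite (_ : e / 2 * _ = 4 * (C + 1)); last by field; lra.
  by lra.
have := ler_norm (Ex (fun w => Num.min (Y n w) A)); lra.
Qed.

End moments.

Section sequential_derivative.
Context {R : realType}.

(** Dominated convergence is stated for sequences; this brings derivatives of expectations within
    its reach. *)
Lemma cvg_dnbhs_seq (f : R -> R) (p l : R) :
  (forall u : nat -> R, (forall n, u n != p) -> u @ \oo --> p ->
     (fun n => f (u n)) @ \oo --> l) ->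
  f x @[x --> p^'] --> l.
Proof.
move=> h.
have hr : f x @[x --> p^'+] --> l.
  by apply/cvg_at_rightP => u [up uc]; apply: h => // n; rewrite gt_eqF.
have hl : f x @[x --> p^'-] --> l.
  by apply/cvg_at_leftP => u [up uc]; apply: h => // n; rewrite lt_eqF.
apply/cvgrPdist_le => e e0.
have [a /= a0 ha] := proj1 (cvgrPdist_le _ _) hr e e0.
have [b /= b0 hb] := proj1 (cvgrPdist_le _ _) hl e e0.
exists (Num.min a b) => /=; first by rewrite lt_min a0 b0.
move=> z /=; rewrite lt_min => /andP[za zb]; rewrite neq_lt => /orP[zp|pz].
  exact: hb.
exact: ha.
Qed.

(** Dropping finitely many terms of a null sequence makes all increments at most [e], so domination
    and domain conditions are needed near [x] only. *)
Lemma is_derive_seq (f : R -> R) (x l e : R) : 0 < e ->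
  (forall u : nat -> R, (forall n, u n != 0) -> (forall n, `|u n| <= e) -> u @ \oo --> 0 ->
     (fun n => (f (x + u n) - f x) / u n) @ \oo --> l) ->
  is_derive x 1 f l.
Proof.
move=> e0 h.
have H : h^-1 *: (f (h *: 1 + x) - f x) @[h --> 0^'] --> l.
  apply: cvg_dnbhs_seq => u u0 uc.
  have /cvgrPdist_le /(_ e e0) [N _ hN] := uc.
  rewrite -(cvg_shiftn N) /=.
  have u1 n : `|u (n + N)%N| <= e.
    by have /= := hN (n + N)%N (leq_addl _ _); rewrite sub0r normrN.
  have uc' : (fun n => u (n + N)%N) @ \oo --> 0 by rewrite (cvg_shiftn N).
  have := h _ (fun n => u0 (n + N)%N) u1 uc'; apply: cvg_trans.
  apply: near_eq_cvg; apply: nearW => n /=.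
  by rewrite scaler1 [u _ + x]addrC mulrC.
apply: DeriveDef; first by apply/cvg_ex; exists l.
exact/cvg_lim.
Qed.

Lemma is_derive_cvg_seq (f : R -> R) (x l : R) (u : nat -> R) :
  is_derive x 1 f l -> (forall n, u n != 0) -> u @ \oo --> 0 ->
  (fun n => (f (x + u n) - f x) / u n) @ \oo --> l.
Proof.
move=> [df dl] u0 uc.
have H : h^-1 *: (f (h *: 1 + x) - f x) @[h --> 0^'] --> l.
  by rewrite -dl; exact: df.
have uc' : u @ \oo --> 0^'.
  move=> A /= [e /= e0 He].
  move/cvgrPdist_lt : uc => /(_ _ e0)[N _ hN]; exists N => // n /hN /= hn.
  by apply: He => //=.
have := cvg_comp _ _ uc' H.
apply: cvg_trans; apply: near_eq_cvg; apply: nearW => n /=.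
by rewrite scaler1 [u n + x]addrC mulrC.
Qed.

End sequential_derivative.

Section derive_expectation.
Context {R : realType} {d : measure_display} {T : measurableType d}.
Variable P : probability T R.

(** The Lipschitz bound says that the difference quotients are dominated by [Y], so dominated
    convergence applies along every sequence of increments. *)
Lemma is_derive_Ex (X : R -> T -> R) (X' Y : T -> R) (t : R) :
  (forall s, itg P (X s)) -> itg P Y ->
  (forall s w, `|s - t| <= 1 -> `|X s w - X t w| <= `|s - t| * Y w) ->
  (forall w, is_derive t 1 (X ^~ w) (X' w)) ->
  itg P X' /\ is_derive t 1 (fun s => Ex P (X s)) (Ex P X').
Proof.
move=> iX iY XY dX.
have key (u : nat -> R) : (forall n, u n != 0) -> (forall n, `|u n| <= 1) -> u @ \oo --> 0 ->
    itg P X' /\ (fun n => (Ex P (X (t + u n)) - Ex P (X t)) / u n) @ \oo --> Ex P X'.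
  move=> u0 u1 uc.
  have [iX' h] : itg P X' /\
      (fun n => Ex P (fun w => (u n)^-1 * (X (t + u n) w - X t w))) @ \oo --> Ex P X'.
    apply: (@Ex_dct _ _ _ _ _ _ Y) => //.
    - move=> n; apply: itg_measurable; apply: itgZ; exact: itgB.
    - move=> n w; rewrite normrM normfV mulrC ler_pdivrMr ?normr_gt0//.
      by rewrite mulrC; have := XY (t + u n) w; rewrite [t + u n - t](_ : _ = u n); [apply|ring].
    - move=> w; have := is_derive_cvg_seq (dX w) u0 uc.
      by under eq_fun do rewrite mulrC.
  split=> //; move: h; apply: cvg_trans; apply: near_eq_cvg; apply: nearW => n.
  by rewrite ExZ ?ExB 1?mulrC//; exact: itgB.
split; last by apply: (is_derive_seq ltr01) => u u0 u1 uc; exact: (key u u0 u1 uc).2.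
(* Integrability of [X'] needs just one admissible sequence of increments. *)
apply: (proj1 (key (fun n => n.+1%:R^-1) _ _ _)).
- by move=> n; rewrite invr_neq0.
- by move=> n; rewrite ger0_norm// invf_le1// ler1n.
exact: cvg_harmonic.
Qed.

End derive_expectation.

Section density.
Local Open Scope ereal_scope.
Context {R : realType} {d : measure_display} {T : measurableType d}.
Variables mu nu : {measure set T -> \bar R}.
Variable p : T -> R.
Hypothesis p_ge0 : forall x, (0 <= p x)%R.
Hypothesis mp : measurable_fun setT p.
Hypothesis nuE : forall A, measurable A -> nu A = \int[mu]_(x in A) (p x)%:E.

Import HBNNSimple.

(** The hypothesis on [nu] is the case of indicators; linearity gives simple functions and monotone
    convergence the rest. *)
Lemma ge0_integral_density (f : T -> \bar R) : measurable_fun setT f ->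
  (forall x, 0 <= f x) -> \int[nu]_x f x = \int[mu]_x (f x * (p x)%:E).
Proof.
move=> mf f0; pose f_ := nnsfun_approx measurableT mf.
have f_cvg x : EFin \o f_^~ x @ \oo --> f x by apply: cvg_nnsfun_approx.
transitivity (limn (fun n => \int[nu]_x (f_ n x)%:E)).
  rewrite -monotone_convergence//.
  - by apply: eq_integral => x _; apply/esym/cvg_lim => //; exact: f_cvg.
  - by move=> n; exact/measurable_EFinP/measurable_funP.
  - by move=> n y _; rewrite lee_fin.
  - by move=> y _ m n mn; rewrite lee_fin; exact/lefP/nd_nnsfun_approx.
rewrite [X in limn X](_ : _ = (fun n => \int[mu]_x ((f_ n x)%:E * (p x)%:E))).
  rewrite -monotone_convergence//.
  - apply: eq_integral => x _; apply/cvg_lim => //.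
    by apply: cvgeZr => //; exact: f_cvg.
  - by move=> n; apply: emeasurable_funM; exact/measurable_EFinP.
  - by move=> n y _; rewrite mule_ge0// lee_fin.
  - by move=> y _ m n mn; rewrite lee_wpmul2r// lee_fin//; exact/lefP/nd_nnsfun_approx.
apply/funext => n.
transitivity (\sum_(k \in range (f_ n)) \int[mu]_x ((k * \1_(f_ n @^-1` [set k]) x)%:E * (p x)%:E)).
  under eq_integral do rewrite fimfunE -fsumEFin//.
  rewrite ge0_integral_fsum//; last 2 first.
  - by move=> y; exact/measurable_EFinP/measurable_funM.
  - by move=> y x _; rewrite nnfun_muleindic_ge0.
  apply: eq_fsbigr => r _; rewrite integralZl_indic_nnsfun// integral_indic//= setIT.
  rewrite nuE//.
  have [r0|r0] := leP 0%R r; last first.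
    rewrite preimage_nnfun0// integral_set0 mule0; apply/esym/integral0_eq => x _.
    by rewrite indic0 mulr0 mul0e.
  rewrite -ge0_integralZl_EFin//; last 2 first.
  - by move=> x _; rewrite lee_fin.
  - exact/measurable_EFinP/measurable_funTS.
  rewrite integral_mkcond; apply: eq_integral => x _.
  rewrite patchE indicE; case: ifPn => _; first by rewrite mulr1.
  by rewrite mulr0 mul0e.
rewrite -ge0_integral_fsum//.
- apply: eq_integral => x _; rewrite [in RHS]fimfunE -fsumEFin// ge0_mule_fsuml//.
  by move=> i; rewrite nnfun_muleindic_ge0.
- move=> r; apply: emeasurable_funM; last exact/measurable_EFinP.
  exact/measurable_EFinP/measurable_funM.
- by move=> r x _; rewrite mule_ge0 ?nnfun_muleindic_ge0// lee_fin.
Qed.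

End density.

Section real_bounds.
Context {R : realType}.
Implicit Types x y : R.

Lemma norm_cosB x y : `|cos x - cos y| <= `|x - y|.
Proof.
have H (a b : R) : b <= a -> `|cos a - cos b| <= `|a - b|.
  move=> ba; have [|c _ ->] := @MVT_segment R cos (fun z => - sin z) b a ba.
    by apply: continuous_subspaceT => z; exact: continuous_cos.
  by rewrite normrM normrN ler_piMl// sin_max.
have [/H//|/ltW/H] := leP y x.
by rewrite distrC [in leRHS]distrC.
Qed.

Lemma norm_expRB1 x : `|expR x - 1| <= `|x| * expR `|x|.
Proof.
have h1 := expR_ge1Dx x; have h2 := expR_ge1Dx (- x).
have [x0|x0] := leP 0 x.
  rewrite ger0_norm ?ger0_norm//; last by lra.
  have : expR x * expR (- x) = 1 by exact: expRxMexpNx_1.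
  have := expR_gt0 x; nra.
rewrite ler0_norm; last by rewrite subr_le0 -[leRHS]expR0 ler_expR ltW.
rewrite ltr0_norm//; have : 1 <= expR (- x) by rewrite -[leLHS]expR0 ler_expR; lra.
nra.
Qed.

Lemma ler_expR_norm x : expR `|x| <= expR x + expR (- x).
Proof.
have [x0|x0] := leP 0 x; first by rewrite ger0_norm// lerDl expR_ge0.
by rewrite ltr0_norm// lerDr expR_ge0.
Qed.

End real_bounds.

Section translation.
Context {R : realType}.
Local Notation mu := (@lebesgue_measure R).

Lemma lebesgue_measure_translation (a : R) (A : set R) : measurable A ->
  pushforward mu ((fun x => x + a) : _ -> measurableTypeR R) A = mu A.
Proof.
have mt : measurable_fun setT ((fun x => x + a) : R -> measurableTypeR R).
  exact: measurable_funD.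
move=> mA; apply/esym/lebesgue_measure_unique => //= _ [[b c]] _ <-.
rewrite /pushforward (_ : _ @^-1` _ = `]b - a, c - a]%classic).
  rewrite !lebesgue_measure_itv/= !lte_fin ltrD2r; case: ifPn => // _.
  by rewrite -!EFinB; congr (_%:E); ring.
by apply/seteqP; split => x /=; rewrite !in_itv/= ltrBlDr lerBrDr.
Qed.

Lemma ge0_integral_translation (a : R) (f : R -> \bar R) :
  measurable_fun setT f -> (forall x, 0 <= f x)%E ->
  (\int[mu]_x f (x + a)%R = \int[mu]_x f x)%E.
Proof.
move=> mf f0.
have mt : measurable_fun (setT : set (measurableTypeR R))
    ((fun x => x + a) : measurableTypeR R -> measurableTypeR R).
  exact: measurable_funD.
have := @ge0_integral_pushforward _ _ _ _ R _ mt mu setT f measurableT mf _.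
rewrite preimage_setT /comp => <-; last by move=> y _; exact: f0.
by apply: eq_measure_integral => //= A mA _; exact: lebesgue_measure_translation.
Qed.

End translation.

(** * Normal laws and Gaussian variables *)

Section normal_law.
Context {R : realType} {d : measure_display} {T : measurableType d}.
Variables (P : probability T R) (Y : T -> R) (s : R).
Hypothesis mY : measurable_fun setT Y.
Hypothesis s_gt0 : 0 < s.
Hypothesis lawY : forall B : set R, measurable B -> P (Y @^-1` B) = normal_prob 0 s B.
Local Notation mu := (@lebesgue_measure R).
Local Notation v := (s ^+ 2).

Let s0 : s != 0. Proof. by rewrite gt_eqF. Qed.
Let v0 : 0 < v. Proof. by rewrite exprn_gt0. Qed.

Lemma ge0_integral_normal_law (phi : R -> R) :
  measurable_fun setT phi -> (forall x, 0 <= phi x) ->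
  (\int[P]_w (phi (Y w))%:E = \int[mu]_x (phi x * normal_pdf 0 s x)%:E)%E.
Proof.
move=> mphi phi0.
rewrite -[LHS](@ge0_integral_pushforward _ _ _ _ _ (Y : T -> measurableTypeR R) mY P setT (EFin \o phi))//; last 2 first.
- exact/measurable_EFinP.
- by move=> y _; rewrite lee_fin.
rewrite (@ge0_integral_density _ _ _ mu _ (normal_pdf 0 s)) //.
- by move=> x; exact: normal_pdf_ge0.
- exact: measurable_normal_pdf.
- exact/measurable_EFinP.
Qed.

(** Completing the square turns the exponential weight into a shift of the mean by [l * v], and the
    shifted density has mass one. *)
Lemma integral_expR_normal (l : R) :
  (\int[P]_w (expR (l * Y w))%:E = (expR (l ^+ 2 * v / 2))%:E)%E.
Proof.
rewrite (@ge0_integral_normal_law (fun x => expR (l * x))); last 2 first.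
- by apply: measurableT_comp => //; exact: measurable_funM.
- by move=> x; exact: expR_ge0.
transitivity (\int[mu]_x ((expR (l ^+ 2 * v / 2))%:E * (normal_pdf (l * v) s x)%:E))%E.
  apply: eq_integral => x _; rewrite -EFinM; congr (_%:E).
  rewrite !normal_pdfE// mulrCA [RHS]mulrCA; congr (_ * _).
  rewrite /normal_fun -!expRD; congr expR; field.
  by [].
rewrite ge0_integralZl//=.
- by rewrite integral_normal_pdf mule1.
- by apply/measurable_EFinP; exact: measurable_normal_pdf.
- by move=> x _; rewrite lee_fin normal_pdf_ge0.
Qed.

Lemma itg_expR_normal (l : R) : itg P (fun w => expR (l * Y w)).
Proof.
apply/integrableP; split.
  by apply/measurable_EFinP; apply: measurableT_comp => //; exact: measurable_funM.
under eq_integral do rewrite /= ger0_norm ?expR_ge0//.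
by rewrite integral_expR_normal ltry.
Qed.

Lemma Ex_expR_normal (l : R) : Ex P (fun w => expR (l * Y w)) = expR (l ^+ 2 * v / 2).
Proof. by apply: EFin_inj; rewrite ExE ?integral_expR_normal//; exact: itg_expR_normal. Qed.

Lemma itg_expR_norm_normal (l : R) : itg P (fun w => expR (l * `|Y w|)).
Proof.
apply: (@itg_le _ _ _ _ _ (fun w => expR (l * Y w) + expR (- l * Y w))).
- by apply: measurableT_comp => //; apply: measurable_funM => //; exact: measurableT_comp.
- by apply: itgD; exact: itg_expR_normal.
move=> w; rewrite ger0_norm ?expR_ge0//.
have [y0|y0] := leP 0 (Y w); first by rewrite ger0_norm// lerDl expR_ge0.
by rewrite ltr0_norm// mulrN mulNr lerDr expR_ge0.
Qed.

Lemma sqi_normal : sqi P Y.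
Proof.
split=> //; apply: (@itg_le _ _ _ _ _ (fun w => 2 * expR (1 * `|Y w|))).
- exact: measurable_funX.
- by apply: itgZ; exact: itg_expR_norm_normal.
move=> w; rewrite ger0_norm ?sqr_ge0// -real_normK ?num_real// mul1r.
have /= := @expR_ge1Dxn R `|Y w| 1 (normr_ge0 _).
have -> : 2`!%:R = 2 :> R by [].
lra.
Qed.

(* The law of Y + e has density expR (e * x / v - e ^ 2 / (2 * v)) with respect to that of Y. *)
Lemma Ex_translation_normal (phi : R -> R) (M e : R) : measurable_fun setT phi ->
  (forall x, `|phi x| <= M) ->
  Ex P (fun w => phi (Y w + e)) =
  Ex P (fun w => phi (Y w) * expR (e * Y w / v - e ^+ 2 / (2 * v))).
Proof.
move=> mphi phiM.
have ge0_case (h : R -> R) : measurable_fun setT h -> (forall x, 0 <= h x) ->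
    (\int[P]_w (h (Y w + e))%:E =
     \int[P]_w (h (Y w) * expR (e * Y w / v - e ^+ 2 / (2 * v)))%:E)%E.
  move=> mh h0.
  rewrite (@ge0_integral_normal_law (fun x => h (x + e))); last 2 first.
  - by apply: (measurableT_comp mh); exact: measurable_funD.
  - by move=> x; exact: h0.
  rewrite (@ge0_integral_normal_law (fun x => h x * expR (e * x / v - e ^+ 2 / (2 * v)))); last 2 first.
  - apply: measurable_funM => //; apply: measurableT_comp => //.
    by apply: measurable_funB => //; apply: measurable_funM => //; exact: measurable_funM.
  - by move=> x; rewrite mulr_ge0// expR_ge0.
  rewrite -(@ge0_integral_translation R e (fun x => (h x * expR (e * x / v - e ^+ 2 / (2 * v)) * normal_pdf 0 s x)%:E)).
  - apply: eq_integral => x _; congr (_%:E); rewrite -mulrA; congr (_ * _).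
    rewrite !normal_pdfE// mulrCA; congr (_ * _); rewrite /normal_fun -expRD; congr expR.
    by field.
  - apply/measurable_EFinP; apply: measurable_funM; last exact: measurable_normal_pdf.
    apply: measurable_funM => //; apply: measurableT_comp => //.
    by apply: measurable_funB => //; apply: measurable_funM => //; exact: measurable_funM.
  - by move=> x; rewrite lee_fin !mulr_ge0 ?expR_ge0// normal_pdf_ge0.
pose G w := expR (e * Y w / v - e ^+ 2 / (2 * v)).
have GE w : G w = expR (- (e ^+ 2 / (2 * v))) * expR (e / v * Y w).
  by rewrite /G -expRD; congr expR; ring.
have iG : itg P G by rewrite (funext GE); apply: itgZ; exact: itg_expR_normal.
have mG := itg_measurable iG.
have G0 w : 0 <= G w by exact: expR_ge0.
have iphi (h : R -> R) K : measurable_fun setT h -> (forall x, `|h x| <= K) ->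
    itg P (fun w => h (Y w + e)) /\ itg P (fun w => h (Y w) * G w).
  move=> mh hK; split.
    apply: (@itg_bounded _ _ _ _ _ K) => //.
    by apply: (measurableT_comp mh); exact: measurable_funD.
  apply: (@itg_le _ _ _ _ _ (fun w => K * G w)).
  - by apply: measurable_funM => //; exact: (measurableT_comp mh).
  - exact: itgZ.
  - by move=> w; rewrite normrM (ger0_norm (G0 w)) ler_wpM2r.
have M0 : 0 <= M by apply: le_trans (phiM 0).
have pos (h : R -> R) K : measurable_fun setT h -> (forall x, `|h x| <= K) ->
    (forall x, 0 <= h x) ->
    Ex P (fun w => h (Y w + e)) = Ex P (fun w => h (Y w) * G w).
  move=> mh hK h0; have [i1 i2] := iphi _ _ mh hK.
  by apply: EFin_inj; rewrite !ExE//; exact: ge0_case.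
have [i1 i2] := iphi _ _ mphi phiM.
(* The identity is known for nonnegative functions, so it is applied to [phi + M] and to the
   constant [1], and the constant is then removed. *)
have e1 : Ex P (fun w => phi (Y w + e) + M) = Ex P (fun w => (phi (Y w) + M) * G w).
  apply: (pos (fun x => phi x + M) (M + M)); first exact: measurable_funD.
  - by move=> x; rewrite (le_trans (ler_normD _ _))// lerD// ger0_norm.
  - by move=> x; rewrite -lerBlDr sub0r; have := phiM x; rewrite ler_norml => /andP[].
have e2 : Ex P (fun=> 1) = Ex P (fun w => 1 * G w).
  by apply: (pos (fun=> 1) 1) => // x; rewrite normr1.
move: e1; rewrite ExD//; last exact: itg_cst.
under [in RHS]eq_Ex do rewrite mulrDl.
rewrite ExD//; last exact: itgZ.
rewrite ExZ//; move: e2; under [in RHS]eq_Ex do rewrite mul1r; move=> <-.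
rewrite !Ex_cst mulr1 => /addIr ->; exact: eq_Ex.
Qed.

End normal_law.

Section normal_characteristic_function.
Context {R : realType} {d : measure_display} {T : measurableType d}.
Variables (P : probability T R) (Y : T -> R) (s : R).
Hypothesis mY : measurable_fun setT Y.
Hypothesis s_gt0 : 0 < s.
Hypothesis lawY : forall B : set R, measurable B -> P (Y @^-1` B) = normal_prob 0 s B.
Local Notation v := (s ^+ 2).

Let v0 : 0 < v. Proof. by rewrite exprn_gt0. Qed.

Let mcos (t b : R) : measurable_fun setT (fun w => cos (t * Y w + b)).
Proof.
apply: measurableT_comp; first by apply: continuous_measurable_fun => z; exact: continuous_cos.
by apply: measurable_funD => //; exact: measurable_funM.
Qed.

Let icos (t b : R) : itg P (fun w => cos (t * Y w + b)).
Proof. by apply: (@itg_bounded _ _ _ _ _ 1) => // w; exact: cos_max. Qed.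

Let mexp (e : R) : measurable_fun setT (fun w => expR (e * Y w / v - e ^+ 2 / (2 * v))).
Proof.
apply: measurableT_comp => //; apply: measurable_funB => //.
by apply: measurable_funM => //; exact: measurable_funM.
Qed.

Let iexp (e : R) : itg P (fun w => expR (e * Y w / v - e ^+ 2 / (2 * v))).
Proof.
rewrite (_ : (fun _ => _) =
  fun w => expR (- (e ^+ 2 / (2 * v))) * expR (e / v * Y w)); last first.
  by apply/funext => w; rewrite -expRD; congr expR; ring.
exact: itgZ (itg_expR_normal mY s_gt0 lawY _).
Qed.

(** Stein's identity. Differentiating both sides of [Ex_translation_normal] at [e = 0] takes the
    place of an integration by parts against the density. *)
Lemma Ex_stein_normal (t b : R) :
  t * v * Ex P (fun w => cos (t * Y w + b)) = Ex P (fun w => Y w * sin (t * Y w + b)).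
Proof.
(* With this phase the derivative in [e] of [cos (t * (Y w + e) + c)] at [0] is
   [t * cos (t * Y w + b)]. *)
pose c := b - pi / 2.
have sinE x : sin (x + b) = cos (x + c) by rewrite /c addrA cosBpihalf.
have cosE x : cos (x + b) = - sin (x + c) by rewrite /c addrA sinBpihalf opprK.
have [i1 d1] : itg P (fun w => t * cos (t * Y w + b)) /\
    is_derive (0 : R) 1 (fun e => Ex P (fun w => cos (t * (Y w + e) + c)))
      (Ex P (fun w => t * cos (t * Y w + b))).
  apply: (@is_derive_Ex _ _ _ _ (fun e w => cos (t * (Y w + e) + c)) _ (fun=> `|t|)).
  - move=> e; rewrite (_ : (fun _ => _) = fun w => cos (t * Y w + (t * e + c))) //.
    by apply/funext => w; congr cos; ring.
  - exact: itg_cst.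
  - move=> e w _; apply: (le_trans (norm_cosB _ _)); rewrite -normrM.
    by rewrite le_eqVlt; apply/orP; left; apply/eqP; congr (`| _ |); ring.
  - move=> w; apply: trigger_derive; rewrite cosE /GRing.scale/= addr0.
    by ring.
(* For [|e| <= 1] the exponent of the density ratio is at most [|e| * q], so its exponential differs
   from [1] by at most [|e| * q * expR q <= |e| * expR (2 * q)]; this is the dominating variable
   [K]. *)
pose q w := `|Y w| / v + (2 * v)^-1.
have q0 w : 0 <= q w.
  have v0' := ltW v0; apply: addr_ge0; first exact: divr_ge0.
  by rewrite invr_ge0; exact: mulr_ge0.
pose K w := expR (2 * q w).
have iK : itg P K.
  rewrite (_ : K = fun w => expR v^-1 * expR ((2 / v) * `|Y w|)); last first.
    by apply/funext => w; rewrite /K /q -expRD; congr expR; field; rewrite gt_eqF.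
  exact: itgZ (itg_expR_norm_normal mY s_gt0 lawY _).
have [i2 d2] : itg P (fun w => v^-1 * (Y w * sin (t * Y w + b))) /\
    is_derive (0 : R) 1
     (fun e => Ex P (fun w => cos (t * Y w + c) * expR (e * Y w / v - e ^+ 2 / (2 * v))))
     (Ex P (fun w => v^-1 * (Y w * sin (t * Y w + b)))).
  apply: (@is_derive_Ex _ _ _ _
    (fun e w => cos (t * Y w + c) * expR (e * Y w / v - e ^+ 2 / (2 * v))) _ K) => //.
  - move=> e; apply: (@itg_le _ _ _ _ _ (fun w => expR (e * Y w / v - e ^+ 2 / (2 * v)))) => //.
      exact: measurable_funM.
    by move=> w; rewrite normrM (ger0_norm (expR_ge0 _)) ler_piMl ?expR_ge0 ?cos_max.
  - move=> e w; rewrite subr0 => e1.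
    rewrite [0 * Y w]mul0r mul0r expr0n mul0r subr0 expR0 -mulrBr normrM.
    apply: (@le_trans _ _ (1 * `|expR (e * Y w / v - e ^+ 2 / (2 * v)) - 1|)).
      by rewrite ler_wpM2r ?cos_max.
    rewrite mul1r; apply: (le_trans (norm_expRB1 _)).
    set z := _ - _; have zq : `|z| <= `|e| * q w.
      apply: (le_trans (ler_normB _ _)); rewrite mulrDr lerD//.
        by rewrite !normrM normfV (ger0_norm (ltW v0)) mulrA.
      have v2 : 0 < 2 * v by exact: mulr_gt0.
      rewrite normrM normfV normrX (ger0_norm (ltW v2)).
      apply: ler_wpM2r; first by rewrite invr_ge0 ltW.
      by rewrite expr2 ler_piMl.
    have zq1 : `|z| <= q w by apply: (le_trans zq); rewrite ler_piMl.
    apply: (@le_trans _ _ (`|e| * q w * expR (q w))).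
      by apply: ler_pM => //; rewrite ?expR_ge0// ler_expR.
    rewrite -mulrA; apply: ler_wpM2l => //.
    rewrite /K (_ : 2 * q w = q w + q w); last by ring.
    rewrite [leRHS]expRD; apply: ler_wpM2r; first exact: expR_ge0.
    by apply: le_trans (expR_ge1Dx _); rewrite lerDr.
  - move=> w; apply: trigger_derive; rewrite sinE !mul0r expr0n mul0r subr0 expR0.
    by rewrite /GRing.scale/=; field; rewrite gt_eqF.
have d12 : (fun e => Ex P (fun w => cos (t * (Y w + e) + c))) =
    (fun e => Ex P (fun w => cos (t * Y w + c) * expR (e * Y w / v - e ^+ 2 / (2 * v)))).
  apply/funext => e.
  apply: (@Ex_translation_normal _ _ _ _ _ _ mY s_gt0 lawY (fun x => cos (t * x + c)) 1).
    apply: measurableT_comp; first by apply: continuous_measurable_fun => z; exact: continuous_cos.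
    by apply: measurable_funD => //; exact: measurable_funM.
  by move=> x; exact: cos_max.
have e1 := @derive_val _ _ _ _ _ _ _ d1.
have e2 := @derive_val _ _ _ _ _ _ _ d2.
have : Ex P (fun w => t * cos (t * Y w + b)) = Ex P (fun w => v^-1 * (Y w * sin (t * Y w + b))).
  by rewrite -e1 -e2 d12.
rewrite ExZ// => h.
rewrite [t * v]mulrC -mulrA h -ExZ//; apply: eq_Ex => w.
by rewrite mulVKf// gt_eqF.
Qed.

(** By Stein's identity [F] solves [F' = - x * v * F], hence its product with
    [expR (x ^+ 2 * v / 2)] is constant. *)
Lemma Ex_cos_normal (t b : R) :
  Ex P (fun w => cos (t * Y w + b)) = cos b * expR (- (t ^+ 2 * v / 2)).
Proof.
pose F (x : R) := Ex P (fun w => cos (x * Y w + b)).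
have dF (x : R) : is_derive x 1 F (- (x * v * F x)).
  have [i1] : itg P (fun w => - (Y w * sin (x * Y w + b))) /\
      is_derive x 1 F (Ex P (fun w => - (Y w * sin (x * Y w + b)))).
    apply: (@is_derive_Ex _ _ _ _ (fun x w => cos (x * Y w + b)) _ (fun w => `|Y w|)) => //.
    - by apply: itg_norm; exact: sqi_itg (sqi_normal mY s_gt0 lawY).
    - move=> e w _; apply: (le_trans (norm_cosB _ _)); rewrite -normrM.
      by rewrite le_eqVlt; apply/orP; left; apply/eqP; congr (`| _ |); ring.
    - move=> w; apply: trigger_derive; rewrite /GRing.scale/=; ring.
  have i2 : itg P (fun w => Y w * sin (x * Y w + b)).
    by have := itgN i1; under eq_fun do rewrite opprK.
  by rewrite ExN// -Ex_stein_normal.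
have h : F t * expR (t ^+ 2 * v / 2) = F 0 * expR (0 ^+ 2 * v / 2).
  pose G x := F x * expR (x ^+ 2 * v / 2).
  apply: (@is_derive_0_is_cst R G) => x; rewrite /G.
  have := dF x => dFx; apply: trigger_derive.
  by rewrite /GRing.scale/=; field.
have F0 : F 0 = cos b by rewrite /F; under eq_Ex do rewrite mul0r add0r; rewrite Ex_cst.
rewrite F0 expr0n !mul0r expR0 mulr1 in h.
by rewrite -h -/(F t) -mulrA -expRD subrr expR0 mulr1.
Qed.

End normal_characteristic_function.

Section real_bounds2.
Context {R : realType}.

Lemma norm_sin_le (x : R) : `|sin x| <= `|x|.
Proof.
have := norm_cosB (x - pi / 2) (0 - pi / 2).
by rewrite !cosBpihalf sin0 subr0 [_ - _ - _](_ : _ = x)//; ring.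
Qed.

Lemma cvg_inv_nat : (fun n : nat => n.+1%:R^-1 : R) @ \oo --> 0.
Proof. exact: cvg_harmonic. Qed.

Lemma expR_le_inv (x : R) : 0 <= x -> expR (- x) <= (1 + x)^-1.
Proof.
by move=> x0; rewrite expRN lef_pV2 ?posrE ?expR_gt0//; [exact: expR_ge1Dx|lra].
Qed.

End real_bounds2.

Section gaussian_variables.
Context {R : realType} {d : measure_display} {T : measurableType d}.
Variable P : probability T R.
Implicit Types (X Y : T -> R).
Local Notation itg := (itg P).
Local Notation Ex := (Ex P).
Local Notation sqi := (sqi P).

(** Centered Gaussian variable, possibly degenerate, in a form stable under pointwise limits. The
    phase [b] encodes cosine and sine transforms together; the exponential moments are only bounded
    above, which is what Fatou's lemma preserves. *)
Definition gl Y := [/\ sqi Y,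
  forall t b, Ex (fun w => cos (t * Y w + b)) =
              cos b * expR (- (t ^+ 2 * Ex (fun w => Y w ^+ 2) / 2)) &
  forall l, itg (fun w => expR (l * Y w)) /\
    Ex (fun w => expR (l * Y w)) <= expR (l ^+ 2 * Ex (fun w => Y w ^+ 2) / 2)].

Lemma measurable_cos_affine Y (t b : R) : measurable_fun setT Y ->
  measurable_fun setT (fun w => cos (t * Y w + b)).
Proof.
move=> mY; apply: measurableT_comp.
  by apply: continuous_measurable_fun => z; exact: continuous_cos.
by apply: measurable_funD => //; exact: measurable_funM.
Qed.

Lemma itg_cos_affine Y (t b : R) : measurable_fun setT Y ->
  itg (fun w => cos (t * Y w + b)).
Proof.
move=> mY; apply: (@itg_bounded _ _ _ _ _ 1); first exact: measurable_cos_affine.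
by move=> w; exact: cos_max.
Qed.

(** The variables [2 * (1 - cos (t * Y)) / t ^+ 2] are dominated by [Y ^+ 2] and tend to it as [t]
    tends to [0], while their means are difference quotients of [- 2 * expR (- (x * v / 2))] at
    [x = 0] with increment [t ^+ 2]. *)
Lemma cos_second_moment Y (v : R) : sqi Y ->
  (forall t, Ex (fun w => cos (t * Y w)) = expR (- (t ^+ 2 * v / 2))) ->
  Ex (fun w => Y w ^+ 2) = v.
Proof.
move=> sY h; pose t (n : nat) : R := n.+1%:R^-1.
have t_gt0 n : 0 < t n by rewrite invr_gt0.
have t0 n : t n != 0 by rewrite gt_eqF.
have tc : t @ \oo --> 0 by exact: cvg_inv_nat.
pose X n w := ((t n)^-1 * (2 * sin (t n * (Y w / 2)))) ^+ 2.
have mY := sY.1.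
have XE n w : X n w = 2 * (t n) ^- 2 * (1 - cos (t n * Y w)).
  have -> : t n * Y w = (t n * (Y w / 2)) *+ 2 by rewrite -mulr_natr; field.
  by rewrite cos_mulr2n /X exprMn exprMn sin2cos2 exprVn -mulr_natr; ring.
have [_ h1] : itg (fun w => Y w ^+ 2) /\ (fun n => Ex (X n)) @ \oo --> Ex (fun w => Y w ^+ 2).
  apply: (@Ex_dct _ _ _ _ _ _ (fun w => Y w ^+ 2)); last 3 first.
  - exact: sY.2.
  - move=> n w; rewrite ger0_norm ?sqr_ge0// -[leRHS]real_normK ?num_real//.
    rewrite /X -real_normK ?num_real//; apply: lerXn2r; rewrite ?nnegrE//.
    rewrite normrM normfV (ger0_norm (ltW (t_gt0 n))) mulrC ler_pdivrMr//.
    rewrite normrM (@ger0_norm _ 2)//.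
    apply: (@le_trans _ _ (2 * `|t n * (Y w / 2)|)).
      by rewrite ler_pM2l// norm_sin_le.
    rewrite !normrM (ger0_norm (ltW (t_gt0 n))) (@ger0_norm _ 2^-1)// le_eqVlt.
    by apply/orP; left; apply/eqP; field.
  - move=> w; rewrite /X expr2; under eq_fun do rewrite expr2.
    have hw : (fun n => (t n)^-1 * (2 * sin (t n * (Y w / 2)))) @ \oo --> Y w.
      have dS : is_derive (0 : R) 1 (fun x => 2 * sin (x * (Y w / 2))) (Y w).
        by apply: trigger_derive; rewrite mul0r cos0 /GRing.scale/=; field.
      have := is_derive_cvg_seq dS t0 tc.
      by under eq_fun do rewrite add0r mul0r sin0 mulr0 subr0 mulrC.
    exact: cvgM.
  - move=> n; rewrite (_ : X n = fun w => 2 * (t n) ^- 2 * (1 - cos (t n * Y w))).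
      apply: measurable_funM => //; apply: measurable_funB => //.
      by under eq_fun do rewrite -[t n * _]addr0; exact: measurable_cos_affine.
    by apply/funext => w; exact: XE.
have h2 : (fun n => Ex (X n)) @ \oo --> v.
  have EX n : Ex (X n) = - 2 * (expR (- (t n ^+ 2 * v / 2)) - expR (- (0 * v / 2))) / t n ^+ 2.
    under eq_Ex do rewrite XE.
    have ic : itg (fun w => cos (t n * Y w)).
      by under eq_fun do rewrite -[t n * _]addr0; exact: itg_cos_affine.
    rewrite ExZ; last by apply: itgB => //; exact: itg_cst.
    rewrite ExB//; last exact: itg_cst.
    by rewrite Ex_cst h !mul0r oppr0 expR0; ring.
  have dE : is_derive (0 : R) 1 (fun x => -2 * expR (- (x * v / 2))) v.
    by apply: trigger_derive; rewrite mul0r mul0r oppr0 expR0 /GRing.scale/=; field.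
  have u0 n : t n ^+ 2 != 0 by rewrite expf_neq0.
  have uc : (fun n => t n ^+ 2) @ \oo --> 0.
    by have := cvgM tc tc; rewrite mulr0; exact.
  have h3 := is_derive_cvg_seq dE u0 uc.
  suff -> : (fun n => Ex (X n)) = (fun n => (- 2 * expR (- ((0 + t n ^+ 2) * v / 2)) -
      - 2 * expR (- (0 * v / 2))) / t n ^+ 2) by exact: h3.
  by apply/funext => n; rewrite EX add0r; ring.
exact: (cvg_unique _ h1 h2).
Qed.

Lemma gl_normal Y (s : R) : measurable_fun setT Y -> 0 < s ->
  (forall B : set R, measurable B -> P (Y @^-1` B) = normal_prob 0 s B) ->
  gl Y /\ Ex (fun w => Y w ^+ 2) = s ^+ 2.
Proof.
move=> mY s0 lawY; have sY := sqi_normal mY s0 lawY.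
have e2 : Ex (fun w => Y w ^+ 2) = s ^+ 2.
  apply: cos_second_moment => // t; have := Ex_cos_normal mY s0 lawY t 0.
  by under eq_Ex do rewrite addr0; rewrite cos0 mul1r.
split=> //; split=> //.
- by move=> t b; rewrite e2; exact: Ex_cos_normal.
- move=> l; split; first exact: (itg_expR_normal mY s0 lawY).
  by rewrite e2 (Ex_expR_normal mY s0 lawY).
Qed.

Lemma Ex_ae0 X : measurable_fun setT X -> (\forall w \ae P, X w = 0) -> Ex X = 0.
Proof.
move=> mX X0; rewrite /Ex /Rintegral.
rewrite (ae_eq_integral (fun=> 0%E)) ?integral0//.
- exact/measurable_EFinP.
- by move: X0; apply: filterS => w /= -> _.
Qed.

Lemma eq_Ex_ae X Y : itg X -> itg Y -> (\forall w \ae P, X w = Y w) -> Ex X = Ex Y.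
Proof.
move=> iX iY XY; apply/eqP; rewrite -subr_eq0 -ExB//; apply/eqP/Ex_ae0.
  by apply: (@itg_measurable _ _ _ P); exact: itgB.
by move: XY; apply: filterS => w ->; rewrite subrr.
Qed.

Lemma gl_dirac Y : measurable_fun setT Y ->
  (forall B : set R, measurable B -> P (Y @^-1` B) = \d_(0 : R) B) ->
  gl Y /\ (\forall w \ae P, Y w = 0).
Proof.
move=> mY lawY.
have Y0 : \forall w \ae P, Y w = 0.
  exists (Y @^-1` ~` [set 0]); split.
  - by rewrite -[X in measurable X]setTI; apply: mY => //; exact: measurableC.
  - rewrite lawY; last exact: measurableC.
    by rewrite diracE memNset// => /(_ erefl).
  - by move=> w /= h; exact: h.
have fY (f : R -> R) : measurable_fun setT f -> (forall w, 0 <= f w) ->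
    itg (fun w => f (Y w)) /\ Ex (fun w => f (Y w)) = f 0.
  move=> mf f0.
  have mfY : measurable_fun setT (fun w => f (Y w)) by exact: measurableT_comp.
  have e : (\int[P]_w (f (Y w))%:E = (f 0)%:E)%E.
    rewrite (ae_eq_integral (fun=> (f 0)%:E)) //.
    - by rewrite integral_cst//= probability_setT mule1.
    - exact/measurable_EFinP.
    - by move: Y0; apply: filterS => w /= -> _.
  split; last by rewrite /Ex /Rintegral e.
  apply/integrableP; split; first exact/measurable_EFinP.
  by under eq_integral do rewrite /= ger0_norm//; rewrite e ltry.
have [||i2 e2] := fY (fun x => x ^+ 2).
- exact: measurable_funX.
- by move=> x; exact: sqr_ge0.
rewrite expr0n /= in e2.
split=> //; split; first by split.
- move=> t b; rewrite e2 mulr0 mul0r oppr0 expR0 mulr1.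
  rewrite -[RHS](Ex_cst P); apply: eq_Ex_ae; [exact: itg_cos_affine|exact: itg_cst|].
  by move: Y0; apply: filterS => w ->; rewrite mulr0 add0r.
- move=> l; rewrite e2 mulr0 mul0r expR0.
  have [|i3 ->] := fY (fun x => expR (l * x)) _ (fun x => expR_ge0 _).
    by apply: measurableT_comp => //; exact: measurable_funM.
  by rewrite mulr0 expR0.
Qed.

Lemma gl_law Y : measurable_fun setT Y -> centered_gaussian_law P Y -> gl Y.
Proof.
move=> mY [/(gl_dirac mY)[]//|[s s0 /(gl_normal mY s0)[]//]].
Qed.

(** Crude bound for the moment of order [2 * m] of a standard Gaussian: [y ^+ (2 * m)] is at most
    [(2 * m)!] times [expR y + expR (- y)], and each exponential has mean at most [expR 1]. *)
Definition gmom (m : nat) : R := (2 * m)`!%:R * (2 * expR 1).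

Lemma gmom_gt0 m : 0 < gmom m.
Proof. by rewrite /gmom mulr_gt0 ?mulr_gt0 ?expR_gt0// ltr0n fact_gt0. Qed.

Lemma gl_moment Y (v : R) (m : nat) : gl Y -> 0 < v -> Ex (fun w => Y w ^+ 2) <= v ->
  itg (fun w => Y w ^+ (2 * m)) /\ Ex (fun w => Y w ^+ (2 * m)) <= gmom m * v ^+ m.
Proof.
move=> [sY _ eY] v0 Yv.
pose l := (Num.sqrt v)^-1.
have l0 : 0 < l by rewrite invr_gt0 sqrtr_gt0.
have lv : l ^+ 2 * v = 1 by rewrite /l exprVn sqr_sqrtr ?(ltW v0)// mulVf// gt_eqF.
have mY := sY.1.
have bd w : Y w ^+ (2 * m) <= v ^+ m * ((2 * m)`!%:R * (expR (l * Y w) + expR (- l * Y w))).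
  rewrite -ler_pdivrMl ?exprn_gt0//.
  have -> : (v ^+ m)^-1 * Y w ^+ (2 * m) = `|l * Y w| ^+ (2 * m).
    rewrite exprM exprM -exprVn -exprMn; congr (_ ^+ m).
    by rewrite real_normK ?num_real// exprMn -[v^-1]mul1r -lv mulfK ?gt_eqF.
  have fc : (0 : R) < (2 * m)`!%:R by rewrite ltr0n fact_gt0.
  rewrite -ler_pdivrMl//.
  apply: (@le_trans _ _ (expR `|l * Y w|)).
    case: m {fc} => [|k]; first by rewrite muln0 expr0 fact0 mulr1 invr1 -[leLHS]expR0 ler_expR.
    have := @expR_ge1Dxn R `|l * Y w| (2 * k.+1).-1 (normr_ge0 _).
    rewrite prednK ?muln_gt0// mulrC; lra.
  by have := ler_expR_norm (l * Y w); rewrite mulNr.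
have [i1 e1] := eY l; have [i2 e2] := eY (- l).
have i3 : itg (fun w => v ^+ m * ((2 * m)`!%:R * (expR (l * Y w) + expR (- l * Y w)))).
  by apply: itgZ; apply: itgZ; exact: itgD.
have i4 : itg (fun w => Y w ^+ (2 * m)).
  apply: (itg_le _ i3); first exact: measurable_funX.
  by move=> w; rewrite ger0_norm// exprM; apply: exprn_ge0; exact: sqr_ge0.
split=> //; apply: (le_trans (Ex_le i4 i3 bd)).
rewrite ExZ; last by apply: itgZ; exact: itgD.
rewrite ExZ; last exact: itgD.
rewrite ExD// mulrC /gmom ler_wpM2r ?exprn_ge0 ?(ltW v0)//.
rewrite ler_wpM2l// mulr_natl mulr2n lerD//.
  apply: (le_trans e1); rewrite ler_expR.
  have : l ^+ 2 * Ex (fun w => Y w ^+ 2) <= 1 by rewrite -lv ler_wpM2l ?sqr_ge0.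
  by lra.
apply: (le_trans e2); rewrite ler_expR sqrrN.
have : l ^+ 2 * Ex (fun w => Y w ^+ 2) <= 1 by rewrite -lv ler_wpM2l ?sqr_ge0.
by lra.
Qed.

End gaussian_variables.

Section gaussian_limit.
Context {R : realType} {d : measure_display} {T : measurableType d}.
Variable P : probability T R.
Implicit Types (X Y : T -> R).
Local Notation itg := (itg P).
Local Notation Ex := (Ex P).
Local Notation sqi := (sqi P).

(** The cosine transforms converge since they are bounded, and a nonzero value of the limit
    transform prevents the variances from growing. Gaussian fourth moments are then bounded, which
    makes the variances converge and identifies the limit law. *)
Lemma gl_limit (X : nat -> T -> R) (X0 : T -> R) :
  (forall n, gl P (X n)) -> (forall w, X ^~ w @ \oo --> X0 w) ->
  gl P X0 /\ (fun n => Ex (fun w => X n w ^+ 2)) @ \oo --> Ex (fun w => X0 w ^+ 2).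
Proof.
move=> gX XX0.
have mX n : measurable_fun setT (X n) by have [[]] := gX n.
have mX0 : measurable_fun setT X0.
  by apply: (@measurable_fun_cvg _ _ _ _ X) => // w _; exact: XX0.
pose v n := Ex (fun w => X n w ^+ 2).
have v0 n : 0 <= v n by apply: Ex_ge0 => w; exact: sqr_ge0.
have cosc (Y : nat -> T -> R) (Y0 : T -> R) : (forall n, measurable_fun setT (Y n)) ->
    (forall w, Y ^~ w @ \oo --> Y0 w) ->
    (fun n => Ex (fun w => cos (Y n w))) @ \oo --> Ex (fun w => cos (Y0 w)).
  move=> mY YY0; apply: (@Ex_dct _ _ _ _ _ _ (fun=> 1) _ _ _ _).2.
  - move=> n; apply: measurableT_comp => //.
    by apply: continuous_measurable_fun => z; exact: continuous_cos.
  - exact: itg_cst.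
  - by move=> n w; exact: cos_max.
  - by move=> w; apply: continuous_cvg; [exact: continuous_cos|exact: YY0].
have cosX t b : (fun n => Ex (fun w => cos (t * X n w + b))) @ \oo -->
    Ex (fun w => cos (t * X0 w + b)).
  apply: (cosc (fun n w => t * X n w + b)).
    by move=> n; apply: measurable_funD => //; exact: measurable_funM.
  by move=> w; apply: cvgD; [apply: cvgMr; exact: XX0|exact: cvg_cst].
(* The limit transform is continuous at [0], where its value is [1]. *)
have [t t0 ht] : exists2 t : R, 0 < t & 1 / 2 <= Ex (fun w => cos (t * X0 w + 0)).
  have h : (fun n : nat => Ex (fun w => cos (n.+1%:R^-1 * X0 w))) @ \oo --> Ex (fun w => cos (0 * X0 w)).
    apply: (cosc (fun n w => n.+1%:R^-1 * X0 w)); first by move=> n; exact: measurable_funM.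
    by move=> w; apply: cvgMl; exact: cvg_inv_nat.
  move: h; under [in X in _ --> X -> _]eq_Ex do rewrite mul0r cos0; rewrite Ex_cst.
  move=> /cvgrPdist_le /(_ (1 / 2) ltac:(lra)) [n _ /(_ n (leqnn n)) /=].
  rewrite ler_norml => /andP[_ h]; exists n.+1%:R^-1; first by rewrite invr_gt0.
  by under eq_Ex do rewrite addr0; lra.
(* From some index on the transform at [t] is at least [1 / 4], and [expR (- y) <= (1 + y)^-1] then
   forces [y = t ^+ 2 * v / 2 <= 3]. *)
have [N vN] : exists N, forall n, v (n + N)%N <= 6 / t ^+ 2.
  have /cvgrPdist_le /(_ (1 / 4) ltac:(lra)) [N _ hN] := cosX t 0.
  exists N => n; have /= := hN (n + N)%N (leq_addl _ _).
  have [_ -> _] := gX (n + N)%N; rewrite cos0 mul1r -/(v _) ler_norml => /andP[_ h].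
  have h1 : 1 / 4 <= expR (- (t ^+ 2 * v (n + N)%N / 2)) by lra.
  have tv : 0 <= t ^+ 2 * v (n + N)%N / 2 by rewrite divr_ge0// mulr_ge0// sqr_ge0.
  have h2 := expR_le_inv tv.
  rewrite ler_pdivlMr ?exprn_gt0//.
  have h3 : 1 / 4 <= (1 + t ^+ 2 * v (n + N)%N / 2)^-1 by lra.
  rewrite -[X in _ <= X]div1r ler_pdivlMr in h3; last by lra.
  lra.
have C0 : 0 < 6 / t ^+ 2 by rewrite divr_gt0// exprn_gt0.
set C := 6 / t ^+ 2 in vN C0.
have m4 n := gl_moment 2 (gX (n + N)%N) C0 (vN n).
have XN0 w : (fun n => X (n + N)%N w) @ \oo --> X0 w.
  by rewrite (@cvg_shiftn N _ (X ^~ w)); exact: XX0.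
have [s2 _ c2] : [/\ sqi (fun w => X0 w ^+ 2),
    Ex (fun w => (X0 w ^+ 2) ^+ 2) <= gmom 2 * C ^+ 2 &
    (fun n => Ex (fun w => X (n + N)%N w ^+ 2)) @ \oo --> Ex (fun w => X0 w ^+ 2)].
  apply: Ex_cvg_sqi.
  - move=> n; split; first exact: measurable_funX.
    by under eq_fun do rewrite -exprM; exact: (m4 n).1.
  - by move=> n; under eq_Ex do rewrite -exprM; exact: (m4 n).2.
  - by move=> w; rewrite expr2; under eq_fun do rewrite expr2; exact: cvgM.
have vc : v @ \oo --> Ex (fun w => X0 w ^+ 2) by rewrite -(@cvg_shiftn N).
have sX0 : sqi X0 by split=> //; exact: sqi_itg.
split=> //; split=> //.
- move=> s b; apply: (cvg_unique _ (cosX s b)) => //.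
  have -> : (fun n => Ex (fun w => cos (s * X n w + b))) =
      fun n => cos b * expR (- (s ^+ 2 * v n / 2)).
    by apply/funext => n; have [_ -> _] := gX n.
  apply: cvgMr; apply: continuous_cvg; first exact: continuous_expR.
  by apply: cvgN; apply: cvgMl; apply: cvgMr.
- move=> l; apply: (@Ex_fatou _ _ _ _ (fun n w => expR (l * X n w)) _
      (fun n => expR (l ^+ 2 * v n / 2))).
  + by move=> n; have [_ _ /(_ l) []] := gX n.
  + by move=> n w; exact: expR_ge0.
  + move=> w; apply: continuous_cvg; first exact: continuous_expR.
    by apply: cvgMr; exact: XX0.
  + by move=> n; have [_ _ /(_ l) []] := gX n.
  + apply: continuous_cvg; first exact: continuous_expR.
    by apply: cvgMl; apply: cvgMr.
Qed.

(* The density of a centered normal law of variance s^2 is at most 1 / s. *)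
Lemma gaussian_small_ball Y (v t : R) : measurable_fun setT Y ->
  centered_gaussian_law P Y -> 0 < v -> v ^+ 2 <= Ex (fun w => Y w ^+ 2) -> 0 <= t ->
  (P [set w | (`|Y w| <= t)%R] <= (2 * t / v)%:E)%E.
Proof.
move=> mY lY v0 vY t0.
case: lY => [lY|[s s0 lY]].
  have [[[_ i2] _ _] Y0] := gl_dirac mY lY.
  have : Ex (fun w => Y w ^+ 2) = 0.
    apply: Ex_ae0; first exact: measurable_funX.
    by move: Y0; apply: filterS => w ->; rewrite expr0n.
  by move=> e; move: vY; rewrite e leNgt exprn_gt0.
have [_ e2] := gl_normal mY s0 lY.
have vs : v <= s.
  by rewrite leNgt; apply/negP => sv; move: vY; rewrite e2; nra.
rewrite (_ : [set w | `|Y w| <= t] = Y @^-1` `[- t, t]%classic); last first.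
  by apply/seteqP; split=> w /=; rewrite in_itv/= ler_norml.
rewrite lY; last exact: measurable_itv.
rewrite /normal_prob.
apply: (@le_trans _ _ (\int[lebesgue_measure]_(x in `[(- t)%R, t]) (s^-1)%:E)%E).
  apply: ge0_le_integral => //=.
  - by move=> x _; rewrite lee_fin normal_pdf_ge0.
  - by apply/measurable_EFinP; apply: measurable_funTS; exact: measurable_normal_pdf.
  - move=> x _; rewrite lee_fin; apply: (le_trans (normal_pdf_ub _ _ _)).
      by rewrite gt_eqF.
    rewrite /normal_peak lef_pV2 ?posrE//; last first.
      by rewrite sqrtr_gt0 mulrn_wgt0// mulr_gt0 ?pi_gt0// exprn_gt0.
    rewrite -[leLHS](ger0_norm (ltW s0)) -sqrtr_sqr ler_wsqrtr//.
    rewrite -mulrnAr ler_peMr ?sqr_ge0//.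
    by have := @pi_ge2 R; rewrite mulr2n; lra.
rewrite integral_cst//= lebesgue_measure_itv/= lte_fin.
case: ifPn => _; last by rewrite mule0 lee_fin divr_ge0 ?mulr_ge0 ?(ltW v0).
rewrite -EFinB -EFinM lee_fin opprK mulrC (_ : t + t = 2 * t); last by ring.
by rewrite ler_wpM2l ?mulr_ge0// lef_pV2.
Qed.

End gaussian_limit.

(** * Limits of trigonometric polynomials *)

Section trigonometric_class.
Context {R : realType} {I : finType}.
Implicit Types (x a : I -> R) (H G : (I -> R) -> R).

Definition ldot a x : R := \sum_i a i * x i.

Inductive trig : ((I -> R) -> R) -> Prop :=
| trig0 : trig (fun=> 0)
| trig_cons (c b : R) a H : trig H -> trig (fun x => c * cos (ldot a x + b) + H x).

(* Closing trigonometric polynomials under bounded pointwise limits gives a class of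
   functions whose Gaussian expectations depend on the covariance only. *)
Inductive tcl : ((I -> R) -> R) -> Prop :=
| tcl_trig H : trig H -> tcl H
| tcl_lim (Hn : nat -> (I -> R) -> R) H (M : R) : (forall n, tcl (Hn n)) ->
    (forall n x, `|Hn n x| <= M) -> (forall x, Hn ^~ x @ \oo --> H x) -> tcl H.

Lemma ldotD a a' x : ldot (fun i => a i + a' i) x = ldot a x + ldot a' x.
Proof. by rewrite /ldot -big_split; apply: eq_bigr => i _; rewrite mulrDl. Qed.

Lemma ldotN a x : ldot (fun i => - a i) x = - ldot a x.
Proof. by rewrite /ldot -sumrN; apply: eq_bigr => i _; rewrite mulNr. Qed.

Lemma trigD H G : trig H -> trig G -> trig (fun x => H x + G x).
Proof.
move=> + tG; elim=> [|c b a H' _ IH]; first by under eq_fun do rewrite add0r.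
by under eq_fun do rewrite -addrA; exact: trig_cons.
Qed.

Lemma trigZ (k : R) H : trig H -> trig (fun x => k * H x).
Proof.
elim=> [|c b a H' _ IH]; first by under eq_fun do rewrite mulr0; exact: trig0.
by under eq_fun do rewrite mulrDr mulrA; exact: trig_cons.
Qed.

Lemma trig_cos (b : R) a : trig (fun x => cos (ldot a x + b)).
Proof.
have := trig_cons 1 b a trig0.
by under [X in trig X -> _]eq_fun do rewrite addr0 mul1r.
Qed.

Lemma trigM H G : trig H -> trig G -> trig (fun x => H x * G x).
Proof.
move=> tH tG; elim: tH => [|c b a H' _ IH].
  by under eq_fun do rewrite mul0r; exact: trig0.
under eq_fun do rewrite mulrDl; apply: trigD => //.
under eq_fun do rewrite -mulrA; apply: trigZ.
elim: tG => [|c' b' a' G' _ IH']; first by under eq_fun do rewrite mulr0; exact: trig0.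
under eq_fun do rewrite mulrDr; apply: trigD => //.
have E x : cos (ldot a x + b) * (c' * cos (ldot a' x + b')) =
    c' / 2 * (cos (ldot (fun i => a i + a' i) x + (b + b')) +
              cos (ldot (fun i => a i + - a' i) x + (b - b'))).
  rewrite !ldotD ldotN.
  have -> : ldot a x + ldot a' x + (b + b') = (ldot a x + b) + (ldot a' x + b') by ring.
  have -> : ldot a x - ldot a' x + (b - b') = (ldot a x + b) - (ldot a' x + b') by ring.
  move: (ldot a x + b) (ldot a' x + b') => A B.
  by rewrite cosD cosB; field.
by under eq_fun do rewrite E; apply: trigZ; apply: trigD; exact: trig_cos.
Qed.

Lemma tcl_bounded H : tcl H -> exists M : R, forall x, `|H x| <= M.
Proof.
elim=> {}H.
  elim=> [|c b a H' _ [M hM]]; first by exists 0 => x; rewrite normr0.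
  exists (`|c| + M) => x; apply: (le_trans (ler_normD _ _)); apply: lerD => //.
  by rewrite normrM ler_piMr// cos_max.
move=> H' M _ _ HM H'c; exists M => x.
have cn : (fun n => `|H n x|) @ \oo --> `|H' x| by exact: cvg_norm.
by rewrite -(cvg_lim _ cn)//; apply: limr_le; [apply/cvg_ex; exists (`|H' x|)|exact: nearW].
Qed.

Lemma tcl_cst (c : R) : tcl (fun=> c).
Proof.
rewrite (_ : (fun=> c) = fun x => c * cos (ldot (fun=> 0) x + 0) + 0).
  by apply: tcl_trig; apply: trig_cons; exact: trig0.
apply/funext => x; rewrite /ldot big1 ?addr0 ?cos0 ?mulr1// => i _.
by rewrite mul0r.
Qed.

Lemma tclD H G : tcl H -> tcl G -> tcl (fun x => H x + G x).
Proof.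
move=> tH tG; elim: tH => {}H.
  move=> tH; elim: tG => {}G; first by move=> tG; apply/tcl_trig/trigD.
  move=> G' M tG IH GM GG'; have [MH hMH] := tcl_bounded (tcl_trig tH).
  apply: (@tcl_lim (fun n x => H x + G n x) _ (MH + M)) => //.
    by move=> n x; apply: (le_trans (ler_normD _ _)); exact: lerD.
  by move=> x; apply: cvgD => //; exact: cvg_cst.
move=> H' M tH IH HM HH'; have [MG hMG] := tcl_bounded tG.
apply: (@tcl_lim (fun n x => H n x + G x) _ (M + MG)) => //.
  by move=> n x; apply: (le_trans (ler_normD _ _)); exact: lerD.
by move=> x; apply: cvgD => //; exact: cvg_cst.
Qed.

Lemma tclM H G : tcl H -> tcl G -> tcl (fun x => H x * G x).
Proof.
move=> tH tG; elim: tH => {}H.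
  move=> tH; elim: tG => {}G; first by move=> tG; apply/tcl_trig/trigM.
  move=> G' M tG IH GM GG'; have [MH hMH] := tcl_bounded (tcl_trig tH).
  apply: (@tcl_lim (fun n x => H x * G n x) _ (MH * M)) => //.
    by move=> n x; rewrite normrM; exact: ler_pM.
  by move=> x; apply: cvgMr.
move=> H' M tH IH HM HH'; have [MG hMG] := tcl_bounded tG.
apply: (@tcl_lim (fun n x => H n x * G x) _ (M * MG)) => //.
  by move=> n x; rewrite normrM; exact: ler_pM.
by move=> x; apply: cvgMl.
Qed.

Lemma tclZ (c : R) H : tcl H -> tcl (fun x => c * H x).
Proof. by move=> tH; apply: tclM => //; exact: tcl_cst. Qed.

Lemma tclN H : tcl H -> tcl (fun x => - H x).
Proof. by move=> tH; under eq_fun do rewrite -mulN1r; exact: tclZ. Qed.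

Lemma tclB H G : tcl H -> tcl G -> tcl (fun x => H x - G x).
Proof. by move=> tH tG; apply: tclD => //; exact: tclN. Qed.

Lemma tclX (n : nat) H : tcl H -> tcl (fun x => H x ^+ n).
Proof.
move=> tH; elim: n => [|n IH]; first by under eq_fun do rewrite expr0; exact: tcl_cst.
by under eq_fun do rewrite exprS; exact: tclM.
Qed.

Lemma tcl_sum (J : Type) (s : seq J) (H : J -> (I -> R) -> R) :
  (forall j, tcl (H j)) -> tcl (fun x => \sum_(j <- s) H j x).
Proof.
move=> tH; elim: s => [|j s IH]; first by under eq_fun do rewrite big_nil; exact: tcl_cst.
by under eq_fun do rewrite big_cons; exact: tclD.
Qed.

(** With [q = 1 - H / M] in [[0, 1)], the inverse is the limit of bounded partial sums of a
    geometric series in [q]. *)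
Lemma tcl_inv H (m M : R) : tcl H -> 0 < m -> (forall x, m <= H x <= M) ->
  tcl (fun x => (H x)^-1).
Proof.
move=> tH m0 mHM.
have M0 x : 0 < M by have /andP[h1 h2] := mHM x; lra.
have [x0|nox] := pselect (exists x : I -> R, True); last first.
  by exfalso; apply: nox; exists (fun=> 0).
have {x0} M0 : 0 < M by exact: M0 (fun=> 0).
pose q x := 1 - M^-1 * H x.
have q01 x : 0 <= q x < 1.
  have /andP[h1 h2] := mHM x; rewrite /q subr_ge0 mulrC ler_pdivrMr// mul1r h2/=.
  by rewrite gtrBl mulr_gt0 ?invr_gt0//; exact: lt_le_trans h1.
have H0 x : 0 < H x by have /andP[h1 _] := mHM x; exact: lt_le_trans h1.
have geo x n : \sum_(0 <= k < n) q x ^+ k = M / H x * (1 - q x ^+ n).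
  have qE : 1 - q x = M^-1 * H x by rewrite /q opprB addrC subrK.
  have -> : M / H x = (1 - q x)^-1 by rewrite qE invfM invrK.
  have qn0 : 1 - q x != 0 by rewrite gt_eqF// subr_gt0; have /andP[] := q01 x.
  apply: (mulfI qn0); rewrite mulrA mulfV// mul1r.
  elim: n => [|n IH]; first by rewrite big_nil mulr0 expr0 subrr.
  by rewrite big_nat_recr//= mulrDr IH exprSr; ring.
apply: (@tcl_lim (fun n x => M^-1 * \sum_(0 <= k < n) q x ^+ k) _ m^-1).
- move=> n; apply: tclZ; apply: tcl_sum => k; apply: tclX.
  by apply: tclB; [exact: tcl_cst|exact: tclZ].
- move=> n x; have /andP[q0 q1] := q01 x; rewrite geo mulrA mulKf ?gt_eqF//.
  have h1 : 0 <= 1 - q x ^+ n by rewrite subr_ge0 exprn_ile1// ltW.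
  rewrite normrM !ger0_norm ?invr_ge0 ?(ltW (H0 x))//.
  apply: (@le_trans _ _ (H x)^-1).
    by rewrite ler_piMr ?invr_ge0 ?(ltW (H0 x))// lerBlDr lerDl exprn_ge0.
  by rewrite lef_pV2 ?posrE//; have /andP[] := mHM x.
- move=> x; have /andP[q0 q1] := q01 x.
  under eq_fun do rewrite geo mulrA mulKf ?gt_eqF//.
  have h : (fun n => 1 - q x ^+ n) @ \oo --> (1 - 0 : R).
    apply: cvgB; first exact: cvg_cst.
    by apply: cvg_expr; rewrite ger0_norm.
  by have := @cvgMr _ _ _ _ _ (H x)^-1 _ h; rewrite subr0 mulr1; exact.
Qed.

(** The recursion [q + (H - q ^+ 2) / 2] started at [0] is polynomial in [H] and increases to the
    square root on [[0, 1]]. *)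
Lemma tcl_sqrt H : tcl H -> (forall x, 0 <= H x <= 1) -> tcl (fun x => Num.sqrt (H x)).
Proof.
move=> tH H01.
pose fix q (n : nat) (x : I -> R) {struct n} : R := if n is k.+1 then q k x + 2^-1 * (H x - q k x ^+ 2) else 0.
pose s x := Num.sqrt (H x).
have s2 x : s x ^+ 2 = H x by rewrite sqr_sqrtr//; have /andP[] := H01 x.
have s0 x : 0 <= s x by exact: sqrtr_ge0.
have s1 x : s x <= 1.
  by rewrite -sqrtr1 ler_wsqrtr//; have /andP[] := H01 x.
(* Each step multiplies the error by [1 - (s + q) / 2 <= 1 - s / 2]; this does not contract where
   [s = 0], but there the error is already [0]. *)
have qs n x : 0 <= q n x <= s x /\ s x - q n x <= s x * (1 - s x / 2) ^+ n.
  have h0 := s0 x; have h1 := s1 x; have h2 := s2 x.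
  elim: n => [|n [/andP[q0 qs] IH]] /=; first by rewrite lexx h0 subr0 expr0 mulr1.
  set e := (1 - s x / 2) ^+ n in IH *.
  have E : s x - (q n x + 2^-1 * (H x - q n x ^+ 2)) =
      (s x - q n x) * (1 - (s x + q n x) / 2) by rewrite -h2; field.
  split.
    apply/andP; split; first by rewrite -h2; nra.
    rewrite -subr_ge0 E mulr_ge0 ?subr_ge0//; lra.
  rewrite E exprSr -/e mulrA; apply: ler_pM => //; rewrite ?subr_ge0//; lra.
apply: (@tcl_lim (fun n x => q n x) _ 1).
- elim=> [|n IH] /=; first exact: tcl_cst.
  by apply: tclD => //; apply: tclZ; apply: tclB => //; exact: tclX.
- by move=> n x; have [/andP[q0 q1] _] := qs n x; rewrite ger0_norm// (le_trans q1).
- move=> x; rewrite -/(s x).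
  apply: (@squeeze_cvgr _ _ _ _ (fun n => s x - s x * (1 - s x / 2) ^+ n) (fun=> s x)).
  + apply: nearW => n; have [/andP[_ ->] h] := qs n x; rewrite andbT.
    by lra.
  + have [->|sn0] := eqVneq (s x) 0.
      by under eq_fun do rewrite mul0r subr0; exact: cvg_cst.
    have h : (fun n => (1 - s x / 2) ^+ n) @ \oo --> (0 : R).
      apply: cvg_expr; have := s0 x; rewrite le_eqVlt eq_sym (negbTE sn0)/= => h.
      by have h1 := s1 x; rewrite ltr_norml; apply/andP; split; lra.
    have h' : (fun n => s x * (1 - s x / 2) ^+ n) @ \oo --> s x * 0 by exact: cvgMr.
    have hc : (fun=> s x : R) @ \oo --> s x by exact: cvg_cst.
    by have := cvgB hc h'; rewrite mulr0 subr0; exact.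
  + exact: cvg_cst.
Qed.

End trigonometric_class.

(** * The smoothed sign function *)

Section soft_sign.
Context {R : realType}.
Implicit Types x y : R.

Definition bump x : R := (1 + x ^+ 2)^-1.
Definition ssgn x : R := x * Num.sqrt (bump x).

Lemma bump_gt0 x : 0 < bump x.
Proof. by rewrite invr_gt0; have := sqr_ge0 x; lra. Qed.

Lemma bump_le1 x : bump x <= 1.
Proof. by rewrite invf_le1; have := sqr_ge0 x; lra. Qed.

Lemma ssgn_sqr x : ssgn x ^+ 2 = 1 - bump x.
Proof.
have h := sqr_ge0 x.
by rewrite exprMn sqr_sqrtr ?(ltW (bump_gt0 x))// /bump; field; lra.
Qed.

Lemma norm_ssgn_le1 x : `|ssgn x| <= 1.
Proof.
rewrite -(ler_pXn2r (n := 2))// ?nnegrE// expr1n real_normK ?num_real// ssgn_sqr.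
by have := bump_gt0 x; lra.
Qed.

Lemma ssgn0 : ssgn 0 = 0. Proof. by rewrite /ssgn mul0r. Qed.

Lemma ssgn_sgE x : ssgn x = Num.sg x * `|ssgn x|.
Proof.
rewrite /ssgn normrM (ger0_norm (sqrtr_ge0 _)) mulrA; congr (_ * _).
by rewrite -numEsg.
Qed.

(** Away from zero the error is [1 - |ssgn x|], which is at most [1 - ssgn x ^+ 2 = bump x]. *)
Lemma sg_ssgn x : `|Num.sg x - ssgn x| <= bump x.
Proof.
have [->|x0] := eqVneq x 0.
  by rewrite sgr0 ssgn0 subr0 normr0 ltW// bump_gt0.
rewrite ssgn_sgE -{1}[Num.sg x]mulr1 -mulrBr normrM normr_sg x0 mul1r.
have h1 := norm_ssgn_le1 x; rewrite ger0_norm ?subr_ge0//.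
have := ssgn_sqr x; rewrite -real_normK ?num_real// => h2.
have := normr_ge0 (ssgn x); nra.
Qed.

Lemma cvg_bump x : x != 0 -> (fun n : nat => bump (n%:R * x)) @ \oo --> 0.
Proof.
move=> x0; have x2 : 0 < x ^+ 2 by rewrite exprn_even_gt0.
apply: (@squeeze_cvgr _ _ _ _ (fun=> 0) (fun n : nat => (x ^+ 2)^-1 * n%:R^-1)).
- near=> n; rewrite ltW ?bump_gt0//=.
  have n0 : (0 : R) < n%:R by rewrite ltr0n; near: n; exists 1%N.
  have n1 : (1 : R) <= n%:R by rewrite ler1n; near: n; exists 1%N.
  have b1 : 0 < 1 + (n%:R * x) ^+ 2 by have h := sqr_ge0 (n%:R * x); lra.
  have b2 : 0 < x ^+ 2 * n%:R by exact: mulr_gt0.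
  rewrite /bump -invfM lef_pV2 ?posrE// exprMn.
  set y := x ^+ 2 in x2 b2 *; set m : R := n%:R in n0 n1 b2 *.
  have : m * y <= m ^+ 2 * y by rewrite ler_wpM2r ?(ltW x2)// expr2; nra.
  lra.
- exact: cvg_cst.
- have h : (fun n : nat => n%:R^-1 : R) @ \oo --> 0.
    by rewrite -cvg_shiftS; exact: cvg_harmonic.
  have h2 : (fun n : nat => (x ^+ 2)^-1 * n%:R^-1 : R) @ \oo --> (x ^+ 2)^-1 * 0 by exact: cvgMr.
  by move: h2; rewrite mulr0.
Unshelve. all: by end_near. Qed.

Lemma cvg_ssgn x : (fun n : nat => ssgn (n%:R * x)) @ \oo --> Num.sg x.
Proof.
have [->|x0] := eqVneq x 0.
  by under eq_fun do rewrite mulr0 ssgn0; rewrite sgr0; exact: cvg_cst.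
apply/cvgrPdist_le => e e0.
have /cvgrPdist_le /(_ e e0) [N _ hN] := cvg_bump x0.
exists N.+1 => // n /= nN; have n0 : (0 : R) < n%:R by rewrite ltr0n; lia.
have h1 : bump (n%:R * x) <= e.
  by have := hN n (ltnW nN); rewrite /= sub0r normrN ger0_norm// ltW// bump_gt0.
apply: le_trans h1; have := sg_ssgn (n%:R * x).
by rewrite sgrM (gtr0_sg n0) mul1r.
Qed.

Lemma is_derive_bump x : is_derive x 1 bump (- (2 * x * bump x ^+ 2)).
Proof.
have h := sqr_ge0 x.
have h0 : 1 + x ^+ 2 != 0 by lra.
have d1 : is_derive x 1 (fun y : R => 1 + y ^+ 2) (2 * x).
  by apply: trigger_derive; rewrite /GRing.scale/=; ring.
have := @is_deriveV R (fun y => 1 + y ^+ 2) x _ _ h0 d1.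
by move=> /is_derive_eq; apply; rewrite /bump /GRing.scale/= -exprVn; ring.
Qed.

Lemma is_derive_ssgn x : is_derive x 1 ssgn (bump x * Num.sqrt (bump x)).
Proof.
have b0 := bump_gt0 x; have h := sqr_ge0 x.
have := is_derive_bump x => db.
have s0 : 0 < Num.sqrt (bump x) by rewrite sqrtr_gt0.
have := is_derive1_sqrt b0 => ds.
have dc : is_derive x 1 (Num.sqrt \o bump) ((2 * Num.sqrt (bump x))^-1 * (- (2 * x * bump x ^+ 2))).
  exact: is_derive1_comp.
have : is_derive x 1 (id * (Num.sqrt \o bump)) (bump x * Num.sqrt (bump x)).
  apply: trigger_derive; rewrite /GRing.scale/= mulr1.
  have e : bump x = Num.sqrt (bump x) ^+ 2 by rewrite sqr_sqrtr ?ltW.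
  set s := Num.sqrt (bump x) in e s0 *.
  have e2 : x ^+ 2 * s ^+ 2 = 1 - s ^+ 2.
    by rewrite -e /bump; field; lra.
  rewrite e.
  transitivity (s - x ^+ 2 * s ^+ 2 * s); first by field; rewrite gt_eqF.
  by rewrite e2; ring.
by [].
Qed.

Lemma measurable_bump : measurable_fun setT bump.
Proof.
apply: continuous_measurable_fun => x.
by apply: differentiable_continuous; apply/derivable1_diffP; have [] := is_derive_bump x.
Qed.

Lemma measurable_ssgn : measurable_fun setT ssgn.
Proof.
apply: continuous_measurable_fun => x.
by apply: differentiable_continuous; apply/derivable1_diffP; have [] := is_derive_ssgn x.
Qed.

End soft_sign.

Section soft_sign_class.
Context {R : realType} {I : finType}.

Lemma tcl_lin_sin (i : I) (c : R) : tcl (fun x : I -> R => sin (c * x i)).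
Proof.
rewrite (_ : (fun _ => _) = fun x => cos (ldot (fun j => if j == i then c else 0) x + - (pi / 2))).
  by apply: tcl_trig; exact: trig_cos.
apply/funext => x; rewrite cosBpihalf /ldot (bigD1 i)//= eqxx big1 ?addr0//.
by move=> j /negbTE ->; rewrite mul0r.
Qed.

(** A coordinate is unbounded and cannot be in the class itself; it is replaced by
    [n * sin (c * x / n)], bounded for each [n] and convergent to [c * x]. *)
Lemma tcl_ssgn (i : I) (c : R) : tcl (fun x : I -> R => ssgn (c * x i)).
Proof.
pose y (n : nat) (x : I -> R) := n.+1%:R * sin (c / n.+1%:R * x i).
have ty n : tcl (y n) by apply: tclZ; exact: tcl_lin_sin.
have y1 n x : `|y n x| <= n.+1%:R.
  by rewrite normrM ger0_norm// ler_piMr// sin_max.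
have tb n : tcl (fun x => bump (y n x)).
  apply: (@tcl_inv _ _ _ 1 (1 + n.+1%:R ^+ 2)) => //.
    by apply: tclD; [exact: tcl_cst|exact: tclX].
  move=> x; rewrite lerDl sqr_ge0/= lerD2l -real_normK ?num_real//.
  by rewrite lerXn2r// nnegrE.
apply: (@tcl_lim _ _ (fun n x => ssgn (y n x)) _ 1).
- move=> n; apply: tclM => //; apply: tcl_sqrt => // x.
  by rewrite bump_le1 (ltW (bump_gt0 _)).
- by move=> n x; exact: norm_ssgn_le1.
- move=> x; apply: (@cvg_comp _ _ _ (fun n => y n x) ssgn _ (nbhs (c * x i))).
    have dS : is_derive (0 : R) 1 (fun t => sin (t * (c * x i))) (c * x i).
      by apply: trigger_derive; rewrite mul0r cos0 /GRing.scale/=; ring.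
    have u0 (n : nat) : (n.+1%:R^-1 : R) != 0 by rewrite invr_neq0.
    have h := is_derive_cvg_seq dS u0 (@cvg_inv_nat R).
    suff -> : (fun n => y n x) = (fun n : nat => (sin ((0 + n.+1%:R^-1) * (c * x i)) -
      sin (0 * (c * x i))) / n.+1%:R^-1) by exact: h.
    apply/funext => n; rewrite /y add0r mul0r sin0 subr0 invrK mulrC; congr (sin _ * _).
    by field; rewrite nat1r pnatr_eq0.
  apply: differentiable_continuous; apply/derivable1_diffP.
  by have [] := is_derive_ssgn (c * x i).
Qed.

Lemma tcl_bump (i : I) (c : R) : tcl (fun x : I -> R => bump (c * x i)).
Proof.
have E x : bump (c * x i) = 1 - ssgn (c * x i) ^+ 2 by rewrite ssgn_sqr; ring.
rewrite (funext E); apply: tclB; [exact: tcl_cst|apply: tclX; exact: tcl_ssgn].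
Qed.

Lemma tcl_sg (i : I) : tcl (fun x : I -> R => Num.sg (x i)).
Proof.
apply: (@tcl_lim _ _ (fun n x => ssgn (n%:R * x i)) _ 1).
- by move=> n; exact: tcl_ssgn.
- by move=> n x; exact: norm_ssgn_le1.
- by move=> x; exact: cvg_ssgn.
Qed.

End soft_sign_class.

Section gaussian_vectors.
Context {R : realType} {I : finType}.

(** A centered Gaussian vector given by its characteristic function, real and imaginary parts being
    combined by the phase [b]. A degenerate covariance is allowed. *)
Definition gvec {d : measure_display} {T : measurableType d} (P : probability T R)
    (Y : I -> T -> R) (C : I -> I -> R) :=
  [/\ forall i, measurable_fun setT (Y i) &
      forall (a : I -> R) (b : R), Ex P (fun w => cos (ldot a (Y ^~ w) + b)) =
        cos b * expR (- ((\sum_i \sum_j a i * a j * C i j) / 2))].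

Lemma tcl_measurable {d : measure_display} {T : measurableType d}
    (Y : I -> T -> R) H : (forall i, measurable_fun setT (Y i)) -> tcl H ->
  measurable_fun setT (fun w => H (Y ^~ w)).
Proof.
move=> mY; elim=> {}H.
  elim=> [|c b a H' _ mH']; first exact: measurable_cst.
  apply: measurable_funD => //; apply: measurable_funM => //.
  apply: measurableT_comp.
    by apply: continuous_measurable_fun => z; exact: continuous_cos.
  apply: measurable_funD => //; apply: measurable_sum => i.
  exact: measurable_funM.
move=> H' M _ IH _ HH'.
by apply: (@measurable_fun_cvg _ _ _ _ (fun n w => H n (Y ^~ w))) => // w _; exact: HH'.
Qed.

Lemma tcl_itg {d : measure_display} {T : measurableType d} (P : probability T R)
    (Y : I -> T -> R) H : (forall i, measurable_fun setT (Y i)) -> tcl H ->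
  itg P (fun w => H (Y ^~ w)).
Proof.
move=> mY tH; have [M hM] := tcl_bounded tH.
by apply: (@itg_bounded _ _ _ _ _ M) => //; exact: tcl_measurable.
Qed.

(** The two vectors may live on different spaces, so a vector can be compared with rotations built
    on a product. *)
Lemma gvec_Ex_eq {d d' : measure_display} {T : measurableType d} {T' : measurableType d'}
    (P : probability T R) (P' : probability T' R) (Y : I -> T -> R) (Y' : I -> T' -> R) C H :
  gvec P Y C -> gvec P' Y' C -> tcl H ->
  Ex P (fun w => H (Y ^~ w)) = Ex P' (fun w => H (Y' ^~ w)).
Proof.
move=> [mY eY] [mY' eY'].
elim=> {}H.
  elim=> [|c b a H' tH' IH]; first by rewrite !Ex_cst.
  have i1 := tcl_itg P mY (tcl_trig tH'); have i1' := tcl_itg P' mY' (tcl_trig tH').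
  have i2 := tcl_itg P mY (tcl_trig (trig_cos b a)).
  have i2' := tcl_itg P' mY' (tcl_trig (trig_cos b a)).
  rewrite ExD//; last exact: itgZ.
  rewrite ExD//; last exact: itgZ.
  by rewrite ExZ// ExZ// eY eY' IH.
move=> H' M tH IH HM HH'.
have [_ h] := @Ex_dct _ _ _ P (fun n w => H n (Y ^~ w)) (fun w => H' (Y ^~ w)) (fun=> M)
  (fun n => tcl_measurable mY (tH n)) (itg_cst _ _) (fun n w => HM n _) (fun w => HH' _).
have [_ h'] := @Ex_dct _ _ _ P' (fun n w => H n (Y' ^~ w)) (fun w => H' (Y' ^~ w)) (fun=> M)
  (fun n => tcl_measurable mY' (tH n)) (itg_cst _ _) (fun n w => HM n _) (fun w => HH' _).
move: h; under [X in X @ \oo --> _ -> _]eq_fun do rewrite IH.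
by move=> h; exact: (cvg_unique _ h h').
Qed.

End gaussian_vectors.

Section power_means.
Context {R : realType}.

Lemma sum_sqr_le (n : nat) (x : 'I_n -> R) :
  (\sum_i x i) ^+ 2 <= n%:R * \sum_i x i ^+ 2.
Proof.
elim: n x => [|n IH] x; first by rewrite !big_ord0 expr0n mul0r.
rewrite !big_ord_recr /=.
set S := \sum_(i < n) _; set Q := \sum_(i < n) _; set y := x ord_max.
have {IH} IH : S ^+ 2 <= n%:R * Q by exact: IH.
have [n0|n0] := posnP n.
  by subst n; rewrite /S /Q !big_ord0 !add0r mul1r.
have {}n0 : 0 < n%:R :> R by rewrite ltr0n.
rewrite -[n.+1%:R]natr1; set m : R := n%:R in n0 IH *.
have h : 2 * S * y <= Q + m * y ^+ 2.
  by rewrite -(ler_pM2l n0); have := sqr_ge0 (S - m * y); nra.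
nra.
Qed.

(** Exponents are powers of two so that repeated use of the quadratic case yields the power mean
    inequality; every moment used for concentration has such an order. *)
Lemma sum_pow2_le (r n : nat) (x : 'I_n -> R) :
  (\sum_i x i) ^+ (2 ^ r) <= n%:R ^+ (2 ^ r).-1 * \sum_i x i ^+ (2 ^ r).
Proof.
elim: r => [|r IH]; first by rewrite expn0 expr1 mul1r.
have e2 : (2 ^ r.+1 = 2 ^ r * 2)%N by rewrite expnSr.
have [r0|r0] := posnP r.
  by subst r; have := sum_sqr_le x; rewrite expn1.
have ev : (2 ^ r = 2 * 2 ^ r.-1)%N by rewrite -expnS prednK.
rewrite e2 exprM.
apply: (@le_trans _ _ ((n%:R ^+ (2 ^ r).-1 * \sum_i x i ^+ (2 ^ r)) ^+ 2)).
  apply: lerXn2r => //; rewrite nnegrE.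
    by rewrite ev exprM exprn_ge0// sqr_ge0.
  rewrite mulr_ge0 ?exprn_ge0//; apply: sumr_ge0 => i _.
  by rewrite ev exprM exprn_ge0// sqr_ge0.
rewrite exprMn -exprM.
apply: (@le_trans _ _ (n%:R ^+ ((2 ^ r).-1 * 2) * (n%:R * \sum_i (x i ^+ (2 ^ r)) ^+ 2))).
  by apply: ler_wpM2l; [rewrite exprn_ge0|exact: sum_sqr_le].
rewrite mulrA -exprSr (_ : ((2 ^ r).-1 * 2).+1 = (2 ^ r * 2).-1)%N; last first.
  have h2 : (0 < 2 ^ r)%N by rewrite expn_gt0.
  by move: h2; generalize (2 ^ r)%N => k; lia.
apply: ler_wpM2l; first by rewrite exprn_ge0.
by apply: ler_sum => i _; rewrite -exprM.
Qed.

End power_means.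

Section product_expectation.
Context {R : realType} {d : measure_display} {T : measurableType d}.
Variable P : probability T R.

Definition P2 : probability (T * T)%type R := (P \x P)%E.

Lemma Ex_P2 (F : T * T -> R) (M : R) : measurable_fun setT F -> (forall z, `|F z| <= M) ->
  Ex P2 F = Ex P (fun x => Ex P (fun y => F (x, y))).
Proof.
move=> mF FM; have iF : itg P2 F by exact: itg_bounded FM.
have iF1 x : itg P (fun y => F (x, y)).
  apply: (@itg_bounded _ _ _ _ _ M) => //.
  by apply: measurableT_comp => //; exact: measurable_pair1.
rewrite {1}/Ex /Rintegral -(@integral12_prod_meas1 _ _ _ _ _ P P (EFin \o F))//.
rewrite /Ex /Rintegral; congr fine; apply: eq_integral => x _.
by rewrite /fubini_F /= -ExE.
Qed.

Lemma P2_tonelli_le (F : T * T -> R) (c : R) : measurable_fun setT F -> (forall z, 0 <= F z) ->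
  (forall x, itg P (fun y => F (x, y)) /\ Ex P (fun y => F (x, y)) <= c) ->
  itg P2 F /\ Ex P2 F <= c.
Proof.
move=> mF F0 h.
have mF' : measurable_fun setT (EFin \o F) by exact/measurable_EFinP.
have e : (\int[P2]_z (F z)%:E <= c%:E)%E.
  rewrite (@fubini_tonelli1 _ _ _ _ _ P P (EFin \o F) mF'); last by move=> z; rewrite lee_fin.
  apply: (@le_trans _ _ (\int[P]_x (cst c%:E) x)%E).
    apply: ge0_le_integral => //.
    - by move=> x _; apply: integral_ge0 => y _; rewrite lee_fin.
    - apply: (@measurable_fun_fubini_tonelli_F _ _ _ _ _ P (EFin \o F)) => //.
    - by move=> x _; have [i1 e1] := h x; rewrite /fubini_F /= -ExE// lee_fin.
  by rewrite integral_cst//= probability_setT mule1.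
have iF : itg P2 F.
  apply/integrableP; split => //.
  under eq_integral do rewrite /= ger0_norm//.
  by apply: le_lt_trans e _; rewrite ltry.
by split => //; rewrite -lee_fin ExE.
Qed.

Lemma Ex_pow2_le (r : nat) (X : T -> R) (M : R) : measurable_fun setT X ->
  (forall w, `|X w| <= M) -> Ex P X ^+ (2 ^ r) <= Ex P (fun w => X w ^+ (2 ^ r)).
Proof.
elim: r X M => [|r IH] X M mX XM.
  by rewrite expn0 expr1; under [leRHS]eq_Ex do rewrite expr1.
rewrite expnS exprM; under [leRHS]eq_Ex do rewrite exprM.
apply: (@le_trans _ _ (Ex P (fun w => X w ^+ 2) ^+ (2 ^ r))).
  apply: lerXn2r; rewrite ?nnegrE ?sqr_ge0//; first by apply: Ex_ge0 => w; exact: sqr_ge0.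
  by apply: Ex_sqr_le; exact: sqi_bounded XM.
apply: (IH _ (M ^+ 2)); first exact: measurable_funX.
by move=> w; rewrite normrX lerXn2r// ?nnegrE// (le_trans _ (XM w)).
Qed.

End product_expectation.

Section reindexing.
Context {R : realType} {I J : finType}.

Lemma tcl_reindex (f : J -> I) (H : (J -> R) -> R) :
  tcl H -> tcl (fun x : I -> R => H (fun j => x (f j))).
Proof.
elim=> {}H.
  move=> tH; apply: tcl_trig; elim: tH => [|c b a H' _ IH]; first exact: trig0.
  rewrite (_ : (fun _ => _) = fun x : I -> R =>
    c * cos (ldot (fun i => \sum_(j | f j == i) a j) x + b) + H' (fun j => x (f j))).
    exact: trig_cons.
  apply/funext => x; congr (_ * cos (_ + _) + _).
  rewrite /ldot (partition_big f predT)//=; apply: eq_bigr => i _.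
  by rewrite mulr_suml; apply: eq_bigr => j /eqP <-.
move=> H' M _ IH HM HH'.
by apply: (@tcl_lim _ _ (fun n (x : I -> R) => H n (fun j => x (f j))) _ M).
Qed.

End reindexing.

Section gaussian_families.
Context {R : realType} {d : measure_display} {T : measurableType d} {J : finType}.
Variables (P : probability T R) (Y : J -> T -> R).
Hypothesis gY : forall a, gl P (fun w => ldot a (Y ^~ w)).

Definition cov (i j : J) : R := Ex P (fun w => Y i w * Y j w).

Lemma gfam_coord (j : J) : gl P (Y j).
Proof.
have := gY (fun i => (i == j)%:R).
suff -> : (fun w => ldot (fun i => (i == j)%:R) (Y ^~ w)) = Y j by [].
apply/funext => w; rewrite /ldot (bigD1 j)//= eqxx mul1r big1 ?addr0//.
by move=> i /negbTE ->; rewrite mul0r.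
Qed.

Lemma sqi_gfam (j : J) : sqi P (Y j).
Proof. by have [] := gfam_coord j. Qed.

Lemma Ex_ldot_sqr (a : J -> R) :
  Ex P (fun w => ldot a (Y ^~ w) ^+ 2) = \sum_i \sum_j a i * a j * cov i j.
Proof.
have iM i j : itg P (fun w => Y i w * Y j w) by exact: sqi_itgM (sqi_gfam i) (sqi_gfam j).
transitivity (Ex P (fun w => \sum_i \sum_j a i * a j * (Y i w * Y j w))).
  apply: eq_Ex => w; rewrite expr2 /ldot mulr_suml; apply: eq_bigr => i _.
  by rewrite mulr_sumr; apply: eq_bigr => j _; ring.
rewrite Ex_sum; last by move=> i; apply: itg_sum => j; exact: itgZ.
apply: eq_bigr => i _; rewrite Ex_sum; last by move=> j; exact: itgZ.
by apply: eq_bigr => j _; rewrite ExZ.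
Qed.

Lemma gvec_gfam : gvec P Y cov.
Proof.
split=> [i|a b]; first by have [] := sqi_gfam i.
have [_ /(_ 1 b) + _] := gY a.
under eq_Ex do rewrite mul1r.
by rewrite expr1n mul1r Ex_ldot_sqr.
Qed.

Definition rotation (t : R) (z : T * T) (j : J) : R := cos t * Y j z.1 + sin t * Y j z.2.

Definition rot2 (t e : R) (s : J + J) (z : T * T) : R :=
  match s with inl j => rotation t z j | inr j => rotation (t + e) z j end.

Definition cov2 (e : R) (s s' : J + J) : R :=
  match s, s' with
  | inl i, inl j => cov i j | inr i, inr j => cov i j
  | inl i, inr j => cos e * cov i j | inr i, inl j => cos e * cov i j
  end.

Lemma measurable_rot (t : R) (j : J) : measurable_fun setT (fun z => rotation t z j).
Proof.
have [mY _] := sqi_gfam j.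
by apply: measurable_funD; apply: measurable_funM => //; apply: (measurableT_comp mY).
Qed.

(** The covariance [cov2 e] of the pair does not involve [t], because [cos t * cos (t + e) + sin t *
    sin (t + e) = cos e]. Increments along the rotation are therefore stationary in law. *)
Lemma gvec_rot2 (t e : R) : gvec (P2 P) (rot2 t e) (cov2 e).
Proof.
have [mY eY] := gvec_gfam.
have mr s : measurable_fun setT (rot2 t e s) by case: s => j; exact: measurable_rot.
split=> // a b.
pose A j := a (inl j) * cos t + a (inr j) * cos (t + e).
pose B j := a (inl j) * sin t + a (inr j) * sin (t + e).
have E z : ldot a (rot2 t e ^~ z) + b = ldot B (Y ^~ z.2) + (ldot A (Y ^~ z.1) + b).
  rewrite addrA; congr (_ + b).
  rewrite /ldot big_sumType /= -big_split -big_split /=; apply: eq_bigr => j _.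
  by rewrite /rotation /A /B; ring.
rewrite (@Ex_P2 _ _ _ _ _ 1); last 2 first.
- apply: measurableT_comp.
    by apply: continuous_measurable_fun => z; exact: continuous_cos.
  apply: measurable_funD => //; apply: measurable_sum => i; exact: measurable_funM.
- by move=> z; exact: cos_max.
transitivity (Ex P (fun x => expR (- ((\sum_i \sum_j B i * B j * cov i j) / 2)) *
    cos (ldot A (Y ^~ x) + b))).
  by apply: eq_Ex => x; under eq_Ex do rewrite E /=; rewrite eY mulrC.
rewrite ExZ; last first.
  apply: (@itg_bounded _ _ _ _ _ 1); last by move=> z; exact: cos_max.
  apply: measurableT_comp.
    by apply: continuous_measurable_fun => z; exact: continuous_cos.
  by apply: measurable_funD => //; apply: measurable_sum => i; exact: measurable_funM.
rewrite eY mulrCA -expRD; congr (_ * expR _).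
rewrite -opprD -mulrDl; congr (- (_ / _)).
rewrite big_sumType /= -2!big_split /=; apply: eq_bigr => i _.
rewrite !big_sumType /= -!big_split /=; apply: eq_bigr => j _.
have cs1 : cos t * cos t + sin t * sin t = 1 by rewrite -!expr2 cos2Dsin2.
have cs2 : cos (t + e) * cos (t + e) + sin (t + e) * sin (t + e) = 1 by rewrite -!expr2 cos2Dsin2.
have cs3 : cos t * cos (t + e) + sin t * sin (t + e) = cos e.
  by rewrite -cosB -cosN; congr cos; ring.
rewrite -cs3 /A /B.
transitivity ((a (inl i) * a (inl j) * (cos t * cos t + sin t * sin t) +
  a (inr i) * a (inr j) * (cos (t + e) * cos (t + e) + sin (t + e) * sin (t + e)) +
  (a (inl i) * a (inr j) + a (inr i) * a (inl j)) *
  (cos t * cos (t + e) + sin t * sin (t + e))) * cov i j); first by ring.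
by rewrite cs1 cs2; ring.
Qed.

Lemma Ex_rot_invariant (H : (J -> R) -> (J -> R) -> R) (t e : R) :
  tcl (fun x : J + J -> R => H (fun j => x (inl j)) (fun j => x (inr j))) ->
  Ex (P2 P) (fun z => H (rotation t z) (rotation (t + e) z)) =
  Ex (P2 P) (fun z => H (rotation 0 z) (rotation e z)).
Proof.
move=> tH; have := gvec_Ex_eq (gvec_rot2 t e) (gvec_rot2 0 e) tH.
by rewrite /= add0r.
Qed.

End gaussian_families.

Section product_expectation2.
Context {R : realType} {d : measure_display} {T : measurableType d}.
Variable P : probability T R.

Lemma sum_pow2_le_fin (J : finType) (r : nat) (x : J -> R) :
  (\sum_j x j) ^+ (2 ^ r) <= #|J|%:R ^+ (2 ^ r).-1 * \sum_j x j ^+ (2 ^ r).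
Proof.
have e (f : J -> R) : \sum_j f j = \sum_(i < #|J|) f (enum_val i).
  by rewrite (big_enum_val (A := J) f).
by rewrite !e; exact: sum_pow2_le.
Qed.

Lemma itg_P2_fst (X : T -> R) : itg P X -> itg (P2 P) (fun z => X z.1).
Proof.
move=> iX; have mX := itg_measurable iX.
have mF : measurable_fun setT (fun z : T * T => (`|X z.1|)%:E).
  by apply/measurable_EFinP; apply: measurableT_comp => //; exact: (measurableT_comp mX).
apply/integrableP; split.
  by apply/measurable_EFinP; exact: (measurableT_comp mX).
under eq_integral do rewrite /=.
rewrite (@fubini_tonelli1 _ _ _ _ _ P P _ mF) //.
rewrite /fubini_F /=; under eq_integral do rewrite integral_cst//= probability_setT mule1.
by have /integrableP[_] := iX.
Qed.

Lemma itg_P2_snd (X : T -> R) : itg P X -> itg (P2 P) (fun z => X z.2).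
Proof.
move=> iX; have mX := itg_measurable iX.
have m2 : measurable_fun setT (fun z : T * T => X z.2) by exact: (measurableT_comp mX).
have [i1 _] : itg (P2 P) (fun z => `|X z.2|) /\ Ex (P2 P) (fun z => `|X z.2|) <= Ex P (fun w => `|X w|).
  apply: P2_tonelli_le => //; first exact: measurableT_comp.
  by move=> x; split=> //=; exact: itg_norm.
exact: (itg_le m2 i1).
Qed.

Lemma itg_Ex_P2 (F : T * T -> R) (M : R) : measurable_fun setT F -> (forall z, `|F z| <= M) ->
  itg P (fun x => Ex P (fun y => F (x, y))).
Proof.
move=> mF FM; have iF : itg (P2 P) F by exact: itg_bounded FM.
have iF1 x : itg P (fun y => F (x, y)).
  apply: (@itg_bounded _ _ _ _ _ M) => //.
  by apply: measurableT_comp => //; exact: measurable_pair1.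
have := @integrable_fubini_F _ _ _ _ _ P P (EFin \o F) iF.
rewrite /itg (_ : fubini_F P (EFin \o F) = (fun x => (Ex P (fun y => F (x, y)))%:E))//.
by apply/funext => x; rewrite /fubini_F /= ExE.
Qed.

End product_expectation2.

(** * Concentration of functionals of Gaussian vectors *)

Section concentration.
Context {R : realType} {d : measure_display} {T : measurableType d} {J : finType}.
Variables (P : probability T R) (Y : J -> T -> R).
Hypothesis gY : forall a, gl P (fun w => ldot a (Y ^~ w)).
Variables (Phi : (J -> R) -> R) (D : (J -> R) -> J -> R) (lam v : R).
Hypothesis tPhi : tcl Phi.
Hypothesis lam_ge0 : 0 <= lam.
Hypothesis lipPhi : forall x y, `|Phi x - Phi y| <= lam * \sum_j `|x j - y j|.
Hypothesis derPhi : forall x y : J -> R,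
  is_derive (0 : R) 1 (fun t => Phi (fun j => cos t * x j + sin t * y j)) (\sum_j D x j * y j).
Hypothesis bD : forall x j, `|D x j| <= lam.
Hypothesis v_gt0 : 0 < v.
Hypothesis cov_v : lam ^+ 2 * (\sum_i \sum_j `|cov P Y i j|) <= v.
Variable r : nat.
Local Notation p := (2 ^ r.+1)%N.
Local Notation PP := (P2 P).
Local Notation rotY := (rotation Y).

Let p_ge0 (x : R) : 0 <= x ^+ p.
Proof. by rewrite expnS exprM exprn_ge0// sqr_ge0. Qed.

Let rot0 z : rotY 0 z = Y ^~ z.1.
Proof. by apply/funext => j; rewrite /rotation cos0 sin0 mul1r mul0r addr0. Qed.

Let rotpi z : rotY (pi / 2) z = Y ^~ z.2.
Proof. by apply/funext => j; rewrite /rotation cos_pihalf sin_pihalf mul1r mul0r add0r. Qed.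

Let mY j : measurable_fun setT (Y j). Proof. by have [] := sqi_gfam gY j. Qed.

Let MPhi : {M : R | forall x, `|Phi x| <= M}.
Proof. by apply: cid; exact: tcl_bounded. Qed.

Let mPhi t : measurable_fun setT (fun z => Phi (rotY t z)).
Proof. exact: (@tcl_measurable _ _ _ _ (fun j z => rotY t z j) _ (measurable_rot gY t)). Qed.

Let dPhi t e z := (Phi (rotY t z) - Phi (rotY (t + e) z)) ^+ p.

Let mdPhi t e : measurable_fun setT (dPhi t e).
Proof. by apply: measurable_funX; apply: measurable_funB; exact: mPhi. Qed.

Let M := (sval MPhi + sval MPhi) ^+ p.

Let dPhi_le t e z : `|dPhi t e z| <= M.
Proof.
rewrite /dPhi normrX; apply: lerXn2r; rewrite ?nnegrE//.
  by rewrite addr_ge0//; apply: le_trans (svalP MPhi (rotY t z)).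
by apply: (le_trans (ler_normB _ _)); rewrite lerD//; exact: (svalP MPhi).
Qed.

Let idPhi t e : itg PP (dPhi t e).
Proof. exact: itg_bounded (dPhi_le t e). Qed.

Let dPhi_invariant t e : Ex PP (dPhi t e) = Ex PP (dPhi 0 e).
Proof.
have := @Ex_rot_invariant _ _ _ _ _ _ gY (fun x y => (Phi x - Phi y) ^+ p) t e.
rewrite /dPhi add0r; apply.
by apply: tclX; apply: tclB; exact: (tcl_reindex _ tPhi).
Qed.

(** The quarter turn telescopes into [m] increments of equal law, and the power mean inequality
    bounds its moment by that of a single increment multiplied by [m]. *)
Let step1 (m : nat) : (0 < m)%N ->
  Ex PP (dPhi 0 (pi / 2)) <=
  Ex PP (fun z => (m%:R * (Phi (rotY 0 z) - Phi (rotY (0 + pi / 2 / m%:R) z))) ^+ p).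
Proof.
move=> m0; pose e : R := pi / 2 / m%:R.
have mr : (m%:R : R) != 0 by rewrite pnatr_eq0 -lt0n.
under [leRHS]eq_Ex do rewrite exprMn.
rewrite ExZ//; last exact: idPhi.
have tele z : Phi (rotY 0 z) - Phi (rotY (0 + pi / 2) z) =
    \sum_(k < m) (Phi (rotY (k%:R * e) z) - Phi (rotY (k%:R * e + e) z)).
  have := @telescope_sumr R 0 m (fun k => - Phi (rotY (k%:R * e) z)) (leq0n _).
  rewrite big_mkord mul0r opprK add0r (_ : m%:R * e = pi / 2); last first.
    by rewrite /e mulrC divfK.
  rewrite addrC => <-; apply: eq_bigr => k _.
  by rewrite -natr1 mulrDl mul1r opprK addrC.
apply: (@le_trans _ _ (Ex PP (fun z => m%:R ^+ p.-1 * \sum_(k < m) dPhi (k%:R * e) e z))).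
  apply: Ex_le => //.
    by apply: itgZ; apply: itg_sum => k; exact: idPhi.
  by move=> z; rewrite /dPhi tele; exact: sum_pow2_le.
rewrite ExZ; last by apply: itg_sum => k; exact: idPhi.
rewrite Ex_sum; last by move=> k; exact: idPhi.
under eq_bigr do rewrite dPhi_invariant.
have pE : p = p.-1.+1 by rewrite prednK// expn_gt0.
rewrite sumr_const card_ord (_ : Ex PP (dPhi 0 e) *+ m = m%:R * Ex PP (dPhi 0 e)); last by rewrite mulr_natl.
by rewrite mulrA -exprSr -pE.
Qed.

(** Derivative of the rotated functional at angle [0]. For a fixed first copy it is a linear form in
    the second one, hence Gaussian, with variance at most [v] by [bD] and [cov_v]. *)
Let S (z : T * T) : R := \sum_j D (Y ^~ z.1) j * Y j z.2.

Let eps (n : nat) : R := pi / 2 / n.+1%:R.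

Let eps_neq0 n : eps n != 0.
Proof. by rewrite mulf_neq0 ?invr_neq0// mulf_neq0 ?invr_neq0// gt_eqF// pi_gt0. Qed.

Let eps_cvg : eps @ \oo --> 0.
Proof.
have h : (fun n => pi / 2 * n.+1%:R^-1 : R) @ \oo --> pi / 2 * 0.
  by apply: cvgMr; exact: cvg_inv_nat.
by move: h; rewrite mulr0.
Qed.

Let F (n : nat) z := n.+1%:R * (Phi (rotY 0 z) - Phi (rotY (0 + eps n) z)).

Let F_cvg z : F ^~ z @ \oo --> - (pi / 2 * S z).
Proof.
have h := is_derive_cvg_seq (derPhi (Y ^~ z.1) (Y ^~ z.2)) eps_neq0 eps_cvg.
have h2 : (fun n => - (pi / 2) * ((Phi (rotY (0 + eps n) z) - Phi (rotY 0 z)) / eps n)) @ \oo -->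
    - (pi / 2) * S z by apply: cvgMr; exact: h.
rewrite mulNr in h2; move: h2; apply: cvg_trans; apply: near_eq_cvg; apply: nearW => n.
have pi0 : pi / 2 != 0 :> R by rewrite gt_eqF// divr_gt0// pi_gt0.
rewrite /F /eps; move: (pi / 2) pi0 => q q0; field.
by rewrite q0 nat1r pnatr_eq0.
Qed.

Let G (z : T * T) : R := \sum_(s : J + J) match s with inl j => `|Y j z.1| | inr j => `|Y j z.2| end.

Let F_le n z : `|F n z| <= pi / 2 * lam * G z.
Proof.
have e0 : 0 <= eps n by rewrite /eps !divr_ge0// pi_ge0.
rewrite /F normrM ger0_norm//.
apply: (@le_trans _ _ (n.+1%:R * (lam * \sum_j (eps n * (`|Y j z.1| + `|Y j z.2|))))).
  rewrite ler_wpM2l//; apply: (le_trans (lipPhi _ _)); apply: ler_wpM2l => //.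
  apply: ler_sum => j _; rewrite /rotation add0r cos0 sin0 mul1r mul0r addr0.
  rewrite (_ : _ - _ = (cos 0 - cos (eps n)) * Y j z.1 - sin (eps n) * Y j z.2); last first.
    by rewrite cos0; ring.
  apply: (le_trans (ler_normB _ _)); rewrite mulrDr !normrM; apply: lerD; apply: ler_wpM2r => //.
    by apply: (le_trans (norm_cosB _ _)); rewrite sub0r normrN ger0_norm.
  by apply: (le_trans (norm_sin_le _)); rewrite ger0_norm.
rewrite -mulr_sumr /G big_sumType /= -big_split /= le_eqVlt; apply/orP; left; apply/eqP.
rewrite /eps; field.
by rewrite nat1r pnatr_eq0.
Qed.

Let imom j : itg P (fun w => `|Y j w| ^+ p).
Proof.
have gYj := gfam_coord gY j; have [[_ i2] _ _] := gYj.
have w0 : 0 < 1 + Ex P (fun w => Y j w ^+ 2).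
  by have := @Ex_ge0 _ _ _ P (fun w => Y j w ^+ 2) (fun w => sqr_ge0 _); lra.
have [|i _] := gl_moment (2 ^ r) gYj w0; first lra.
under eq_fun do rewrite expnS exprM real_normK ?num_real//.
by move: i; under eq_fun do rewrite exprM.
Qed.

Let iG : itg PP (fun z => (pi / 2 * lam * G z) ^+ p).
Proof.
under eq_fun do rewrite exprMn.
have G0 z : 0 <= G z by apply: sumr_ge0 => -[j|j] _.
apply: itgZ; apply: (@itg_le _ _ _ _ _ (fun z => #|{: J + J}|%:R ^+ p.-1 *
    \sum_(s : J + J) (match s with inl j => `|Y j z.1| | inr j => `|Y j z.2| end) ^+ p)).
- apply: measurable_funX; apply: measurable_sum => -[j|j]; apply: measurableT_comp => //;
    exact: (measurableT_comp (mY j)).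
- apply: itgZ; apply: itg_sum => -[j|j].
    exact: (itg_P2_fst (imom j)).
  exact: (itg_P2_snd (imom j)).
- by move=> z; rewrite ger0_norm ?p_ge0//; exact: sum_pow2_le_fin.
Qed.

Let bound := (pi / 2) ^+ p * (gmom (2 ^ r) * v ^+ (2 ^ r)).

Let S_moment : itg PP (fun z => (- (pi / 2 * S z)) ^+ p) /\
  (fun n => Ex PP (fun z => F n z ^+ p)) @ \oo --> Ex PP (fun z => (- (pi / 2 * S z)) ^+ p).
Proof.
apply: (@Ex_dct _ _ _ _ _ _ (fun z => (pi / 2 * lam * G z) ^+ p)) => //.
- move=> n; apply: measurable_funX; apply: measurable_funM => //.
  by apply: measurable_funB; exact: mPhi.
- move=> n z; rewrite normrX; apply: lerXn2r => //; rewrite nnegrE//.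
  by apply: le_trans (F_le n z).
- move=> z; apply: (@cvg_comp _ _ _ (F ^~ z) (fun x => x ^+ p) _ (nbhs (- (pi / 2 * S z)))).
    exact: F_cvg.
  exact: exprn_continuous.
Qed.

Let S_bound : Ex PP (fun z => (- (pi / 2 * S z)) ^+ p) <= bound.
Proof.
have [iS _] := S_moment.
apply: (proj2 (@P2_tonelli_le _ _ _ P _ bound (itg_measurable iS) (fun z => p_ge0 _) _)) => x.
have gS := gY (D (Y ^~ x)).
have vS : Ex P (fun w => ldot (D (Y ^~ x)) (Y ^~ w) ^+ 2) <= v.
  rewrite Ex_ldot_sqr//; apply: le_trans cov_v; rewrite mulr_sumr.
  apply: ler_sum => i _; rewrite mulr_sumr; apply: ler_sum => j _.
  apply: (le_trans (ler_norm _)); rewrite !normrM; apply: ler_wpM2r => //.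
  by rewrite expr2; apply: ler_pM.
have [i1 e1] := gl_moment (2 ^ r) gS v_gt0 vS.
have E y : (- (pi / 2 * S (x, y))) ^+ p = (pi / 2) ^+ p * ldot (D (Y ^~ x)) (Y ^~ y) ^+ (2 * 2 ^ r).
  by rewrite expnS -exprMn !exprM sqrrN.
split; first by rewrite (funext E); exact: itgZ.
by rewrite (funext E) ExZ// /bound ler_wpM2l// exprn_ge0// divr_ge0// pi_ge0.
Qed.

(* Maurey-Pisier: rotate Y into an independent copy in m steps and let m tend to infinity. *)
Theorem concentration :
  Ex P (fun w => (Phi (Y ^~ w) - Ex P (fun w' => Phi (Y ^~ w'))) ^+ p) <=
  (pi / 2) ^+ p * (gmom (2 ^ r) * v ^+ (2 ^ r)).
Proof.
have h1 : Ex PP (dPhi 0 (pi / 2)) <= bound.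
  have [_ h] := S_moment; apply: le_trans S_bound.
  rewrite -(cvg_lim _ h)//; apply: limr_ge; first by apply/cvg_ex; eexists; exact: h.
  by apply: nearW => n; exact: step1.
apply: le_trans h1.
rewrite (@Ex_P2 _ _ _ P _ M (mdPhi 0 (pi / 2)) (dPhi_le 0 (pi / 2))).
have iPhi : itg P (fun w => Phi (Y ^~ w)) by exact: tcl_itg.
have ie := @itg_Ex_P2 _ _ _ P _ M (mdPhi 0 (pi / 2)) (dPhi_le 0 (pi / 2)).
have mP : measurable_fun setT (fun w => Phi (Y ^~ w)) by exact: tcl_measurable.
have bP x y : `|Phi x - Phi y| <= sval MPhi + sval MPhi.
  by apply: (le_trans (ler_normB _ _)); rewrite lerD//; exact: (svalP MPhi).
(* The mean is an integral over the independent copy, so Jensen's inequality bounds the centered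
   power by that of a difference of two copies. *)
have main x : (Phi (Y ^~ x) - Ex P (fun w' => Phi (Y ^~ w'))) ^+ p <=
    Ex P (fun y => dPhi 0 (pi / 2) (x, y)).
  have -> : Phi (Y ^~ x) - Ex P (fun w' => Phi (Y ^~ w')) =
      Ex P (fun y => Phi (Y ^~ x) - Phi (Y ^~ y)).
    by rewrite ExB ?Ex_cst//; exact: itg_cst.
  rewrite (_ : (fun y => dPhi 0 (pi / 2) (x, y)) =
      fun y => (Phi (Y ^~ x) - Phi (Y ^~ y)) ^+ p); last first.
    by apply/funext => y; rewrite /dPhi add0r rot0 rotpi.
  apply: (@Ex_pow2_le _ _ _ P _ _ (sval MPhi + sval MPhi)); last by move=> w; exact: bP.
  exact: measurable_funB.
apply: Ex_le => //.
apply: (@itg_le _ _ _ _ _ (fun x => Ex P (fun y => dPhi 0 (pi / 2) (x, y)))) => //.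
  by apply: measurable_funX; exact: measurable_funB.
by move=> x; rewrite ger0_norm// p_ge0.
Qed.

End concentration.

Section edge_functionals.
Context {R : realType} {d : measure_display} {T : measurableType d} {J E : finType}.
Variables (P : probability T R) (Y : J -> T -> R).
Hypothesis gY : forall a, gl P (fun w => ldot a (Y ^~ w)).
Variables (src tgt : E -> J).
Hypothesis src_inj : injective src.
Hypothesis tgt_inj : injective tgt.
Variables (f1 f2 df1 df2 : R -> R) (c : R).
Hypothesis c_ge0 : 0 <= c.
Hypothesis t1 : forall j : J, tcl (fun x : J -> R => f1 (c * x j)).
Hypothesis t2 : forall j : J, tcl (fun x : J -> R => f2 (c * x j)).
Hypothesis b1 : forall x, `|f1 x| <= 1.
Hypothesis b2 : forall x, `|f2 x| <= 1.
Hypothesis d1 : forall x : R, is_derive x 1 f1 (df1 x).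
Hypothesis d2 : forall x : R, is_derive x 1 f2 (df2 x).
Hypothesis bd1 : forall x, `|df1 x| <= 1.
Hypothesis bd2 : forall x, `|df2 x| <= 1.

Definition edge_sum (x : J -> R) : R := \sum_e f1 (c * x (src e)) * f2 (c * x (tgt e)).

Let edge_grad (x : J -> R) (j : J) : R :=
  \sum_(e | src e == j) c * df1 (c * x (src e)) * f2 (c * x (tgt e)) +
  \sum_(e | tgt e == j) c * f1 (c * x (src e)) * df2 (c * x (tgt e)).

Let lip (f df : R -> R) (x y : R) : (forall x : R, is_derive x 1 f (df x)) ->
  (forall x, `|df x| <= 1) -> `|f x - f y| <= `|x - y|.
Proof.
move=> dfP bdf.
have H (a b : R) : b <= a -> `|f a - f b| <= `|a - b|.
  move=> ba; have [|z _ ->] := @MVT_segment R f df b a ba.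
    apply: continuous_subspaceT => z.
    by apply: differentiable_continuous; apply/derivable1_diffP; have [] := dfP z.
  by rewrite normrM ler_piMl.
have [/H//|/ltW/H] := leP y x.
by rewrite distrC [in leRHS]distrC.
Qed.

Let sum_inj (s : E -> J) (g : J -> R) : injective s -> (forall j, 0 <= g j) ->
  \sum_e g (s e) <= \sum_j g j.
Proof.
move=> sI g0; rewrite -(big_imset g (A := predT)); last by move=> x y _ _; exact: sI.
by rewrite [leRHS](bigID [in s @: predT])/= lerDl; apply: sumr_ge0.
Qed.

Let card_fib (s : E -> J) (g : E -> R) (j : J) : injective s -> (forall e, `|g e| <= c) ->
  `|\sum_(e | s e == j) g e| <= c.
Proof.
move=> sI gc; have [[e /eqP ej]|nej] := pselect (exists e, s e == j).
  rewrite (big_pred1 e) => [|e']; first exact: gc.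
  by apply/eqP/eqP => [|->//]; rewrite -ej => /sI.
rewrite big_pred0 ?normr0// => e; apply/negP => se; apply: nej; by exists e.
Qed.

(** By injectivity of [src] and [tgt] each vertex occurs in at most two terms, so every partial
    derivative is at most [2 * c], whatever the number of edges. This is the source of the factor
    [4 * c ^+ 2]. *)
Lemma edge_sum_concentration (v : R) (r : nat) : 0 < v ->
  4 * c ^+ 2 * (\sum_i \sum_j `|cov P Y i j|) <= v ->
  Ex P (fun w => (edge_sum (Y ^~ w) - Ex P (fun w' => edge_sum (Y ^~ w'))) ^+ (2 ^ r.+1)) <=
  (pi / 2) ^+ (2 ^ r.+1) * (gmom (2 ^ r) * v ^+ (2 ^ r)).
Proof.
move=> v0 cv.
apply: (@concentration _ _ _ _ _ _ gY edge_sum edge_grad (2 * c)) => //.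
- by apply: tcl_sum => e; exact: tclM.
- by rewrite mulr_ge0.
- move=> x y; rewrite /edge_sum -sumrB.
  apply: (@le_trans _ _ (\sum_e (c * `|x (src e) - y (src e)| + c * `|x (tgt e) - y (tgt e)|))).
    apply: (le_trans (ler_norm_sum _ _ _)); apply: ler_sum => e _.
    rewrite (_ : _ - _ = (f1 (c * x (src e)) - f1 (c * y (src e))) * f2 (c * x (tgt e)) +
      f1 (c * y (src e)) * (f2 (c * x (tgt e)) - f2 (c * y (tgt e)))); last by ring.
    apply: (le_trans (ler_normD _ _)); rewrite !normrM; apply: lerD.
      apply: (@le_trans _ _ (`|c * x (src e) - c * y (src e)| * 1)).
        by apply: ler_pM => //; exact: lip d1 bd1.
      by rewrite mulr1 -mulrBr normrM ger0_norm.
    apply: (@le_trans _ _ (1 * `|c * x (tgt e) - c * y (tgt e)|)).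
      by apply: ler_pM => //; exact: lip d2 bd2.
    by rewrite mul1r -mulrBr normrM ger0_norm.
  rewrite big_split /= -!mulr_sumr -mulrA mulr2n mulrDl !mul1r.
  by apply: lerD; apply: ler_wpM2l => //; apply: sum_inj.
- move=> x y.
  have dE e : is_derive (0 : R) 1 (fun t => f1 (c * (cos t * x (src e) + sin t * y (src e))) *
      f2 (c * (cos t * x (tgt e) + sin t * y (tgt e))))
      (c * df1 (c * x (src e)) * f2 (c * x (tgt e)) * y (src e) +
       c * f1 (c * x (src e)) * df2 (c * x (tgt e)) * y (tgt e)).
    have lin j : is_derive (0 : R) 1 (fun t => c * (cos t * x j + sin t * y j)) (c * y j).
      by apply: trigger_derive; rewrite cos0 sin0 /GRing.scale/=; ring.
    have e0 j : c * (cos 0 * x j + sin 0 * y j) = c * x j by rewrite cos0 sin0; ring.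
    have h1 : is_derive (0 : R) 1 (f1 \o (fun t => c * (cos t * x (src e) + sin t * y (src e))))
        (df1 (c * x (src e)) * (c * y (src e))).
      by apply: is_derive1_comp; rewrite e0.
    have h2 : is_derive (0 : R) 1 (f2 \o (fun t => c * (cos t * x (tgt e) + sin t * y (tgt e))))
        (df2 (c * x (tgt e)) * (c * y (tgt e))).
      by apply: is_derive1_comp; rewrite e0.
    have := @is_deriveM _ _ _ _ _ _ _ _ h1 h2.
    by move=> /is_derive_eq; apply; rewrite /= !e0 /GRing.scale/=; ring.
  have := @is_derive_sum R R R #|E| (fun i t => f1 (c * (cos t * x (src (enum_val i)) + sin t * y (src (enum_val i)))) *
      f2 (c * (cos t * x (tgt (enum_val i)) + sin t * y (tgt (enum_val i))))) 0 1 _ (fun i => dE (enum_val i)).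
  have enumE (f : E -> R) : \sum_e f e = \sum_(i < #|E|) f (enum_val i).
    by rewrite (big_enum_val (A := E) f).
  rewrite (_ : (fun t => edge_sum _) = \sum_(i < #|E|) (fun t => f1 (c * (cos t * x (src (enum_val i)) + sin t * y (src (enum_val i)))) *
      f2 (c * (cos t * x (tgt (enum_val i)) + sin t * y (tgt (enum_val i)))))); last first.
    by apply/funext => t; rewrite fct_sumE /edge_sum enumE.
  move=> /is_derive_eq; apply.
  rewrite -(enumE (fun e => c * df1 (c * x (src e)) * f2 (c * x (tgt e)) * y (src e) +
       c * f1 (c * x (src e)) * df2 (c * x (tgt e)) * y (tgt e))) big_split /=.
  rewrite (partition_big src predT)//= [X in _ + X](partition_big tgt predT)//= -big_split /=.
  apply: eq_bigr => j _; rewrite /edge_grad mulrDl !mulr_suml.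
  by congr (_ + _); apply: eq_bigr => e /eqP <-.
- move=> x j; rewrite mulr2n mulrDl !mul1r; apply: (le_trans (ler_normD _ _)); apply: lerD.
    apply: card_fib => // e; rewrite !normrM (ger0_norm c_ge0) -mulrA ler_piMr//.
    by rewrite mulr_ile1.
  apply: card_fib => // e; rewrite !normrM (ger0_norm c_ge0) -mulrA ler_piMr//.
  by rewrite mulr_ile1.
- by rewrite exprMn; apply: le_trans cv; rewrite le_eqVlt; apply/orP; left; apply/eqP; ring.
Qed.

End edge_functionals.

(** * The orthant formula *)

Section additive_functions.
Context {R : realType}.

(** Positivity makes [p] monotone, and enclosing [a] between consecutive multiples of [L / m]
    locates [p a] up to [p L / m]. *)
Lemma nonneg_additive_linear (p : R -> R) (L : R) : 0 < L ->
  (forall a, 0 <= a -> a <= L -> 0 <= p a) ->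
  (forall a b, 0 <= a -> 0 <= b -> a + b <= L -> p (a + b) = p a + p b) ->
  forall a, 0 <= a -> a <= L -> p a = p L * (a / L).
Proof.
move=> L0 p0 pD a a0 aL.
have mono x y : 0 <= x -> x <= y -> y <= L -> p x <= p y.
  move=> x0 xy yL; rewrite -(subrK x y) addrC pD ?subr_ge0//; last by rewrite addrC subrK.
  by rewrite lerDl p0 ?subr_ge0//; lra.
have pjm (m : nat) (u : R) : 0 <= u -> m%:R * u <= L -> p (m%:R * u) = m%:R * p u.
  elim: m => [|m IH] u0 muL.
    have := pD 0 0 (lexx _) (lexx _); rewrite addr0 => h.
    by rewrite !mul0r; have := h (ltW L0); lra.
  rewrite -natr1 !mulrDl !mul1r in muL *.
  have mu0 : 0 <= m%:R * u by rewrite mulr_ge0.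
  by rewrite pD// IH//; lra.
have pL0 : 0 <= p L by apply: p0 => //; exact: ltW.
have bound (m : nat) : (0 < m)%N -> `|p a - p L * (a / L)| <= p L / m%:R.
  move=> m0; have mr : (0 : R) < m%:R by rewrite ltr0n.
  pose u := L / m%:R; have u0 : 0 < u by rewrite divr_gt0.
  have mu : m%:R * u = L by rewrite /u mulrC divfK// gt_eqF.
  have pu : p u = p L / m%:R.
    by rewrite -mu pjm ?mu ?(ltW u0)// mulrC mulKf// gt_eqF.
  have au0 : 0 <= a / u by rewrite divr_ge0// ltW.
  pose j := Num.truncn (a / u).
  have /andP[j1 j2] := truncn_itv au0; rewrite -/j in j1 j2.
  have ju : j%:R * u <= a by rewrite -ler_pdivlMr.
  have ju1 : a < j.+1%:R * u by rewrite -ltr_pdivrMr.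
  have lo : j%:R * p u <= p a.
    rewrite -pjm ?(ltW u0)//; last by apply: le_trans ju _.
    by apply: mono => //; rewrite mulr_ge0// ltW.
  have hi : p a <= j.+1%:R * p u.
    have [h|h] := leP (j.+1%:R * u) L.
      by rewrite -pjm ?(ltW u0)//; apply: mono => //; exact: ltW.
    have jm : (m <= j.+1)%N by rewrite -(ler_nat R) -(ler_pM2r u0) mu ltW.
    apply: (@le_trans _ _ (p L)); first exact: mono.
    by rewrite -{1}mu pjm ?mu ?(ltW u0)// ler_wpM2r ?ler_nat// pu divr_ge0.
  have e : p L * (a / L) = (a / u) * p u.
    by rewrite pu /u; field; rewrite !gt_eqF.
  have pu0 : 0 <= p u by rewrite pu divr_ge0.
  rewrite e -pu -natr1 in hi j2 *.
  have h1 : j%:R * p u <= a / u * p u by rewrite ler_wpM2r.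
  have h2 : a / u * p u <= (j%:R + 1) * p u by rewrite ler_wpM2r// ltW.
  by rewrite ler_norml; apply/andP; split; nra.
apply/eqP; rewrite -subr_eq0 -normr_le0; apply/ler_addgt0Pl => e e0.
have [m m0 me] : exists2 m : nat, (0 < m)%N & p L / m%:R <= e.
  exists (Num.truncn (p L / e)).+1 => //.
  rewrite ler_pdivrMr ?ltr0n// mulrC -ler_pdivrMr//.
  have /andP[_ /ltW] := truncn_itv (divr_ge0 pL0 (ltW e0)).
  by [].
by rewrite addr0; apply: le_trans me; exact: bound.
Qed.

End additive_functions.

Section orthant_formula.
Context {R : realType} {d : measure_display} {T : measurableType d}.
Variables (P : probability T R) (X1 X2 : T -> R).
Hypothesis g12 : forall a b, gl P (fun w => a * X1 w + b * X2 w).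
Hypothesis X1_neq0 : Ex P (fun w => Num.sg (X1 w) ^+ 2) = 1.
Local Notation v1 := (Ex P (fun w => X1 w ^+ 2)).
Local Notation v2 := (Ex P (fun w => X2 w ^+ 2)).
Hypothesis v1_gt0 : 0 < v1.
Hypothesis v2_gt0 : 0 < v2.
Local Notation rho := (Ex P (fun w => X1 w * X2 w) / Num.sqrt (v1 * v2)).
Local Notation PP := (P2 P).

Let Y (_ : unit) := X1.

Let gY (a : unit -> R) : gl P (fun w => ldot a (Y ^~ w)).
Proof.
have := g12 (a tt) 0; rewrite (_ : (fun w => _) = fun w => a tt * X1 w); last first.
  by apply/funext => w; rewrite mul0r addr0.
rewrite (_ : (fun w => ldot a _) = fun w => a tt * X1 w)//.
apply/funext => w; rewrite /ldot (bigD1 tt)//= big1 ?addr0// => -[]; by [].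
Qed.

Let A (t : R) (z : T * T) : R := rotation Y t z tt.
Let sA (t : R) (z : T * T) : R := Num.sg (A t z).

Let measurable_sg : measurable_fun setT (@Num.sg R).
Proof.
apply: (@measurable_fun_cvg _ _ _ _ (fun (n : nat) (x : R) => ssgn (n%:R * x))) => //.
  move=> n; apply: measurableT_comp; first exact: measurable_ssgn.
  exact: measurable_funM.
by move=> x _; exact: cvg_ssgn.
Qed.

Let msA t : measurable_fun setT (sA t).
Proof. by apply: measurableT_comp => //; exact: (measurable_rot gY t tt). Qed.

Let sA_le1 t z : `|sA t z| <= 1.
Proof. by rewrite normr_sg; case: (_ == 0). Qed.

Let isA s t : itg PP (fun z => sA s z * sA t z).
Proof.
apply: (@itg_bounded _ _ _ _ _ 1); first exact: measurable_funM.
by move=> z; rewrite normrM mulr_ile1.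
Qed.

Let corr (e : R) : R := Ex PP (fun z => sA 0 z * sA e z).

Let corrE t e : Ex PP (fun z => sA t z * sA (t + e) z) = corr e.
Proof.
have := @Ex_rot_invariant _ _ _ _ _ _ gY (fun x y => Num.sg (x tt) * Num.sg (y tt)) t e.
by apply; apply: tclM; exact: tcl_sg.
Qed.

Let corr0 : corr 0 = 1.
Proof.
rewrite /corr -[RHS]X1_neq0.
have mF : measurable_fun setT (fun z : T * T => sA 0 z * sA 0 z) by exact: measurable_funM.
rewrite (@Ex_P2 _ _ _ P _ 1 mF); last by move=> z; rewrite normrM mulr_ile1.
apply: eq_Ex => x; rewrite -[RHS](Ex_cst P); apply: eq_Ex => y.
by rewrite /sA /A /rotation cos0 sin0 mul1r mul0r addr0 expr2.
Qed.

Let sA_sqr t : Ex PP (fun z => 1 - sA t z * sA t z) = 0.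
Proof.
rewrite ExB//; last exact: itg_cst.
by rewrite Ex_cst -{2}(addr0 t) corrE corr0 subrr.
Qed.

(** Up to the factor [sin (a + b) >= 0], the projection at angle [a] is a positive combination of
    those at angles [0] and [a + b]. Hence, when no sign vanishes, the sign changes from [0] to [a]
    and from [a] to [a + b] add up to that from [0] to [a + b]. *)
Let angle_additive (a b : R) : 0 <= a -> 0 <= b -> a + b <= pi ->
  1 - corr (a + b) = (1 - corr a) + (1 - corr b).
Proof.
move=> a0 b0 abpi.
have [->|an0] := eqVneq a 0; first by rewrite add0r corr0 subrr add0r.
have [->|bn0] := eqVneq b 0; first by rewrite addr0 corr0 subrr addr0.
have {an0} ap : 0 < a by rewrite lt0r an0.
have {bn0} bp : 0 < b by rewrite lt0r bn0.
have sa : 0 < sin a by apply: sin_gt0_pi; lra.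
have sb : 0 < sin b by apply: sin_gt0_pi; lra.
have sab : 0 <= sin (a + b) by apply: sin_ge0_pi; lra.
have E z : sin (a + b) * A a z = sin b * A 0 z + sin a * A (a + b) z.
  have -> : A 0 z = cos 0 * X1 z.1 + sin 0 * X1 z.2 by [].
  have -> : A a z = cos a * X1 z.1 + sin a * X1 z.2 by [].
  have -> : A (a + b) z = cos (a + b) * X1 z.1 + sin (a + b) * X1 z.2 by [].
  rewrite cos0 sin0 sinD cosD.
  have c1 : cos a * cos a = 1 - sin a * sin a by rewrite -!expr2 cos2sin2.
  transitivity ((sin a * cos b * cos a + (cos a * cos a) * sin b) * X1 z.1 +
    sin a * (sin a * cos b + cos a * sin b) * X1 z.2); first by ring.
  by rewrite c1; ring.
have F z : 1 - sA 0 z * sA (a + b) z - (1 - sA 0 z * sA a z) - (1 - sA a z * sA (a + b) z) =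
    sA 0 z * sA a z + sA a z * sA (a + b) z - sA 0 z * sA (a + b) z - 1 by ring.
(* The left side is at most [4] and can be nonzero only if one of the three signs is [0], in which
   case the right side is at least [4]. The right side has mean zero by [sA_sqr]. *)
have bound z : `|sA 0 z * sA a z + sA a z * sA (a + b) z - sA 0 z * sA (a + b) z - 1| <=
    4 * ((1 - sA 0 z * sA 0 z) + (1 - sA a z * sA a z) + (1 - sA (a + b) z * sA (a + b) z)).
  have := E z; rewrite /sA.
  move: (A 0 z) (A a z) (A (a + b) z) => x y u e.
  case: (sgrP x) => x0; case: (sgrP y) => y0; case: (sgrP u) => u0;
    rewrite ?(mul0r, mulr0, mul1r, mulr1, mulrN1, mulN1r, opprK, subr0, sub0r, addr0, add0r);
    try by (rewrite ler_norml; apply/andP; split; lra).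
  - by exfalso; nra.
  - by exfalso; nra.
have i1 := isA 0 a; have i2 := isA a (a + b); have i3 := isA 0 (a + b).
have iq t : itg PP (fun z => 1 - sA t z * sA t z) by apply: itgB; [exact: itg_cst|exact: isA].
have iF : itg PP (fun z => sA 0 z * sA a z + sA a z * sA (a + b) z - sA 0 z * sA (a + b) z - 1).
  by apply: itgB; [apply: itgB => //; exact: itgD|exact: itg_cst].
have : `|Ex PP (fun z => sA 0 z * sA a z + sA a z * sA (a + b) z - sA 0 z * sA (a + b) z - 1)| <= 0.
  apply: (le_trans (Ex_norm_le iF)).
  apply: (@le_trans _ _ (Ex PP (fun z => 4 * ((1 - sA 0 z * sA 0 z) +
    (1 - sA a z * sA a z) + (1 - sA (a + b) z * sA (a + b) z))))).
    apply: Ex_le => //; first exact: itg_norm.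
    by apply: itgZ; apply: itgD => //; exact: itgD.
  rewrite ExZ; last by apply: itgD => //; exact: itgD.
  rewrite ExD//; last exact: itgD.
  by rewrite ExD// !sA_sqr !addr0 mulr0.
rewrite normr_le0 ExB//; [|by apply: itgB => //; exact: itgD|exact: itg_cst].
rewrite ExB//; last exact: itgD.
rewrite ExD// Ex_cst corrE -/(corr a) -/(corr (a + b)).
by move=> /eqP h; lra.
Qed.

Let corr_pi : corr pi = -1.
Proof.
have := corr0; rewrite /corr => h.
rewrite (_ : Ex PP _ = Ex PP (fun z => - (sA 0 z * sA 0 z))); first by rewrite ExN// h.
apply: eq_Ex => z; rewrite /sA (_ : A pi z = - A 0 z) ?sgrN ?mulrN//.
by rewrite /A /rotation cospi sinpi cos0 sin0; ring.
Qed.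

Let corr_linear a : 0 <= a -> a <= pi -> corr a = 1 - 2 * (a / pi).
Proof.
move=> a0 api.
have pos b : 0 <= b -> b <= pi -> 0 <= 1 - corr b.
  move=> _ _; rewrite subr_ge0.
  apply: (@le_trans _ _ (Ex PP (fun=> 1))); last by rewrite Ex_cst.
  apply: Ex_le => //; first exact: itg_cst.
  by move=> z; apply: (le_trans (ler_norm _)); rewrite normrM mulr_ile1.
have := nonneg_additive_linear (pi_gt0 R) pos angle_additive a0 api.
rewrite corr_pi; lra.
Qed.

Lemma rho_itv : -1 <= rho <= 1.
Proof.
have s1 : sqi P X1.
  have [+ _ _] := g12 1 0; rewrite (_ : (fun w => _) = X1)//.
  by apply/funext => w; rewrite mul1r mul0r addr0.
have s2 : sqi P X2.
  have [+ _ _] := g12 0 1; rewrite (_ : (fun w => _) = X2)//.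
  by apply/funext => w; rewrite mul1r mul0r add0r.
have v0 : 0 < v1 * v2 by exact: mulr_gt0.
have := Ex_CS s1 s2 => h.
rewrite -ler_norml normrM normfV (ger0_norm (sqrtr_ge0 _)) ler_pdivrMr ?sqrtr_gt0// mul1r.
by rewrite -sqrtr_sqr ler_wsqrtr.
Qed.

Theorem orthant_formula :
  Ex P (fun w => Num.sg (X1 w) * Num.sg (X2 w)) = 1 - 2 * (acos rho / pi).
Proof.
have rI := rho_itv; have rI' : rho \in `[(-1), 1] by rewrite in_itv.
rewrite -corr_linear ?acos_ge0 ?acos_lepi//.
(* Rescaling [X2] to the variance of [X1] keeps its sign and gives the pair the covariance of two
   projections of a planar Gaussian vector at angle [acos rho]. *)
pose k := Num.sqrt v1 / Num.sqrt v2.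
have k0 : 0 < k by rewrite divr_gt0 ?sqrtr_gt0.
pose Z (s : unit + unit) : T -> R := match s with inl _ => X1 | inr _ => fun w => k * X2 w end.
have sumU (f : unit -> R) : \sum_i f i = f tt.
  by rewrite (bigD1 tt)//= big1 ?addr0// => -[].
have gZ (a : unit + unit -> R) : gl P (fun w => ldot a (Z ^~ w)).
  have := g12 (a (inl tt)) (a (inr tt) * k).
  rewrite (_ : (fun w => ldot a _) = fun w => a (inl tt) * X1 w + a (inr tt) * k * X2 w)//.
  by apply/funext => w; rewrite /ldot big_sumType /= !sumU mulrA.
have sZ s := sqi_gfam gZ s.
have gv := gvec_gfam gZ.
have covE s s' : cov P Z s s' = cov2 P Y (acos rho) s s'.
  have i12 : itg P (fun w => X1 w * X2 w).
    have := sqi_itgM (sZ (inl tt)) (sZ (inr tt)) => /= h.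
    have := itgZ k^-1 h; rewrite (_ : (fun w => _) = fun w => X1 w * X2 w)//.
    by apply/funext => w; field; rewrite gt_eqF.
  have i22 : itg P (fun w => X2 w ^+ 2).
    have [_ h] := sZ (inr tt).
    have := itgZ (k ^- 2) h; rewrite (_ : (fun w => _) = fun w => X2 w ^+ 2)//.
    by apply/funext => w /=; field; rewrite gt_eqF.
  have e12 : k * Ex P (fun w => X1 w * X2 w) = rho * v1.
    rewrite /k sqrtrM ?(ltW v1_gt0)//.
    rewrite -{3}(sqr_sqrtr (ltW v1_gt0)); field.
    by rewrite !gt_eqF ?sqrtr_gt0.
  have aK : cos (acos rho) = rho by rewrite acosK.
  case: s s' => [[]|[]] [[]|[]]; rewrite /cov2 ?aK /cov /=.
  - by [].
  - by under eq_Ex do rewrite mulrCA; rewrite ExZ// e12.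
  - by under eq_Ex do rewrite -mulrA [X2 _ * _]mulrC; rewrite ExZ// e12.
  - transitivity (k ^+ 2 * v2).
      by rewrite -ExZ//; apply: eq_Ex => w; ring.
    rewrite /k exprMn exprVn !sqr_sqrtr ?ltW// divfK ?gt_eqF//.
have gv' : gvec P Z (cov2 P Y (acos rho)).
  case: gv => mZ eZ; split; first exact: mZ.
  move=> a b; apply: (etrans (eZ a b)).
  suff -> : \sum_i \sum_j a i * a j * cov P Z i j =
    \sum_i \sum_j a i * a j * cov2 P Y (acos rho) i j by [].
  by apply: eq_bigr => i _; apply: eq_bigr => j _; rewrite covE.
pose H (x : unit + unit -> R) := Num.sg (x (inl tt)) * Num.sg (x (inr tt)).
have tH : tcl H by apply: tclM; exact: tcl_sg.
transitivity (Ex P (fun w => H (Z ^~ w))).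
  by apply: eq_Ex => w; rewrite /H /Z sgrM (gtr0_sg k0) mul1r.
apply: (etrans (gvec_Ex_eq gv' (gvec_rot2 gY 0 (acos rho)) tH)).
by apply: eq_Ex => z; rewrite /H /rot2 add0r.
Qed.

End orthant_formula.

Section fourth_moments.
Context {R : realType} {d : measure_display} {T : measurableType d}.
Variable P : probability T R.
Implicit Types X Y : T -> R.

(** Fourth moments of both factors make a product square integrable, as [Ex_cvg_sqi] requires when
    covariances are differentiated. *)
Definition m4 X := measurable_fun setT X /\ itg P (fun w => X w ^+ 4).

Lemma gl_m4 X : gl P X -> m4 X.
Proof.
move=> gX; have [[mX iX] _ _] := gX; split=> //.
have w0 : 0 < 1 + Ex P (fun w => X w ^+ 2).
  by have := @Ex_ge0 _ _ _ P (fun w => X w ^+ 2) (fun w => sqr_ge0 _); lra.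
by have [|i _] := gl_moment 2 gX w0; first lra.
Qed.

Lemma m4_sqi X : m4 X -> sqi P X.
Proof.
move=> [mX iX]; split=> //; apply: (@itg_le _ _ _ _ _ (fun w => 1 + X w ^+ 4)).
- exact: measurable_funX.
- by apply: itgD => //; exact: itg_cst.
move=> w; rewrite ger0_norm ?sqr_ge0// (_ : X w ^+ 4 = (X w ^+ 2) ^+ 2); last by ring.
by have := sqr_ge0 (X w); nra.
Qed.

Lemma m4Z (c : R) X : m4 X -> m4 (fun w => c * X w).
Proof.
move=> [mX iX]; split; first exact: measurable_funM.
by under eq_fun do rewrite exprMn; exact: itgZ.
Qed.

Lemma m4D X Y : m4 X -> m4 Y -> m4 (fun w => X w + Y w).
Proof.
move=> [mX iX] [mY iY]; have mXY : measurable_fun setT (fun w => X w + Y w) by exact: measurable_funD.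
split=> //; apply: (@itg_le _ _ _ _ _ (fun w => 8 * (X w ^+ 4 + Y w ^+ 4))).
- exact: measurable_funX.
- by apply: itgZ; exact: itgD.
move=> w; move: (X w) (Y w) => x y; rewrite (_ : (x + y) ^+ 4 = ((x + y) ^+ 2) ^+ 2); last by ring.
rewrite ger0_norm ?sqr_ge0//.
have h1 : (x + y) ^+ 2 <= 2 * (x ^+ 2 + y ^+ 2) by have := sqr_ge0 (x - y); nra.
have h0 := sqr_ge0 (x + y).
have h2 : ((x + y) ^+ 2) ^+ 2 <= (2 * (x ^+ 2 + y ^+ 2)) ^+ 2 by rewrite lerXn2r// ?nnegrE//; lra.
apply: (le_trans h2).
by have := sqr_ge0 (x ^+ 2 - y ^+ 2); nra.
Qed.

Lemma m4B X Y : m4 X -> m4 Y -> m4 (fun w => X w - Y w).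
Proof.
move=> mX mY; have := m4D mX (m4Z (-1) mY).
by under eq_fun do rewrite mulN1r.
Qed.

End fourth_moments.

Section finite_sums.
Context {R : realType}.

Lemma cvg_sum_seq (J : finType) (f : J -> nat -> R) (l : J -> R) :
  (forall j, f j @ \oo --> l j) -> (fun n => \sum_j f j n) @ \oo --> \sum_j l j.
Proof.
move=> fl; elim: (index_enum J) => [|j r IH].
  by rewrite big_nil; under eq_fun do rewrite big_nil; exact: cvg_cst.
by rewrite big_cons; under eq_fun do rewrite big_cons; exact: cvgD.
Qed.

Lemma MVT_closed (f df : R -> R) (s t : R) : s <= t ->
  (forall x, s <= x <= t -> is_derive x 1 f (df x)) ->
  exists2 c, s <= c <= t & f t - f s = df c * (t - s).
Proof.
move=> st dfP; have [||c] := @MVT_segment R f df s t st.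
- by move=> x; rewrite in_itv/= => /andP[sx xt]; apply: dfP; rewrite !ltW.
- apply: derivable_within_continuous => x; rewrite in_itv/= => xst.
  by have [] := dfP x xst.
- by rewrite in_itv/= => cst e; exists c.
Qed.

End finite_sums.

Section path_derivatives.
Context {R : realType}.
Variables (q : nat) (A : set R) (h : R -> R).
Hypothesis hq : of_class q A h.

Lemma of_class_is_derive (u : nat) (s : R) : (u < q)%N -> A s ->
  is_derive s 1 (derive1n u h) (derive1n u.+1 h s).
Proof.
move=> uq As; have [h1 _] := hq.
by rewrite derive1nS derive1E; apply: derivableP; exact: h1.
Qed.

Lemma of_class_continuous (u : nat) (s : R) : (u <= q)%N -> A s ->
  {for s, continuous (derive1n u h)}.
Proof.
move=> uq As; have [h1 h2] := hq.
have [->|uq'] := eqVneq u q; first exact: h2.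
apply: differentiable_continuous; apply/derivable1_diffP; apply: h1 => //.
by rewrite ltn_neqAle uq'.
Qed.

End path_derivatives.

(** * Derivatives of smooth Gaussian processes *)

Section derivative_processes.
Context {R : realType} {d : measure_display} {T : measurableType d}.
Variables (P : probability T R) (q : nat) (A : set R) (X : R -> T -> R).
Hypothesis oA : open A.
Hypothesis smooth : forall w, of_class q A (X ^~ w).
Hypothesis gX : forall (k : nat) (s a : 'I_k -> R), (forall i, A (s i)) ->
  gl P (fun w => \sum_(i < k) a i * X (s i) w).

Definition dX (u : nat) (s : R) (w : T) : R := derive1n u (X ^~ w) s.

Let openA (s : R) : A s -> exists2 e : R, 0 < e & forall x, `|x - s| <= e -> A x.
Proof.
move=> As; have /= [e /= e0 he] := oA As.
exists (e / 2); first by rewrite divr_gt0.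
move=> x xe; apply: he => /=; rewrite distrC; lra.
Qed.

Lemma dX_is_derive (u : nat) (s : R) w : (u < q)%N -> A s ->
  is_derive s 1 ((dX u) ^~ w) (dX u.+1 s w).
Proof. by move=> uq As; exact: (of_class_is_derive (smooth w)). Qed.

Lemma gl_dX (u : nat) : (u <= q)%N ->
  forall (J : finType) (s a : J -> R), (forall j, A (s j)) ->
  gl P (fun w => \sum_j a j * dX u (s j) w).
Proof.
elim: u => [_|u IH uq] J s a As.
  have := @gX #|J| (s \o enum_val) (a \o enum_val) (fun i => As _).
  rewrite (_ : (fun w => _) = (fun w => \sum_j a j * dX 0 (s j) w))//.
  by apply/funext => w; rewrite [RHS](big_enum_val (A := J) (fun j => a j * dX 0 (s j) w)).
have e_ex j : {e : R | 0 < e & forall x, `|x - s j| <= e -> A x}.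
  by apply: cid2; exact: openA.
pose e j := s2val (e_ex j).
have e0 j : 0 < e j by exact: s2valP (e_ex j).
have eA j x : `|x - s j| <= e j -> A x by exact: s2valP' (e_ex j) x.
pose t (n : nat) (j : J) : R := e j * n.+1%:R^-1.
have t0 n j : t n j != 0 by rewrite mulf_neq0 ?invr_neq0// gt_eqF.
have tc j : (t ^~ j) @ \oo --> 0.
  have h : (fun n : nat => e j * n.+1%:R^-1) @ \oo --> e j * 0.
    by apply: cvgMr; exact: cvg_inv_nat.
  by move: h; rewrite mulr0.
have te n j : A (s j + t n j).
  apply: eA; rewrite [s j + _ - _](_ : _ = t n j); last by ring.
  have n1 : `|n.+1%:R^-1 : R| <= 1 by rewrite ger0_norm// invf_le1// ler1n.
  by rewrite normrM (ger0_norm (ltW (e0 j))) ler_piMr// ltW.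
pose D n w := \sum_j a j * ((dX u (s j + t n j) w - dX u (s j) w) / t n j).
have [] // := @gl_limit _ _ _ P D (fun w => \sum_j a j * dX u.+1 (s j) w).
- move=> n.
  have := IH (ltnW uq) (J + J)%type
    (fun z => match z with inl j => s j + t n j | inr j => s j end)
    (fun z => match z with inl j => a j / t n j | inr j => - (a j / t n j) end) _.
  rewrite (_ : (fun w => _) = D n); first by apply; case=> j.
  apply/funext => w; rewrite big_sumType /= -big_split /=; apply: eq_bigr => j _.
  by field; exact: t0.
- move=> w; rewrite /D.
  apply: (@cvg_sum_seq _ J (fun j n => a j * ((dX u (s j + t n j) w - dX u (s j) w) / t n j))
    (fun j => a j * dX u.+1 (s j) w)) => j.
  apply: cvgMr.
  exact: (is_derive_cvg_seq (dX_is_derive w uq (As j)) (fun n => t0 n j) (tc j)).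
Qed.

Lemma gl_dX1 (u : nat) (s : R) : (u <= q)%N -> A s -> gl P (dX u s).
Proof.
move=> uq As; have := @gl_dX u uq unit (fun=> s) (fun=> 1) (fun=> As).
rewrite (_ : (fun w => _) = dX u s)//.
by apply/funext => w; rewrite (bigD1 tt)//= big1 ?addr0 ?mul1r// => -[].
Qed.

Lemma gl_dX_diff (u : nat) (s t c : R) : (u <= q)%N -> A s -> A t ->
  gl P (fun w => (dX u t w - dX u s w) / c).
Proof.
move=> uq As At.
have := @gl_dX u uq bool (fun b => if b then t else s) (fun b => if b then c^-1 else - c^-1) _.
rewrite (_ : (fun w => _) = (fun w => (dX u t w - dX u s w) / c)); first by apply; case.
apply/funext => w; rewrite (bigD1 true)//= (bigD1 false)//= big1 => [|[]//].
by rewrite addr0; ring.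
Qed.

Lemma diffquot_cvg (u : nat) (s : R) (e : nat -> R) : (u < q)%N -> A s ->
  (forall n, e n != 0) -> (forall n, A (s + e n)) -> e @ \oo --> 0 ->
  (fun n => Ex P (fun w => ((dX u (s + e n) w - dX u s w) / e n) ^+ 2)) @ \oo -->
  Ex P (fun w => dX u.+1 s w ^+ 2).
Proof.
move=> uq As e0 eA ec.
apply: (proj2 (@gl_limit _ _ _ P (fun n w => (dX u (s + e n) w - dX u s w) / e n) _ _ _)).
  by move=> n; apply: gl_dX_diff => //; exact: ltnW.
by move=> w; exact: (is_derive_cvg_seq (dX_is_derive w uq As) e0 ec).
Qed.

(** No dominating variable is at hand. The variances of the difference quotients converge, hence are
    bounded, Gaussianity bounds their fourth moments, and convergence of the means follows from
    bounded second moments of the products. *)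
Lemma Ex_dX_is_derive (u : nat) (s : R) (Z : T -> R) : (u < q)%N -> A s -> m4 P Z ->
  is_derive s 1 (fun x => Ex P (fun w => Z w * dX u x w)) (Ex P (fun w => Z w * dX u.+1 s w)).
Proof.
move=> uq As mZ; have [r r0 rA] := openA As.
have sZ := m4_sqi mZ.
apply: (is_derive_seq r0) => e e0 er ec.
have eA n : A (s + e n) by apply: rA; rewrite [s + _ - _](_ : _ = e n)//; ring.
have gD n : gl P (fun w => (dX u (s + e n) w - dX u s w) / e n).
  by apply: gl_dX_diff => //; exact: ltnW.
have vc := diffquot_cvg uq As e0 eA ec.
pose v n := Ex P (fun w => ((dX u (s + e n) w - dX u s w) / e n) ^+ 2).
have [C C0 vC] : exists2 C : R, 0 < C & forall n, v n <= C.
  have /cvg_seq_bounded /bounded_fun_has_ubound := cvgP _ vc.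
  move=> [C hC]; exists (`|C| + 1); first by rewrite ltr_wpDl.
  move=> n; apply: (@le_trans _ _ C); first by apply: hC; exists n.
  by apply: (le_trans (ler_norm _)); lra.
have mD n := gl_moment 2 (gD n) C0 (vC n).
have [mZ1 iZ4] := mZ.
have mDn n : measurable_fun setT (fun w => (dX u (s + e n) w - dX u s w) / e n).
  by have [[]] := gD n.
have i4 n : itg P (fun w => Z w ^+ 4 + ((dX u (s + e n) w - dX u s w) / e n) ^+ 4).
  by apply: itgD => //; exact: (mD n).1.
have sq_le (x y : R) : (x * y) ^+ 2 <= x ^+ 4 + y ^+ 4.
  rewrite exprMn -[4%N]/(2 * 2)%N !exprM.
  set a := x ^+ 2; set b := y ^+ 2; have := sqr_ge0 (a - b).
  have : 0 <= a * b by rewrite mulr_ge0// sqr_ge0.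
  have -> : (a - b) ^+ 2 = a ^+ 2 + b ^+ 2 - 2 * (a * b) by ring.
  lra.
have [_ _ h] : [/\ sqi P (fun w => Z w * dX u.+1 s w),
    Ex P (fun w => (Z w * dX u.+1 s w) ^+ 2) <= Ex P (fun w => Z w ^+ 4) + gmom 2 * C ^+ 2 &
    (fun n => Ex P (fun w => Z w * ((dX u (s + e n) w - dX u s w) / e n))) @ \oo -->
      Ex P (fun w => Z w * dX u.+1 s w)].
  apply: Ex_cvg_sqi.
  - move=> n; split; first exact: measurable_funM.
    apply: (itg_le _ (i4 n)); first by apply: measurable_funX; exact: measurable_funM.
    by move=> w; rewrite ger0_norm ?sqr_ge0.
  - move=> n; apply: (@le_trans _ _ (Ex P (fun w => Z w ^+ 4 +
      ((dX u (s + e n) w - dX u s w) / e n) ^+ 4))).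
      apply: Ex_le => //; apply: (itg_le _ (i4 n)).
        by apply: measurable_funX; exact: measurable_funM.
      by move=> w; rewrite ger0_norm ?sqr_ge0.
    by rewrite ExD//; [rewrite lerD2l; exact: (mD n).2|exact: (mD n).1].
  - move=> w; apply: cvgMr.
    exact: (is_derive_cvg_seq (dX_is_derive w uq As) e0 ec).
have iZ x : A x -> itg P (fun w => Z w * dX u x w).
  by move=> Ax; apply: sqi_itgM => //; have [] := gl_dX1 (ltnW uq) Ax.
move: h; apply: cvg_trans; apply: near_eq_cvg; apply: nearW => n.
rewrite -ExB; [|exact: iZ|exact: iZ].
rewrite mulrC -ExZ; last by apply: itgB; exact: iZ.
by apply: eq_Ex => w; ring.
Qed.

(** A duality argument: the mean value theorem is applied to the scalar function [E[Z * X^(u)]] with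
    [Z] the increment itself, and Cauchy-Schwarz leaves one factor of the norm of [Z] to cancel. *)
Lemma Ex_increment_le (u : nat) (s t K : R) : (u < q)%N -> s <= t ->
  (forall x, s <= x <= t -> A x) -> 0 <= K ->
  (forall x, s <= x <= t -> Ex P (fun w => dX u.+1 x w ^+ 2) <= K ^+ 2) ->
  Ex P (fun w => (dX u t w - dX u s w) ^+ 2) <= K ^+ 2 * (t - s) ^+ 2.
Proof.
move=> uq st sA K0 hK.
have As : A s by apply: sA; rewrite lexx.
have At : A t by apply: sA; rewrite lexx andbT.
pose Z w := dX u t w - dX u s w.
have mZ : m4 P Z.
  by apply: m4B; apply: gl_m4; apply: gl_dX1 => //; exact: ltnW.
have sZ := m4_sqi mZ.
have iZ x : s <= x <= t -> itg P (fun w => Z w * dX u x w).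
  by move=> xst; apply: sqi_itgM => //; have [] := gl_dX1 (ltnW uq) (sA x xst).
have [c cst e] := MVT_closed st (fun x xst => Ex_dX_is_derive uq (sA x xst) mZ).
have sc : sqi P (dX u.+1 c) by have [] := gl_dX1 uq (sA c cst).
have := Ex_CS sZ sc; set b := Ex P (fun w => Z w * dX u.+1 c w) in e *.
set a := Ex P (fun w => Z w ^+ 2) => h.
have ea : a = b * (t - s).
  rewrite -e -ExB; [|by apply: iZ; rewrite st lexx|by apply: iZ; rewrite lexx st].
  by apply: eq_Ex => w; rewrite /Z; ring.
have a0 : 0 <= a by apply: Ex_ge0 => w; exact: sqr_ge0.
rewrite -/a; have [->|an0] := eqVneq a 0; first by rewrite mulr_ge0 ?sqr_ge0.
have ap : 0 < a by rewrite lt0r an0.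
rewrite -(ler_pM2l ap) -expr2 [a ^+ 2](_ : _ = b ^+ 2 * (t - s) ^+ 2); last by rewrite ea exprMn.
rewrite [leRHS]mulrA; apply: ler_wpM2r; first exact: sqr_ge0.
by apply: (le_trans h); apply: ler_wpM2l => //; exact: hK.
Qed.

(** The duality of [Ex_increment_le] with [Z] the Taylor remainder; subtracting [x * b] brings in
    the increment of the first derivative, bounded by that lemma. *)
Lemma Ex_taylor_le (s t K : R) : (1 < q)%N -> s <= t ->
  (forall x, s <= x <= t -> A x) -> 0 <= K ->
  (forall x, s <= x <= t -> Ex P (fun w => dX 2 x w ^+ 2) <= K ^+ 2) ->
  Ex P (fun w => (X t w - X s w - (t - s) * dX 1 s w) ^+ 2) <= (K * (t - s) ^+ 2) ^+ 2.
Proof.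
move=> q1 st sA K0 hK; have q0 : (0 < q)%N by exact: ltnW.
have As : A s by apply: sA; rewrite lexx.
have At : A t by apply: sA; rewrite lexx andbT.
pose Z w := dX 0 t w - dX 0 s w - (t - s) * dX 1 s w.
have mZ : m4 P Z.
  apply: m4B; last by apply: m4Z; apply: gl_m4; exact: gl_dX1.
  by apply: m4B; apply: gl_m4; exact: gl_dX1.
have sZ := m4_sqi mZ.
have iZ u x : (u <= q)%N -> s <= x <= t -> itg P (fun w => Z w * dX u x w).
  by move=> uq xst; apply: sqi_itgM => //; have [] := gl_dX1 uq (sA x xst).
pose b := Ex P (fun w => Z w * dX 1 s w).
have dZ x : s <= x <= t -> is_derive x 1
    ((fun x => Ex P (fun w => Z w * dX 0 x w)) \- (fun x => x * b))
    (Ex P (fun w => Z w * dX 1 x w) - b).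
  move=> xst; apply: is_deriveB; first by apply: Ex_dX_is_derive => //; exact: sA.
  have h : is_derive x (1 : R) ( *%R^~ b : R -> R) (1 * b) by apply: trigger_derive; rewrite /GRing.scale/=; ring.
  by move: h; rewrite mul1r.
have [c cst e] := MVT_closed st dZ.
have sc : sqi P (fun w => dX 1 c w - dX 1 s w).
  by apply: sqiB; [have [] := gl_dX1 q0 (sA c cst)|have [] := gl_dX1 q0 As].
have /andP[sc1 ct] := cst.
have cs : Ex P (fun w => (dX 1 c w - dX 1 s w) ^+ 2) <= K ^+ 2 * (t - s) ^+ 2.
  apply: (@le_trans _ _ (K ^+ 2 * (c - s) ^+ 2)).
    apply: Ex_increment_le => // x /andP[sx xc]; [apply: sA|apply: hK];
      by rewrite sx (le_trans xc).
  apply: ler_wpM2l; first exact: sqr_ge0.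
  by rewrite lerXn2r// ?nnegrE ?subr_ge0// lerD2r.
have := Ex_CS sZ sc; set a := Ex P (fun w => Z w ^+ 2).
have ts : s <= t <= t by rewrite st lexx.
have ss : s <= s <= t by rewrite st lexx.
have -> : Ex P (fun w => Z w * (dX 1 c w - dX 1 s w)) = Ex P (fun w => Z w * dX 1 c w) - b.
  rewrite -ExB; [|exact: iZ|exact: iZ].
  by apply: eq_Ex => w; ring.
set k := _ - b in e * => h.
have ea : a = k * (t - s).
  have <- : Ex P (fun w => Z w * dX 0 t w) - Ex P (fun w => Z w * dX 0 s w) - (t - s) * b = k * (t - s).
    by rewrite -e /= !/(_ \- _); ring.
  rewrite /b -ExB; [|exact: iZ|exact: iZ].
  rewrite -ExZ -?ExB; [|apply: itgB; exact: iZ|apply: itgZ; exact: iZ|exact: iZ].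
  by apply: eq_Ex => w; rewrite /Z; ring.
have a0 : 0 <= a by apply: Ex_ge0 => w; exact: sqr_ge0.
rewrite -/a; have [->|an0] := eqVneq a 0; first exact: sqr_ge0.
have ap : 0 < a by rewrite lt0r an0.
rewrite -(ler_pM2l ap) -expr2 [a ^+ 2](_ : _ = k ^+ 2 * (t - s) ^+ 2); last by rewrite ea exprMn.
apply: (@le_trans _ _ (a * (K ^+ 2 * (t - s) ^+ 2) * (t - s) ^+ 2)).
  apply: ler_wpM2r; first exact: sqr_ge0.
  by apply: (le_trans h); apply: ler_wpM2l.
by rewrite le_eqVlt; apply/orP; left; apply/eqP; ring.
Qed.

End derivative_processes.

(** * Suprema of Gaussian paths *)

Section path_supremum.
Context {R : realType} {d : measure_display} {T : measurableType d}.
Variables (P : probability T R).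

Lemma dyadic_dense (f : R -> R) (c L lam : R) : 0 <= L ->
  (forall x, c <= x <= c + L -> {for x, continuous f}) ->
  (forall N i, (i <= 2 ^ N)%N -> `|f (c + i%:R * (L / (2 ^ N)%:R))| <= lam) ->
  forall x, c <= x <= c + L -> `|f x| <= lam.
Proof.
move=> L0 fc fN x /andP[cx xL].
have [L00|Lp] := eqVneq L 0.
  have -> : x = c + 0%:R * (L / (2 ^ 0)%:R) by rewrite mul0r addr0; apply/eqP; rewrite eq_le cx andbT; move: xL; rewrite L00 addr0.
  exact: fN.
have {}L0 : 0 < L by rewrite lt0r Lp.
pose y := (x - c) / L.
have y0 : 0 <= y by apply: divr_ge0; [rewrite subr_ge0|exact: ltW].
have y1 : y <= 1 by rewrite ler_pdivrMr// mul1r; lra.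
have p2 (N : nat) : 0 < (2 ^ N)%:R :> R by rewrite ltr0n expn_gt0.
pose i N := Num.truncn (y * (2 ^ N)%:R).
have iN N : (i N)%:R <= y * (2 ^ N)%:R < (i N).+1%:R.
  by apply: truncn_itv; rewrite mulr_ge0// ltW.
have i2 N : (i N <= 2 ^ N)%N.
  rewrite -(ler_nat R); have /andP[h _] := iN N; apply: (le_trans h).
  by rewrite ler_piMl// ltW.
pose t N := c + (i N)%:R * (L / (2 ^ N)%:R).
have tx : t @ \oo --> x.
  have h : (fun N : nat => x - L * (2 ^ N)%:R^-1) @ \oo --> x.
    rewrite -[X in _ --> X]subr0 -[X in _ --> _ - X](mulr0 L).
    apply: cvgB; first exact: cvg_cst.
    apply: cvgMr.
    have := @cvg_geometric R 1 2^-1 _; rewrite ger0_norm ?invr_ge0// => /(_ _).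
    have -> : geometric 1 2^-1 = (fun N : nat => (2 ^ N)%:R^-1 :> R).
      by apply/funext => N; rewrite /geometric/= mul1r natrX exprVn.
    by apply; rewrite invf_lt1// ltr1n.
  apply: (squeeze_cvgr _ h); last exact: cvg_cst.
  apply: nearW => N; have /andP[h1 h2] := iN N; rewrite /t.
  have ex : x = c + y * (2 ^ N)%:R * (L / (2 ^ N)%:R).
    by rewrite /y; field; rewrite !gt_eqF.
  have q0 : 0 < L / (2 ^ N)%:R by rewrite divr_gt0.
  move: h2; rewrite -natr1 => h2.
  apply/andP; split; rewrite {1}ex; last by rewrite lerD2l ler_pM2r.
  rewrite -addrA lerD2l -[X in _ - X]mul1r -mulrBl ler_pM2r//; lra.
have tin N : c <= t N <= c + L.
  have q0 : 0 < L / (2 ^ N)%:R by rewrite divr_gt0.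
  rewrite /t; apply/andP; split; first by rewrite lerDl; apply: mulr_ge0 => //; exact: ltW.
  rewrite lerD2l mulrCA; apply: ler_piMr; first exact: ltW.
  by rewrite ler_pdivrMr// mul1r ler_nat.
have fx : {for x, continuous f} by apply: fc; rewrite cx.
have ft : (fun N => `|f (t N)|) @ \oo --> `|f x|.
  by apply: cvg_norm; apply: (cvg_comp _ _ tx fx).
have : `|f x| \in [set z | z <= lam].
  rewrite inE; apply: (closed_cvg _ _ _ _ ft); first exact: closed_le.
  by apply: nearW => N; exact: fN.
by rewrite inE.
Qed.

Lemma nondecreasing_prob_le (B : nat -> set T) (b : \bar R) :
  (forall N, measurable (B N)) -> (forall N, B N `<=` B N.+1) ->
  (forall N, (P (B N) <= b)%E) -> (P (\bigcup_N B N) <= b)%E.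
Proof.
move=> mB BS Bb.
have hB : {homo B : n m / (n <= m)%N >-> (n <= m)%O}.
  move=> i j ij; apply/subsetPset; move: ij; elim: j => [|j IH].
    by rewrite leqn0 => /eqP->.
  rewrite leq_eqVlt ltnS => /orP[/eqP->//|/IH h].
  exact: (subset_trans h (BS j)).
have h := nondecreasing_cvg_mu (mu := P) mB (bigcup_measurable (fun k _ => mB k)) hB.
by apply: (cvge_le _ h); apply: nearW => N; exact: Bb.
Qed.

Lemma normrX_pow2 (x : R) (p : nat) : `|x| ^+ (2 * p) = x ^+ (2 * p).
Proof. by rewrite exprM real_normK ?num_real// -exprM. Qed.

Lemma norm_walk_le (n : nat) (x : nat -> R) (i : nat) : (i <= n)%N ->
  `|x i| <= `|x 0%N| + \sum_(k < n) `|x k.+1 - x k|.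
Proof.
elim: n i => [|n IH] i; first by rewrite leqn0 => /eqP->; rewrite big_ord0 addr0.
rewrite leq_eqVlt ltnS => /orP[/eqP->|/IH h].
  have := IH n (leqnn n); rewrite big_ord_recr/= => h.
  have := ler_normD (x n) (x n.+1 - x n); rewrite [x n + _]addrC subrK; lra.
by rewrite big_ord_recr/=; have := normr_ge0 (x n.+1 - x n); lra.
Qed.

Variables (q : nat) (A : set R) (X : R -> T -> R).
Hypothesis oA : open A.
Hypothesis smooth : forall w, of_class q A (X ^~ w).
Hypothesis gX : forall (k : nat) (s a : 'I_k -> R), (forall i, A (s i)) ->
  gl P (fun w => \sum_(i < k) a i * X (s i) w).
Notation dX := (dX X).

(** No multiscale chaining is needed: over [2 ^ N] steps the increments are of order [2 ^- N] in
    moment norm, so the initial value plus the total variation along the grid has a moment bounded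
    uniformly in [N]. The grid events increase with [N], and continuity extends the bound to the
    whole interval. *)
Lemma path_sup (u r : nat) (c L V lam : R) : (u < q)%N -> 0 <= L <= 1 ->
  (forall x, c <= x <= c + L -> A x) -> 0 < V -> 0 < lam ->
  (forall v x, (u <= v <= u.+1)%N -> c <= x <= c + L -> Ex P (fun w => dX v x w ^+ 2) <= V) ->
  exists B, [/\ measurable B,
    (P B <= (2 ^+ (2 ^ r.+1) * (gmom (2 ^ r) * V ^+ (2 ^ r)) / lam ^+ (2 ^ r.+1))%:E)%E &
    forall w, ~ B w -> forall x, c <= x <= c + L -> `|dX u x w| <= lam].
Proof.
move=> uq /andP[L0 L1] LA V0 lam0 hV.
set p := (2 ^ r)%N; have ep : (2 ^ r.+1 = 2 * p)%N by rewrite expnS.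
set m := (2 ^ r.+1)%N in ep *.
have m0 : (0 < m)%N by rewrite expn_gt0.
pose M N : R := (2 ^ N)%:R.
have M0 N : 0 < M N by rewrite ltr0n expn_gt0.
pose t N (i : nat) : R := c + i%:R * (L / M N).
have tin N i : (i <= 2 ^ N)%N -> c <= t N i <= c + L.
  move=> iN; apply/andP; split.
    by rewrite lerDl; apply: mulr_ge0 => //; apply: divr_ge0 => //; exact: ltW.
  rewrite lerD2l mulrCA; apply: ler_piMr => //.
  by rewrite ler_pdivrMr// mul1r ler_nat.
have mX v x : (v <= q)%N -> c <= x <= c + L -> measurable_fun setT (dX v x).
  by move=> vq xc; have [[]] := gl_dX1 oA smooth gX vq (LA x xc).
pose B N := \bigcup_(i in [set i | (i <= 2 ^ N)%N]) [set w | lam < `|dX u (t N i) w|].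
have mB N : measurable (B N).
  apply: bigcup_measurable => i /= iN.
  rewrite -[X in measurable X]setTI.
  have mf : measurable_fun setT (fun w => `|dX u (t N i) w|).
    by apply: measurableT_comp => //; apply: mX; [exact: ltnW|exact: tin].
  have := mf measurableT `]lam, +oo[%classic (measurable_itv _).
  by rewrite (_ : _ @^-1` _ = [set w | lam < `|dX u (t N i) w|])//;
    apply/funext => w /=; rewrite in_itv/= andbT.
have BS N : B N `<=` B N.+1.
  move=> w [i /= iN h]; exists (2 * i)%N => /=; first by rewrite expnS leq_mul2l.
  rewrite (_ : t N.+1 (2 * i)%N = t N i)// /t /M expnS !natrM.
  by congr (_ + _); field; rewrite gt_eqF// ltr0n expn_gt0.
pose D N (i : 'I_(2 ^ N)) w := dX u (t N i.+1) w - dX u (t N i) w.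
(* Power mean bound for [(|X c| + \sum |D|) ^+ m]; the factor [M N ^+ m.-1] is compensated by the
   [M N] increments having moments of order [M N ^- m]. *)
pose Y N w := 2 ^+ m.-1 * (dX u c w ^+ m + M N ^+ m.-1 * \sum_i D N i w ^+ m).
have cc : c <= c <= c + L by rewrite lexx lerDl.
have uu : (u <= u <= u.+1)%N by rewrite leqnn leqnSn.
have gc : gl P (dX u c) by apply: (gl_dX1 oA smooth gX (ltnW uq)); exact: LA.
have [ic Ec] := gl_moment p gc V0 (hV u c uu cc).
have DP N i : itg P (fun w => D N i w ^+ m) /\
    Ex P (fun w => D N i w ^+ m) <= gmom p * (V ^+ p / M N ^+ m).
  have i1 : (i <= 2 ^ N)%N by exact: ltnW.
  have gD : gl P (D N i).
    have := @gl_dX_diff _ _ _ P q A X oA smooth gX u (t N i) (t N i.+1) 1 (ltnW uq)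
      (LA _ (tin _ _ i1)) (LA _ (tin _ _ (ltn_ord i))).
    by under eq_fun do rewrite divr1.
  have h0 : 0 < V / M N ^+ 2 by rewrite divr_gt0// exprn_gt0.
  have tS : t N i.+1 - t N i = L / M N by rewrite /t -natr1; ring.
  have LM : 0 <= L / M N by apply: divr_ge0 => //; exact: ltW.
  have eD : Ex P (fun w => D N i w ^+ 2) <= V / M N ^+ 2.
    have := @Ex_increment_le _ _ _ P q A X oA smooth gX u (t N i) (t N i.+1)
      (Num.sqrt V) uq _ _ (sqrtr_ge0 _) _.
    rewrite tS (sqr_sqrtr (ltW V0)) => h; apply: (le_trans (h _ _ _)).
    - by rewrite -subr_ge0 tS.
    - move=> x /andP[x1 x2]; apply: LA; have /andP[h1 _] := tin _ _ i1.
      have /andP[_ h2] := tin _ _ (ltn_ord i).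
      by rewrite (le_trans h1 x1) (le_trans x2 h2).
    - move=> x /andP[x1 x2]; apply: hV; first by rewrite leqnSn leqnn.
      have /andP[h1 _] := tin _ _ i1; have /andP[_ h2] := tin _ _ (ltn_ord i).
      by rewrite (le_trans h1 x1) (le_trans x2 h2).
    rewrite ler_pM2l// exprMn exprVn ler_piMl//; first by rewrite invr_ge0 exprn_ge0// ltW.
    by rewrite exprn_ile1.
  have := gl_moment p gD h0 eD.
  by rewrite -ep ep exprM -ep exprMn exprVn.
have iY N : itg P (Y N).
  apply: itgZ; apply: itgD; first by rewrite ep.
  by apply: itgZ; apply: itg_sum => i; exact: (DP N i).1.
have EY N : Ex P (Y N) <= 2 ^+ m * (gmom p * V ^+ p).
  rewrite /Y ExZ; last first.
    apply: itgD; first by rewrite ep.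
    by apply: itgZ; apply: itg_sum => i; exact: (DP N i).1.
  rewrite ExD; [|by rewrite ep|by apply: itgZ; apply: itg_sum => i; exact: (DP N i).1].
  rewrite ExZ; last by apply: itg_sum => i; exact: (DP N i).1.
  rewrite Ex_sum; last by move=> i; exact: (DP N i).1.
  have h1 : \sum_i Ex P (fun w => D N i w ^+ m) <= M N * (gmom p * (V ^+ p / M N ^+ m)).
    apply: (@le_trans _ _ (\sum_(i < 2 ^ N) (gmom p * (V ^+ p / M N ^+ m)))).
      by apply: ler_sum => i _; exact: (DP N i).2.
    by rewrite sumr_const card_ord -mulr_natl.
  have h2 : M N ^+ m.-1 * \sum_i Ex P (fun w => D N i w ^+ m) <= gmom p * V ^+ p.
    apply: (le_trans (ler_wpM2l _ h1)); first by apply: exprn_ge0; exact: ltW.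
    have -> : M N ^+ m = M N ^+ m.-1 * M N by rewrite -exprSr prednK.
    rewrite le_eqVlt; apply/orP; left; apply/eqP; move: (M N) (M0 N) => z z0.
    have zm : z ^+ m.-1 != 0 by rewrite expf_neq0// gt_eqF.
    by field; rewrite zm gt_eqF.
  rewrite -[X in 2 ^+ X * (gmom _ * _)](prednK m0) exprSr -mulrA ler_pM2l ?exprn_gt0//.
  by move: Ec; rewrite -ep => Ec; lra.
have BY N w : B N w -> lam ^+ m <= Y N w.
  move=> [i /= iN h].
  have := @norm_walk_le (2 ^ N) (fun i => dX u (t N i) w) i iN.
  have -> : t N 0%N = c by rewrite /t mul0r addr0.
  set S := \sum_(k < _) _ => hS.
  have S0 : 0 <= S by apply: sumr_ge0 => k _.
  have hl : lam ^+ m <= (`|dX u c w| + S) ^+ m.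
    rewrite lerXn2r// ?nnegrE ?addr_ge0// ?(ltW lam0)//.
    by apply: ltW; apply: (lt_le_trans h).
  apply: (le_trans hl).
  have := @sum_pow2_le _ r.+1 2 (fun i : 'I_2 => if i == ord0 then `|dX u c w| else S).
  rewrite !big_ord_recl !big_ord0 /= !addr0 -/m => hh; apply: (le_trans hh).
  rewrite /Y ler_pM2l ?exprn_gt0//.
  have -> : `|dX u c w| ^+ m = dX u c w ^+ m by rewrite ep normrX_pow2.
  rewrite lerD2l; have := @sum_pow2_le _ r.+1 (2 ^ N) (fun i => `|D N i w|).
  rewrite -/m -/S (eq_bigr (fun i => D N i w ^+ m))// => k _.
  by rewrite ep normrX_pow2.
exists (\bigcup_N B N); split.
- exact: bigcup_measurable.
- apply: nondecreasing_prob_le => // N.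
  have lm : 0 < lam ^+ m by exact: exprn_gt0.
  apply: (le_trans (@probability_le_Ex _ _ _ P (B N) (Y N) (lam ^+ m) (mB N) (iY N) lm _ (BY N))).
    move=> w; rewrite /Y; apply: mulr_ge0; first exact: exprn_ge0.
    apply: addr_ge0; first by rewrite ep exprM exprn_ge0// sqr_ge0.
    apply: mulr_ge0; first by apply: exprn_ge0; exact: ltW.
    by apply: sumr_ge0 => i _; rewrite ep exprM exprn_ge0// sqr_ge0.
  by rewrite lee_fin ler_pM2r ?invr_gt0.
- move=> w nB; apply: (dyadic_dense L0).
    move=> x xc; apply: (of_class_continuous (smooth w) (ltnW uq)); exact: LA.
  move=> N i iN; rewrite leNgt; apply/negP => h; apply: nB.
  by exists N => //; exists i.
Qed.

End path_supremum.

(** * Counting zeros of a smooth function *)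

Section zeros_of_smooth_functions.
Context {R : realType}.
Implicit Types (F : nat -> R -> R) (a b x y z t : R) (s : seq R) (S : set R).

Definition iterated_derivatives F k a b :=
  forall u t, (u < k)%N -> a <= t <= b -> is_derive t 1 (F u) (F u.+1 t).

Lemma iterated_derivatives_sub F k a b k' a' b' : (k' <= k)%N -> a <= a' -> b' <= b ->
  iterated_derivatives F k a b -> iterated_derivatives F k' a' b'.
Proof.
move=> kk aa bb dF u t uk /andP[at' tb]; apply: dF; first exact: (leq_trans uk).
by rewrite (le_trans aa) ?(le_trans tb).
Qed.

Lemma iterated_derivatives_within F k a b : (0 < k)%N -> iterated_derivatives F k a b ->
  {within `[a, b], continuous (F 0)}.
Proof.
move=> k0 dF; apply: derivable_within_continuous => x; rewrite in_itv/= => xab.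
by have [] := dF 0 x k0 xab.
Qed.

Lemma mean_value F k a b x y : (0 < k)%N -> iterated_derivatives F k a b ->
  a <= x <= b -> a <= y <= b ->
  exists2 c, a <= c <= b & F 0 y - F 0 x = F 1 c * (y - x).
Proof.
move=> k0 dF /andP[ax xb] /andP[ay yb].
wlog xy : x y ax xb ay yb / x <= y.
  move=> h; have [/h|/ltW /h] := leP x y; first by apply.
  move=> [//|//|//|//|c cab e]; exists c => //.
  by rewrite -opprB e -mulrN opprB.
have [|c /andP[xc cy] e] := @MVT_closed R (F 0) (F 1) x y xy.
  by move=> z /andP[xz zy]; apply: dF => //; rewrite (le_trans ax) ?(le_trans zy).
by exists c => //; rewrite (le_trans ax) ?(le_trans cy).
Qed.

Lemma rolle_zero F k a b x y : (0 < k)%N -> iterated_derivatives F k a b ->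
  a <= x -> x < y -> y <= b -> F 0 x = 0 -> F 0 y = 0 ->
  exists2 c, x < c < y & F 1 c = 0.
Proof.
move=> k0 dF ax xy yb Fx Fy.
have [|||c cxy d0] := @Rolle R (F 0) x y xy.
- move=> z; rewrite in_itv/= => /andP[xz zy].
  by have [] // := dF 0 z k0 _; rewrite (le_trans ax (ltW xz)) (le_trans (ltW zy)).
- apply: (@iterated_derivatives_within F k x y k0).
  exact: (iterated_derivatives_sub _ ax yb dF).
- by rewrite Fx Fy.
exists c; first by move: cxy; rewrite in_itv.
have /andP[xc cy] : x < c < y by move: cxy; rewrite in_itv.
have h : is_derive c 1 (F 0) (F 1 c).
  by apply: dF => //; rewrite (le_trans ax (ltW xc)) (le_trans (ltW cy)).
by have [_ <-] := h; have [_ ->] := d0.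
Qed.

(** Between [k.+1] zeros of [F 0] Rolle's theorem gives [k] zeros of [F 1], which is small by
    induction; the mean value theorem from a zero of [F 0] costs one more factor [b - a]. *)
Lemma many_zeros F k a b (M : R) (z : nat -> R) : iterated_derivatives F k a b ->
  (forall t, a <= t <= b -> `|F k t| <= M) ->
  (forall i, (i < k)%N -> a <= z i <= b /\ F 0 (z i) = 0) ->
  (forall i, (i.+1 < k)%N -> z i < z i.+1) ->
  forall t, a <= t <= b -> `|F 0 t| <= (b - a) ^+ k * M.
Proof.
elim: k F z => [|k IH] F z dF FM zab zS t tab.
  by rewrite expr0 mul1r; exact: FM.
have ba : a <= b by move: tab => /andP[]; exact: le_trans.
have zex i : {c | (i < k)%N -> z i < c < z i.+1 /\ F 1 c = 0}.
  apply: cid; have [ik|ki] := ltnP i k; last by exists 0.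
  have [/andP[h1 _] h2] := zab i (ltnW ik : (i < k.+1)%N).
  have [/andP[_ h3] h4] := zab i.+1 ik.
  by have [c c1 c2] := rolle_zero (ltn0Sn k) dF h1 (zS i ik) h3 h2 h4; exists c.
pose z' i := sval (zex i).
have z'P i : (i < k)%N -> z i < z' i < z i.+1 /\ F 1 (z' i) = 0 by exact: svalP (zex i).
have F1 x : a <= x <= b -> `|F 1 x| <= (b - a) ^+ k * M.
  apply: (IH (fun u => F u.+1) z').
  - by move=> u y uk; exact: dF.
  - exact: FM.
  - move=> i ik; have [/andP[h1 h2] h3] := z'P i ik; split => //.
    have [/andP[h4 _] _] := zab i (ltnW ik : (i < k.+1)%N).
    have [/andP[_ h5] _] := zab i.+1 ik.
    by rewrite (le_trans h4 (ltW h1)) (le_trans (ltW h2)).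
  - move=> i ik; have [/andP[_ h1] _] := z'P i (ltnW ik).
    by have [/andP[h2 _] _] := z'P i.+1 ik; exact: (lt_trans h1).
have [z0 f0] := zab 0%N (ltn0Sn k).
have [c cab e] := mean_value (ltn0Sn k) dF z0 tab.
rewrite -[F 0%N t]subr0 -f0 e normrM exprSr mulrAC ler_pM//; first exact: F1.
by move: tab z0 => /andP[? ?] /andP[? ?]; rewrite ler_norml; lra.
Qed.

(** One duplicate-free list carries both the finiteness of the set and its cardinality. *)
Definition enumerates s S := uniq s /\ forall x, x \in s <-> S x.

(** A duplicate-free list in [S] that does not exhaust it can be extended, so in the absence of an
    enumeration lists of length [k] would exist. *)
Lemma finite_enumeration S (k : nat) :
  (forall s, uniq s -> (forall x, x \in s -> S x) -> (size s < k)%N) ->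
  exists2 s, enumerates s S & (size s < k)%N.
Proof.
move=> hS; apply: contrapT => no.
suff [s [us sS]] : exists s, [/\ uniq s, (forall x, x \in s -> S x) & size s = k].
  by move=> e; have := hS s us sS; rewrite e ltnn.
elim: {-2}k (leqnn k) => [|j IH] jk; first by exists [::].
have [s [us sS ss]] := IH (ltnW jk).
have [x Sx xs] : exists2 x, S x & x \notin s.
  apply: contrapT => h; apply: no; exists s; last by rewrite ss.
  split=> // x; split; first exact: sS.
  by move=> Sx; apply: contrapT => xs; apply: h; exists x => //; apply/negP.
exists (x :: s); split; rewrite /= ?xs ?ss//.
by move=> y; rewrite inE => /orP[/eqP->|/sS].
Qed.

Lemma few_zeros F k a b (M : R) x : iterated_derivatives F k a b -> a <= x <= b ->
  (forall t, a <= t <= b -> `|F k t| <= M) -> (b - a) ^+ k * M < `|F 0 x| ->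
  exists2 s, enumerates s [set t | a <= t < b /\ F 0 t = 0] & (size s < k)%N.
Proof.
move=> dF xab FM hx; apply: finite_enumeration => s us sS.
rewrite ltnNge; apply/negP => ks.
have so : sorted <%R (sort <=%R s) by rewrite sort_lt_sorted.
have := @many_zeros F k a b M (nth 0 (sort <=%R s)) dF FM _ _ x xab.
rewrite leNgt hx => h; suff: false by [].
apply: h => i ik.
  have : nth 0 (sort <=%R s) i \in s.
    by rewrite -(mem_sort <=%R) mem_nth// size_sort (leq_trans ik).
  by move=> /sS[/andP[-> /ltW ->]].
have := @lt_sorted_ltn_nth _ _ 0 _ so i i.+1; rewrite !inE size_sort => -> //.
- by rewrite (leq_trans (ltnW ik)).
- by rewrite (leq_trans ik).
Qed.

Lemma slope_diff F a b (M : R) x y : iterated_derivatives F 2 a b ->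
  (forall t, a <= t <= b -> `|F 2 t| <= M) -> a <= x <= b -> a <= y <= b ->
  `|F 1 x - F 1 y| <= M * (b - a).
Proof.
move=> dF FM xab yab.
have dF1 : iterated_derivatives (fun u => F u.+1) 1 a b.
  by move=> u t u1; exact: dF.
have [c cab e] := mean_value (ltn0Sn 0) dF1 yab xab.
rewrite e normrM ler_pM//; first exact: FM.
by move: xab yab => /andP[? ?] /andP[? ?]; rewrite ler_norml; lra.
Qed.

(** A zero in the cell and an end value above [zeta] force a slope larger than [M * (b - a)], the
    total variation allowed to the slope. Two zeros would give a point of zero slope by Rolle, and a
    zero between end values of equal sign would give two such slopes of opposite signs. *)
Lemma zeros_good_cell F a b (M zeta : R) : a < b -> iterated_derivatives F 2 a b ->
  (forall t, a <= t <= b -> `|F 2 t| <= M) -> (b - a) ^+ 2 * M <= zeta ->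
  zeta < `|F 0 a| -> zeta < `|F 0 b| ->
  exists2 s, enumerates s [set t | a <= t < b /\ F 0 t = 0] &
    size s = (F 0 a * F 0 b < 0).
Proof.
move=> ab dF FM hz za zb.
have ba : 0 < b - a by rewrite subr_gt0.
have aab : a <= a <= b by rewrite lexx ltW.
have M0 : 0 <= M by exact: le_trans (FM a aab).
have zeta0 : 0 <= zeta by apply: le_trans hz; apply: mulr_ge0 => //; exact: sqr_ge0.
have bab : a <= b <= b by rewrite lexx ltW.
have steep x y : a <= x <= b -> a <= y <= b -> F 0 x = 0 -> zeta < `|F 0 y| ->
    exists2 c, a <= c <= b & F 0 y = F 1 c * (y - x) /\ M * (b - a) < `|F 1 c|.
  move=> xab yab Fx Fy; have [c cab e] := mean_value (ltn0Sn 1) dF xab yab.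
  move: e; rewrite Fx subr0 => e; exists c => //; split=> //.
  rewrite -(ltr_pM2r ba); apply: (@le_lt_trans _ _ zeta).
    by apply: le_trans hz; rewrite le_eqVlt; apply/orP; left; apply/eqP; ring.
  apply: (lt_le_trans Fy); rewrite e normrM ler_wpM2l//.
  by move: xab yab => /andP[? ?] /andP[? ?]; rewrite ler_norml; lra.
have a0 : F 0 a != 0 by rewrite -normr_gt0 (le_lt_trans zeta0).
have b0 : F 0 b != 0 by rewrite -normr_gt0 (le_lt_trans zeta0).
have uniqz x y : a <= x < b -> a <= y < b -> F 0 x = 0 -> F 0 y = 0 -> x = y.
  wlog xy : x y / x < y.
    move=> h xab yab Fx Fy; have [xy|xy|//] := ltgtP x y; first exact: h.
    by apply/esym; exact: h.
  move=> /andP[ax xb] /andP[ay yb] Fx Fy.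
  have [c /andP[xc cy] F1c] := rolle_zero (ltn0Sn 1) dF ax xy (ltW yb) Fx Fy.
  have xab : a <= x <= b by rewrite ax ltW.
  have [c' cab [_ h]] := steep x a xab aab Fx za.
  have cab' : a <= c <= b by rewrite (le_trans ax (ltW xc)) (le_trans (ltW cy) (ltW yb)).
  have := slope_diff dF FM cab cab'; rewrite F1c subr0 => h2.
  by have := lt_le_trans h h2; rewrite ltxx.
case: ltP => [neg|pos].
  have [||x xab Fx] := @IVT R (F 0) a b 0 (ltW ab).
  - exact: (iterated_derivatives_within (ltn0Sn 1) dF).
  - by rewrite ge_min le_max; move: neg; have [?|?] := leP (F 0%N a) 0; have [?|?] := leP (F 0%N b) 0; rewrite ?orbT//= ?orbT//=; nra.
  have {}xab : a <= x < b.
    move: xab; rewrite in_itv/= => /andP[-> xb]; rewrite lt_neqAle xb andbT/=.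
    by apply: contra_neq b0 => <-.
  exists [:: x] => //; split=> // y; rewrite inE; split=> [/eqP->//|[yab Fy]].
  by apply/eqP; exact: uniqz.
exists [::] => //; split=> // x; rewrite in_nil; split=> // -[/andP[ax xb] Fx].
have xab : a <= x <= b by rewrite ax ltW.
have [c cab [e h]] := steep x a xab aab Fx za.
have [c' cab' [e' h']] := steep x b xab bab Fx zb.
have ax' : a < x by rewrite lt_neqAle ax andbT; apply: contra_neq a0 => ->.
have := slope_diff dF FM cab cab'; rewrite leNgt => /negP h3; exfalso; apply: h3.
apply: (lt_le_trans h).
(* The increments from the zero to the two ends have the same sign while the displacements have
   opposite signs. *)
have fab : F 1 c * F 1 c' <= 0.
  have q0 : 0 < (x - a) * (b - x) by rewrite mulr_gt0 ?subr_gt0.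
  rewrite -(pmulr_lle0 _ q0); rewrite e e' in pos.
  by apply: le_trans (_ : - (F 1 c * (a - x) * (F 1 c' * (b - x))) <= 0);
    [rewrite le_eqVlt; apply/orP; left; apply/eqP; ring|rewrite oppr_le0].
rewrite -ler_sqr ?nnegrE// -!normrX ger0_norm ?sqr_ge0// ger0_norm ?sqr_ge0//.
by have := sqr_ge0 (F 1 c'); rewrite sqrrB; lra.
Qed.

Lemma enumerates_cat s1 s2 a b c (f : R -> R) : a <= b -> b <= c ->
  enumerates s1 [set t | a <= t < b /\ f t = 0] ->
  enumerates s2 [set t | b <= t < c /\ f t = 0] ->
  enumerates (s1 ++ s2) [set t | a <= t < c /\ f t = 0].
Proof.
move=> ab bc [u1 h1] [u2 h2]; split.
  rewrite cat_uniq u1 u2 andbT/=; apply/hasPn => x /h2 [/andP[bx _] _].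
  by apply/negP => /h1[/andP[_ xb] _]; move: bx; rewrite leNgt xb.
move=> x; rewrite mem_cat; split=> [/orP[/h1|/h2] [/andP[l r] fx]|[/andP[l r] fx]].
- by split=> //; rewrite l (lt_le_trans r bc).
- by split=> //; rewrite r (le_trans ab l).
- apply/orP; have [xb|bx] := ltP x b; first by left; apply/h1; split=> //; rewrite l.
  by right; apply/h2; split=> //; rewrite bx.
Qed.

Lemma sg_prod_bump (x y : R) :
  `|(1 - Num.sg x * Num.sg y) / 2 - (1 - ssgn x * ssgn y) / 2| <= (bump x + bump y) / 2.
Proof.
have -> : (1 - Num.sg x * Num.sg y) / 2 - (1 - ssgn x * ssgn y) / 2 =
    - (Num.sg x * (Num.sg y - ssgn y) + (Num.sg x - ssgn x) * ssgn y) / 2 by field.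
rewrite normrM normrN (ger0_norm (_ : 0 <= 2^-1)) ?invr_ge0// ler_pM2r ?invr_gt0//.
apply: (le_trans (ler_normD _ _)); rewrite addrC lerD//.
  rewrite normrM -[bump x]mulr1 ler_pM//; [exact: sg_ssgn|exact: norm_ssgn_le1].
rewrite normrM -[bump y]mul1r ler_pM//; last exact: sg_ssgn.
by rewrite normr_sg lern1; case: (x != 0).
Qed.

(* A good cell has the right number of zeros up to the smoothing error; in a bad
   cell one of the bumps is at least 1/2. *)
Lemma zeros_cell F k a b (c M2 Mk : R) : a < b -> 0 < c -> (2 <= k)%N ->
  iterated_derivatives F k a b ->
  (forall t, a <= t <= b -> `|F 2 t| <= M2) -> (forall t, a <= t <= b -> `|F k t| <= Mk) ->
  (b - a) ^+ 2 * M2 <= c^-1 -> (b - a) ^+ k * Mk < `|F 0 a| ->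
  exists2 s, enumerates s [set t | a <= t < b /\ F 0 t = 0] &
    `|(size s)%:R - (1 - ssgn (c * F 0 a) * ssgn (c * F 0 b)) / 2|
      <= 2 * k%:R * (bump (c * F 0 a) + bump (c * F 0 b)).
Proof.
move=> ab c0 k2 dF FM2 FMk hc ha.
have k2R : 2 <= k%:R :> R by rewrite (ler_nat R 2).
have [ba bb] : 0 < bump (c * F 0 a) /\ 0 < bump (c * F 0 b) by split; exact: bump_gt0.
have [good|bad] := boolP ((c^-1 < `|F 0 a|) && (c^-1 < `|F 0 b|)).
  have /andP[ga gb] := good.
  have dF2 : iterated_derivatives F 2 a b by exact: iterated_derivatives_sub dF.
  have [s se ss] := zeros_good_cell ab dF2 FM2 hc ga gb.
  exists s => //.
  have c00 : 0 <= c^-1 by rewrite invr_ge0 ltW.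
  have a0 : F 0 a != 0 by rewrite -normr_gt0 (le_lt_trans c00).
  have b0 : F 0 b != 0 by rewrite -normr_gt0 (le_lt_trans c00).
  have -> : (size s)%:R = (1 - Num.sg (c * F 0 a) * Num.sg (c * F 0 b)) / 2 :> R.
    rewrite ss !sgrM (gtr0_sg c0) !mul1r -sgrM.
    have [p|p|p] := ltgtP (F 0 a * F 0 b) 0.
    - by rewrite ltr0_sg//=; field.
    - by rewrite gtr0_sg//= subrr mul0r.
    - by move/eqP: p; rewrite mulf_eq0 (negPf a0) (negPf b0).
  by apply: (le_trans (sg_prod_bump _ _)); nra.
have half x : `|x| <= c^-1 -> 1 / 2 <= bump (c * x).
  move=> xc; rewrite /bump mul1r lef_pV2 ?posrE//; last by have := sqr_ge0 (c * x); lra.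
  have : `|c * x| <= 1 by rewrite normrM gtr0_norm// mulrC -ler_pdivlMr// mul1r.
  by rewrite -(real_normK (num_real (c * x))); have := normr_ge0 (c * x); nra.
have hb : 1 / 2 <= bump (c * F 0 a) + bump (c * F 0 b).
  move: bad; rewrite negb_and -!leNgt => /orP[/half|/half]; lra.
have aab : a <= a <= b by rewrite lexx ltW.
have [s se ss] := few_zeros dF aab FMk ha.
exists s => //.
have := ler_pM (normr_ge0 _) (normr_ge0 _) (norm_ssgn_le1 (c * F 0 a)) (norm_ssgn_le1 (c * F 0 b)).
rewrite mulr1 -normrM ler_norml => /andP[h1 h2].
have sk : (size s)%:R + 1 <= k%:R :> R by rewrite natr1 ler_nat.
have s0 : 0 <= (size s)%:R :> R by [].
have hk : k%:R <= 2 * k%:R * (bump (c * F 0 a) + bump (c * F 0 b)) by nra.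
by rewrite ler_norml; apply/andP; split; lra.
Qed.

(** Half-open cells let the lists be concatenated without double counting, and the Rolle bound asks
    for a value that is not too small at the left ends only. *)
Lemma zeros_cells F k a h (c M2 Mk : R) (K : nat) : 0 < h -> 0 < c -> (2 <= k)%N ->
  iterated_derivatives F k a (a + K%:R * h) ->
  (forall t, a <= t <= a + K%:R * h -> `|F 2 t| <= M2) ->
  (forall t, a <= t <= a + K%:R * h -> `|F k t| <= Mk) ->
  h ^+ 2 * M2 <= c^-1 -> (forall j, (j < K)%N -> h ^+ k * Mk < `|F 0 (a + j%:R * h)|) ->
  let x j := c * F 0 (a + j%:R * h) in
  exists2 s, enumerates s [set t | a <= t < a + K%:R * h /\ F 0 t = 0] &
    `|(size s)%:R - \sum_(j < K) (1 - ssgn (x j) * ssgn (x j.+1)) / 2|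
      <= 2 * k%:R * \sum_(j < K) (bump (x j) + bump (x j.+1)).
Proof.
move=> h0 c0 k2 + + + hc + x.
elim: K => [|K IH] dF FM2 FMk hx.
  exists [::]; last by rewrite !big_ord0 mulr0 subr0 normr0.
  split=> // t; rewrite in_nil; split=> // -[/andP[h1 h2] _].
  by move: (le_lt_trans h1 h2); rewrite mul0r addr0 ltxx.
have eK : a + K.+1%:R * h = a + K%:R * h + h by rewrite -natr1; ring.
have Kh : 0 <= K%:R * h by rewrite mulr_ge0// ltW.
have hK : a + K%:R * h <= a + K.+1%:R * h by rewrite eK lerDl ltW.
have aK : a <= a + K%:R * h by rewrite lerDl.
have [||||s1 e1 b1] := IH.
- exact: (iterated_derivatives_sub _ _ hK dF).
- by move=> t /andP[t1 t2]; apply: FM2; rewrite t1 (le_trans t2).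
- by move=> t /andP[t1 t2]; apply: FMk; rewrite t1 (le_trans t2).
- by move=> j jK; apply: hx; exact: ltnW.
have eh : a + K.+1%:R * h - (a + K%:R * h) = h by rewrite eK; ring.
have [||||||s2 e2 b2] := @zeros_cell F k (a + K%:R * h) (a + K.+1%:R * h) c M2 Mk _ c0 k2.
- by rewrite eK ltrDl.
- exact: (iterated_derivatives_sub _ aK _ dF).
- by move=> t /andP[t1 t2]; apply: FM2; rewrite t2 (le_trans aK).
- by move=> t /andP[t1 t2]; apply: FMk; rewrite t2 (le_trans aK).
- by rewrite eh.
- by rewrite eh; exact: hx.
exists (s1 ++ s2); first exact: (enumerates_cat aK hK e1 e2).
rewrite size_cat !big_ord_recr/= mulrDr natrD.
apply: le_trans (lerD b1 b2).
apply: le_trans (ler_normD _ _).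
by rewrite le_eqVlt; apply/orP; left; apply/eqP; congr `|_|; rewrite /x; ring.
Qed.

End zeros_of_smooth_functions.

Section deviations.
Context {R : realType} {d : measure_display} {T : measurableType d}.
Variable P : probability T R.

Lemma measurable_gt_norm (f : T -> R) (c : R) : measurable_fun setT f ->
  measurable [set w | c < `|f w|].
Proof.
move=> mf; have mn : measurable_fun setT (fun w => `|f w|) by exact: measurableT_comp.
have := mn measurableT `]c, +oo[%classic (measurable_itv _); rewrite setTI.
by rewrite (_ : _ @^-1` _ = [set w | c < `|f w|])//; apply/funext => w /=; rewrite in_itv/= andbT.
Qed.

Lemma measurable_le_norm (f : T -> R) (c : R) : measurable_fun setT f ->
  measurable [set w | `|f w| <= c].
Proof.
move=> mf; rewrite (_ : [set w | _] = ~` [set w | c < `|f w|]).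
  by apply: measurableC; exact: measurable_gt_norm.
by apply/funext => w /=; apply/propext; rewrite leNgt; split=> /negP.
Qed.

Lemma probU_le (A B : set T) : measurable A -> measurable B ->
  (P (A `|` B) <= P A + P B)%E.
Proof. exact: measureU2. Qed.

Lemma prob_bigcup_le (n : nat) (F : nat -> set T) (b : R) :
  (forall j, (j < n)%N -> measurable (F j)) -> (forall j, (j < n)%N -> (P (F j) <= b%:E)%E) ->
  (P (\bigcup_(j in `I_n) F j) <= (n%:R * b)%:E)%E.
Proof.
elim: n => [|n IH] mF bF; first by rewrite II0 bigcup_set0 measure0 mul0r.
rewrite IIS bigcup_setU bigcup_set1.
apply: (le_trans (probU_le _ _)).
- by apply: bigcup_measurable => j /= jn; apply: mF; exact: ltnW.
- exact: mF.
rewrite -natr1 mulrDl mul1r EFinD; apply: leeD; last exact: bF.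
by apply: IH => j jn; [apply: mF|apply: bF]; exact: ltnW.
Qed.

Lemma Ex_sg_sqr (Y : T -> R) (v : R) : measurable_fun setT Y -> centered_gaussian_law P Y ->
  0 < v -> v ^+ 2 <= Ex P (fun w => Y w ^+ 2) -> Ex P (fun w => Num.sg (Y w) ^+ 2) = 1.
Proof.
move=> mY lY v0 hv.
have := gaussian_small_ball mY lY v0 hv (lexx 0); rewrite mulr0 mul0r => h.
have mZ : measurable [set w | `|Y w| <= 0] by exact: measurable_le_norm.
have ae : \forall w \ae P, Num.sg (Y w) ^+ 2 = 1.
  exists [set w | `|Y w| <= 0]; split => //.
    by apply/eqP; rewrite eq_le measure_ge0 andbT.
  move=> w /=; apply: contra_notP => /negP; rewrite normr_le0 => Y0.
  by rewrite sqr_sg Y0.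
have ms : measurable_fun setT (fun w => Num.sg (Y w) ^+ 2).
  apply: measurable_funX.
  apply: (@measurable_fun_cvg _ _ _ _ (fun n w => ssgn (n%:R * Y w))) => //.
  - move=> n; apply: (measurableT_comp measurable_ssgn).
    by apply: measurable_funM.
  - by move=> w _; exact: cvg_ssgn.
have := @Ex_ae0 _ _ _ P (fun w => Num.sg (Y w) ^+ 2 - 1) _ _.
rewrite ExB; [|apply: (@itg_bounded _ _ _ _ _ 1) => //|exact: itg_cst].
  rewrite Ex_cst => h2; apply/eqP; rewrite -subr_eq0; apply/eqP; apply: h2.
    exact: measurable_funB.
  by move: ae; apply: filterS => w ->; rewrite subrr.
by move=> w; rewrite sqr_sg ger0_norm// lern1; case: (_ != _).
Qed.

(** Where [|Y| <= tau] the bump is at most [1] and the density bound applies; elsewhere the bump is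
    at most [(c * tau) ^- 2]. *)
Lemma Ex_bump_le (Y : T -> R) (v c tau : R) : measurable_fun setT Y -> centered_gaussian_law P Y ->
  0 < v -> v ^+ 2 <= Ex P (fun w => Y w ^+ 2) -> 0 < c -> 0 < tau ->
  Ex P (fun w => bump (c * Y w)) <= 2 * tau / v + (c * tau) ^- 2.
Proof.
move=> mY lY v0 hv c0 tau0.
have ct0 : 0 < (c * tau) ^+ 2 by rewrite exprn_gt0// mulr_gt0.
pose B := [set w | `|Y w| <= tau].
have mB : measurable B by exact: measurable_le_norm.
have iB : itg P (\1_B : T -> R).
  apply: (@itg_bounded _ _ _ _ _ 1); first exact: measurable_indic.
  by move=> w; rewrite indicE ger0_norm// lern1; case: (_ \in _).
have ib : itg P (fun w => bump (c * Y w)).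
  apply: (@itg_bounded _ _ _ _ _ 1).
    apply: (measurableT_comp measurable_bump).
    by apply: measurable_funM.
  by move=> w; rewrite ger0_norm ?bump_le1// ltW ?bump_gt0.
apply: (@le_trans _ _ (Ex P (fun w => \1_B w + (c * tau) ^- 2))).
  apply: Ex_le => //; first by apply: itgD => //; exact: itg_cst.
  move=> w; rewrite indicE; have [wB|wB] := boolP (w \in B).
    by apply: (le_trans (bump_le1 _)); rewrite lerDl invr_ge0 ltW.
  rewrite add0r /bump lef_pV2 ?posrE//; last by have := sqr_ge0 (c * Y w); lra.
  move: wB; rewrite notin_setE /B/= => /negP; rewrite -ltNge => h.
  rewrite !exprMn; apply: (@le_trans _ _ (c ^+ 2 * Y w ^+ 2)); last by rewrite lerDr.
  apply: ler_wpM2l; first exact: sqr_ge0.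
  by rewrite -[Y w ^+ 2](real_normK (num_real _)) lerXn2r ?nnegrE// ltW.
rewrite ExD//; last exact: itg_cst.
rewrite Ex_cst lerD2r -lee_fin; apply: le_trans (gaussian_small_ball mY lY v0 hv (ltW tau0)).
by rewrite ExE// integral_indic// setIT.
Qed.

End deviations.

Lemma deviation_arith {R : realFieldType} (N Q S1 E1 S2 E2 S3 E3 delta b k : R) : 2 <= k ->
  E2 <= b -> E3 <= b -> `|S2 - E2| <= delta -> `|S3 - E3| <= delta ->
  `|N| <= 2 * k * (S2 + S3) -> `|Q| <= b -> `|S1 - E1| <= delta ->
  `|N + Q - (S1 - E1) / 2| <= (4 * k + 1) * (b + delta).
Proof.
move=> k2 E2b E3b; rewrite !ler_norml => /andP[_ h2] /andP[d0 h3] /andP[n1 n2] /andP[q1 q2] /andP[s1 s2].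
have h1 : 2 * k * (S2 + S3) <= 2 * k * (2 * b + 2 * delta).
  by apply: ler_wpM2l; [rewrite mulr_ge0//; lra|lra].
have e1 : 2 * k * (2 * b + 2 * delta) = 4 * k * (b + delta) by ring.
rewrite mulrDl mul1r -e1; apply/andP; split; lra.
Qed.

(** * Deviations of the number of zeros *)

Section one_process.
Context {R : realType} {d : measure_display} {T : measurableType d}.
Variables (P : probability T R) (q : nat) (A : set R) (X : R -> T -> R).
Hypothesis oA : open A.
Hypothesis smooth : forall w, of_class q A (X ^~ w).
Hypothesis gX : forall (k : nat) (s a : 'I_k -> R), (forall i, A (s i)) ->
  gl P (fun w => \sum_(i < k) a i * X (s i) w).
Hypothesis lX : forall s, A s -> centered_gaussian_law P (X s).

Variables (al h : R) (K : nat).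
Hypothesis h_gt0 : 0 < h.
Hypothesis inA : forall x, al <= x <= al + K%:R * h -> A x.
Variables (v S c tau delta : R).
Hypothesis v_gt0 : 0 < v.
Hypothesis Xv : forall x, al <= x <= al + K%:R * h -> v ^+ 2 <= Ex P (fun w => X x w ^+ 2).
Hypothesis c_gt0 : 0 < c.
Hypothesis tau_gt0 : 0 < tau.
Hypothesis delta_gt0 : 0 < delta.

Definition grid (j : nat) : R := al + j%:R * h.

Hypothesis S_gt0 : 0 < S.
Hypothesis XS : \sum_(i < K.+1) \sum_(j < K.+1)
  `|Ex P (fun w => X (grid i) w * X (grid j) w)| <= S.

Lemma grid_in j : (j <= K)%N -> al <= grid j <= al + K%:R * h.
Proof.
move=> jK; rewrite /grid; apply/andP; split.
  by rewrite lerDl; apply: mulr_ge0 => //; exact: ltW.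
by rewrite lerD2l ler_pM2r// ler_nat.
Qed.

Lemma grid_A j : (j <= K)%N -> A (grid j).
Proof. by move=> jK; apply: inA; exact: grid_in. Qed.

Let Y (j : 'I_K.+1) := X (grid j).
Let src (e : 'I_K) : 'I_K.+1 := widen_ord (leqnSn K) e.
Let tgt (e : 'I_K) : 'I_K.+1 := lift ord0 e.

Lemma gl_grid a : gl P (fun w => ldot a (Y ^~ w)).
Proof. by apply: gX => i; apply: grid_A; rewrite -ltnS. Qed.

Lemma measurable_grid j : (j <= K)%N -> measurable_fun setT (X (grid j)).
Proof.
move=> jK; have [[+ _] _ _] := gl_dX1 oA smooth gX (leq0n q) (grid_A jK).
exact.
Qed.

(** Markov's inequality at order [2 ^ r.+1], the edges joining consecutive grid points. *)
Lemma edge_fluctuation (f1 f2 df1 df2 : R -> R) (r : nat) :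
  (forall j : 'I_K.+1, tcl (fun x : 'I_K.+1 -> R => f1 (c * x j))) ->
  (forall j : 'I_K.+1, tcl (fun x : 'I_K.+1 -> R => f2 (c * x j))) ->
  (forall x, `|f1 x| <= 1) -> (forall x, `|f2 x| <= 1) ->
  (forall x : R, is_derive x 1 f1 (df1 x)) -> (forall x : R, is_derive x 1 f2 (df2 x)) ->
  (forall x, `|df1 x| <= 1) -> (forall x, `|df2 x| <= 1) ->
  let Phi w := \sum_(e < K) f1 (c * X (grid e) w) * f2 (c * X (grid e.+1) w) in
  exists B, [/\ measurable B,
    (P B <= ((pi / 2) ^+ (2 ^ r.+1) * gmom (2 ^ r) *
      (4 * c ^+ 2 * S) ^+ (2 ^ r) / delta ^+ (2 ^ r.+1))%:E)%E &
    forall w, ~ B w -> `|Phi w - Ex P Phi| <= delta].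
Proof.
move=> t1 t2 b1 b2 d1 d2 db1 db2 Phi.
have src_inj : injective src by move=> i j /(congr1 val)/= ij; exact: val_inj.
have tgt_inj : injective tgt by exact: lift_inj.
have ePhi : Phi = fun w => edge_sum src tgt f1 f2 c (Y ^~ w).
  by apply/funext => w; apply: eq_bigr => e _; rewrite /Y /tgt/=.
pose v' := 4 * c ^+ 2 * S.
have v'0 : 0 < v' by rewrite mulr_gt0// mulr_gt0// exprn_gt0.
have cv : 4 * c ^+ 2 * (\sum_i \sum_j `|cov P Y i j|) <= v'.
  by apply: ler_wpM2l => //; rewrite mulr_ge0// sqr_ge0.
have hc := edge_sum_concentration gl_grid src_inj tgt_inj (ltW c_gt0) t1 t2 b1 b2 d1 d2 db1 db2 r v'0 cv.
have tPhi : tcl (edge_sum src tgt f1 f2 c).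
  by apply: tcl_sum => e; exact: tclM.
have mY (j : 'I_K.+1) : measurable_fun setT (Y j).
  by apply: measurable_grid; rewrite -ltnS.
have iD : itg P (fun w => (Phi w - Ex P Phi) ^+ (2 ^ r.+1)).
  have := @tcl_itg _ _ _ _ P Y (fun x => (edge_sum src tgt f1 f2 c x - Ex P Phi) ^+ (2 ^ r.+1)) mY _.
  rewrite ePhi; apply; apply: tclX; apply: tclB => //; exact: tcl_cst.
have mPhi : measurable_fun setT Phi.
  by rewrite ePhi; apply: (tcl_measurable mY).
exists [set w | delta < `|Phi w - Ex P Phi|]; split.
- apply: (@measurable_gt_norm _ _ _ (fun w => Phi w - Ex P Phi)).
  exact: measurable_funB.
- have dd : 0 < delta ^+ (2 ^ r.+1) by exact: exprn_gt0.
  have e2 (x : R) : x ^+ (2 ^ r.+1) = `|x| ^+ (2 ^ r.+1) by rewrite expnS normrX_pow2.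
  apply: (le_trans (@probability_le_Ex _ _ _ P _ (fun w => (Phi w - Ex P Phi) ^+ (2 ^ r.+1)) _ _ iD dd _ _)).
  + apply: (@measurable_gt_norm _ _ _ (fun w => Phi w - Ex P Phi)).
    exact: measurable_funB.
  + by move=> w; rewrite e2; exact: exprn_ge0.
  + move=> w /= hw; rewrite [leRHS]e2; apply: lerXn2r; rewrite ?nnegrE//; exact: ltW.
  by rewrite lee_fin ler_pM2r ?invr_gt0// -mulrA ePhi.
- by move=> w /= /negP; rewrite -leNgt.
Qed.

Definition fluctuation_bound (r : nat) : R :=
  (pi / 2) ^+ (2 ^ r.+1) * gmom (2 ^ r) * (4 * c ^+ 2 * S) ^+ (2 ^ r) / delta ^+ (2 ^ r.+1).

Definition correlation (j : nat) : R := Ex P (fun w => X (grid j) w * X (grid j.+1) w) /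
  Num.sqrt (Ex P (fun w => X (grid j) w ^+ 2) * Ex P (fun w => X (grid j.+1) w ^+ 2)).

Let norm_dssgn_le1 (x : R) : `|bump x * Num.sqrt (bump x)| <= 1.
Proof.
have b0 := bump_gt0 x; have b1 := bump_le1 x.
rewrite normrM (ger0_norm (sqrtr_ge0 _)) (ger0_norm (ltW b0)).
apply: mulr_ile1; rewrite ?sqrtr_ge0 ?(ltW b0)//.
by rewrite -sqrtr1 ler_sqrt.
Qed.

Let norm_dbump_le1 (x : R) : `|- (2 * x * bump x ^+ 2)| <= 1.
Proof.
have b0 := bump_gt0 x; have b1 := bump_le1 x.
rewrite normrN (_ : _ * _ = (2 * x * bump x) * bump x); last by ring.
rewrite normrM (ger0_norm (ltW b0)); apply: mulr_ile1 => //; first exact: ltW.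
have x0 : 0 < 1 + x ^+ 2 by have := sqr_ge0 x; lra.
rewrite /bump normrM (ger0_norm (_ : 0 <= (1 + x ^+ 2)^-1)) ?ler_pdivrMr// ?mul1r; last by rewrite invr_ge0 ltW.
have h1 := sqr_ge0 (1 + x); have h2 := sqr_ge0 (1 - x).
by rewrite ler_norml; apply/andP; split; nra.
Qed.

Let itg_comp (f : R -> R) j : (j <= K)%N -> measurable_fun setT f -> (forall x, `|f x| <= 1) ->
  itg P (fun w => f (c * X (grid j) w)).
Proof.
move=> jK mf f1; apply: (@itg_bounded _ _ _ _ _ 1) => //.
apply: (measurableT_comp mf); apply: measurable_funM => //.
exact: measurable_grid.
Qed.

Let norm_bump_le1 (x : R) : `|bump x| <= 1.
Proof. by rewrite ger0_norm ?bump_le1// ltW// bump_gt0. Qed.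

Let itg_ss j : (j < K)%N ->
  itg P (fun w => ssgn (c * X (grid j) w) * ssgn (c * X (grid j.+1) w)).
Proof.
move=> jK; apply: (@itg_bounded _ _ _ _ _ 1).
  by apply: measurable_funM; apply: (measurableT_comp measurable_ssgn);
    apply: measurable_funM => //; apply: measurable_grid => //; exact: ltnW.
by move=> w; rewrite normrM mulr_ile1 ?norm_ssgn_le1.
Qed.

Let measurable_sg j : (j <= K)%N -> measurable_fun setT (fun w => Num.sg (X (grid j) w)).
Proof.
move=> jK; apply: (@measurable_fun_cvg _ _ _ _ (fun n w => ssgn (n%:R * X (grid j) w))) => //.
  move=> n; apply: (measurableT_comp measurable_ssgn).
  by apply: measurable_funM => //; exact: measurable_grid.
by move=> w _; exact: cvg_ssgn.
Qed.

Let norm_sg_le1 (x : R) : `|Num.sg x| <= 1.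
Proof. by rewrite normr_sg lern1; case: (x != 0). Qed.

Let Ex_sg_grid j : (j < K)%N ->
  (1 - Ex P (fun w => Num.sg (X (grid j) w) * Num.sg (X (grid j.+1) w))) / 2 =
  acos (correlation j) / pi.
Proof.
move=> jK; have jA := grid_A (ltnW jK); have jA' := grid_A jK.
have j1 := Xv (grid_in (ltnW jK)); have j2 := Xv (grid_in jK).
have v2 : 0 < v ^+ 2 by exact: exprn_gt0.
rewrite (@orthant_formula _ _ _ P (X (grid j)) (X (grid j.+1))).
- have p0 : (pi : R) != 0 by apply: lt0r_neq0; exact: pi_gt0.
  by rewrite -/(correlation j); move: (pi : R) (acos _) p0 => p x p0; field.
- move=> a b; have := @gX 2 (fun i => if i == ord0 then grid j else grid j.+1)
    (fun i => if i == ord0 then a else b) _.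
  rewrite (_ : (fun w => \sum_(i < 2) _) = (fun w => a * X (grid j) w + b * X (grid j.+1) w)).
    by apply=> i; case: ifP.
  by apply/funext => w; rewrite !big_ord_recl big_ord0 /= addr0.
- exact: (Ex_sg_sqr (measurable_grid (ltnW jK)) (lX jA) v_gt0 j1).
- exact: (lt_le_trans v2).
- exact: (lt_le_trans v2).
Qed.

(** The exceptional event unites failure of the derivative bounds, a left end value too small for
    the Rolle bound, and three large fluctuations. Outside it the count is compared with the
    smoothed sum, the latter with its mean, and this mean with that of the signs; the bump means
    control the first and last errors. *)
Theorem zero_count_deviation (k r : nat) (M2 Mk : R) (E : set T) : (2 <= k <= q)%N ->
  measurable E -> 0 <= Mk ->
  (forall w, ~ E w -> forall x, al <= x <= al + K%:R * h -> `|dX X 2 x w| <= M2) ->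
  (forall w, ~ E w -> forall x, al <= x <= al + K%:R * h -> `|dX X k x w| <= Mk) ->
  h ^+ 2 * M2 <= c^-1 ->
  exists B, [/\ measurable B,
    (P B <= P E + (K%:R * (2 * (h ^+ k * Mk) / v))%:E + (3 * fluctuation_bound r)%:E)%E &
    forall w, ~ B w ->
    exists2 s, enumerates s [set t | al <= t < al + K%:R * h /\ X t w = 0] &
      `|(size s)%:R - \sum_(j < K) acos (correlation j) / pi|
        <= (4 * k%:R + 1) * (K%:R * (2 * tau / v + (c * tau) ^- 2) + delta)].
Proof.
move=> /andP[k2 kq] mE Mk0 EM2 EMk hM.
set b := 2 * tau / v + _.
have cst1 (x : R) : `|(fun _ : R => 1 : R) x| <= 1 by rewrite normr1.
have cst0 (x : R) : `|(fun _ : R => 0 : R) x| <= 1 by rewrite normr0.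
have tcst (j : 'I_K.+1) : tcl (fun x : 'I_K.+1 -> R => (fun _ : R => 1 : R) (c * x j)).
  exact: tcl_cst.
have dcst (x : R) : is_derive x 1 (fun _ : R => 1 : R) ((fun _ : R => 0 : R) x).
  exact: is_derive_cst.
have [B1 [mB1 PB1 hB1]] := @edge_fluctuation ssgn ssgn _ _ r (fun j => tcl_ssgn j c)
  (fun j => tcl_ssgn j c) norm_ssgn_le1 norm_ssgn_le1 is_derive_ssgn is_derive_ssgn
  norm_dssgn_le1 norm_dssgn_le1.
(* The sums of bumps over left and over right ends are edge functionals with one factor constant. *)
have [B2 [mB2 PB2 hB2]] := @edge_fluctuation bump (fun=> 1) _ _ r (fun j => tcl_bump j c)
  tcst norm_bump_le1 cst1 is_derive_bump dcst norm_dbump_le1 cst0.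
have [B3 [mB3 PB3 hB3]] := @edge_fluctuation (fun=> 1) bump _ _ r tcst (fun j => tcl_bump j c)
  cst1 norm_bump_le1 dcst is_derive_bump cst0 norm_dbump_le1.
pose sb j := [set w | `|X (grid j) w| <= h ^+ k * Mk].
have hk0 : 0 <= h ^+ k * Mk by rewrite mulr_ge0// exprn_ge0// ltW.
have msb j : (j < K)%N -> measurable (sb j).
  by move=> jK; apply: measurable_le_norm; apply: measurable_grid; exact: ltnW.
pose SB := \bigcup_(j in `I_K) sb j.
have mSB : measurable SB by apply: bigcup_measurable => j; exact: msb.
have PSB : (P SB <= (K%:R * (2 * (h ^+ k * Mk) / v))%:E)%E.
  apply: prob_bigcup_le => // j jK; apply: gaussian_small_ball => //.
  - by apply: measurable_grid; exact: ltnW.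
  - by apply: lX; apply: grid_A; exact: ltnW.
  - by apply: Xv; apply: grid_in; exact: ltnW.
exists (E `|` SB `|` (B1 `|` B2 `|` B3)); split.
- by apply: measurableU; [exact: measurableU|apply: measurableU => //; exact: measurableU].
- apply: (le_trans (probU_le _ _ _)); [exact: measurableU|by apply: measurableU => //; exact: measurableU|].
  apply: leeD; first by apply: (le_trans (probU_le _ _ _)) => //; exact: leeD2l.
  apply: (le_trans (probU_le _ _ _)) => //; first exact: measurableU.
  rewrite (_ : 3 * _ = fluctuation_bound r + fluctuation_bound r + fluctuation_bound r); last by ring.
  rewrite !EFinD; apply: leeD => //.
  by apply: (le_trans (probU_le _ _ _)) => //; exact: leeD.
move=> w nB; have [nE nSB nB1 nB2 nB3] : [/\ ~ E w, ~ SB w, ~ B1 w, ~ B2 w & ~ B3 w].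
  by split=> hw; apply: nB; [left; left|left; right|right; left; left|right; left; right|right; right].
have [|||||s es bs] := @zeros_cells R (fun u => derive1n u (X ^~ w)) k al h c M2 Mk K h_gt0 c_gt0 k2.
- move=> u t uk tin; apply: (of_class_is_derive (smooth w)); first exact: (leq_trans uk).
  exact: inA.
- by move=> t tin; exact: EM2.
- by move=> t tin; exact: EMk.
- exact: hM.
- move=> j jK; rewrite ltNge; apply/negP => hj; apply: nSB; exists j => //.
exists s => //.
move/hB1: nB1; rewrite /=; set S1 := \sum_(e < K) _; set E1 := Ex P _ => b1.
move/hB2: nB2; rewrite /=; set S2 := \sum_(e < K) _; set E2 := Ex P _ => b2.
move/hB3: nB3; rewrite /=; set S3 := \sum_(e < K) _; set E3 := Ex P _ => b3.
have eS : \sum_(j < K) (bump (c * X (grid j) w) + bump (c * X (grid j.+1) w)) = S2 + S3.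
  by rewrite big_split /=; congr (_ + _); apply: eq_bigr => j _; rewrite ?mul1r ?mulr1.
have eS1 : \sum_(j < K) (1 - ssgn (c * X (grid j) w) * ssgn (c * X (grid j.+1) w)) / 2 =
    (K%:R - S1) / 2.
  by rewrite -mulr_suml sumrB sumr_const card_ord.
have Eb j : (j <= K)%N -> Ex P (fun w => bump (c * X (grid j) w)) <= b.
  move=> jK; apply: Ex_bump_le => //; [exact: measurable_grid|by apply: lX; exact: grid_A|].
  by apply: Xv; exact: grid_in.
have ib j : (j <= K)%N -> itg P (fun w => bump (c * X (grid j) w)).
  by move=> jK; apply: itg_comp => //; exact: measurable_bump.
have sumb (z : 'I_K -> R) : (forall j, z j <= b) -> \sum_j z j <= K%:R * b.
  move=> zb; apply: (@le_trans _ _ (\sum_(j < K) b)); first exact: ler_sum.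
  by rewrite sumr_const card_ord mulr_natl.
have E2b : E2 <= K%:R * b.
  rewrite /E2 Ex_sum; last by move=> j; under eq_fun do rewrite mulr1; apply: ib; exact: ltnW.
  by apply: sumb => j; under eq_Ex do rewrite mulr1; apply: Eb; exact: ltnW.
have E3b : E3 <= K%:R * b.
  rewrite /E3 Ex_sum; last by move=> j; under eq_fun do rewrite mul1r; exact: ib.
  by apply: sumb => j; under eq_Ex do rewrite mul1r; exact: Eb.
have hE1 : `|(K%:R - E1) / 2 - \sum_(j < K) acos (correlation j) / pi| <= K%:R * b.
  have -> : (K%:R - E1) / 2 = \sum_(j < K)
      (1 - Ex P (fun w => ssgn (c * X (grid j) w) * ssgn (c * X (grid j.+1) w))) / 2.
    rewrite -mulr_suml sumrB sumr_const card_ord -Ex_sum// => j; exact: itg_ss.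
  rewrite -sumrB; apply: (le_trans (ler_norm_sum _ _ _)); apply: sumb => j.
  have jK := ltn_ord j; have jK' := ltnW jK.
  rewrite -Ex_sg_grid// distrC.
  have isg : itg P (fun w => Num.sg (X (grid j) w) * Num.sg (X (grid j.+1) w)).
    apply: (@itg_bounded _ _ _ _ _ 1); first by apply: measurable_funM; exact: measurable_sg.
    by move=> w'; rewrite normrM mulr_ile1.
  have i1 := itg_ss jK.
  have half (x y : R) : (1 - x) / 2 - (1 - y) / 2 = (y - x) / 2 by field.
  rewrite half -ExB//.
  apply: (@le_trans _ _ (Ex P (fun w => bump (c * X (grid j) w) + bump (c * X (grid j.+1) w)) / 2)); last first.
    rewrite ExD; [|exact: ib|exact: ib].
    by rewrite ler_pdivrMr// mulr_natr mulr2n; apply: lerD; exact: Eb.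
  rewrite normrM (ger0_norm (_ : 0 <= 2^-1)) ?invr_ge0// ler_pM2r ?invr_gt0//.
  apply: (le_trans (Ex_norm_le _)); first exact: itgB.
  apply: Ex_le; [by apply: itg_norm; exact: itgB|by apply: itgD; exact: ib|].
  move=> w'; have := sg_prod_bump (c * X (grid j) w') (c * X (grid j.+1) w').
  rewrite !sgrM (gtr0_sg c_gt0) !mul1r half.
  by rewrite normrM (ger0_norm (_ : 0 <= 2^-1)) ?invr_ge0// ler_pM2r ?invr_gt0.
have k0 : 2 <= k%:R :> R by rewrite (ler_nat R 2).
have Kb : 0 <= K%:R * b.
  rewrite mulr_ge0// /b addr_ge0//; first by rewrite divr_ge0 ?mulr_ge0 ?ltW.
  by rewrite invr_ge0 sqr_ge0.
move: bs; rewrite /= -/(grid _) eS1 eS => bs.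
rewrite -[X in `|X|](_ : (size s)%:R - (K%:R - S1) / 2 + ((K%:R - E1) / 2 -
  \sum_(j < K) acos (correlation j) / pi) - (S1 - E1) / 2 = _); last by field.
by apply: (deviation_arith k0 E2b E3b b2 b3 bs hE1 b1).
Qed.

End one_process.

(** * Asymptotics of the correlations *)

Section arccosine_asymptotics.
Context {R : realType}.

Lemma mul_cos_le_sin (x : R) : 0 <= x <= pi -> x * cos x <= sin x.
Proof.
move=> /andP[x0 xpi].
have dF (t : R) : 0 <= t <= x -> is_derive t 1 (fun t : R => sin t - t * cos t) (t * sin t).
  by move=> _; apply: trigger_derive; rewrite /GRing.scale/=; ring.
have [c /andP[c0 cx]] := MVT_closed x0 dF.
rewrite sin0 mul0r !subr0 => e; rewrite -subr_ge0 e !mulr_ge0// sin_ge0_pi//.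
by rewrite c0 (le_trans cx).
Qed.

(** For [x = acos rho] the inequalities [sin x <= x <= sin x / cos x] enclose [acos rho] between
    [sqrt (1 - rho ^+ 2)] and that quantity divided by [rho], once [rho > 0]. *)
Lemma acos_asymptotic (rho h : nat -> R) (g : R) : (forall n, 0 < h n) ->
  (forall n, -1 <= rho n <= 1) ->
  (fun n => (1 - rho n ^+ 2) / h n ^+ 2) @ \oo --> g -> rho @ \oo --> (1 : R) ->
  (fun n => acos (rho n) / h n) @ \oo --> Num.sqrt g.
Proof.
move=> h0 rho1 hg rhoc.
pose s n := Num.sqrt (1 - rho n ^+ 2) / h n.
have sc : s @ \oo --> Num.sqrt g.
  have : (fun n => Num.sqrt ((1 - rho n ^+ 2) / h n ^+ 2)) @ \oo --> Num.sqrt g.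
    exact: (continuous_cvg _ (@sqrt_continuous R g) hg).
  apply: cvg_trans; apply: near_eq_cvg; apply: nearW => n.
  rewrite /s sqrtrM ?sqrtrV ?sqrtr_sqr ?exprn_ge0 ?(ltW (h0 n))// ?ger0_norm ?(ltW (h0 n))//.
  by have := rho1 n; nra.
have sr : (fun n => s n / rho n) @ \oo --> Num.sqrt g.
  rewrite -[X in _ --> X]divr1; apply: cvgM => //; apply: cvgV => //.
apply: (squeeze_cvgr _ sc sr).
near=> n.
have r0 : 0 < rho n by near: n; exact: (cvgr_gt _ rhoc).
have ri : rho n \in `[(-1), 1] by rewrite in_itv/=; exact: rho1.
have a0 := acos_ge0 (rho1 n); have api := acos_lepi (rho1 n).
have ec : cos (acos (rho n)) = rho n by exact: acosK.
have es : sin (acos (rho n)) = Num.sqrt (1 - rho n ^+ 2) by rewrite sin_acos.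
have h1 : sin (acos (rho n)) <= acos (rho n).
  by have := norm_sin_le (acos (rho n)); rewrite (ger0_norm a0); apply: le_trans; exact: ler_norm.
have h2 : acos (rho n) * rho n <= Num.sqrt (1 - rho n ^+ 2).
  by rewrite -es -[X in _ * X]ec mul_cos_le_sin// a0.
rewrite /s -es; apply/andP; split; first by rewrite ler_pM2r ?invr_gt0.
rewrite mulrAC ler_pM2r ?invr_gt0// ler_pdivlMr// es//.
Unshelve. all: by end_near. Qed.

(* With a = E X^2, p = E[X D]/h and d = E D^2 / h^2 for the increment D over a
   step h, the Gram determinant of X and X + D is h^2 (a d - p^2). *)
Lemma correlation_asymptotic (a p d w h : nat -> R) (m M l0 l2 : R) :
  0 < m -> (forall n, m <= w n <= M) -> 0 < l0 -> (forall n, 0 < h n) -> h @ \oo --> (0 : R) ->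
  (fun n => a n - w n * l0) @ \oo --> (0 : R) -> p @ \oo --> (0 : R) ->
  (fun n => d n - w n * l2) @ \oo --> (0 : R) ->
  let v n := a n + 2 * (h n * p n) + h n ^+ 2 * d n in
  let rho n := (a n + h n * p n) / Num.sqrt (a n * v n) in
  (forall n, 0 < a n) -> (forall n, 0 < v n) -> (forall n, -1 <= rho n <= 1) ->
  (fun n => acos (rho n) / h n) @ \oo --> Num.sqrt (l2 / l0).
Proof.
move=> m0 wm l00 h0 hc ac pc dc v rho a0 v0 rho1.
have w0 n : 0 < w n by have /andP[h1 _] := wm n; exact: lt_le_trans h1.
have wn n : w n != 0 by rewrite gt_eqF.
(* The weights [w n] come from values of [psi] at moving points and need not converge, so all
   moments are normalised by them first; they cancel in the correlation. *)
have divw (u : nat -> R) (l : R) : (fun n => u n - w n * l) @ \oo --> (0 : R) ->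
    (fun n => u n / w n) @ \oo --> l.
  move=> uc; apply/cvgrPdist_le => e e0.
  have em : 0 < e * m by rewrite mulr_gt0.
  move/cvgrPdist_le : uc => /(_ _ em); apply: filterS => n.
  rewrite sub0r normrN => hn; rewrite distrC.
  rewrite (_ : u n / w n - l = (u n - w n * l) / w n); last by field.
  rewrite normrM normfV (gtr0_norm (w0 n)) ler_pdivrMr//; apply: (le_trans hn).
  by rewrite ler_pM2l//; have /andP[] := wm n.
have aw := divw _ _ ac; have dw := divw _ _ dc.
have pw : (fun n => p n / w n) @ \oo --> (0 : R).
  by apply: divw; under eq_fun do rewrite mulr0 subr0.
have hpw : (fun n => h n * (p n / w n)) @ \oo --> (0 : R).
  by rewrite -[X in _ --> X](mulr0 (0 : R)); apply: cvgM.
have hdw : (fun n => h n * (h n * (d n / w n))) @ \oo --> (0 : R).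
  have h1 : (fun n => h n * (d n / w n)) @ \oo --> (0 * l2 : R) by apply: cvgM.
  have h2 : (fun n => h n * (h n * (d n / w n))) @ \oo --> (0 * (0 * l2) : R) by apply: cvgM.
  by move: h2; rewrite mul0r.
have vw : (fun n => v n / w n) @ \oo --> l0.
  have h1 : (fun n => a n / w n + 2 * (h n * (p n / w n)) + h n * (h n * (d n / w n))) @ \oo --> (l0 + 2 * 0 + 0 : R).
    by apply: cvgD => //; apply: cvgD => //; exact: cvgMr.
  move: h1; rewrite mulr0 !addr0; apply: cvg_trans; apply: near_eq_cvg; apply: nearW => n.
  by rewrite /v; field; rewrite wn.
have avw : (fun n => (a n / w n) * (v n / w n)) @ \oo --> (l0 * l0 : R) by apply: cvgM.
have ll0 : l0 * l0 != 0 by rewrite mulf_neq0 ?gt_eqF.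
apply: acos_asymptotic => //.
- have h1 : (fun n => ((a n / w n) * (d n / w n) - (p n / w n) * (p n / w n)) / ((a n / w n) * (v n / w n)))
      @ \oo --> ((l0 * l2 - 0 * 0) / (l0 * l0) : R).
    by apply: cvgM; [apply: cvgB; exact: cvgM|exact: cvgV].
  have e2 : (l0 * l2 - 0 * 0) / (l0 * l0) = l2 / l0 by field; rewrite gt_eqF.
  move: h1; rewrite e2; apply: cvg_trans; apply: near_eq_cvg; apply: nearW => n.
  have av0 : 0 < a n * v n by rewrite mulr_gt0.
  rewrite /rho exprMn exprVn sqr_sqrtr ?(ltW av0)//.
  have an : a n != 0 by rewrite gt_eqF.
  have vn : v n != 0 by rewrite gt_eqF.
  have hn : h n != 0 by rewrite gt_eqF.
  have hv : v n = a n + 2 * (h n * p n) + h n ^+ 2 * d n by [].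
  have -> : 1 - (a n + h n * p n) ^+ 2 / (a n * v n) =
     h n ^+ 2 * (a n * d n - p n ^+ 2) / (a n * v n).
    rewrite -[X in X - _](divff (lt0r_neq0 av0)) -mulrBl; congr (_ / _).
    by rewrite hv; ring.
  by field; rewrite hn vn an wn.
- have h1 : (fun n => (a n / w n + h n * (p n / w n)) / Num.sqrt ((a n / w n) * (v n / w n)))
      @ \oo --> ((l0 + 0) / Num.sqrt (l0 * l0) : R).
    apply: cvgM; first exact: cvgD.
    apply: cvgV; first by rewrite -expr2 sqrtr_sqr normr_eq0 gt_eqF.
    exact: (continuous_cvg _ (@sqrt_continuous R _) avw).
  have e2 : (l0 + 0) / Num.sqrt (l0 * l0) = 1.
    by rewrite addr0 -expr2 sqrtr_sqr gtr0_norm// divff// gt_eqF.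
  move: h1; rewrite e2; apply: cvg_trans; apply: near_eq_cvg; apply: nearW => n.
  have av0 : 0 < a n * v n by rewrite mulr_gt0.
  have -> : a n / w n * (v n / w n) = a n * v n / w n ^+ 2 by field; rewrite wn.
  rewrite sqrtrM ?(ltW av0)// sqrtrV ?sqr_ge0// sqrtr_sqr (gtr0_norm (w0 n)) /rho.
  have sn : Num.sqrt (a n * v n) != 0 by rewrite gt_eqF// sqrtr_gt0.
  by field; rewrite wn sn.
Qed.

End arccosine_asymptotics.

Section increments.
Context {R : realType} {d : measure_display} {T : measurableType d}.
Variable P : probability T R.

Lemma norm_le_sqr (x y : R) : 0 <= y -> x ^+ 2 <= y ^+ 2 -> `|x| <= y.
Proof. by move=> y0 h; rewrite -(ler_sqr (normr_ge0 x)) ?nnegrE// real_normK ?num_real. Qed.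

Lemma Ex_CS_norm (X Y : T -> R) (u v : R) : sqi P X -> sqi P Y -> 0 <= u -> 0 <= v ->
  Ex P (fun w => X w ^+ 2) <= u ^+ 2 -> Ex P (fun w => Y w ^+ 2) <= v ^+ 2 ->
  `|Ex P (fun w => X w * Y w)| <= u * v.
Proof.
move=> sX sY u0 v0 hu hv; apply: norm_le_sqr; first exact: mulr_ge0.
apply: (le_trans (Ex_CS sX sY)); rewrite exprMn ler_pM//;
  by apply: Ex_ge0 => w; exact: sqr_ge0.
Qed.

Variables (q : nat) (A : set R) (X : R -> T -> R).
Hypothesis oA : open A.
Hypothesis smooth : forall w, of_class q A (X ^~ w).
Hypothesis gX : forall (k : nat) (s a : 'I_k -> R), (forall i, A (s i)) ->
  gl P (fun w => \sum_(i < k) a i * X (s i) w).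
Variables (s h V : R).
Hypothesis q1 : (1 < q)%N.
Hypothesis h_gt0 : 0 < h.
Hypothesis V_ge0 : 0 <= V.
Hypothesis inA : forall x, s <= x <= s + h -> A x.
Hypothesis hV : forall u x, (u <= 2)%N -> s <= x <= s + h -> Ex P (fun w => dX X u x w ^+ 2) <= V ^+ 2.

Let sqiX u x : (u <= q)%N -> s <= x <= s + h -> sqi P (dX X u x).
Proof. by move=> uq xs; have [] := gl_dX1 oA smooth gX uq (inA xs). Qed.

Let D w := (X (s + h) w - X s w) / h.
Let Z w := D w - dX X 1 s w.

Let s_in : s <= s <= s + h. Proof. by rewrite lexx lerDl ltW. Qed.
Let sh_in : s <= s + h <= s + h. Proof. by rewrite lexx lerDl ltW. Qed.

Let sqiD : sqi P D.
Proof.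
have -> : D = (fun w => h^-1 * (X (s + h) w - X s w)) by apply/funext => w; rewrite /D mulrC.
exact: sqiZ (sqiB (sqiX (leq0n q) sh_in) (sqiX (leq0n q) s_in)).
Qed.

Let sqiZ' : sqi P Z.
Proof. by apply: sqiB => //; apply: sqiX => //; exact: ltnW. Qed.

Let Ex_Z : Ex P (fun w => Z w ^+ 2) <= (V * h) ^+ 2.
Proof.
have ss : s <= s + h by rewrite lerDl ltW.
have := @Ex_taylor_le _ _ _ P q A X oA smooth gX s (s + h) V q1 ss inA V_ge0
  (fun x => @hV 2 x (leqnn 2)).
rewrite (_ : s + h - s = h); last by ring.
have e : Ex P (fun w => (X (s + h) w - X s w - h * dX X 1 s w) ^+ 2) =
    h ^+ 2 * Ex P (fun w => Z w ^+ 2).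
  have [_ iZ] := sqiZ'.
  by rewrite -ExZ//; apply: eq_Ex => w; rewrite /Z /D; field; rewrite gt_eqF.
rewrite e (_ : (V * h ^+ 2) ^+ 2 = h ^+ 2 * (V * h) ^+ 2); last by ring.
by rewrite ler_pM2l// exprn_gt0.
Qed.

(** The square of [D = Z + X'] is expanded; the remainder [Z] has second moment at most
    [(V * h) ^+ 2], and Cauchy-Schwarz bounds the cross term. *)
Lemma Ex_slope_sqr :
  `|Ex P (fun w => D w ^+ 2) - Ex P (fun w => dX X 1 s w ^+ 2)| <= V ^+ 2 * (h ^+ 2 + 2 * h).
Proof.
have q1' := ltnW q1.
have s1 := sqiX q1' s_in; have iM := sqi_itgM sqiZ' s1.
have [_ i1] := s1; have [_ iZ] := sqiZ'.
have -> : Ex P (fun w => D w ^+ 2) =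
    Ex P (fun w => Z w ^+ 2) + 2 * Ex P (fun w => Z w * dX X 1 s w) + Ex P (fun w => dX X 1 s w ^+ 2).
  rewrite -ExZ// -ExD//; last exact: itgZ.
  rewrite -ExD//; last by apply: itgD => //; exact: itgZ.
  by apply: eq_Ex => w; rewrite /Z; ring.
rewrite addrK.
have c := Ex_CS_norm sqiZ' s1 (mulr_ge0 V_ge0 (ltW h_gt0)) V_ge0 Ex_Z (@hV 1%N s isT s_in).
have z0 : 0 <= Ex P (fun w => Z w ^+ 2) by apply: Ex_ge0 => w; exact: sqr_ge0.
apply: (le_trans (ler_normD _ _)); rewrite (ger0_norm z0) normrM ger0_norm//.
rewrite mulrDr; apply: lerD; first by have := Ex_Z; rewrite exprMn.
by rewrite mulrCA ler_pM2l//; apply: (le_trans c); rewrite le_eqVlt; apply/orP; left; apply/eqP; ring.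
Qed.

Lemma Ex_slope_cross :
  `|Ex P (fun w => X s w * D w) - Ex P (fun w => X s w * dX X 1 s w)| <= V ^+ 2 * h.
Proof.
have s0 := sqiX (leq0n q) s_in; have s1 := sqiX (ltnW q1) s_in.
rewrite -ExB; [|exact: sqi_itgM|exact: sqi_itgM].
have -> : Ex P (fun w => X s w * D w - X s w * dX X 1 s w) = Ex P (fun w => dX X 0 s w * Z w).
  by apply: eq_Ex => w; rewrite /Z mulrBr.
have := Ex_CS_norm s0 sqiZ' V_ge0 (mulr_ge0 V_ge0 (ltW h_gt0)) (@hV 0%N s isT s_in) Ex_Z.
by rewrite mulrA -expr2.
Qed.

Lemma Ex_step_cov : Ex P (fun w => X s w * X (s + h) w) =
  Ex P (fun w => X s w ^+ 2) + h * Ex P (fun w => X s w * D w).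
Proof.
have s0 := sqiX (leq0n q) s_in; have [_ i0] := s0.
have iM := sqi_itgM s0 sqiD.
rewrite -ExZ// -ExD//; last exact: itgZ.
by apply: eq_Ex => w; rewrite /D; field; rewrite gt_eqF.
Qed.

Lemma Ex_step_var : Ex P (fun w => X (s + h) w ^+ 2) =
  Ex P (fun w => X s w ^+ 2) + 2 * (h * Ex P (fun w => X s w * D w)) +
  h ^+ 2 * Ex P (fun w => D w ^+ 2).
Proof.
have s0 := sqiX (leq0n q) s_in; have [_ i0] := s0.
have iM := sqi_itgM s0 sqiD; have [_ iD] := sqiD.
rewrite -!ExZ//; [|exact: itgZ].
rewrite -!ExD//; [|by apply: itgD => //; do 2 apply: itgZ|exact: itgZ|by do 2 apply: itgZ].
by apply: eq_Ex => w; rewrite /D; field; rewrite gt_eqF.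
Qed.

Lemma corr_itv (Y : T -> R) : sqi P (X s) -> sqi P Y ->
  0 < Ex P (fun w => X s w ^+ 2) -> 0 < Ex P (fun w => Y w ^+ 2) ->
  -1 <= Ex P (fun w => X s w * Y w) /
    Num.sqrt (Ex P (fun w => X s w ^+ 2) * Ex P (fun w => Y w ^+ 2)) <= 1.
Proof.
move=> s0 s1 a0 b0.
have q0 : 0 < Num.sqrt (Ex P (fun w => X s w ^+ 2) * Ex P (fun w => Y w ^+ 2)).
  by rewrite sqrtr_gt0 mulr_gt0.
rewrite -ler_norml normrM normfV (gtr0_norm q0) ler_pdivrMr// mul1r.
apply: norm_le_sqr; first exact: ltW.
by rewrite sqr_sqrtr; [exact: Ex_CS|rewrite mulr_ge0// ltW].
Qed.

End increments.

(** * The Borel-Cantelli lemma and the choice of scales *)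

Section borel_cantelli.
Context {R : realType} {d : measure_display} {T : measurableType d}.
Variable P : probability T R.

Lemma sum_inv_sqr (n : nat) : \sum_(i < n.+1) (i.+1%:R ^- 2 : R) <= 2 - n.+1%:R^-1.
Proof.
elim: n => [|n IH]; first by rewrite big_ord_recl big_ord0 /= expr1n invr1; lra.
rewrite big_ord_recr/=; apply: (le_trans (lerD IH (lexx _))).
rewrite -[n.+2]addn1 natrD; have : 0 < n.+1%:R :> R by rewrite ltr0n.
move: (n.+1%:R : R) => x x0; have x1 : 0 < x + 1 by lra.
rewrite -subr_ge0 (_ : _ - _ = ((x + 1) ^+ 2 * x)^-1); first by rewrite invr_ge0 mulr_ge0 ?sqr_ge0 ?ltW.
by field; rewrite !gt_eqF.
Qed.

Lemma borel_cantelli_inv_sqr (B : nat -> set T) (C : R) (n1 : nat) : 0 <= C ->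
  (forall n, measurable (B n)) ->
  (forall n, (n1 <= n)%N -> (0 < n)%N -> (P (B n) <= (C * n%:R ^- 2)%:E)%E) ->
  \forall w \ae P, exists n0, forall n, (n0 <= n)%N -> ~ B n w.
Proof.
move=> C0 mB PB.
(* The shift avoids the index [0], where the bound is meaningless, and the events before [n1], for
   which no bound is known, are emptied. *)
pose F n := if (n1 <= n.+1)%N then B n.+1 else set0.
have mF n : measurable (F n) by rewrite /F; case: ifP.
have PF n : (P (F n) <= (C * n.+1%:R ^- 2)%:E)%E.
  rewrite /F; case: ifP => h; first exact: PB.
  by rewrite measure0 lee_fin mulr_ge0// invr_ge0 sqr_ge0.
have lim0 : P (lim_sup_set F) = 0%E.
  apply: lim_sup_set_cvg0 => //.
  apply: (@le_lt_trans _ _ (C * 2)%:E); last exact: ltry.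
  apply: lime_le; first by apply: is_cvg_nneseries => n _ _; exact: measure_ge0.
  apply: nearW => n; rewrite big_mkord.
  apply: (@le_trans _ _ (\sum_(i < n.+1) (C * i.+1%:R ^- 2)%:E)%E).
    rewrite big_ord_recr/= -[leLHS]adde0; apply: leeD; first by apply: lee_sum => i _; exact: PF.
    by rewrite lee_fin mulr_ge0// invr_ge0 sqr_ge0.
  rewrite sumEFin lee_fin -mulr_sumr; apply: ler_wpM2l => //.
  by apply: (le_trans (sum_inv_sqr n)); rewrite gerBl invr_ge0.
exists (lim_sup_set F); split => //.
  by apply: bigcap_measurable => // n _; apply: bigcup_measurable => j _; exact: mF.
move=> w /= nw n _; apply: contrapT => h; apply: nw.
exists (maxn n1 n.+1) => k hk Bk; apply: h.
case: k hk Bk => [|k]; first by rewrite leqn0 => /eqP e; have := leq_maxr n1 n.+1; rewrite e.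
rewrite geq_max ltnS => /andP[h1 h2] Bk.
by exists k => //=; rewrite /F h1.
Qed.

End borel_cantelli.

Section scales.
Context {R : realType}.

Lemma root_floor (Q n : nat) : (0 < Q)%N -> exists k, (k ^ Q <= n < k.+1 ^ Q)%N.
Proof.
move=> Q0; elim: n => [|n [k /andP[h1 h2]]]; first by exists 0%N; rewrite exp0n// exp1n.
move: h2; rewrite leq_eqVlt => /orP[/eqP e|h2]; last by exists k; rewrite leqW.
by exists k.+1; rewrite e leqnn/= ltn_exp2r.
Qed.

Lemma sum_image_le (n : nat) (Q : pred 'I_n) (f : 'I_n -> 'I_n) (phi : 'I_n -> R) :
  {in Q &, injective f} -> (forall j, 0 <= phi j) ->
  \sum_(j | Q j) phi (f j) <= \sum_j phi j.
Proof.
move=> fI phi0; rewrite -(big_imset phi (A := Q) fI).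
by rewrite [leRHS](bigID [in f @: Q])/= lerDl; apply: sumr_ge0.
Qed.

(** Only the squares of [g] are summable, so [g <= lam + g ^+ 2 / lam] is used with a free level
    [lam]. In a row each value of [|i - j|] occurs at most twice, whence [2 * G]. *)
Lemma cov_double_sum (C : nat -> nat -> R) (g : R -> R) (h lam G : R) (K : nat) :
  (forall x, g (- x) = g x) -> 0 < lam ->
  (forall i j, (i <= K)%N -> (j <= K)%N -> `|C i j| <= g ((i%:R - j%:R) * h)) ->
  \sum_(i < K.+1) g (i%:R * h) ^+ 2 <= G ->
  \sum_(i < K.+1) \sum_(j < K.+1) `|C i j| <= K.+1%:R ^+ 2 * lam + K.+1%:R * (2 * G / lam).
Proof.
move=> ge l0 hC hG.
pose phi (m : 'I_K.+1) := g (m%:R * h) ^+ 2.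
have row (i : 'I_K.+1) : \sum_(j < K.+1) g ((i%:R - j%:R) * h) ^+ 2 <= 2 * G.
  rewrite (bigID (fun j : 'I_K.+1 => (j <= i)%N))/= [2 * G]mulr_natl mulr2n.
  apply: lerD; apply: le_trans hG.
    rewrite (eq_bigr (fun j : 'I_K.+1 => phi (inord (i - j)))) => [|j ji].
      apply: sum_image_le => [j k|j]; last exact: sqr_ge0.
      rewrite !unfold_in => ji ki /(congr1 val)/=; rewrite !inordK; last 2 first.
      - by rewrite ltnS (leq_trans (leq_subr _ _))// -ltnS.
      - by rewrite ltnS (leq_trans (leq_subr _ _))// -ltnS.
      by move=> e; apply: val_inj => /=; have := subKn ji; rewrite e subKn.
    rewrite /phi inordK ?natrB//.
    by rewrite ltnS (leq_trans (leq_subr _ _))// -ltnS.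
  rewrite (eq_bigr (fun j : 'I_K.+1 => phi (inord (j - i)))) => [|j ji].
    apply: sum_image_le => [j k|j]; last exact: sqr_ge0.
    rewrite !unfold_in /= -!ltnNge => ji ki /(congr1 val)/=; rewrite !inordK; last 2 first.
    - by rewrite ltnS (leq_trans (leq_subr _ _))// -ltnS.
    - by rewrite ltnS (leq_trans (leq_subr _ _))// -ltnS.
    by move=> e; apply: val_inj => /=; rewrite -(subnK (ltnW ji)) e subnK// ltnW.
  rewrite -ltnNge in ji.
  rewrite /phi inordK; last by rewrite ltnS (leq_trans (leq_subr _ _))// -ltnS.
  by rewrite natrB ?(ltnW ji)// -ge; congr (g _ ^+ 2); ring.
have gle x : g x <= lam + g x ^+ 2 / lam.
  rewrite -(ler_pM2r l0) mulrDl divfK ?gt_eqF//; move: (g x) => y.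
  by have := sqr_ge0 (y - lam); have := sqr_ge0 y; have := sqr_ge0 lam; nra.
have -> : K.+1%:R ^+ 2 * lam + K.+1%:R * (2 * G / lam) =
    \sum_(i < K.+1) (K.+1%:R * lam + 2 * G / lam).
  by rewrite sumr_const card_ord -[RHS]mulr_natl; ring.
apply: ler_sum => i _.
apply: (@le_trans _ _ (\sum_(j < K.+1) (lam + g ((i%:R - j%:R) * h) ^+ 2 / lam))).
  apply: ler_sum => j _; apply: le_trans (gle _).
  by apply: hC; rewrite -ltnS.
rewrite big_split /= sumr_const card_ord -[X in X + _]mulr_natl lerD2l -mulr_suml.
by rewrite ler_pM2r ?invr_gt0//; exact: row.
Qed.

End scales.

Section long_intervals.
Context {R : realType} {d : measure_display} {T : measurableType d}.
Variables (P : probability T R) (q : nat) (A : set R) (X : R -> T -> R).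
Hypothesis oA : open A.
Hypothesis smooth : forall w, of_class q A (X ^~ w).
Hypothesis gX : forall (k : nat) (s a : 'I_k -> R), (forall i, A (s i)) ->
  gl P (fun w => \sum_(i < k) a i * X (s i) w).

Lemma path_sup_long (u r n : nat) (c L V lam : R) : (u < q)%N -> 0 <= L <= 1 ->
  (forall x, c <= x <= c + n.+1%:R * L -> A x) -> 0 < V -> 0 < lam ->
  (forall v x, (u <= v <= u.+1)%N -> c <= x <= c + n.+1%:R * L ->
    Ex P (fun w => dX X v x w ^+ 2) <= V) ->
  exists B, [/\ measurable B,
    (P B <= (n.+1%:R * (2 ^+ (2 ^ r.+1) * (gmom (2 ^ r) * V ^+ (2 ^ r)) / lam ^+ (2 ^ r.+1)))%:E)%E &
    forall w, ~ B w -> forall x, c <= x <= c + n.+1%:R * L -> `|dX X u x w| <= lam].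
Proof.
move=> uq L01 inA V0 l0 hV; have /andP[L0 L1] := L01.
have piece i : (i <= n)%N -> forall x, c + i%:R * L <= x <= c + i%:R * L + L ->
    c <= x <= c + n.+1%:R * L.
  move=> iN x /andP[h1 h2]; apply/andP; split.
    by apply: le_trans h1; rewrite lerDl mulr_ge0.
  apply: (le_trans h2); rewrite -addrA lerD2l -[X in _ + X]mul1r -mulrDl natr1.
  by apply: ler_wpM2r => //; rewrite ler_nat.
have Bex i : exists B, (i <= n)%N -> [/\ measurable B,
    (P B <= (2 ^+ (2 ^ r.+1) * (gmom (2 ^ r) * V ^+ (2 ^ r)) / lam ^+ (2 ^ r.+1))%:E)%E &
    forall w, ~ B w -> forall x, c + i%:R * L <= x <= c + i%:R * L + L -> `|dX X u x w| <= lam].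
  have [iN|Ni] := leqP i n; last by exists set0.
  have [B hB] := @path_sup _ _ _ P q A X oA smooth gX u r (c + i%:R * L) L V lam uq L01
    (fun x hx => inA x (piece i iN x hx)) V0 l0 (fun v x uv hx => hV v x uv (piece i iN x hx)).
  by exists B.
have [B hB] := choice Bex.
exists (\bigcup_(i in `I_n.+1) B i); split.
- by apply: bigcup_measurable => i /= iN; have [] := hB i iN.
- by apply: prob_bigcup_le => i iN; have [] := hB i iN.
- move=> w nB x /andP[cx xn].
  have [i iN hi] : exists2 i, (i <= n)%N & c + i%:R * L <= x <= c + i%:R * L + L.
    elim: {hB nB inA hV piece Bex} n xn => [|m IH] xm.
      by exists 0%N => //; rewrite mul0r addr0 cx; move: xm; rewrite mul1r.
    have [h|h] := leP x (c + m.+1%:R * L).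
      by have [i im hi] := IH h; exists i => //; exact: leqW.
    exists m.+1 => //; rewrite (ltW h)/=; move: xm.
    by rewrite -[m.+2]addn1 natrD mulrDl mul1r addrA.
  have [_ _ h] := hB i iN; apply: h => // Bw; apply: nB; exists i => //=.
Qed.

End long_intervals.

(* Here x stands for k and N for n, with x^80 <= N <= (2 x)^80; each probability is
   bounded by a constant times N^(-2). *)
Section scale_estimates.
Context {R : realType}.
Variables (x N : R).
Hypothesis x_ge1 : 1 <= x.
Hypothesis xN : x ^+ 80 <= N.
Hypothesis Nx : N <= 2 ^+ 80 * x ^+ 80.

Let x_gt0 : 0 < x. Proof. exact: lt_le_trans x_ge1. Qed.
Let xn_gt0 i : 0 < x ^+ i. Proof. exact: exprn_gt0. Qed.
Let N_gt0 : 0 < N. Proof. exact: lt_le_trans xN. Qed.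
Let N_ge1 : 1 <= N. Proof. by apply: le_trans xN; exact: exprn_ege1. Qed.

Lemma inv_scale (j e : nat) : (e * 80 <= j)%N -> x ^- j <= (2 ^+ 80) ^+ e * N ^- e.
Proof.
move=> ej; have Ne : 0 < N ^+ e by exact: exprn_gt0.
rewrite ler_pdivlMr// mulrC ler_pdivrMr//.
apply: (@le_trans _ _ ((2 ^+ 80 * x ^+ 80) ^+ e)).
  by apply: lerXn2r => //; rewrite nnegrE; apply: ltW => //; apply: mulr_gt0 => //; exact: exprn_gt0.
rewrite exprMn ler_pM2l ?exprn_gt0// -exprM mulnC.
by apply: ler_weXn2l.
Qed.

(** The union over [N] pieces costs a factor [N], so [x ^- m] has to be of order [N ^- 3], that is
    [240 <= m]. *)
Lemma sup_estimate (c l : R) (m : nat) : 0 <= c -> 0 < l -> (240 <= m)%N ->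
  N * (c / (x / l) ^+ m) <= c * l ^+ m * (2 ^+ 80) ^+ 3 * N ^- 2.
Proof.
move=> c0 l0 m240; have lm : 0 < l ^+ m by exact: exprn_gt0.
have -> : N * (c / (x / l) ^+ m) = c * l ^+ m * (N * x ^- m).
  by rewrite exprMn exprVn; field; rewrite !gt_eqF.
rewrite -[leRHS]mulrA; apply: ler_wpM2l; first by rewrite mulr_ge0// ltW.
have h := @inv_scale m 3 m240; rewrite -(ler_pM2l N_gt0) in h; apply: (le_trans h).
by rewrite le_eqVlt; apply/orP; left; apply/eqP; field; rewrite gt_eqF.
Qed.

Lemma sup_estimate_high (c : R) (m : nat) : 0 <= c -> (2 <= m)%N ->
  N * (c / (N ^+ 2) ^+ m) <= c * N ^- 2.
Proof.
move=> c0 m2; rewrite mulrCA; apply: ler_wpM2l => //.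
rewrite -exprM ler_pdivrMr ?exprn_gt0// mulrC ler_pdivlMr ?exprn_gt0// -exprS.
by apply: ler_weXn2l => //; rewrite (@leq_trans (2 * 2)%N)// leq_mul2l.
Qed.

(** This fixes the Rolle order: [x ^+ 5] cells times the step to the power [81] give [x ^- 400], of
    order [N ^- 5], which absorbs [N] from the union and [N ^+ 2] from the derivative bound. *)
Lemma small_value_estimate (L v : R) : 0 < L <= 1 -> 0 < v ->
  N * x ^+ 5 * (2 * ((L / x ^+ 5) ^+ 81 * N ^+ 2) / v) <= 2 / v * (2 ^+ 80) ^+ 5 * N ^- 2.
Proof.
move=> /andP[L0 L1] v0.
have hL : L ^+ 81 <= 1 by rewrite exprn_ile1// ltW.
have -> : N * x ^+ 5 * (2 * ((L / x ^+ 5) ^+ 81 * N ^+ 2) / v) =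
    2 / v * (L ^+ 81 * (N ^+ 3 * x ^- 400)).
  have e : x ^+ 400 * x ^+ 5 = (x ^+ 5) ^+ 81 by rewrite -exprD -exprM.
  rewrite exprMn exprVn -e; move: (L ^+ 81) (x ^+ 400) (xn_gt0 400) (x ^+ 5) (xn_gt0 5) => y z z0 t t0.
  by field; rewrite !gt_eqF.
rewrite -[leRHS]mulrA; apply: ler_wpM2l; first by rewrite divr_ge0// ltW.
have N3 : 0 < N ^+ 3 by exact: exprn_gt0.
apply: (@le_trans _ _ (N ^+ 3 * x ^- 400)).
  by rewrite ler_piMl// mulr_ge0 ?invr_ge0// ltW.
have h := @inv_scale 400 5 isT; rewrite -(ler_pM2l N3) in h; apply: (le_trans h).
rewrite le_eqVlt; apply/orP; left; apply/eqP; move: ((2 ^+ 80) ^+ 5 : R) => y.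
by field; rewrite gt_eqF.
Qed.

(** Here the level of [cov_double_sum] is [x ^- 40]. The first term is then of order
    [N ^+ 2 * x ^- 30], and the second, of order [N * x ^+ 50], is no larger because
    [x ^+ 80 <= N]. *)
Lemma cov_sum_estimate (L Cg K1 : R) : 0 < L -> 0 <= Cg -> 0 <= K1 <= 2 * (N * x ^+ 5) ->
  K1 ^+ 2 * x ^- 40 + K1 * (2 * (Cg / (L / x ^+ 5)) / x ^- 40) <=
  (4 + 4 * Cg / L) * (N ^+ 2 * x ^- 30).
Proof.
move=> L0 C0 /andP[K0 K2].
rewrite [leRHS]mulrDl; apply: lerD.
  apply: (@le_trans _ _ ((2 * (N * x ^+ 5)) ^+ 2 * x ^- 40)).
    by apply: ler_wpM2r; [rewrite invr_ge0 ltW|apply: lerXn2r => //; rewrite nnegrE ?mulr_ge0// ltW].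
  rewrite le_eqVlt; apply/orP; left; apply/eqP.
  have -> : x ^+ 40 = x ^+ 30 * (x ^+ 5) ^+ 2 by rewrite -exprM -exprD.
  move: (x ^+ 30) (x ^+ 5) (xn_gt0 30) (xn_gt0 5) => y z y0 z0.
  by field; rewrite !gt_eqF.
apply: (@le_trans _ _ (2 * (N * x ^+ 5) * (2 * (Cg / (L / x ^+ 5)) / x ^- 40))).
  apply: ler_wpM2r => //; apply: mulr_ge0; last by rewrite invr_ge0 invr_ge0 ltW.
  by rewrite mulr_ge0// divr_ge0// divr_ge0// ltW.
have -> : 2 * (N * x ^+ 5) * (2 * (Cg / (L / x ^+ 5)) / x ^- 40) =
    4 * Cg / L * (N * (x ^+ 80 * x ^- 30)).
  have -> : x ^+ 80 = x ^+ 40 * (x ^+ 30 * (x ^+ 5) ^+ 2) by rewrite -exprM -!exprD.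
  move: (x ^+ 40) (x ^+ 30) (x ^+ 5) (xn_gt0 40) (xn_gt0 30) (xn_gt0 5) => t y z t0 y0 z0.
  by field; rewrite !gt_eqF.
apply: ler_wpM2l; first by rewrite divr_ge0 ?mulr_ge0// ltW.
rewrite expr2 -mulrA; apply: ler_wpM2l; first exact: ltW.
by apply: ler_wpM2r => //; rewrite invr_ge0 ltW.
Qed.

(** The squared Lipschitz constant [x ^+ 18], the covariance gain [x ^- 30] and the tolerance
    [N / x] leave [x ^- 10] per unit of [p], hence order [N ^- 2] as soon as [16 <= p]. *)
Lemma fluctuation_estimate (b C : R) (p : nat) : 0 <= b -> 0 <= C -> (16 <= p)%N ->
  b * (4 * (x ^+ 9) ^+ 2 * (C * (N ^+ 2 * x ^- 30))) ^+ p / (N / x) ^+ (2 * p) <=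
  b * (4 * C) ^+ p * (2 ^+ 80) ^+ 2 * N ^- 2.
Proof.
move=> b0 C0 p16.
have -> : b * (4 * (x ^+ 9) ^+ 2 * (C * (N ^+ 2 * x ^- 30))) ^+ p / (N / x) ^+ (2 * p) =
    b * (4 * C) ^+ p * x ^- (10 * p).
  have e1 (u w : R) : b * u ^+ p / w ^+ p = b * (u / w) ^+ p by rewrite expr_div_n mulrA.
  rewrite [(N / x) ^+ _]exprM [x ^+ (10 * p)]exprM !e1; congr (_ * _ ^+ p).
  have -> : x ^+ 30 = x ^+ 10 * x ^+ 2 * (x ^+ 9) ^+ 2 by rewrite -exprM -!exprD.
  rewrite expr_div_n.
  move: (x ^+ 10) (x ^+ 9) (x ^+ 2) (xn_gt0 10) (xn_gt0 9) (xn_gt0 2) => t y z t0 y0 z0.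
  by field; rewrite !gt_eqF.
rewrite -[leRHS]mulrA; apply: ler_wpM2l; first by rewrite mulr_ge0// exprn_ge0// mulr_ge0.
by apply: inv_scale; rewrite (@leq_trans (10 * 16)%N)// leq_mul2l.
Qed.

(** The level [tau = x ^- 6] balances the two parts of the bump mean: with [c = x ^+ 9] both are of
    order [x ^- 6], and [N * x ^+ 5] cells add up to order [N / x]. *)
Lemma error_estimate (v k : R) :
  k * (N * x ^+ 5 * (2 * x ^- 6 / v + (x ^+ 9 * x ^- 6) ^- 2) + N / x) = N * (k * (2 / v + 2) / x).
Proof.
have -> : (x ^+ 9 * x ^- 6) ^- 2 = x ^- 6.
  have -> : x ^+ 9 = x ^+ 3 * x ^+ 6 by rewrite -exprD.
  by rewrite mulfK ?gt_eqF// -exprM.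
have -> : x ^+ 6 = x ^+ 5 * x by rewrite exprSr.
move: (x ^+ 5) (xn_gt0 5) (v^-1) => y y0 z.
by field; rewrite !gt_eqF.
Qed.

End scale_estimates.

(** * The law of large numbers along the integers *)

Section zero_count_lln.
Context {R : realType} {d : measure_display} {T : measurableType d}.
Variables (P : probability T R) (A : nat -> set R) (X : nat -> R -> T -> R) (a b : R).
Hypothesis ab : a < b.
Hypothesis ba1 : b - a <= 1.
Hypothesis oA : forall n, (0 < n)%N -> open (A n).
Hypothesis smooth : forall n, (0 < n)%N -> forall w, of_class 82 (A n) ((X n) ^~ w).
Hypothesis gX : forall n, (0 < n)%N -> forall (k : nat) (s c : 'I_k -> R),
  (forall i, A n (s i)) -> gl P (fun w => \sum_(i < k) c i * X n (s i) w).
Hypothesis lX : forall n, (0 < n)%N -> forall s, A n s -> centered_gaussian_law P (X n s).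
Hypothesis inA : forall n x, (0 < n)%N -> n%:R * a <= x <= n%:R * b -> A n x.
Variable V : R.
Hypothesis V_gt0 : 0 < V.
Hypothesis hV : forall n u x, (0 < n)%N -> (u <= 82)%N -> n%:R * a <= x <= n%:R * b ->
  Ex P (fun w => dX (X n) u x w ^+ 2) <= V ^+ 2.
Variables (g : R -> R) (omega Cg : R).
Hypothesis g_even : forall x, g (- x) = g x.
Hypothesis omega_gt0 : 0 < omega.
Hypothesis Cg_ge0 : 0 <= Cg.
Hypothesis g_sum : forall h K, 0 < h <= omega -> \sum_(i < K) g (i%:R * h) ^+ 2 <= Cg / h.
Hypothesis cov_le : forall n s t, (0 < n)%N -> n%:R * a <= s <= n%:R * b ->
  n%:R * a <= t <= n%:R * b -> `|Ex P (fun w => X n s w * X n t w)| <= g (s - t).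
Variables (psi : R -> R) (m M l0 l2 : R).
Hypothesis m_gt0 : 0 < m.
Hypothesis psi_itv : forall x, a <= x <= b -> m <= psi x <= M.
Hypothesis l0_gt0 : 0 < l0.
Hypothesis moments : forall e, 0 < e -> exists n0, forall n x, (n0 <= n)%N -> (0 < n)%N ->
  a <= x <= b ->
  [/\ `|Ex P (fun w => X n (n%:R * x) w ^+ 2) - psi x * l0| <= e,
      `|Ex P (fun w => X n (n%:R * x) w * dX (X n) 1 (n%:R * x) w)| <= e &
      `|Ex P (fun w => dX (X n) 1 (n%:R * x) w ^+ 2) - psi x * l2| <= e].

Let L := b - a.
Let L_gt0 : 0 < L. Proof. by rewrite subr_gt0. Qed.

Variable kap : nat -> nat.
Hypothesis kapP : forall n, (kap n ^ 80 <= n < (kap n).+1 ^ 80)%N.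

Let x n : R := (kap n)%:R.

Lemma scale_ge1 n : (0 < n)%N -> 1 <= x n.
Proof.
move=> n0; rewrite ler1n lt0n; apply/eqP => k0; have /andP[_] := kapP n.
by rewrite k0 exp1n ltnS leqNgt n0.
Qed.

Lemma scale_lower n : x n ^+ 80 <= n%:R.
Proof. by have /andP[h _] := kapP n; rewrite /x -natrX ler_nat. Qed.

Lemma scale_upper n : (0 < n)%N -> n%:R <= 2 ^+ 80 * x n ^+ 80.
Proof.
move=> n0; have /andP[_ h] := kapP n; have x1 := scale_ge1 n0.
apply: (@le_trans _ _ ((kap n).+1%:R ^+ 80)).
  by rewrite -natrX ler_nat ltnW.
rewrite -exprMn; apply: lerXn2r; rewrite ?nnegrE// ?mulr_ge0//.
by rewrite -natr1 -/(x n); lra.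
Qed.

Lemma scale_cvg (C e : R) : 0 <= C -> 0 < e -> exists n0, forall n, (n0 <= n)%N -> C / x n <= e.
Proof.
move=> C0 e0; pose k := (Num.truncn (C / e)).+1.
exists (k ^ 80)%N => n hn.
have kk : (k <= kap n)%N.
  rewrite leqNgt; apply/negP => h; have /andP[_] := kapP n.
  by rewrite ltnNge (leq_trans _ hn)// leq_exp2r.
have k0 : 0 < x n by rewrite ltr0n (leq_trans _ kk).
rewrite ler_pdivrMr// mulrC -ler_pdivrMr//.
have /andP[_ /ltW h] := truncn_itv (divr_ge0 C0 (ltW e0)).
by apply: (le_trans h); rewrite ler_nat.
Qed.

Definition mesh n : R := L / x n ^+ 5.
Definition cells n : nat := (n * kap n ^ 5)%N.

Lemma mesh_gt0 n : (0 < n)%N -> 0 < mesh n.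
Proof. by move=> n0; rewrite divr_gt0// exprn_gt0// (lt_le_trans _ (scale_ge1 n0)). Qed.

Lemma cellsE n : (cells n)%:R = n%:R * x n ^+ 5.
Proof. by rewrite natrM natrX. Qed.

Lemma cells_mesh n : (0 < n)%N -> n%:R * a + (cells n)%:R * mesh n = n%:R * b.
Proof.
move=> n0; rewrite cellsE /mesh /L; have : 0 < x n ^+ 5.
  by rewrite exprn_gt0// (lt_le_trans _ (scale_ge1 n0)).
by move: (x n ^+ 5) => y y0; field; rewrite gt_eqF.
Qed.

Lemma mesh_le n : (0 < n)%N -> mesh n <= L / x n.
Proof.
move=> n0; have x1 := scale_ge1 n0; have x0 : 0 < x n by exact: lt_le_trans x1.
rewrite ler_pM2l// lef_pV2 ?posrE ?exprn_gt0//.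
by rewrite -{1}[x n]expr1; apply: ler_weXn2l.
Qed.

Lemma mesh_small e : 0 < e -> exists n0, forall n, (n0 <= n)%N -> (0 < n)%N -> mesh n <= e.
Proof.
move=> e0; have [n0 h] := scale_cvg (ltW L_gt0) e0.
by exists n0 => n hn n1; apply: (le_trans (mesh_le n1)); exact: h.
Qed.

Lemma rescale_in n y : (0 < n)%N -> n%:R * a <= y <= n%:R * b ->
  a <= y / n%:R <= b /\ n%:R * (y / n%:R) = y.
Proof.
move=> n0 /andP[h1 h2]; have nn : 0 < n%:R :> R by rewrite ltr0n.
rewrite ler_pdivlMr// ler_pdivrMr// mulrC h1 mulrC h2; split=> //.
by field; rewrite gt_eqF.
Qed.

Lemma variance_lower : exists n0, forall n y, (n0 <= n)%N -> (0 < n)%N ->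
  n%:R * a <= y <= n%:R * b -> m * l0 / 2 <= Ex P (fun w => X n y w ^+ 2).
Proof.
have e0 : 0 < m * l0 / 2 by rewrite divr_gt0// mulr_gt0.
have [n0 h] := moments e0; exists n0 => n y hn n1 hy.
have [hy' ey] := rescale_in n1 hy; have [+ _ _] := h n _ hn n1 hy'.
rewrite ey ler_norml => /andP[h1 _]; have /andP[p _] := psi_itv hy'.
have : m * l0 <= psi (y / n%:R) * l0 by rewrite ler_pM2r.
lra.
Qed.

(** Instance of [zero_count_deviation] with [c = k^9], [tau = k^(-6)], [delta = n / k] and Rolle
    order [81]. The bound [n^2] asked of the derivative of that order can be generous because the
    step enters to the power [81]. *)
Theorem zero_count_event : exists C : R, exists n1 : nat, 0 <= C /\
  forall n, (n1 <= n)%N -> (0 < n)%N -> exists B, [/\ measurable B,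
    (P B <= (C * n%:R ^- 2)%:E)%E &
    forall w, ~ B w ->
    exists2 s, enumerates s [set t | n%:R * a <= t < n%:R * b /\ X n t w = 0] &
      `|(size s)%:R - \sum_(j < cells n)
          acos (correlation P (X n) (n%:R * a) (mesh n) j) / pi| <= n%:R * (C / x n)].
Proof.
(* The moment order [mm = 2 * p] has to reach [240] for the bound on the second derivative; the
   condition [16 <= p] of the fluctuations is then met. *)
have [p7 hp7] : exists r, (120 <= 2 ^ r)%N by exists 7.
have [n2 hn2] := variance_lower.
have [n3 hn3] := mesh_small omega_gt0.
pose v := Num.sqrt (m * l0 / 2).
have ml0 : 0 < m * l0 / 2 by rewrite divr_gt0// mulr_gt0.
have v0 : 0 < v by rewrite sqrtr_gt0.
have v2 : v ^+ 2 = m * l0 / 2 by rewrite sqr_sqrtr// ltW.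
pose p := (2 ^ p7)%N; pose mm := (2 ^ p7.+1)%N.
have emm : mm = (2 * p)%N by rewrite /mm expnS.
pose cS : R := 2 ^+ mm * (gmom p * (V ^+ 2) ^+ p).
have cS0 : 0 <= cS.
  by rewrite mulr_ge0 ?exprn_ge0// mulr_ge0 ?exprn_ge0 ?sqr_ge0// ltW// gmom_gt0.
pose D : R := 4 + 4 * Cg / L.
have D0 : 0 < D by rewrite ltr_wpDr// divr_ge0 ?mulr_ge0// ltW.
pose fb : R := (pi / 2) ^+ mm * gmom p.
have fb0 : 0 <= fb.
  by rewrite mulr_ge0 ?(ltW (gmom_gt0 p))// exprn_ge0// divr_ge0// pi_ge0.
have [E80 [eE p80]] : exists e : R, e = 2 ^+ 80 /\ 0 <= e by exists (2 ^+ 80); rewrite exprn_ge0.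
pose C1 := cS * (L ^+ 2) ^+ mm * E80 ^+ 3 + cS + 2 / v * E80 ^+ 5 +
  3 * (fb * (4 * D) ^+ p * E80 ^+ 2).
pose C2 : R := (4 * 81 + 1) * (2 / v + 2).
have L2 : 0 < L ^+ 2 by exact: exprn_gt0.
have c1 : 0 <= cS * (L ^+ 2) ^+ mm * E80 ^+ 3.
  by apply: mulr_ge0; [apply: mulr_ge0 => //; apply: exprn_ge0; exact: ltW|exact: exprn_ge0].
have iv : 0 <= 2 / v by apply: divr_ge0 => //; exact: ltW.
have c2 : 0 <= 2 / v * E80 ^+ 5 by apply: mulr_ge0 => //; exact: exprn_ge0.
have c3 : 0 <= fb * (4 * D) ^+ p * E80 ^+ 2.
  apply: mulr_ge0; last exact: exprn_ge0.
  by apply: mulr_ge0 => //; apply: exprn_ge0; apply: mulr_ge0 => //; exact: ltW.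
have C10 : 0 <= C1 by rewrite /C1; lra.
have C20 : 0 <= C2 by rewrite /C2; lra.
exists (C1 + C2), (maxn n2 n3); split; first exact: addr_ge0.
move=> n; rewrite geq_max => /andP[hna hnb] n0.
have x1 := scale_ge1 n0; have x0 : 0 < x n by exact: lt_le_trans x1.
have xN := scale_lower n; have Nx := scale_upper n0.
have N0 : 0 < n%:R :> R by rewrite ltr0n.
have N1 : 1 <= n%:R :> R by rewrite ler1n.
have h0 := mesh_gt0 n0; have hK := cells_mesh n0.
have L01 : 0 <= L <= 1 by rewrite ltW.
have nS : n.-1.+1 = n by rewrite prednK.
have nL : n%:R * a + n.-1.+1%:R * L = n%:R * b by rewrite nS /L; ring.
(* With this bound on the second derivative, [mesh n ^+ 2] times it is exactly the threshold
   [x n ^- 9]. *)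
have M20 : 0 < x n / L ^+ 2 by exact: divr_gt0.
have Mk0 : 0 < n%:R ^+ 2 :> R by exact: exprn_gt0.
have V2 : 0 < V ^+ 2 by exact: exprn_gt0.
have [E1 [mE1 PE1 hE1]] : exists B, [/\ measurable B,
    (P B <= (n%:R * (cS / (x n / L ^+ 2) ^+ mm))%:E)%E &
    forall w, ~ B w -> forall y, n%:R * a <= y <= n%:R * b -> `|dX (X n) 2 y w| <= x n / L ^+ 2].
  have := @path_sup_long _ _ _ P 82 (A n) (X n) (oA n0) (smooth n0) (gX n0) 2 p7 n.-1
    (n%:R * a) L (V ^+ 2) (x n / L ^+ 2) isT L01.
  rewrite nL nS; apply=> //; first by move=> y; exact: inA.
  by move=> u y /andP[_ u3]; apply: hV => //; exact: leq_trans u3 _.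
have [E2 [mE2 PE2 hE2]] : exists B, [/\ measurable B,
    (P B <= (n%:R * (cS / (n%:R ^+ 2) ^+ mm))%:E)%E &
    forall w, ~ B w -> forall y, n%:R * a <= y <= n%:R * b -> `|dX (X n) 81 y w| <= n%:R ^+ 2].
  have := @path_sup_long _ _ _ P 82 (A n) (X n) (oA n0) (smooth n0) (gX n0) 81 p7 n.-1
    (n%:R * a) L (V ^+ 2) (n%:R ^+ 2) isT L01.
  rewrite nL nS; apply=> //; first by move=> y; exact: inA.
  by move=> u y /andP[_ u3]; apply: hV.
pose S := D * (n%:R ^+ 2 * x n ^- 30).
have S0 : 0 < S by rewrite mulr_gt0// mulr_gt0// ?invr_gt0 exprn_gt0.
have gridin i : (i <= cells n)%N -> n%:R * a <= grid (n%:R * a) (mesh n) i <= n%:R * b.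
  by move=> ic; rewrite -hK; apply: grid_in.
have XS : \sum_(i < (cells n).+1) \sum_(j < (cells n).+1)
    `|Ex P (fun w => X n (grid (n%:R * a) (mesh n) i) w * X n (grid (n%:R * a) (mesh n) j) w)| <= S.
  have lam0 : 0 < x n ^- 40 by rewrite invr_gt0 exprn_gt0.
  have hG : \sum_(i < (cells n).+1) g (i%:R * mesh n) ^+ 2 <= Cg / mesh n.
    by apply: g_sum; rewrite h0 hn3.
  have hC i j : (i <= cells n)%N -> (j <= cells n)%N ->
      `|Ex P (fun w => X n (grid (n%:R * a) (mesh n) i) w * X n (grid (n%:R * a) (mesh n) j) w)| <=
      g ((i%:R - j%:R) * mesh n).
    move=> ic jc; have := cov_le n0 (gridin i ic) (gridin j jc).
    by rewrite (_ : grid _ _ i - grid _ _ j = (i%:R - j%:R) * mesh n)// /grid; ring.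
  apply: (le_trans (cov_double_sum g_even lam0 hC hG)).
  apply: cov_sum_estimate => //; rewrite ler0n/= -natr1 cellsE.
  have : 1 <= n%:R * x n ^+ 5 by rewrite mulr_ege1// exprn_ege1.
  lra.
have c0 : 0 < x n ^+ 9 by exact: exprn_gt0.
have tau0 : 0 < x n ^- 6 by rewrite invr_gt0 exprn_gt0.
have delta0 : 0 < n%:R / x n by exact: divr_gt0.
have [|B [mB PB hB]] := @zero_count_deviation _ _ _ P 82 (A n) (X n) (oA n0) (smooth n0)
  (gX n0) (lX n0) (n%:R * a) (mesh n) (cells n) h0 (fun y hy => inA n0 (eq_ind _ (fun z => n%:R * a <= y <= z) hy _ hK))
  v S (x n ^+ 9) (x n ^- 6) (n%:R / x n) v0
  (fun y hy => eq_ind_r (fun z => z <= _) (hn2 n y hna n0 (eq_ind _ (fun z => n%:R * a <= y <= z) hy _ hK)) v2)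
  c0 tau0 delta0 S0 XS 81 p7 (x n / L ^+ 2) (n%:R ^+ 2) (E1 `|` E2) isT (measurableU _ _ mE1 mE2)
  (ltW Mk0)
  (fun w nE y hy => hE1 w (fun h => nE (or_introl h)) y (eq_ind _ (fun z => n%:R * a <= y <= z) hy _ hK))
  (fun w nE y hy => hE2 w (fun h => nE (or_intror h)) y (eq_ind _ (fun z => n%:R * a <= y <= z) hy _ hK)).
  rewrite /mesh le_eqVlt; apply/orP; left; apply/eqP.
  have -> : x n ^+ 9 = x n ^+ 4 * x n ^+ 5 by rewrite -exprD.
  have -> : (L / x n ^+ 5) ^+ 2 * (x n / L ^+ 2) = x n / (x n ^+ 5 * x n ^+ 5).
    by move: (x n ^+ 5) (exprn_gt0 5 x0) => y y0; field; rewrite !gt_eqF.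
  have e5 : x n ^+ 5 = x n ^+ 4 * x n by rewrite exprSr.
  rewrite {1}e5; move: (x n ^+ 4) (exprn_gt0 4 x0) (x n ^+ 5) (exprn_gt0 5 x0) => y y0 z z0.
  by field; rewrite !gt_eqF.
exists B; split => //.
- apply: (le_trans PB).
  apply: (@le_trans _ _ ((n%:R * (cS / (x n / L ^+ 2) ^+ mm))%:E + (n%:R * (cS / (n%:R ^+ 2) ^+ mm))%:E +
    (2 / v * E80 ^+ 5 * n%:R ^- 2)%:E + (3 * (fb * (4 * D) ^+ p * E80 ^+ 2 * n%:R ^- 2))%:E)%E).
    apply: leeD; last first.
      rewrite lee_fin ler_pM2l//.
      have := @fluctuation_estimate R (x n) n%:R x1 xN Nx fb D p fb0 (ltW D0) _.
      rewrite -emm -eE; apply; exact: leq_trans hp7.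
    apply: leeD; first by apply: (le_trans (probU_le P mE1 mE2)); exact: leeD.
    rewrite lee_fin cellsE; rewrite eE; apply: small_value_estimate => //.
    by rewrite L_gt0.
  rewrite -!EFinD lee_fin.
  have mm240 : (240 <= mm)%N by rewrite emm (@leq_trans (2 * 120)%N)// leq_mul2l.
  have t1 := sup_estimate x1 xN Nx cS0 L2 mm240; rewrite -eE in t1.
  have t2 := @sup_estimate_high R (x n) n%:R x1 xN cS mm cS0 (leq_trans _ mm240).
  have NN : 0 <= n%:R ^- 2 :> R by rewrite invr_ge0 sqr_ge0.
  have t3 : 0 <= C2 * n%:R ^- 2 by rewrite mulr_ge0.
  move: t1 t2 NN t3 C20; rewrite /C1.
  move: (n%:R ^- 2) (2 / v * E80 ^+ 5) (fb * (4 * D) ^+ p * E80 ^+ 2) (cS * (L ^+ 2) ^+ mm * E80 ^+ 3)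
    (n%:R * (cS / (x n / L ^+ 2) ^+ mm)) (n%:R * (cS / (n%:R ^+ 2) ^+ mm)).
  move=> z y1 y2 y3 y4 y5 t1 /(_ isT) t2 t3 t4 t5; lra.
- move=> w nB; have [s es bs] := hB w nB.
  exists s; first by move: es; rewrite hK.
  apply: (le_trans bs); rewrite cellsE error_estimate// ler_pM2l// ler_pM2r ?invr_gt0//.
  by rewrite /C2 lerDr.
Qed.

Definition step_corr n y : R := Ex P (fun w => X n y w * X n (y + mesh n) w) /
  Num.sqrt (Ex P (fun w => X n y w ^+ 2) * Ex P (fun w => X n (y + mesh n) w ^+ 2)).

Lemma cvg0_eps (u : nat -> R) :
  (forall e, 0 < e -> exists n0, forall k, (n0 <= k)%N -> `|u k| <= e) -> u @ \oo --> (0 : R).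
Proof.
move=> h; apply/cvgrPdist_le => e e0; have [n0 hn] := h e e0.
by exists n0 => // k /= hk; rewrite sub0r normrN; exact: hn.
Qed.

(** Uniformity in [y] is obtained by contradiction: counterexamples with growing [n] form a
    sequence, to which [correlation_asymptotic] applies. *)
Lemma correlation_uniform e : 0 < e -> exists n1, forall n y, (n1 <= n)%N -> (0 < n)%N ->
  n%:R * a <= y -> y + mesh n <= n%:R * b ->
  `|acos (step_corr n y) / mesh n - Num.sqrt (l2 / l0)| <= e.
Proof.
move=> e0; apply: contrapT => hno.
have [n2 hn2] := variance_lower.
have ml0 : 0 < m * l0 / 2 by rewrite divr_gt0// mulr_gt0.
have bad k : exists z : nat * R, [/\ (k <= z.1)%N, (n2 <= z.1)%N, (0 < z.1)%N,
    z.1%:R * a <= z.2 /\ z.2 + mesh z.1 <= z.1%:R * b &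
    e < `|acos (step_corr z.1 z.2) / mesh z.1 - Num.sqrt (l2 / l0)|].
  apply: contrapT => h; apply: hno; exists (maxn k n2) => n y.
  rewrite geq_max => /andP[h1 h2] h3 h4 h5; rewrite leNgt; apply/negP => h6.
  by apply: h; exists (n, y).
have [z hz] := choice bad.
pose nn k := (z k).1; pose yy k := (z k).2; pose hh k := mesh (nn k).
have nk k : (k <= nn k)%N by have [] := hz k.
have nn0 k : (0 < nn k)%N by have [] := hz k.
have nn2 k : (n2 <= nn k)%N by have [] := hz k.
have ylo k : (nn k)%:R * a <= yy k by have [_ _ _ []] := hz k.
have yhi k : yy k + hh k <= (nn k)%:R * b by have [_ _ _ []] := hz k.
have h0 k : 0 < hh k by exact: mesh_gt0.
have yin k t : yy k <= t <= yy k + hh k -> (nn k)%:R * a <= t <= (nn k)%:R * b.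
  by move=> /andP[t1 t2]; rewrite (le_trans (ylo k))// (le_trans t2).
have y1 k : yy k <= yy k <= yy k + hh k by rewrite lexx lerDl ltW.
have y2 k : yy k <= yy k + hh k <= yy k + hh k by rewrite lexx lerDl ltW.
pose aa k := Ex P (fun w => X (nn k) (yy k) w ^+ 2).
pose DD k w := (X (nn k) (yy k + hh k) w - X (nn k) (yy k) w) / hh k.
pose pp k := Ex P (fun w => X (nn k) (yy k) w * DD k w).
pose dd k := Ex P (fun w => DD k w ^+ 2).
pose ww k := psi (yy k / (nn k)%:R).
have res k := rescale_in (nn0 k) (yin k _ (y1 k)).
have inAk k t : yy k <= t <= yy k + hh k -> A (nn k) t.
  by move=> /yin; exact: inA.
have hVk k u t : (u <= 2)%N -> yy k <= t <= yy k + hh k ->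
    Ex P (fun w => dX (X (nn k)) u t w ^+ 2) <= V ^+ 2.
  by move=> u2 /yin; apply: hV => //; exact: leq_trans u2 _.
have V0 := ltW V_gt0.
have slope k := @Ex_slope_sqr _ _ _ P 82 (A (nn k)) (X (nn k)) (oA (nn0 k)) (smooth (nn0 k))
  (gX (nn0 k)) (yy k) (hh k) V isT (h0 k) V0 (inAk k) (hVk k).
have cross k := @Ex_slope_cross _ _ _ P 82 (A (nn k)) (X (nn k)) (oA (nn0 k)) (smooth (nn0 k))
  (gX (nn0 k)) (yy k) (hh k) V isT (h0 k) V0 (inAk k) (hVk k).
have stepc k := @Ex_step_cov _ _ _ P 82 (A (nn k)) (X (nn k)) (oA (nn0 k)) (smooth (nn0 k))
  (gX (nn0 k)) (yy k) (hh k) (h0 k) (inAk k).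
have stepv k := @Ex_step_var _ _ _ P 82 (A (nn k)) (X (nn k)) (oA (nn0 k)) (smooth (nn0 k))
  (gX (nn0 k)) (yy k) (hh k) (h0 k) (inAk k).
have hc : hh @ \oo --> (0 : R).
  apply: cvg0_eps => e' /mesh_small [n0 hn]; exists n0 => k hk.
  by rewrite (ger0_norm (ltW (h0 k))); apply: hn => //; exact: leq_trans (nk k).
have mom e' : 0 < e' -> exists n0, forall k, (n0 <= k)%N ->
    [/\ `|aa k - ww k * l0| <= e',
        `|Ex P (fun w => X (nn k) (yy k) w * dX (X (nn k)) 1 (yy k) w)| <= e' &
        `|Ex P (fun w => dX (X (nn k)) 1 (yy k) w ^+ 2) - ww k * l2| <= e'].
  move=> /moments [n0 hn]; exists n0 => k hk; have [r1 r2] := res k.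
  by have := hn (nn k) _ (leq_trans hk (nk k)) (nn0 k) r1; rewrite r2.
have small e' : 0 < e' -> exists n0, forall k, (n0 <= k)%N -> V ^+ 2 * (hh k ^+ 2 + 2 * hh k) <= e'.
  move=> e'0.
  have h1 : (fun k => V ^+ 2 * (hh k ^+ 2 + 2 * hh k)) @ \oo --> (V ^+ 2 * (0 ^+ 2 + 2 * 0) : R).
    by apply: cvgMr; apply: cvgD; [exact: (cvgM hc hc)|exact: cvgMr].
  move: h1; rewrite expr0n/= mulr0 addr0 mulr0 => /cvgrPdist_le /(_ _ e'0) [n0 _ hn].
  by exists n0 => k hk; have := hn k hk; rewrite sub0r normrN; apply: le_trans; exact: ler_norm.
have two e' : 0 < e' -> 0 < e' / 2 by move=> ?; rewrite divr_gt0.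
have V2h k : V ^+ 2 * hh k <= V ^+ 2 * (hh k ^+ 2 + 2 * hh k).
  apply: ler_wpM2l; first exact: sqr_ge0.
  by have := sqr_ge0 (hh k); have := h0 k; lra.
have ev k : Ex P (fun w => X (nn k) (yy k + hh k) w ^+ 2) = aa k + 2 * (hh k * pp k) + hh k ^+ 2 * dd k.
  exact: stepv.
have ec k : Ex P (fun w => X (nn k) (yy k) w * X (nn k) (yy k + hh k) w) = aa k + hh k * pp k.
  exact: stepc.
have a0 k : 0 < aa k.
  by apply: (lt_le_trans ml0); apply: hn2 => //; apply: yin.
have v0 k : 0 < Ex P (fun w => X (nn k) (yy k + hh k) w ^+ 2).
  by apply: (lt_le_trans ml0); apply: hn2 => //; apply: yin.
have sq k t : yy k <= t <= yy k + hh k -> sqi P (X (nn k) t).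
  move=> ht; have [+ _ _] := gl_dX1 (oA (nn0 k)) (smooth (nn0 k)) (gX (nn0 k)) (leq0n 82) (inAk k t ht).
  by [].
have := @correlation_asymptotic R aa pp dd ww hh m M l0 l2 m_gt0 _ l0_gt0 h0 hc _ _ _ a0 _ _.
move=> /(_ _ _ _ _ _ _)/cvgrPdist_le h.
have {}h : \forall k \near \oo, `|Num.sqrt (l2 / l0) - acos (step_corr (nn k) (yy k)) / hh k| <= e.
  apply: (@filterS _ _ _ (fun k => `|Num.sqrt (l2 / l0) - acos ((aa k + hh k * pp k) /
    Num.sqrt (aa k * (aa k + 2 * (hh k * pp k) + hh k ^+ 2 * dd k))) / hh k| <= e)).
    by move=> k; rewrite /step_corr -/(hh k) ev ec.
  apply: h => //.
  - by move=> k; apply: psi_itv; exact: (res k).1.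
  - by apply: cvg0_eps => e' /mom [n0 hn]; exists n0 => k /hn [].
  - apply: cvg0_eps => e' /two e2; have [n0 hn] := mom _ e2; have [n1 hn1] := small _ e2.
    exists (maxn n0 n1) => k; rewrite geq_max => /andP[/hn[_ k1 _] /hn1 k2].
    rewrite -[pp k](subrK (Ex P (fun w => X (nn k) (yy k) w * dX (X (nn k)) 1 (yy k) w))).
    apply: (le_trans (ler_normD _ _)); rewrite [leRHS](splitr e'); apply: lerD => //.
    by apply: (le_trans (cross k)); apply: (le_trans (V2h k)).
  - apply: cvg0_eps => e' /two e2; have [n0 hn] := mom _ e2; have [n1 hn1] := small _ e2.
    exists (maxn n0 n1) => k; rewrite geq_max => /andP[/hn[_ _ k1] /hn1 k2].
    rewrite -[dd k](subrK (Ex P (fun w => dX (X (nn k)) 1 (yy k) w ^+ 2))) -addrA.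
    apply: (le_trans (ler_normD _ _)); rewrite [leRHS](splitr e'); apply: lerD => //.
    exact: (le_trans (slope k)).
  - by move=> k; rewrite -ev.
  - move=> k; rewrite -ev -ec; apply: corr_itv; [exact: (sq k _ (y1 k))|exact: (sq k _ (y2 k))|exact: a0|exact: v0].
have [k0 _ hk0] := h; have := hk0 k0 (leqnn k0); rewrite /= distrC leNgt => /negP; apply.
by have [] := hz k0.
Qed.

Theorem zero_count_lln : \forall w \ae P, forall e : R, 0 < e ->
  exists n0, forall n, (n0 <= n)%N -> (0 < n)%N ->
  exists2 s, enumerates s [set t | n%:R * a <= t < n%:R * b /\ X n t w = 0] &
    `|(size s)%:R / n%:R - Num.sqrt (l2 / l0) / pi * (b - a)| <= e.
Proof.
have [C [n1 [C0 hC]]] := zero_count_event.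
have Bex n : exists B : set T, [/\ measurable B,
    (n1 <= n)%N -> (0 < n)%N -> (P B <= (C * n%:R ^- 2)%:E)%E &
    (n1 <= n)%N -> (0 < n)%N -> forall w, ~ B w ->
    exists2 s, enumerates s [set t | n%:R * a <= t < n%:R * b /\ X n t w = 0] &
      `|(size s)%:R - \sum_(j < cells n)
          acos (correlation P (X n) (n%:R * a) (mesh n) j) / pi| <= n%:R * (C / x n)].
  have [h|h] := boolP ((n1 <= n)%N && (0 < n)%N).
    by have /andP[h1 h2] := h; have [B [mB PB hB]] := hC n h1 h2; exists B.
  by exists set0; split => // h1 h2; move: h; rewrite h1 h2.
have [B hB] := choice Bex.
have := @borel_cantelli_inv_sqr _ _ _ P B C n1 C0 (fun n => let: And3 h _ _ := hB n in h)
  (fun n => let: And3 _ h _ := hB n in h).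
apply: filterS => w [n2 hn2] e e0.
have e20 : 0 < e / 2 by rewrite divr_gt0.
have [n3 hn3] := scale_cvg C0 e20; have [n4 hn4] := correlation_uniform e0.
exists (maxn (maxn n1 n2) (maxn n3 n4)) => n; rewrite !geq_max => /andP[/andP[m1 m2] /andP[m3 m4]] n0.
have [_ _ /(_ m1 n0 w (hn2 n m2))[s es bs]] := hB n.
exists s => //.
have N0 : 0 < n%:R :> R by rewrite ltr0n.
have h0 := mesh_gt0 n0; have hK := cells_mesh n0.
have pi2 : 2 <= (pi : R) by exact: pi_ge2.
have pi0 : 0 < (pi : R) by exact: pi_gt0.
set g0 := Num.sqrt (l2 / l0) in hn4 *.
set S := \sum_(j < _) _ in bs.
have KL : (cells n)%:R * mesh n = n%:R * (b - a) by move: hK; rewrite mulrBr; lra.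
(* The accuracy [e] of each angle becomes at most [e / 2] after division by [pi >= 2], the cells
   having total length [n * (b - a) <= n]. *)
have hS : `|S - n%:R * (b - a) * g0 / pi| <= n%:R * (e / 2).
  have -> : n%:R * (b - a) * g0 / pi = \sum_(j < cells n) (mesh n * g0 / pi).
    rewrite sumr_const card_ord -[RHS]mulr_natl -KL.
    by move: (mesh n) (pi^-1 : R) => y z; ring.
  rewrite -sumrB; apply: (le_trans (ler_norm_sum _ _ _)).
  apply: (@le_trans _ _ (\sum_(j < cells n) (mesh n * e / pi))); last first.
    rewrite sumr_const card_ord -[leLHS]mulr_natl.
    have -> : (cells n)%:R * (mesh n * e / pi) = n%:R * ((b - a) * e / pi).
      transitivity ((cells n)%:R * mesh n * (e / pi)); last first.
        by rewrite KL; move: (pi^-1 : R) => z; ring.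
      by move: (mesh n) (pi^-1 : R) => y z; ring.
    rewrite ler_pM2l// ler_pdivrMr//.
    have h2 : (b - a) * e <= e by rewrite ler_piMl// ltW.
    have h3 : e / 2 * 2 <= e / 2 * pi by rewrite ler_pM2l.
    by apply: (le_trans h2); move: h3; rewrite divfK.
  apply: ler_sum => j _.
  have jK := ltn_ord j.
  have gj := grid_in (n%:R * a) h0 (ltnW jK); have gj1 := grid_in (n%:R * a) h0 jK.
  have eg : grid (n%:R * a) (mesh n) j.+1 = grid (n%:R * a) (mesh n) j + mesh n.
    by rewrite /grid -natr1; ring.
  rewrite hK in gj gj1.
  have hj := hn4 n (grid (n%:R * a) (mesh n) j) m4 n0 _ _.
  have {}hj : `|acos (step_corr n (grid (n%:R * a) (mesh n) j)) / mesh n - g0| <= e.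
    by apply: hj; [by have /andP[] := gj|by rewrite -eg; have /andP[] := gj1].
  have -> : correlation P (X n) (n%:R * a) (mesh n) j = step_corr n (grid (n%:R * a) (mesh n) j).
    by rewrite /correlation /step_corr eg.
  move: hj; set ac := acos _; move: ac (mesh n) h0 (pi : R) pi0 => ac y y0 p p0 hj.
  have -> : ac / p - y * g0 / p = y * (ac / y - g0) / p by field; rewrite !gt_eqF.
  rewrite normrM normfV normrM (gtr0_norm p0) (gtr0_norm y0) ler_pM2r ?invr_gt0//.
  by rewrite ler_pM2l.
rewrite -(ler_pM2l N0) -{1}(gtr0_norm N0) -normrM.
have -> : n%:R * ((size s)%:R / n%:R - g0 / pi * (b - a)) =
    ((size s)%:R - S) + (S - n%:R * (b - a) * g0 / pi).
  by move: (pi : R) pi0 => p p0; field; rewrite !gt_eqF.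
apply: (le_trans (ler_normD _ _)).
rewrite [leRHS](_ : _ = n%:R * (e / 2) + n%:R * (e / 2)); last by field.
apply: lerD => //.
by apply: (le_trans bs); rewrite ler_pM2l//; exact: hn3.
Qed.

End zero_count_lln.

(** * Modification on null events, and decay of the covariance *)

Section null_modifications.
Context {R : realType} {d : measure_display} {T : measurableType d}.
Variables (P : probability T R) (N : set T).
Hypothesis mN : measurable N.
Hypothesis PN : P N = 0%E.

Import HBNNSimple.

(** The integral of a nonnegative function is a supremum over simple functions below it; restricting
    such a function to the complement of [N] keeps its integral and puts it below [g]. *)
Let integral_le_off_null (f g : T -> \bar R) : (forall w, (0 <= f w)%E) -> (forall w, (0 <= g w)%E) ->
  (forall w, ~ N w -> f w = g w) -> (\int[P]_w f w <= \int[P]_w g w)%E.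
Proof.
move=> f0 g0 fg; rewrite !ge0_integralTE//.
apply: ge_ereal_sup => _ [h hf <-].
have mC : measurable (~` N) by exact: measurableC.
apply: (@le_trans _ _ (sintegral P (proj_nnsfun h mC))).
  rewrite -!integralT_nnsfun le_eqVlt; apply/orP; left; apply/eqP.
  apply: ae_eq_integral => //.
  - by apply/measurable_EFinP.
  - by apply/measurable_EFinP.
  - exists N; split => // w /=; apply: contra_notP => nN _.
    by rewrite mindicE mem_set ?mulr1.
apply: ereal_sup_ubound; exists (proj_nnsfun h mC) => // w /=; rewrite mindicE.
have [wN|wN] := pselect (N w); last by rewrite mem_set// mulr1 -fg.
by rewrite memNset ?mulr0// => /(_ wN).
Qed.

(* No measurability is assumed, since the derivatives of the original process
   need not be measurable. *)
Lemma integral_eq_off_null (f g : T -> \bar R) : (forall w, ~ N w -> f w = g w) ->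
  (\int[P]_w f w = \int[P]_w g w)%E.
Proof.
move=> fg.
have h (u v : T -> \bar R) : (forall w, (0 <= u w)%E) -> (forall w, (0 <= v w)%E) ->
    (forall w, ~ N w -> u w = v w) -> (\int[P]_w u w = \int[P]_w v w)%E.
  move=> u0 v0 uv; apply/eqP; rewrite eq_le; apply/andP; split; apply: integral_le_off_null => //.
  by move=> w /uv.
rewrite [LHS]integralE [RHS]integralE; congr (_ - _)%E; apply: h => // w /fg e.
- by rewrite !funeposE e.
- by rewrite !funenegE e.
Qed.

(** Zeroing the paths on the null event [N] makes every path smooth, not just almost every one, and
    preserves the laws. *)
Definition off_null (f : R -> T -> R) (s : R) (w : T) : R := \1_(~` N) w * f s w.

Lemma off_nullE (f : R -> T -> R) w : ~ N w -> (off_null f) ^~ w = f ^~ w.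
Proof. by move=> nN; apply/funext => s; rewrite /off_null indicE mem_set// mul1r. Qed.

Lemma off_null0 (f : R -> T -> R) w : N w -> (off_null f) ^~ w = fun=> 0.
Proof.
by move=> Nw; apply/funext => s; rewrite /off_null indicE memNset ?mul0r// => /(_ Nw).
Qed.

Lemma derive1n_cst0 (u : nat) : derive1n u (fun _ : R => 0 : R) = fun=> 0.
Proof.
elim: u => [//|u IH]; rewrite derive1nS IH; apply/funext => s.
by rewrite derive1_cst.
Qed.

Lemma off_null_of_class (q : nat) (A : set R) (f : R -> T -> R) :
  (forall w, ~ N w -> of_class q A (f ^~ w)) -> forall w, of_class q A ((off_null f) ^~ w).
Proof.
move=> fq w; have [Nw|nNw] := pselect (N w); last by rewrite off_nullE//; exact: fq.
rewrite off_null0//; split => [u _|] s _; rewrite derive1n_cst0.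
  exact: derivable_cst.
exact: cvg_cst.
Qed.

Lemma off_null_law (Y : T -> R) : measurable_fun setT Y -> centered_gaussian_law P Y ->
  measurable_fun setT (fun w => \1_(~` N) w * Y w) /\
  centered_gaussian_law P (fun w => \1_(~` N) w * Y w).
Proof.
move=> mY lY.
have mZ : measurable_fun setT (fun w => \1_(~` N) w * Y w).
  by apply: measurable_funM => //; apply: measurable_indic; exact: measurableC.
have eP (B : set R) : measurable B -> P ((fun w => \1_(~` N) w * Y w) @^-1` B) = P (Y @^-1` B).
  move=> mB.
  have PI (C : set T) : measurable C -> P C = (\int[P]_w (\1_C w)%:E)%E.
    by move=> mC; rewrite integral_indic// setIT.
  have mpre (f : T -> R) : measurable_fun setT f -> measurable (f @^-1` B).
    by move=> mf; rewrite -[X in measurable X]setTI; exact: mf.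
  rewrite !PI; [|exact: mpre|exact: mpre].
  apply: integral_eq_off_null => w nN; rewrite !indicE; congr ((_ : bool)%:R%:E).
  by apply/idP/idP; rewrite !inE /= indicE mem_set// mul1r.
split=> //; case: lY => [l|[s s0 l]]; [left|right; exists s => //] => B mB; by rewrite eP// l.
Qed.

End null_modifications.

Section distance_and_decay.
Context {R : realType}.

(** A nonzero multiple of the period has size at least [p], so adding it to a difference of size at
    most [p / 2] cannot shorten it. *)
Lemma quotient_distE (p s t : R) : 0 <= p -> (p = 0 \/ `|s - t| <= p / 2) ->
  quotient_dist p s t = `|s - t|.
Proof.
move=> p0 st; rewrite /quotient_dist; set S := [set _ | k in _].
have mem : S `|s - t| by exists 0 => //; rewrite mul0r addr0.
have lb : lbound S `|s - t|.
  move=> _ [k _ <-]; case: st => [->|st]; first by rewrite mulr0 addr0.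
  have [->|k0] := eqVneq k 0; first by rewrite mul0r addr0.
  have k1 : 1 <= `|k%:~R : R| by rewrite -intr_norm ler1z -gtz0_ge1 normr_gt0.
  have kp : p <= `|k%:~R * p| by rewrite normrM (ger0_norm p0) ler_peMl.
  have := ler_normB (s - t + k%:~R * p) (s - t); rewrite [X in `|X|](_ : _ = k%:~R * p); last by ring.
  lra.
apply/eqP; rewrite eq_le; apply/andP; split.
  by apply: ge_inf => //; exists `|s - t|.
by apply: lb_le_inf => //; exists `|s - t|.
Qed.

(** For [h <= omega] the value [g (i * h)] is below [local_sup g omega] on the whole cell starting
    at [i * h], so the sum times [h] is at most the integral of its square, uniformly in [h] and
    [K]. *)
Lemma decay_sum (g : R -> R) (omega : R) : 0 < omega ->
  (forall x, 0 <= g x) -> (exists M, forall x, `|g x| <= M) ->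
  local_sup g omega \in Lfun (@lebesgue_measure R) 2%:E ->
  exists Cg : R, 0 <= Cg /\
    forall h K, 0 < h <= omega -> \sum_(i < K) g (i%:R * h) ^+ 2 <= Cg / h.
Proof.
move=> o0 g0 [M gM] gL.
pose F x := local_sup g omega x ^+ 2.
have /integrableP[mF iF] : lebesgue_measure.-integrable setT (EFin \o F) by exact: Lfun2_integrable_sqr.
have F0 x : 0 <= F x by exact: sqr_ge0.
have IF : (\int[lebesgue_measure]_x (F x)%:E < +oo)%E.
  apply: le_lt_trans iF; rewrite le_eqVlt; apply/orP; left; apply/eqP.
  by apply: eq_integral => x _; rewrite /= ger0_norm.
have I0 : (0 <= \int[lebesgue_measure]_x (F x)%:E)%E by apply: integral_ge0 => x _; rewrite lee_fin.
have If : (\int[lebesgue_measure]_x (F x)%:E)%E \is a fin_num by rewrite ge0_fin_numE.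
exists (fine (\int[lebesgue_measure]_x (F x)%:E)); split; first exact: fine_ge0.
move=> h K /andP[h0 ho]; rewrite ler_pdivlMr// -lee_fin fineK//.
have mFD (D : set R) : measurable D -> measurable_fun D (EFin \o F).
  by move=> mD; apply: measurable_funS mF.
pose J (i : nat) : set R := `[(i%:R * h), (i.+1%:R * h)[%classic.
have mJ i : measurable (J i) by exact: measurable_itv.
have piece (i : nat) : ((h * g (i%:R * h) ^+ 2)%:E <=
    \int[lebesgue_measure]_(x in J i) (F x)%:E)%E.
  have -> : (h * g (i%:R * h) ^+ 2)%:E =
      (\int[lebesgue_measure]_(x in J i) (g (i%:R * h) ^+ 2)%:E)%E.
    rewrite /J integral_cst//= lebesgue_measure_itv/= lte_fin ltr_pM2r// ltr_nat ltnSn.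
    by rewrite -EFinB -EFinM; congr (_%:E); rewrite -natr1; ring.
  apply: ge0_le_integral.
  - exact: measurable_itv.
  - by move=> x _; rewrite lee_fin sqr_ge0.
  - exact: measurable_cst.
  - exact: mFD.
  - move=> x; rewrite /J /= in_itv/= -natr1 mulrDl mul1r => /andP[x1 x2].
    rewrite lee_fin; apply: lerXn2r; rewrite ?nnegrE//.
      apply: (le_trans (g0 x)); apply: ub_le_sup; last by exists 0; rewrite ?addr0//= normr0 ltW.
      by exists M => _ [u _ <-]; apply: le_trans (gM (x + u)); exact: ler_norm.
    apply: ub_le_sup.
      by exists M => _ [u _ <-]; apply: le_trans (gM (x + u)); exact: ler_norm.
    exists (i%:R * h - x); last by congr g; ring.
    by rewrite /= ler_norml; apply/andP; split; lra.
pose J0 (k : nat) : set R := `[0, (k%:R * h)[%classic.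
have mJ0 k : measurable (J0 k) by exact: measurable_itv.
apply: (@le_trans _ _ (\int[lebesgue_measure]_(x in J0 K) (F x)%:E)%E); last first.
  apply: ge0_subset_integral.
  - exact: measurable_itv.
  - exact: measurableT.
  - exact: mF.
  - by move=> x _; rewrite lee_fin.
  - by [].
elim: K => [|K IH]; first by rewrite big_ord0 mul0r; apply: integral_ge0 => x _; rewrite lee_fin.
have Kh : K%:R * h <= K.+1%:R * h by rewrite ler_pM2r// ler_nat.
have K0 : 0 <= K%:R * h by rewrite mulr_ge0// ltW.
have -> : J0 K.+1 = J0 K `|` J K.
  apply/seteqP; split => x; rewrite /J0 /J /= !in_itv/=.
    by move=> /andP[x1 x2]; rewrite x1 x2/= andbT; have [?|?] := ltP x (K%:R * h); [left|right].
  by move=> [/andP[-> x2]|/andP[x1 ->]]; rewrite ?(lt_le_trans x2)// (le_trans K0).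
rewrite ge0_integral_setU.
- rewrite big_ord_recr/= mulrDl EFinD; apply: leeD => //.
  by rewrite mulrC; exact: piece.
- exact: measurable_itv.
- exact: measurable_itv.
- by apply: mFD; apply: measurableU; exact: measurable_itv.
- by move=> x _; rewrite lee_fin.
- apply/disj_setPS => x []; rewrite /J0 /J /= !in_itv/= => /andP[_ h1] /andP[h2 _].
  by move: (lt_le_trans h1 h2); rewrite ltxx.
Qed.

End distance_and_decay.

(** * Stationary processes *)

Section stationary_covariances.
Context {R : realType} {d : measure_display} {T : measurableType d}.
Variable P : probability T R.

Lemma Ex_sqr_law (Y Z : T -> R) : measurable_fun setT Y -> measurable_fun setT Z ->
  (forall B : set R, measurable B -> P (Y @^-1` B) = P (Z @^-1` B)) ->
  Ex P (fun w => Y w ^+ 2) = Ex P (fun w => Z w ^+ 2).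
Proof.
move=> mY mZ law; rewrite /Ex /Rintegral; congr fine.
pose Y' : {mfun T >-> measurableTypeR R} := HB.pack Y (isMeasurableFun.Build _ _ T (measurableTypeR R) Y mY).
pose Z' : {mfun T >-> measurableTypeR R} := HB.pack Z (isMeasurableFun.Build _ _ T (measurableTypeR R) Z mZ).
have E (W : {mfun T >-> measurableTypeR R}) : (\int[P]_w (W w ^+ 2)%:E)%E =
    (\int[distribution P W]_x (x ^+ 2)%:E)%E.
  rewrite (@ge0_integral_pushforward _ _ _ _ _ W (measurable_funPT W) P setT (fun x => (x ^+ 2)%:E))//.
    by apply/measurable_EFinP; exact: measurable_funX.
  by move=> y _; rewrite lee_fin sqr_ge0.
rewrite [LHS](E Y') [RHS](E Z'); apply: eq_measure_integral => A mA _; exact: law.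
Qed.

(** Equality of laws is used for the sums [f u + f v] only; the covariance is recovered from their
    second moments by polarization. *)
Lemma stationary_cov (f : R -> T -> R) : stationary P f -> (forall s, sqi P (f s)) ->
  forall h s t, Ex P (fun w => f (s + h) w * f (t + h) w) = Ex P (fun w => f s w * f t w).
Proof.
move=> st sf h s t.
have mf s' : measurable_fun setT (f s') by have [] := sf s'.
have sq (u v : R) : Ex P (fun w => (f (u + h) w + f (v + h) w) ^+ 2) =
    Ex P (fun w => (f u w + f v w) ^+ 2).
  apply: Ex_sqr_law; [exact: measurable_funD|exact: measurable_funD|].
  move=> B mB; pose B2 := [set z : 2.-tuple R | B (tnth z ord0 + tnth z (lift ord0 ord0))].
  have mB2 : measurable B2.
    have mp : measurable_fun [set: 2.-tuple R] (fun z => tnth z ord0 + tnth z (lift ord0 ord0)).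
      by apply: measurable_funD; exact: measurable_tnth.
    by have := mp measurableT B mB; rewrite setTI.
  have := st h 2 [tuple u; v] B2 mB2.
  have e (k : R) : [set w | B2 (map_tuple (fun t => f (t + k) w) [tuple u; v])] =
      (fun w => f (u + k) w + f (v + k) w) @^-1` B.
    by apply/funext => w; rewrite /B2 /preimage /= !tnth_map !(tnth_nth 0).
  have e0 : [set w | B2 (map_tuple (fun t => f t w) [tuple u; v])] =
      (fun w => f u w + f v w) @^-1` B.
    by apply/funext => w; rewrite /B2 /preimage /= !tnth_map !(tnth_nth 0).
  by rewrite e e0.
have pol (u v : R) : Ex P (fun w => f u w * f v w) = (Ex P (fun w => (f u w + f v w) ^+ 2)
    - Ex P (fun w => (f u w + f u w) ^+ 2) / 4 - Ex P (fun w => (f v w + f v w) ^+ 2) / 4) / 2.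
  have [_ i1] := sqiD (sf u) (sf v); have [_ iu] := sf u; have [_ iv] := sf v.
  have iM := sqi_itgM (sf u) (sf v).
  have E4 x : Ex P (fun w => (f x w + f x w) ^+ 2) = 4 * Ex P (fun w => f x w ^+ 2).
    by have [_ ix] := sf x; rewrite -ExZ//; apply: eq_Ex => w; ring.
  have -> : Ex P (fun w => (f u w + f v w) ^+ 2) = Ex P (fun w => f u w ^+ 2) +
      2 * Ex P (fun w => f u w * f v w) + Ex P (fun w => f v w ^+ 2).
    rewrite -ExZ// -ExD//; last exact: itgZ.
    rewrite -ExD//; last by apply: itgD => //; exact: itgZ.
    by apply: eq_Ex => w; ring.
  by rewrite !E4; field.
by rewrite !pol !sq.
Qed.

Lemma covariance_derivE (f : R -> T -> R) (N : set T) (u v : nat) (s t : R) :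
  measurable N -> P N = 0%E ->
  covariance_deriv P f u v s t =
  Ex P (fun w => dX (off_null N f) u s w * dX (off_null N f) v t w).
Proof.
move=> mN PN; rewrite /covariance_deriv /Ex /Rintegral expectation.unlock; congr fine.
apply: (integral_eq_off_null mN PN) => w nN.
by rewrite /dX /derivative_process !off_nullE.
Qed.

Variables (q : nat) (X : R -> T -> R).
Hypothesis q1 : (1 < q)%N.
Hypothesis smooth : forall w, of_class q setT (X ^~ w).
Hypothesis gX : forall (k : nat) (s a : 'I_k -> R), (forall i, [set: R] (s i)) ->
  gl P (fun w => \sum_(i < k) a i * X (s i) w).
Hypothesis statX : forall h s t,
  Ex P (fun w => X (s + h) w * X (t + h) w) = Ex P (fun w => X s w * X t w).

Let rho x := Ex P (fun w => X x w * X 0 w).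
Let rho1 x := Ex P (fun w => dX X 1 x w * X 0 w).

Let rhoE x z : Ex P (fun w => X x w * X z w) = rho (x - z).
Proof. by rewrite /rho -[RHS](statX z) subrK add0r. Qed.

Let dcov (u : nat) (x : R) (v : nat) (z : R) : (u < q)%N -> (v <= q)%N ->
  is_derive x 1 (fun x => Ex P (fun w => dX X u x w * dX X v z w))
    (Ex P (fun w => dX X u.+1 x w * dX X v z w)).
Proof.
move=> uq vq.
have mZ : m4 P (dX X v z) by apply: gl_m4; exact: (gl_dX1 openT smooth gX vq).
have := @Ex_dX_is_derive _ _ _ P q setT X openT smooth gX u x (dX X v z) uq I mZ.
have c (y : R) i : Ex P (fun w => dX X v z w * dX X i y w) = Ex P (fun w => dX X i y w * dX X v z w).
  by apply: eq_Ex => w; rewrite mulrC.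
by rewrite c (_ : (fun y => Ex P (fun w => dX X v z w * dX X u y w)) =
  fun y => Ex P (fun w => dX X u y w * dX X v z w))//; apply/funext => y; exact: c.
Qed.

Let dN (x : R) : is_derive x 1 (fun y : R => - y) (-1).
Proof. exact: (is_deriveN (is_derive_id x 1)). Qed.

Let drho (x : R) : is_derive x 1 rho (rho1 x).
Proof. exact: (@dcov 0 x 0 0 (ltnW q1) (leq0n q)). Qed.

(** The covariance function [rho] is even, so its derivative at [0] vanishes. *)
Lemma stationary_cross : Ex P (fun w => X 0 w * dX X 1 0 w) = 0.
Proof.
have even x : rho (- x) = rho x.
  rewrite /rho -[LHS](statX x) addNr add0r.
  by apply: eq_Ex => w; rewrite mulrC.
have h : is_derive (0 : R) 1 (rho \o (fun y : R => - y)) (rho1 0 * -1).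
  by apply: is_derive1_comp; rewrite oppr0; exact: drho.
have e : rho \o (fun y : R => - y) = rho by apply/funext => x; exact: even.
have [_ h1] := h; have [_ h2] := drho 0.
have r0 : rho1 0 = 0 by move: h1; rewrite e h2 mulrN1 => /eqP; rewrite -addr_eq0 -mulr2n mulrn_eq0/= => /eqP.
transitivity (rho1 0); last exact: r0.
by apply: eq_Ex => w; rewrite mulrC.
Qed.

(** The identity [E[X x * X z] = rho (x - z)] is differentiated once in each variable, and the inner
    derivative [-1] in [z] produces the sign. *)
Lemma stationary_curvature : derive1n 2 rho 0 = - Ex P (fun w => dX X 1 0 w ^+ 2).
Proof.
have e1 : derive1 rho = rho1.
  by apply/funext => x; rewrite derive1E; have [_ ->] := drho x.
have e2 z : rho1 (- z) = Ex P (fun w => dX X 1 0 w * X z w).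
  have h : is_derive (0 : R) 1 (rho \o (fun x => x - z)) (rho1 (- z) * 1).
    apply: is_derive1_comp; first by rewrite sub0r; exact: drho.
    by apply: trigger_derive; rewrite ?subr0.
  have h' := @dcov 0 0 0 z (ltnW q1) (leq0n q).
  have e : (fun x => Ex P (fun w => dX X 0 x w * dX X 0 z w)) = rho \o (fun x => x - z).
    by apply/funext => x; exact: rhoE.
  by rewrite e in h'; have [_ h1] := h; have [_ h2] := h'; rewrite -[LHS]mulr1 -h1 h2.
have d2 : is_derive (0 : R) 1 rho1 (Ex P (fun w => dX X 1 0 w ^+ 2) * -1).
  have e : rho1 = (fun z => Ex P (fun w => dX X 1 0 w * X z w)) \o (fun y : R => - y).
    by apply/funext => z; rewrite /= -e2 opprK.
  rewrite e; apply: is_derive1_comp.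
  rewrite oppr0; have := @dcov 0 0 1 0 (ltnW q1) (ltnW q1).
  rewrite (_ : (fun x => _) = (fun z => Ex P (fun w => dX X 1 0 w * X z w))).
    by [].
  by apply/funext => z; apply: eq_Ex => w; rewrite mulrC.
rewrite /= e1 derive1E; have [_ ->] := d2.
by rewrite mulrN1.
Qed.

End stationary_covariances.

Section dilations.
Context {R : realType}.

Lemma open_saturate (p : R) (I : set R) : open I -> open (saturate p I).
Proof.
move=> oI; rewrite (_ : saturate p I = \bigcup_(k in [set: int]) ((fun x => x + k%:~R * p) @^-1` I)).
  apply: bigcup_open => k _; apply: open_comp => // x _.
  by apply: cvgD; [exact: cvg_id|exact: cvg_cst].
by apply/seteqP; split => x [k]; [exists k|move=> _ ?; exists k].
Qed.

Lemma saturate_sub (p : R) (I : set R) : I `<=` saturate p I.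
Proof. by move=> x Ix; exists 0; rewrite mul0r addr0. Qed.

Lemma dilateE (r : R) (U : set R) y : 0 < r -> dilate r%:E U y <-> U (y / r).
Proof.
move=> r0; split => [[x Ux <-]|Uy]; first by rewrite mulrC mulKf// gt_eqF.
by exists (y / r) => //; rewrite mulrC divfK// gt_eqF.
Qed.

Lemma open_dilate (r : R) (U : set R) : 0 < r -> open U -> open (dilate r%:E U).
Proof.
move=> r0 oU; rewrite (_ : dilate r%:E U = (fun y => y / r) @^-1` U).
  by apply: open_comp => // x _; apply: cvgMl; exact: cvg_id.
by apply/seteqP; split => y; rewrite /preimage => /(dilateE _ _ r0).
Qed.

Lemma near_within_pinfty (N : set R) (Q : R -> Prop) :
  (\forall n \near within N (pinfty_nbhs R), Q n) ->
  exists n0 : nat, forall r, n0%:R <= r -> N r -> Q r.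
Proof.
move=> [M [Mr hM]]; exists (Num.truncn (Num.max M 0)).+1 => r hr Nr.
apply: hM => //; apply: (lt_le_trans _ hr).
have m0 : 0 <= Num.max M 0 by rewrite le_max lexx orbT.
have /andP[_ h] := truncn_itv m0.
by apply: le_lt_trans h; rewrite le_max lexx.
Qed.

End dilations.

(** * The law of large numbers on one interval *)

Section process_lln.
Context {R : realType} {d : measure_display} {Omega : measurableType d}.
Variables (P : probability Omega R) (ell : R) (I N : set R) (f : \bar R -> R -> Omega -> R).
Let U := saturate ell I.
Hypothesis ell_ge0 : 0 <= ell.
Hypothesis oI : open I.
Hypothesis N_nat : forall k : nat, (0 < k)%N -> N k%:R.
Hypothesis gP : forall n, add_infty N n ->
  centered_gaussian_process P (dilated_period n ell) (dilate n U) (f n).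
Hypothesis stat : stationary P (f +oo%E).
Hypothesis nz : non_zero P (f +oo%E).
Hypothesis h1 : H1 P ell U N f 82.
Hypothesis h2 : H2 P ell U N f 82.

Let inf_in : add_infty N +oo%E. Proof. by right. Qed.
Let nat_in k : (0 < k)%N -> add_infty N (k%:R)%:E.
Proof. by move=> k0; left; exists k%:R => //; exact: N_nat. Qed.

Let gl_comb n (Z : set Omega) : add_infty N n -> measurable Z -> P Z = 0%E ->
  forall (k : nat) (s c : 'I_k -> R), (forall i, dilate n U (s i)) ->
  gl P (fun w => \sum_(i < k) c i * off_null Z (f n) (s i) w).
Proof.
move=> nN mZ PZ k s c sA; have [mf _ lf] := gP nN.
have mS : measurable_fun setT (fun w => \sum_(i < k) c i * f n (s i) w).
  by apply: measurable_sum => i; apply: measurable_funM => //; exact: mf.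
have [m l] := off_null_law mZ PZ mS (lf k s c sA).
have := gl_law m l; rewrite (_ : (fun w => _ * _) = fun w => \sum_(i < k) c i * off_null Z (f n) (s i) w)//.
by apply/funext => w; rewrite mulr_sumr; apply: eq_bigr => i _; rewrite /off_null mulrCA.
Qed.

Let law1 n s : add_infty N n -> dilate n U s -> centered_gaussian_law P (f n s).
Proof.
move=> nN As; have [_ _ lf] := gP nN.
have := lf 1%N (fun=> s) (fun=> 1) (fun=> As).
by rewrite (_ : (fun w => _) = f n s)//; apply/funext => w; rewrite big_ord1 mul1r.
Qed.

Let law_off n (Z : set Omega) s : add_infty N n -> measurable Z -> P Z = 0%E ->
  dilate n U s -> centered_gaussian_law P (off_null Z (f n) s).
Proof.
move=> nN mZ PZ As; have [mf _ _] := gP nN.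
by have [] := off_null_law mZ PZ (mf s As) (law1 nN As).
Qed.

Let null_ex n : add_infty N n -> exists Z : set Omega, [/\ measurable Z, P Z = 0%E &
  forall w, ~ Z w -> of_class 82 (dilate n U) ((f n) ^~ w)].
Proof.
move=> nN; have [c _] := h1; have [Z [mZ PZ hZ]] := c n nN.
by exists Z; split => // w nZ; apply: contrapT => h; apply: nZ; apply: hZ.
Qed.

Let sqi_inf s : sqi P (f +oo%E s).
Proof.
have [mf _ _] := gP inf_in.
by have [] := gl_law (mf s Logic.I) (law1 inf_in (Logic.I : dilate +oo%E U s)).
Qed.

Let cov00 s t : covariance_deriv P (f +oo%E) 0 0 s t = Ex P (fun w => f +oo%E s w * f +oo%E t w).
Proof. by rewrite /covariance_deriv expectation.unlock. Qed.

Let l0_gt0 : 0 < covariance_deriv P (f +oo%E) 0 0 0 0.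
Proof.
have [s hs] := nz; have [mf _ _] := gP inf_in.
have -> : covariance_deriv P (f +oo%E) 0 0 0 0 = Ex P (fun w => f +oo%E s w ^+ 2).
  by rewrite cov00 -(stationary_cov stat sqi_inf s) add0r.
have [l|[v v0 l]] := law1 inf_in (Logic.I : dilate +oo%E U s).
  by have [_] := gl_dirac (mf s Logic.I) l.
by have [_ ->] := gl_normal (mf s Logic.I) v0 l; exact: exprn_gt0.
Qed.

(** Turns [H1] and [H2] into the hypotheses of [zero_count_lln] for the modified processes. The
    bound by half a period makes the quotient distance in [H2] equal to [|s - t|] on the dilated
    interval. *)
Theorem process_lln (a b : R) : a < b -> b - a <= 1 -> (forall x, a <= x <= b -> I x) ->
  (ell = 0 \/ b - a <= ell / 2) ->
  \forall w \ae P, forall e : R, 0 < e ->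
  exists n0, forall n : nat, (n0 <= n)%N -> (0 < n)%N ->
  exists2 s, enumerates s [set t | n%:R * a <= t < n%:R * b /\ f n%:R%:E t w = 0] &
    `|(size s)%:R / n%:R - gamma1 P (f +oo%E) * (b - a)| <= e.
Proof.
move=> ab ba1 abI hell.
have [Zi [mZi PZi hZi]] := null_ex inf_in.
have Zex (n : nat) : exists Z : set Omega, (0 < n)%N -> [/\ measurable Z, P Z = 0%E &
    forall w, ~ Z w -> of_class 82 (dilate n%:R%:E U) ((f n%:R%:E) ^~ w)].
  have [n0|n0] := posnP n; first by exists set0; rewrite n0.
  by have [Z hZ] := null_ex (nat_in n0); exists Z.
have [Z hZ] := choice Zex.
have mZ n : (0 < n)%N -> measurable (Z n) by move=> /hZ[].
have PZ n : (0 < n)%N -> P (Z n) = 0%E by move=> /hZ[].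
pose X (n : nat) := off_null (Z n) (f n%:R%:E).
pose Xi := off_null Zi (f +oo%E).
have [g [g_even [Mg gM] _ g_cov [omega omega0 g_Lfun]]] := h2.
have [_ [psi [_ [m [M [m0 psiM]]] hpsi]]] := h1.
have n_gt0 n : (0 < n)%N -> 0 < n%:R :> R by rewrite ltr0n.
have inA n x : (0 < n)%N -> n%:R * a <= x <= n%:R * b -> dilate n%:R%:E U x.
  move=> n0 /andP[x1 x2]; apply/dilateE; first exact: n_gt0.
  apply: saturate_sub; apply: abI; rewrite ler_pdivlMr ?ler_pdivrMr ?n_gt0//.
  by rewrite mulrC x1 mulrC x2.
(* [g] dominates an absolute value at every distance on the line, and it is even. *)
have g_ge0 x : 0 <= g x.
  have h (y : R) : 0 <= g `|y|.
    have := @g_cov 0%N 0%N +oo%E y 0 isT isT inf_in Logic.I Logic.I.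
    rewrite /= quotient_distE//; last by left.
    by rewrite subr0; apply: le_trans.
  by have := h x; have [x0|x0] := leP 0 x; [rewrite ger0_norm|rewrite ltr0_norm// g_even].
have covX n u v s t : (0 < n)%N ->
    covariance_deriv P (f n%:R%:E) u v s t = Ex P (fun w => dX (X n) u s w * dX (X n) v t w).
  by move=> n0; apply: covariance_derivE; [exact: mZ|exact: PZ].
have covXi u v s t :
    covariance_deriv P (f +oo%E) u v s t = Ex P (fun w => dX Xi u s w * dX Xi v t w).
  exact: covariance_derivE.
have smoothi w : of_class 82 setT (Xi ^~ w) by apply: off_null_of_class.
have gXi : forall (k : nat) (s c : 'I_k -> R), (forall i, [set: R] (s i)) ->
    gl P (fun w => \sum_(i < k) c i * Xi (s i) w).
  by move=> k s c _; apply: (gl_comb inf_in mZi PZi).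
have statXi h s t : Ex P (fun w => Xi (s + h) w * Xi (t + h) w) = Ex P (fun w => Xi s w * Xi t w).
  have e u v : Ex P (fun w => Xi u w * Xi v w) = Ex P (fun w => f +oo%E u w * f +oo%E v w).
    by rewrite -cov00 covXi.
  by rewrite !e; exact: stationary_cov.
pose l0 := covariance_deriv P (f +oo%E) 0 0 0 0.
pose l2 := Ex P (fun w => dX Xi 1 0 w ^+ 2).
have gammaE : gamma1 P (f +oo%E) = Num.sqrt (l2 / l0) / pi.
  rewrite /gamma1 mulrC; congr (_ / _); congr Num.sqrt.
  have -> : reduced_covariance P (f +oo%E) = fun x => Ex P (fun w => Xi x w * Xi 0 w).
    by apply/funext => x; rewrite /reduced_covariance covXi.
  rewrite (@stationary_curvature _ _ _ P 82 Xi isT smoothi gXi statXi) opprK; congr (_ / _).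
  by rewrite /l0 covXi.
(* Variances are to be bounded by a square, and [|Mg| <= (|Mg| + 1) ^+ 2]. *)
pose V := `|Mg| + 1.
have V0 : 0 < V by rewrite ltr_wpDl.
have gV x : g x <= V ^+ 2.
  have : g x <= `|Mg| by apply: le_trans (ler_norm _) _; apply: le_trans (gM x) _; exact: ler_norm.
  by rewrite /V; have := normr_ge0 Mg; nra.
have [Cg [Cg0 g_sum]] := decay_sum omega0 g_ge0 (ex_intro _ Mg gM) g_Lfun.
have [kap kapP] := choice (fun n => @root_floor 80 n isT).
have moments e : 0 < e -> exists n0, forall n x, (n0 <= n)%N -> (0 < n)%N -> a <= x <= b ->
    [/\ `|Ex P (fun w => X n (n%:R * x) w ^+ 2) - psi x * l0| <= e,
        `|Ex P (fun w => X n (n%:R * x) w * dX (X n) 1 (n%:R * x) w)| <= e &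
        `|Ex P (fun w => dX (X n) 1 (n%:R * x) w ^+ 2) - psi x * l2| <= e].
  move=> e0.
  (* [H1] is used on the diagonal only, at [s = t = 0]; covariances between distinct points enter
     through [g]. *)
  have key u v : (u <= 82)%N -> (v <= 82)%N -> exists n0, forall n x, (n0 <= n)%N -> (0 < n)%N ->
      a <= x <= b -> `|Ex P (fun w => dX (X n) u (n%:R * x) w * dX (X n) v (n%:R * x) w) -
        psi x * Ex P (fun w => dX Xi u 0 w * dX Xi v 0 w)| <= e.
    move=> u82 v82; have [n0 hn0] := near_within_pinfty (hpsi u v u82 v82 0 e e0).
    exists n0 => n x hn n1 xab.
    have Ux : U x by apply: saturate_sub; exact: abI.
    have nUx : dilate n%:R%:E U (n%:R * x + 0) by rewrite addr0; exists x.
    have n0n : n0%:R <= n%:R :> R by rewrite ler_nat.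
    have := hn0 n%:R n0n (N_nat n1) x 0 0 Ux _ _ nUx nUx.
    by rewrite normr0 lexx addr0 covX// covXi; exact.
  have [n1 k1] := key 0%N 0%N isT isT; have [n2 k2] := key 0%N 1%N isT isT.
  have [n3 k3] := key 1%N 1%N isT isT.
  exists (maxn n1 (maxn n2 n3)) => n x; rewrite !geq_max => /and3P[q1 q2 q3] n0 xab.
  split; first by have := k1 n x q1 n0 xab; rewrite -covXi.
    have := k2 n x q2 n0 xab.
    by rewrite (@stationary_cross _ _ _ P 82 Xi isT smoothi gXi statXi) mulr0 subr0.
  exact: k3.
have cov_le n s t : (0 < n)%N -> n%:R * a <= s <= n%:R * b -> n%:R * a <= t <= n%:R * b ->
    `|Ex P (fun w => X n s w * X n t w)| <= g (s - t).
  move=> n0 hs ht.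
  have := @g_cov 0%N 0%N n%:R%:E s t isT isT (nat_in n0) (inA n s n0 hs) (inA n t n0 ht).
  rewrite covX// /= quotient_distE.
  - move=> h; apply: (le_trans h).
    by have [x0|x0] := leP 0 (s - t); [rewrite ger0_norm|rewrite ltr0_norm// g_even].
  - by rewrite mulr_ge0.
  - case: hell => [->|hell]; first by left; rewrite mulr0.
    right; rewrite -mulrA; apply: (@le_trans _ _ (n%:R * (b - a))); last by rewrite ler_pM2l// n_gt0.
    by move: hs ht => /andP[? ?] /andP[? ?]; rewrite mulrBr ler_norml; apply/andP; split; lra.
have := @zero_count_lln R d Omega P (fun n => dilate n%:R%:E U) X a b ab ba1
  (fun n n0 => open_dilate (n_gt0 n n0) (open_saturate oI))
  _ (fun n n0 => gl_comb (nat_in n0) (mZ n n0) (PZ n n0))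
  (fun n n0 s hs => law_off (nat_in n0) (mZ n n0) (PZ n n0) hs)
  inA V V0 _ g omega Cg g_even omega0 Cg0 g_sum cov_le psi m M l0 l2 m0 _ l0_gt0 moments kap kapP.
move=> lln.
have : \forall w \ae P, forall n, (0 < n)%N -> ~ Z n w.
  apply: ae_foralln => n; have [n0|n0] := posnP n; first by rewrite n0; exact: nearW.
  exists (Z n); split; [exact: mZ|exact: PZ|].
  by move=> w /=; apply: contra_notP => h _.
have : \forall w \ae P, forall e : R, 0 < e ->
  exists n0, forall n, (n0 <= n)%N -> (0 < n)%N ->
  exists2 s, enumerates s [set t | n%:R * a <= t < n%:R * b /\ X n t w = 0] &
    `|(size s)%:R / n%:R - Num.sqrt (l2 / l0) / pi * (b - a)| <= e.
  apply: lln.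
  - by move=> n n0 w; apply: off_null_of_class => w'; have [_ _] := hZ n n0; exact.
  - move=> n u x n0 u82 xab; have := @g_cov u u n%:R%:E x x u82 u82 (nat_in n0) (inA n x n0 xab) (inA n x n0 xab).
    rewrite covX// => h; apply: le_trans (gV _); apply: le_trans h; exact: ler_norm.
  - by move=> x xab; apply: psiM; apply: saturate_sub; exact: abI.
rewrite gammaE.
apply: filterS2 => w hw nZ e /hw[n0 hn0]; exists n0 => n hn n1.
have [s es bs] := hn0 n hn n1; exists s => //.
have eX t : X n t w = f n%:R%:E t w.
  by have := congr1 (fun F => F t) (off_nullE (f n%:R%:E) (nZ n n1)).
by move: es; under eq_set do rewrite eX.
Qed.

End process_lln.

(** * Real dilations *)

Section real_dilations.
Context {R : realType}.

Lemma rat_between (x y : R) : x < y -> exists q : rat, x < ratr q < y.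
Proof. by move=> xy; have [q hq] := rat_in_itvoo xy; exists q; move: hq; rewrite in_itv. Qed.

Variables (F : R -> R -> R) (I N : set R) (g delta0 : R).
Hypothesis oI : open I.
Hypothesis g_ge0 : 0 <= g.
Hypothesis F_trunc : forall r t, N r -> 1 <= r -> dilate r%:E I t ->
  dilate (Num.truncn r)%:R%:E I t -> F r t = F (Num.truncn r)%:R t.
Hypothesis rational_counts : forall p q : rat, ratr p < ratr q :> R ->
  (forall x : R, ratr p <= x <= ratr q -> I x) -> ratr q - ratr p <= delta0 ->
  forall e : R, 0 < e -> exists n0, forall n : nat, (n0 <= n)%N -> (0 < n)%N ->
  exists2 s, enumerates s [set t | n%:R * ratr p <= t < n%:R * ratr q /\ F n%:R t = 0] &
    `|(size s)%:R / n%:R - g * (ratr q - ratr p)| <= e.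

(** The difference between [r] and its integer part is less than [1], so for large [r] any gap
    between [x] and [y] absorbs it, whatever their signs. *)
Lemma trunc_scale (x y : R) : x < y ->
  exists n0 : nat, forall r, n0%:R <= r -> (Num.truncn r)%:R * x <= r * y /\ r * x <= (Num.truncn r)%:R * y.
Proof.
move=> xy; have d0 : 0 < y - x by rewrite subr_gt0.
pose C := (`|x| + `|y|) / (y - x).
have C0 : 0 <= C by apply: divr_ge0; [exact: addr_ge0|exact: ltW].
exists (Num.truncn C).+2 => r hr.
have r0 : 0 <= r by apply: le_trans hr.
have /andP[k1 k2] := truncn_itv r0.
have kC : C <= (Num.truncn r)%:R.
  have /andP[_ h] := truncn_itv C0; apply: ltW; apply: (lt_le_trans h).
  by rewrite ler_nat -ltnS -(ltr_nat R); apply: le_lt_trans k2; apply: le_trans hr; rewrite ler_nat.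
move: k2; rewrite -natr1; move: k1 kC; move: ((Num.truncn r)%:R : R) => k k1 kC k2.
have h : `|x| + `|y| <= k * (y - x) by move: kC; rewrite /C ler_pdivrMr.
have nx := ler_norm x; have ny := ler_norm y.
have nx' : - x <= `|x| by rewrite -normrN ler_norm.
have ny' : - y <= `|y| by rewrite -normrN ler_norm.
have x0 := normr_ge0 x; have y0 := normr_ge0 y.
split; nra.
Qed.

(** With [k] the integer part of [r], the interval [r [a, b)] lies inside [k [p, q)] and contains [k
    [p', q')] for rationals close to [a] and [b]. Since the two functions agree there, the count at
    [r] is enclosed between two counts at [k]. *)
Lemma real_counts (a b : R) : a < b -> (forall x, a <= x <= b -> I x) -> b - a < delta0 ->
  forall e : R, 0 < e -> exists n0 : nat, forall r, N r -> n0%:R <= r ->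
  exists2 s, enumerates s [set x | a <= x < b /\ F r (r * x) = 0] &
    `|(size s)%:R / r - g * (b - a)| <= e.
Proof.
move=> ab abI bad e e0.
have Ia : I a by apply: abI; rewrite lexx ltW.
have Ib : I b by apply: abI; rewrite lexx ltW.
have /= [ra /= ra0 hra] := oI Ia; have /= [rb /= rb0 hrb] := oI Ib.
(* The terms keep, in turn, the outer interval in [I], its length below [delta0], the inner interval
   nonempty, and the change of the limit below [e / 4]. *)
pose eta := Num.min (Num.min ra rb) (Num.min ((delta0 - (b - a)) / 2) (Num.min ((b - a) / 4) (e / (8 * (g + 1))))).
have g1 : 0 < g + 1 by rewrite ltr_wpDl.
have eta0 : 0 < eta.
  by rewrite /eta !lt_min ra0 rb0 !divr_gt0 ?subr_gt0// mulr_gt0.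
have [ea eb ed eab ee] : [/\ eta <= ra, eta <= rb, eta <= (delta0 - (b - a)) / 2, eta <= (b - a) / 4 &
    eta <= e / (8 * (g + 1))].
  by rewrite /eta; split; rewrite !ge_min ?lexx ?orbT.
have ge : 2 * (eta * g) <= e / 4.
  have h : eta * (8 * (g + 1)) <= e by rewrite -ler_pdivlMr// mulr_gt0.
  by nra.
have [p /andP[p1 p2]] := @rat_between (a - eta) a ltac:(lra).
have [q /andP[q1 q2]] := @rat_between b (b + eta) ltac:(lra).
have [p' /andP[p1' p2']] := @rat_between a (a + eta) ltac:(lra).
have [q' /andP[q1' q2']] := @rat_between (b - eta) b ltac:(lra).
have pqI x : ratr p <= x <= ratr q -> I x.
  move=> /andP[x1 x2]; have [xa|ax] := ltP x a.
    by apply: hra => /=; rewrite ger0_norm; lra.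
  have [xb|bx] := leP x b; first by apply: abI; rewrite ax xb.
  by apply: hrb => /=; rewrite ler0_norm; lra.
have pqI' x : ratr p' <= x <= ratr q' -> I x by move=> /andP[? ?]; apply: abI; apply/andP; split; lra.
have e4 : 0 < e / 4 by rewrite divr_gt0.
have pq : ratr p < ratr q :> R by lra.
have pq' : ratr p' < ratr q' :> R by lra.
have [n1 h1] := rational_counts pq pqI ltac:(lra) e4.
have [n2 h2] := rational_counts pq' pqI' ltac:(lra) e4.
have [m1 t1] := trunc_scale p2; have [m2 t2] := trunc_scale q1.
have [m3 t3] := trunc_scale p1'; have [m4 t4] := trunc_scale q2'.
pose G := g * (b - a).
have G0 : 0 <= G by rewrite mulr_ge0// subr_ge0 ltW.
have G2 : 0 <= 2 * G / e by apply: divr_ge0; [exact: mulr_ge0|exact: ltW].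
(* The last threshold ensures [2 * G <= r * e], so that passing from [k] to [r] in the lower bound
   costs at most [e / 2] after division by [r]. *)
exists (maxn (maxn (maxn n1 n2) (maxn m1 m2)) (maxn (maxn m3 m4) (Num.truncn (2 * G / e)).+2)) => r Nr hr.
have rn n : (n <= maxn (maxn (maxn n1 n2) (maxn m1 m2)) (maxn (maxn m3 m4) (Num.truncn (2 * G / e)).+2))%N -> n%:R <= r.
  by move=> h; apply: le_trans hr; rewrite ler_nat.
have rG : (Num.truncn (2 * G / e)).+2%:R <= r by apply: rn; rewrite !leq_max leqnn !orbT.
have r1 : 1 <= r by apply: le_trans rG; rewrite ler1n.
have r0 : 0 < r by exact: lt_le_trans r1.
have [i1 _] := t1 r (rn m1 ltac:(by rewrite !leq_max leqnn ?orbT)).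
have [_ i2] := t2 r (rn m2 ltac:(by rewrite !leq_max leqnn ?orbT)).
have [_ i3] := t3 r (rn m3 ltac:(by rewrite !leq_max leqnn ?orbT)).
have [i4 _] := t4 r (rn m4 ltac:(by rewrite !leq_max leqnn ?orbT)).
have kn n : (n <= maxn (maxn (maxn n1 n2) (maxn m1 m2)) (maxn (maxn m3 m4) (Num.truncn (2 * G / e)).+2))%N ->
    (n <= Num.truncn r)%N.
  by move=> /rn h; rewrite (truncn_ge_nat _ (ltW r0)).
have k0 : (0 < Num.truncn r)%N by rewrite (truncn_ge_nat _ (ltW r0)).
have [s1 es1 bs1] := h1 _ (kn n1 ltac:(by rewrite !leq_max leqnn ?orbT)) k0.
have [s2 es2 bs2] := h2 _ (kn n2 ltac:(by rewrite !leq_max leqnn ?orbT)) k0.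
have /andP[kr rk] := truncn_itv (ltW r0).
have := F_trunc Nr r1.
move: kr rk k0 i1 i2 i3 i4 es1 es2 bs1 bs2; set k := Num.truncn r.
move=> kr rk k0 i1 i2 i3 i4 es1 es2 bs1 bs2 Fk.
have kp : 0 < k%:R :> R by rewrite ltr0n.
have inI (u v x : R) (rr : R) : 0 < rr -> (forall y, u <= y <= v -> I y) -> rr * u <= x <= rr * v -> dilate rr%:E I x.
  move=> rr0 uv /andP[h3 h4]; apply/dilateE => //; apply: uv.
  by rewrite ler_pdivlMr// ler_pdivrMr// mulrC h3 mulrC h4.
pose s := [seq x <- [seq t / r | t <- s1] | (a <= x < b) && (F r (r * x) == 0)].
have es : enumerates s [set x | a <= x < b /\ F r (r * x) = 0].
  split.
    rewrite filter_uniq// map_inj_uniq ?es1.1// => x y.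
    by apply: mulIf; rewrite invr_eq0 gt_eqF.
  move=> x; rewrite mem_filter; split=> [/andP[/andP[h /eqP ?] _]//|[/andP[xa xb] Fx]].
  rewrite xa xb Fx eqxx/=; apply/mapP; exists (r * x); last by rewrite mulrC mulKf// gt_eqF.
  apply/es1.2; have rxa : r * a <= r * x by rewrite ler_pM2l.
  have rxb : r * x < r * b by rewrite ltr_pM2l.
  have krx : k%:R * ratr p <= r * x < k%:R * ratr q by rewrite (le_trans i1 rxa) (lt_le_trans rxb i2).
  split => //; rewrite -Fk//; first by apply: (inI a b) => //; rewrite rxa ltW.
  by have /andP[? ?] := krx; apply: (inI (ratr p) (ratr q)) => //; apply/andP; split => //; exact: ltW.
exists s => //.
have su : (size s <= size s1)%N.
  by rewrite size_filter (leq_trans (count_size _ _))// size_map.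
have sl : (size s2 <= size s)%N.
  rewrite -(size_map (fun t => t / r) s2); apply: uniq_leq_size.
    by rewrite map_inj_uniq ?es2.1// => x y; apply: mulIf; rewrite invr_eq0 gt_eqF.
  move=> _ /mapP[t /es2.2[/andP[h3 h4] Ft] ->]; apply/es.2.
  have tr : r * (t / r) = t by rewrite mulrC divfK// gt_eqF.
  have ra1 : r * a <= t := le_trans i3 h3; have rb1 : t < r * b := lt_le_trans h4 i4.
  rewrite /= tr ler_pdivlMr// ltr_pdivrMr// [a * r]mulrC [b * r]mulrC ra1 rb1; split=> //.
  rewrite Fk//; first by apply: (inI a b) => //; rewrite ra1 ltW.
  by apply: (inI (ratr p') (ratr q')) => //; rewrite h3 ltW.
have suR : (size s)%:R <= (size s1)%:R :> R by rewrite ler_nat.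
have slR : (size s2)%:R <= (size s)%:R :> R by rewrite ler_nat.
have s20 : 0 <= (size s2)%:R :> R by [].
have up : (size s1)%:R <= k%:R * (G + e / 2).
  move: bs1; rewrite ler_norml => /andP[_ h]; rewrite mulrC -ler_pdivrMr//.
  have : g * (ratr q - ratr p) <= g * (b - a + 2 * eta) by apply: ler_wpM2l => //; lra.
  by rewrite /G; lra.
have lo : k%:R * (G - e / 2) <= (size s2)%:R.
  move: bs2; rewrite ler_norml => /andP[h _]; rewrite mulrC -ler_pdivlMr//.
  have : g * (b - a - 2 * eta) <= g * (ratr q' - ratr p') by apply: ler_wpM2l => //; lra.
  by rewrite /G; lra.
have kG : k%:R * (G + e / 2) <= r * (G + e / 2) by rewrite ler_wpM2r//; lra.
have re : 2 * G <= r * e.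
  rewrite -ler_pdivrMr//; apply: le_trans rG; have /andP[_ h] := truncn_itv G2.
  by apply: ltW; apply: (lt_le_trans h); rewrite ler_nat.
have {}rk : r < k%:R + 1 by rewrite natr1.
rewrite -/G ler_norml; apply/andP; split; last first.
  rewrite lerBlDr ler_pdivrMr// [leRHS]mulrC.
  have : r * (G + e / 2) <= r * (e + G) by rewrite ler_pM2l//; lra.
  by move=> h; apply: le_trans h; apply: le_trans kG; apply: le_trans up.
rewrite lerBrDr ler_pdivlMr//; apply: (@le_trans _ _ (size s2)%:R) => //.
have [Y0|Y0] := leP 0 (G - e / 2); last first.
  by apply: le_trans s20; rewrite mulr_le0_ge0//; [lra|exact: ltW].
have h : (r - 1) * (G - e / 2) <= k%:R * (G - e / 2) by rewrite ler_wpM2r//; lra.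
apply: le_trans lo; apply: le_trans h.
rewrite -subr_ge0 (_ : _ - _ = (r * e - 2 * G + e) / 2); last by field.
by rewrite divr_ge0//; lra.
Qed.

End real_dilations.

(** * Integrals against counting measures, compactness and Riemann sums *)

Section atomic_integrals.
Context {R : realType}.
Variables (Z E : set R) (s : seq R).
Hypothesis es : enumerates s (Z `&` E).

Let dirac_sumE (A : set R) : measurable A -> A `<=` E ->
  dirac_sum (R := R) Z A = (\sum_(i < size s) \d_(nth 0%R s i) A)%E.
Proof.
move=> mA AE; rewrite /dirac_sum.
transitivity (\esum_(x in Z `&` E) (\d_(x) A : \bar R)).
  rewrite esum_mkcondr; apply: eq_esum => x Zx; case: ifPn => // xE.
  rewrite diracE memNset// => Ax; move/negP: xE; apply; rewrite inE; exact: AE.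
have -> : Z `&` E = [set` s] by apply/seteqP; split => x /= /es.2.
rewrite esum_fset; [|exact: finite_seq|by move=> x _; exact: measure_ge0].
rewrite -fsbig_seq; last exact: es.1.
by rewrite (big_nth 0) big_mkord.
Qed.

Let ge0_integral_dirac_sum (f : R -> R) : measurable_fun (setT : set R) f ->
  (forall x, 0 <= f x) -> (forall x, ~ E x -> f x = 0) ->
  (\int[dirac_sum (R := R) Z]_x (f x)%:E = (\sum_(x <- s) f x)%:E)%E.
Proof.
move=> mf f0 fE.
have mEf : measurable_fun (setT : set R) (fun x => (f x)%:E) by exact/measurable_EFinP.
have onE (mu : {measure set R -> \bar R}) : (\int[mu]_x (f x)%:E = \int[mu]_(x in E) (f x)%:E)%E.
  rewrite [RHS]integral_mkcond; apply: eq_integral => x _; rewrite /patch.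
  by case: ifPn => // /negP h; rewrite fE// => Ex; apply: h; rewrite inE.
rewrite onE (eq_measure_integral (msum (fun i => \d_(nth 0%R s i)) (size s))) => [|A mA AE]; last first.
  by rewrite /= /msum dirac_sumE.
rewrite -onE ge0_integral_measure_sum//.
rewrite (eq_bigr (fun i : 'I_(size s) => (f (nth 0%R s i))%:E)).
  by rewrite sumEFin [in RHS](big_nth 0) big_mkord.
by move=> i _; rewrite integral_dirac// diracT mul1e.
by move=> x _; rewrite lee_fin.
Qed.

(** [Z] may be infinite off [E]. Since [f] vanishes there, the measure is compared on subsets of [E]
    only, where it is a finite sum of Dirac masses. *)
Lemma integral_dirac_sum (f : R -> R) : measurable_fun (setT : set R) f ->
  (forall x, ~ E x -> f x = 0) ->
  (\int[dirac_sum (R := R) Z]_x (f x)%:E = (\sum_(x <- s) f x)%:E)%E.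
Proof.
move=> mf fE; rewrite integralE.
have e1 : (fun x => (f x)%:E)^\+%E = fun x => (Num.max (f x) 0)%:E.
  by apply/funext => x; rewrite funeposE -EFin_max.
have e2 : (fun x => (f x)%:E)^\-%E = fun x => (Num.max (- f x) 0)%:E.
  by apply/funext => x; rewrite funenegE -EFinN -EFin_max.
rewrite e1 e2 !ge0_integral_dirac_sum.
- rewrite -EFinB; congr (_%:E); rewrite -sumrB; apply: eq_bigr => x _.
  by have [h|h] := leP 0 (f x); rewrite ?(max_l h) ?(max_r (ltW h));
    [rewrite max_r ?oppr_le0// subr0|rewrite max_l ?oppr_ge0 ?ltW// sub0r opprK].
- by apply: measurable_maxr => //; exact: measurable_funN.
- by move=> x; rewrite le_max lexx orbT.
- by move=> x /fE ->; rewrite oppr0 maxxx.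
- exact: measurable_maxr.
- by move=> x; rewrite le_max lexx orbT.
- by move=> x /fE ->; rewrite maxxx.
Qed.

End atomic_integrals.

Section compactness.
Context {R : realType}.

(** A Lebesgue number for the cover of [K] by translates of [I]: one translation by periods carries
    the whole neighbourhood of a point into [I]. *)
Lemma lebesgue_number (K I : set R) (p : R) : compact K -> open I -> K `<=` saturate p I ->
  exists2 rho : R, 0 < rho &
    forall y, K y -> exists k : int, forall z, `|z - y| <= rho -> I (z + k%:~R * p).
Proof.
move=> cK oI KI.
have /compact_near_coveringP ncK := cK.
have := ncK R (0 : R)^'+ (fun rho y => exists k : int, forall z, `|z - y| <= rho -> I (z + k%:~R * p)) _ _.
move=> /(_ _) h; have {}h : \forall rho \near (0 : R)^'+, K `<=`
    (fun y => exists k : int, forall z, `|z - y| <= rho -> I (z + k%:~R * p)).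
  apply: h => x /KI[k Ik]; have /= [e /= e0 he] := oI _ Ik.
  exists (ball x (e / 2), [set rho : R | rho < e / 2]).
    split; first by apply: nbhsx_ballx; rewrite divr_gt0.
    by apply: nbhs_right_lt; rewrite divr_gt0.
  move=> [x' rho] [/= xx' re]; exists k => z zx'; apply: he => /=.
  rewrite /ball/= in xx'; rewrite (_ : _ - _ = (x - x') - (z - x')); last by ring.
  by apply: (le_lt_trans (ler_normB _ _)); rewrite [ltRHS](splitr e) ltr_leD// (le_trans zx')// ltW.
near (0 : R)^'+ => rho; exists rho.
  by near: rho; exact: nbhs_right_gt.
by near: rho; exact: h.
Unshelve. all: by end_near. Qed.

Lemma segment_modulus (phi : R -> R) (a b e : R) : continuous phi -> 0 < e ->
  exists2 rho : R, 0 < rho &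
    forall y, a <= y <= b -> forall z, `|z - y| <= rho -> `|phi z - phi y| <= e.
Proof.
move=> cphi e0.
have /compact_near_coveringP ncK := @segment_compact R a b.
have := ncK R (0 : R)^'+ (fun rho y => forall z, `|z - y| <= rho -> `|phi z - phi y| <= e) _ _.
move=> /(_ _) h; have {}h : \forall rho \near (0 : R)^'+, [set` `[a, b]] `<=`
    (fun y => forall z, `|z - y| <= rho -> `|phi z - phi y| <= e).
  apply: h => x _; have e2 : 0 < e / 2 by rewrite divr_gt0.
  have /cvgrPdist_le /(_ _ e2) /= [r /= r0 hr] := cphi x.
  exists (ball x (r / 2), [set rho : R | rho < r / 2]).
    split; first by apply: nbhsx_ballx; rewrite divr_gt0.
    by apply: nbhs_right_lt; rewrite divr_gt0.
  move=> [x' rho] [/= xx' re] z zx'; rewrite /ball/= in xx'.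
  have h1 : `|phi x - phi x'| <= e / 2 by apply: hr => /=; apply: (lt_le_trans xx'); lra.
  have h2 : `|phi x - phi z| <= e / 2.
    apply: hr => /=; rewrite (_ : _ - _ = (x - x') - (z - x')); last by ring.
    by apply: (le_lt_trans (ler_normB _ _)); rewrite [ltRHS](splitr r) ltr_leD// (le_trans zx')// ltW.
  rewrite (_ : _ - _ = (phi x - phi x') - (phi x - phi z)); last by ring.
  by apply: (le_trans (ler_normB _ _)); rewrite [leRHS](splitr e) lerD.
near (0 : R)^'+ => rho; exists rho.
  by near: rho; exact: nbhs_right_gt.
move=> y yab; have : [set` `[a, b]] y by rewrite /= in_itv.
by move: y {yab}; near: rho; exact: h.
Unshelve. all: by end_near. Qed.

End compactness.

Section riemann_sums.
Context {R : realType}.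
Local Notation mu := (@lebesgue_measure R).

Lemma riemann_sum (phi : R -> R) (c delta e : R) (K : nat) : continuous phi -> 0 < delta ->
  (forall i x, (i < K)%N -> c + i%:R * delta <= x <= c + i%:R * delta + delta ->
    `|phi x - phi (c + i%:R * delta)| <= e) ->
  mu.-integrable [set` `[c, c + K%:R * delta[] (EFin \o phi) /\
  `|\int[mu]_(x in [set` `[c, c + K%:R * delta[]) phi x - \sum_(i < K) phi (c + i%:R * delta) * delta|
    <= K%:R * (e * delta).
Proof.
move=> cphi d0.
have iseg (a b : R) : mu.-integrable [set` `[a, b[] (EFin \o phi).
  apply: (@integrableS _ _ _ mu [set` `[a, b]]); [exact: measurable_itv|exact: measurable_itv| |].
    by apply: subset_itvl; rewrite bnd_simp.
  apply: continuous_compact_integrable; first exact: segment_compact.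
  exact: continuous_subspaceT.
elim: K => [|K IH] hphi.
  rewrite mul0r addr0 set_itvco0 ; split; last by rewrite Rintegral_set0 big_ord0 subr0 normr0 mul0r.
  by have := iseg c c; rewrite set_itvco0.
split; first exact: iseg.
have [|iK bK] := IH; first by move=> i x iK; apply: hphi; exact: ltnW.
have Kd : 0 <= K%:R * delta by rewrite mulr_ge0// ltW.
have eK : c + K.+1%:R * delta = c + K%:R * delta + delta by rewrite -natr1; ring.
set x0 := c + K%:R * delta in eK bK iK *.
have -> : [set` `[c, c + K.+1%:R * delta[] = [set` `[c, x0[] `|` [set` `[x0, x0 + delta[] :> set R.
  apply/seteqP; split => x /=; rewrite !in_itv/= eK.
    by move=> /andP[x1 x2]; rewrite x1 x2/= andbT; have [?|?] := ltP x x0; [left|right].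
  move=> [/andP[-> x2]|/andP[x1 ->]]; first by rewrite (lt_le_trans x2)// lerDl ltW.
  by rewrite (le_trans _ x1)// /x0 lerDl.
rewrite Rintegral_setU; last 4 first.
- exact: measurable_itv.
- exact: measurable_itv.
- have := iseg c (x0 + delta); rewrite (_ : [set` _] = [set` `[c, x0[] `|` [set` `[x0, x0 + delta[])//.
  apply/seteqP; split => x /=; rewrite !in_itv/=.
    by move=> /andP[x1 x2]; rewrite x1 x2/= andbT; have [?|?] := ltP x x0; [left|right].
  move=> [/andP[-> x2]|/andP[x1 ->]]; first by rewrite (lt_le_trans x2)// lerDl ltW.
  by rewrite (le_trans _ x1)// /x0 lerDl.
- apply/disj_setPS => x /= []; rewrite !in_itv/= => /andP[_ h1] /andP[h2 _].
  by move: (lt_le_trans h1 h2); rewrite ltxx.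
have icst (k : R) : mu.-integrable [set` `[x0, x0 + delta[] (EFin \o cst k).
  apply: (@integrableS _ _ _ mu [set` `[x0, x0 + delta]]); [exact: measurable_itv|exact: measurable_itv| |].
    by apply: subset_itvl; rewrite bnd_simp.
  apply: continuous_compact_integrable; first exact: segment_compact.
  by apply: continuous_subspaceT => ?; exact: cvg_cst.
have Icst (k : R) : \int[mu]_(x in [set` `[x0, x0 + delta[]) (cst k) x = k * delta.
  have mJ : mu (`[x0, x0 + delta[%classic : set R) = delta%:E.
    rewrite lebesgue_measure_itv/= lte_fin ltrDl d0 -EFinB; congr (_%:E); ring.
  by rewrite Rintegral_cst//= mJ.
have hx x : x \in `[x0, x0 + delta[ -> `|phi x - phi x0| <= e.
  by rewrite in_itv/= => /andP[x1 x2]; apply: hphi => //; rewrite x1 ltW.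
have lo : (phi x0 - e) * delta <= \int[mu]_(x in [set` `[x0, x0 + delta[]) phi x.
  rewrite -Icst; apply: le_Rintegral; [exact: measurable_itv|exact: icst|exact: iseg|].
  by move=> x /= /hx; rewrite ler_norml => /andP[]; lra.
have hi : \int[mu]_(x in [set` `[x0, x0 + delta[]) phi x <= (phi x0 + e) * delta.
  rewrite -Icst; apply: le_Rintegral; [exact: measurable_itv|exact: iseg|exact: icst|].
  by move=> x /= /hx; rewrite ler_norml => /andP[]; lra.
rewrite big_ord_recr/= -/x0; move: bK lo hi.
move: (Rintegral _ _ _) (\sum_(i < K) _) (Rintegral _ _ _) => u v u'.
rewrite -natr1 !ler_norml => /andP[b1 b2] lo hi; apply/andP; split; lra.
Qed.

End riemann_sums.

(** * Vague convergence *)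

Section zero_shifts.
Context {R : realType}.
Variables (ell : R) (I N : set R) (F : R -> R -> R) (g delta0 : R).
Let U := saturate ell I.
Hypothesis ell_ge0 : 0 <= ell.
Hypothesis oI : open I.
Hypothesis g_ge0 : 0 <= g.
Hypothesis delta0_gt0 : 0 < delta0.
Hypothesis N_gt0 : forall r, N r -> 0 < r.
Hypothesis F_periodic : forall r x, N r -> U x -> F r (r * (x + ell)) = F r (r * x).
Hypothesis counts : forall a b, a < b -> (forall x, a <= x <= b -> I x) -> b - a < delta0 ->
  forall e : R, 0 < e -> exists n0 : nat, forall r, N r -> n0%:R <= r ->
  exists2 s, enumerates s [set x | a <= x < b /\ F r (r * x) = 0] &
    `|(size s)%:R / r - g * (b - a)| <= e.

Lemma saturate_shift x (k : int) : U x -> U (x + k%:~R * ell).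
Proof. by move=> [j Ij]; exists (j - k); rewrite (_ : x + _ + _ = x + j%:~R * ell)// intrB; ring. Qed.

Lemma zero_shift r x (k : int) : N r -> U x -> F r (r * (x + k%:~R * ell)) = F r (r * x).
Proof.
move=> Nr; have nat_shift (n : nat) y : U y -> F r (r * (y + n%:R * ell)) = F r (r * y).
  elim: n => [|n IH] Uy; first by rewrite mul0r addr0.
  transitivity (F r (r * (y + n%:R * ell + ell))).
    by congr (F r (r * _)); rewrite -natr1; ring.
  rewrite F_periodic//; first exact: IH.
  exact: (@saturate_shift y n Uy).
case: k => n Ux; first exact: nat_shift.
have Uy := @saturate_shift x (Negz n) Ux.
rewrite -(nat_shift n.+1 _ Uy); congr (F r (r * _)).
by rewrite NegzE mulrNz; ring.
Qed.

(** Translation by [k] periods preserves the zeros and moves the cell into [I], where the counts are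
    known; a cell inside the fundamental domain meets each class once. *)
Lemma cell_count (a delta : R) (k : int) : 0 < delta -> delta < delta0 ->
  (forall z, a <= z <= a + delta -> I (z + k%:~R * ell)) ->
  (forall x, a <= x < a + delta -> fundamental_domain ell x) ->
  forall e, 0 < e -> exists n0 : nat, forall r, N r -> n0%:R <= r ->
  exists2 s, enumerates s [set x | a <= x < a + delta /\ zeros ell U r (F r) x] &
    `|(size s)%:R / r - g * delta| <= e.
Proof.
move=> d0 dd hI hfd e e0; set t := k%:~R * ell in hI.
have [||| n0 hn0] := @counts (a + t) (a + t + delta) _ _ _ e e0.
- by rewrite ltrDl.
- by move=> x /andP[x1 x2]; rewrite -(subrK t x); apply: hI; apply/andP; split; lra.
- by rewrite (_ : _ - _ = delta)//; ring.
exists n0 => r Nr hr; have [s es bs] := hn0 r Nr hr.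
exists [seq x - t | x <- s]; last first.
  by rewrite size_map; move: bs; rewrite (_ : a + t + delta - (a + t) = delta)//; ring.
have UI z : a <= z <= a + delta -> U z by move=> /hI; exists k.
split; first by rewrite map_inj_uniq ?es.1// => x y /addIr.
move=> x; split.
  move=> /mapP[y /es.2[/andP[y1 y2] Fy] ->].
  have yt : a <= y - t < a + delta by apply/andP; split; lra.
  have Uy : U (y - t) by apply: UI; have /andP[h1 h2] := yt; rewrite h1 ltW.
  split => //; split => //; first exact: hfd.
  by rewrite -(@zero_shift r (y - t) k)// -/t subrK.
move=> [/andP[x1 x2] [Ux _ Fx]]; apply/mapP; exists (x + t); last by rewrite addrK.
apply/es.2; split; first by apply/andP; split; lra.
by rewrite /t zero_shift.
Qed.

(** An active cell contributes an error of at most [e * delta * (g + 2)]: the oscillation of [phi]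
    over its zeros, plus the counting error, divided beforehand by [Mphi + 1] to survive
    multiplication by [phi]. Zeros in other cells are left out of [s], and those cells add nothing
    to the Riemann sum. *)
Lemma cells_prefix (phi : R -> R) (c delta e Mphi : R) (act : nat -> Prop) (r : R) (m : nat) :
  0 < delta -> 0 < e <= 1 -> N r -> 0 <= Mphi ->
  (forall i x, (i < m)%N -> c + i%:R * delta <= x <= c + i%:R * delta + delta ->
    `|phi x - phi (c + i%:R * delta)| <= e) ->
  (forall i, (i < m)%N -> `|phi (c + i%:R * delta)| <= Mphi) ->
  (forall i, (i < m)%N -> ~ act i -> phi (c + i%:R * delta) = 0) ->
  (forall i, (i < m)%N -> act i ->
    exists2 s, enumerates s [set x | c + i%:R * delta <= x < c + i%:R * delta + delta /\
        zeros ell U r (F r) x] &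
      `|(size s)%:R / r - g * delta| <= e * delta / (Mphi + 1)) ->
  exists2 s, enumerates s [set x | (exists i, [/\ (i < m)%N, act i &
        c + i%:R * delta <= x < c + i%:R * delta + delta]) /\ zeros ell U r (F r) x] &
    `|(\sum_(x <- s) phi x) / r - g * \sum_(i < m) phi (c + i%:R * delta) * delta|
      <= m%:R * (e * delta * (g + 2)).
Proof.
move=> d0 /andP[e0 e1] Nr M0 osc bnd nact cnt.
have r0 := N_gt0 Nr.
elim: m osc bnd nact cnt => [|m IH] osc bnd nact cnt.
  exists [::]; last by rewrite big_nil big_ord0 mul0r mulr0 subr0 normr0 mul0r.
  by split=> // x; split=> // -[[i []]].
have [||||s [us hs] bs] := IH.
- by move=> i x im; apply: osc; exact: ltnW.
- by move=> i im; apply: bnd; exact: ltnW.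
- by move=> i im; apply: nact; exact: ltnW.
- by move=> i im; apply: cnt; exact: ltnW.
have eg0 : 0 <= e * delta * (g + 2).
  by apply: mulr_ge0; [apply: mulr_ge0; exact: ltW|exact: addr_ge0].
have [am|nam] := pselect (act m); last first.
  exists s.
    split=> // x; split=> [/hs[[i [im ai xi]] zx]|[[i [im ai xi]] zx]].
      by split=> //; exists i; split => //; exact: ltnW.
    apply/hs; split => //; exists i; split => //.
    by move: im; rewrite ltnS leq_eqVlt => /orP[/eqP im|//]; case: nam; rewrite -im.
  by rewrite big_ord_recr/= (nact m)// mul0r addr0 -natr1 mulrDl mul1r ler_wpDr.
have [s' [us' hs'] bs'] := cnt m (ltnSn m) am.
exists (s ++ s').
  split.
    rewrite cat_uniq us us' andbT/=; apply/hasPn => x /hs'[/andP[x1 _] _].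
    apply/negP => /hs[[i [im _ /andP[_ x2]]] _].
    have : c + i%:R * delta + delta <= c + m%:R * delta.
      rewrite -addrA lerD2l -[X in _ + X]mul1r -mulrDl natr1; apply: ler_wpM2r; first exact: ltW.
      by rewrite ler_nat.
    by move=> h; move: (lt_le_trans (le_lt_trans x1 x2) h); rewrite ltxx.
  move=> x; rewrite mem_cat; split=> [/orP[/hs[[i [im ai xi]] zx]|/hs'[xm zx]]|].
  - by split=> //; exists i; split => //; exact: ltnW.
  - by split=> //; exists m.
  - move=> [[i [im ai xi]] zx]; apply/orP.
    move: im; rewrite ltnS leq_eqVlt => /orP[/eqP im|im]; last by left; apply/hs; split=> //; exists i.
    by right; apply/hs'; rewrite im in xi.
rewrite big_cat/= big_ord_recr/=; set p := phi (c + m%:R * delta).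
have e1M : 0 <= e * delta / (Mphi + 1).
  by apply: divr_ge0; [apply: mulr_ge0; exact: ltW|exact: addr_ge0].
have M1 : 0 < Mphi + 1 by rewrite ltr_wpDl.
have ed0 : 0 < e * delta by exact: mulr_gt0.
have h1 : Mphi * (e * delta / (Mphi + 1)) <= e * delta.
  rewrite mulrA ler_pdivrMr// [leRHS]mulrC; apply: ler_wpM2r; first exact: ltW.
  by rewrite lerDl.
have h2 : e * delta / (Mphi + 1) <= e * delta.
  by rewrite ler_pdivrMr// ler_peMr ?(ltW ed0)// lerDr.
have h3 : e * (e * delta) <= e * delta by rewrite ler_piMl// ltW.
have sz : (size s')%:R / r <= g * delta + e * delta.
  by move: bs'; rewrite ler_norml => /andP[_]; lra.
have d1 : `|\sum_(x <- s') phi x - (size s')%:R * p| <= (size s')%:R * e.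
  have -> : (size s')%:R * p = \sum_(x <- s') p by rewrite big_const_seq count_predT iter_addr_0 mulr_natl.
  rewrite -sumrB; apply: (le_trans (ler_norm_sum _ _ _)).
  have -> : (size s')%:R * e = \sum_(x <- s') e by rewrite big_const_seq count_predT iter_addr_0 mulr_natl.
  rewrite !big_seq; apply: ler_sum => x /hs'[/andP[x1 x2] _].
  by apply: osc => //; rewrite x1 ltW.
have d2 : `|(\sum_(x <- s') phi x) / r - p * (g * delta)| <= e * delta * (g + 2).
  have -> : (\sum_(x <- s') phi x) / r - p * (g * delta) =
      (\sum_(x <- s') phi x - (size s')%:R * p) / r + p * ((size s')%:R / r - g * delta).
    by field; rewrite gt_eqF.
  apply: (le_trans (ler_normD _ _)).
  have t1 : `|(\sum_(x <- s') phi x - (size s')%:R * p) / r| <= e * (g * delta + e * delta).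
    rewrite normrM normfV (gtr0_norm r0); apply: (@le_trans _ _ ((size s')%:R * e / r)).
      by rewrite ler_pM2r ?invr_gt0.
    by rewrite mulrAC mulrC; apply: ler_wpM2l => //; exact: ltW.
  have t2 : `|p * ((size s')%:R / r - g * delta)| <= e * delta.
    rewrite normrM; apply: le_trans h1; apply: ler_pM => //; exact: bnd.
  have -> : e * delta * (g + 2) = e * (g * delta) + e * delta + e * delta by ring.
  by apply: lerD => //; apply: (le_trans t1); rewrite mulrDr lerD2l.
rewrite -natr1 [leRHS]mulrDl mul1r.
have -> : (\sum_(x <- s) phi x + \sum_(x <- s') phi x) / r -
    g * (\sum_(i < m) phi (c + i%:R * delta) * delta + p * delta) =
    ((\sum_(x <- s) phi x) / r - g * \sum_(i < m) phi (c + i%:R * delta) * delta) +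
    ((\sum_(x <- s') phi x) / r - p * (g * delta)) by ring.
by apply: (le_trans (ler_normD _ _)); apply: lerD.
Qed.

(** On a circle the fundamental domain is itself an interval; on the line it is unbounded, and an
    interval containing the compact support replaces it. *)
Lemma fundamental_interval (phi : R -> R) (K : set R) : compact K ->
  (forall x, phi x != 0 -> saturate ell K x) ->
  exists c L : R, [/\ 0 < L, (forall x, c <= x < c + L -> fundamental_domain ell x) &
    forall x, phi x != 0 -> fundamental_domain ell x -> c <= x < c + L].
Proof.
move=> cK phiK; have [e0|e0] := eqVneq ell 0; last first.
  exists 0, ell; rewrite lt0r e0; split => // x; rewrite add0r => h; first by right.
  by case=> // e1; rewrite e1 eqxx in e0.
have [M [_ hM]] := compact_bounded cK.
have hM1 := hM (`|M| + 1) _; pose B := `|M| + 1.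
exists (- (B + 1)), (2 * (B + 1)).
have B0 : 0 < B by rewrite /B ltr_wpDl.
split; first by rewrite mulr_gt0//; lra.
  by move=> x _; left.
move=> x /phiK[k]; rewrite e0 mulr0 addr0 => Kx _.
have : `|x| <= B by apply: hM1 => //; rewrite (le_lt_trans (ler_norm M))// ltrDl.
by rewrite ler_norml => /andP[? ?]; apply/andP; split; lra.
Qed.

Theorem vague_convergence (phi : R -> R) : test_function ell U phi ->
  ((n^-1)%:E * \int[zeros_measure ell U n (F n)]_x (phi x)%:E)%E
    @[n --> within N (pinfty_nbhs R)] --> (g%:E * lebesgue_integral_on ell U phi)%E.
Proof.
move=> [cphi pphi [K [cK KU phiK]]].
have [c [L [L0 Dfd phiD]]] := fundamental_interval cK phiK.
have [rho rho0 hrho] := lebesgue_number cK oI KU.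
have cL : c <= c + L by rewrite lerDl ltW.
have [Mphi M0 hM] : exists2 Mphi : R, 0 <= Mphi & forall x, c <= x <= c + L -> `|phi x| <= Mphi.
  have [|z _ hz] := @EVT_max R (fun x => `|phi x|) c (c + L) cL.
    by apply: continuous_subspaceT => x; apply: cvg_norm; exact: cphi.
  by exists `|phi z| => // x xin; apply: hz; rewrite in_itv.
have mphi : measurable_fun (setT : set R) phi by exact: continuous_measurable_fun.
pose D : set R := [set` `[c, c + L[].
have phi0 x : ~ U x -> phi x = 0.
  move=> nU; apply: contrapT => /eqP /phiK[k Kx]; apply: nU.
  have [j Ij] := KU _ Kx; exists (k + j); rewrite (_ : x + _ = x + k%:~R * ell + j%:~R * ell)// intrD; ring.
have ID : lebesgue_integral_on ell U phi = (\int[lebesgue_measure]_(x in D) (phi x)%:E)%E.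
  rewrite /lebesgue_integral_on integral_mkcond [RHS]integral_mkcond; apply: eq_integral => x _.
  rewrite /patch; case: ifPn => h1; case: ifPn => h2 //.
    congr (_%:E); apply: contrapT => /eqP /phiD h; move/negP: h2; apply; rewrite inE.
    by rewrite inE in h1; have := h h1.2; rewrite /D /= in_itv.
  congr (_%:E); apply/esym; apply: contrapT => /eqP ph; move/negP: h1; apply; rewrite inE.
  split; first by apply: contrapT => /phi0 h; rewrite h eqxx in ph.
  by apply: Dfd; rewrite inE /D /= in_itv in h2.
have [iD _] : lebesgue_measure.-integrable D (EFin \o phi) /\ True.
  have [] := @riemann_sum R phi c L (2 * Mphi) 1 cphi L0 _; last by rewrite mul1r.
  move=> i x i1 xin; have -> : i = 0%N by case: i i1 {xin}.
  rewrite mul0r addr0; apply: (le_trans (ler_normB _ _)); rewrite mulr_natl mulr2n.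
  have i0 : i = 0%N by case: i i1 {xin}.
  by rewrite i0 mul0r addr0 in xin; apply: lerD; apply: hM => //; rewrite lexx.
pose Iphi := \int[lebesgue_measure]_(x in D) phi x.
have IDE : lebesgue_integral_on ell U phi = Iphi%:E.
  by rewrite ID /Iphi /Rintegral fineK//; apply: integrable_fin_num => //; exact: measurable_itv.
have key e : 0 < e -> exists n0 : nat, forall r, N r -> n0%:R <= r ->
    exists v, ((r^-1)%:E * \int[zeros_measure ell U r (F r)]_x (phi x)%:E)%E = v%:E /\
      `|v - g * Iphi| <= e.
  (* Total error per unit of [ep]: [L * (g + 2)] from the zero counts and [g * L] from the Riemann
     sum. *)
  move=> e0; pose C := L * (g + 2) + g * L.
  have C0 : 0 <= C.
    by rewrite /C; apply: addr_ge0; apply: mulr_ge0 => //; [exact: ltW|exact: addr_ge0|exact: ltW].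
  have C1 : 0 < C + 1 by rewrite ltr_wpDl.
  pose ep := Num.min 1 (e / (C + 1)).
  have ep0 : 0 < ep by rewrite lt_min ltr01 divr_gt0.
  have ep1 : ep <= 1 by rewrite ge_min lexx.
  have epC : ep * C <= e.
    have : ep <= e / (C + 1) by rewrite ge_min lexx orbT.
    rewrite ler_pdivlMr// => h; apply: le_trans h; apply: ler_wpM2l; first exact: ltW.
    by rewrite lerDl.
  have [du du0 hdu] := segment_modulus c (c + L) cphi ep0.
  (* The three bounds let an active cell be moved into [I], keep the oscillation of [phi] below
     [ep], and make the counts applicable, [delta0 / 2] giving a strict inequality. *)
  pose mu := Num.min (Num.min rho du) (delta0 / 2).
  have mu0 : 0 < mu by rewrite !lt_min rho0 du0 divr_gt0.
  have Lmu : 0 <= L / mu by apply: divr_ge0; exact: ltW.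
  pose m := (Num.truncn (L / mu)).+1.
  have m0 : 0 < m%:R :> R by rewrite ltr0n.
  pose delta := L / m%:R.
  have d0 : 0 < delta by exact: divr_gt0.
  have md : m%:R * delta = L by rewrite /delta mulrC divfK// gt_eqF.
  have dmu : delta <= mu.
    rewrite /delta ler_pdivrMr// mulrC -ler_pdivrMr//; apply: ltW.
    by have /andP[_] := truncn_itv Lmu.
  have [drho ddu dd0] : [/\ delta <= rho, delta <= du & delta < delta0].
    have h1 : mu <= rho by rewrite !ge_min lexx.
    have h2 : mu <= du by rewrite !ge_min lexx orbT.
    have h3 : mu <= delta0 / 2 by rewrite !ge_min lexx !orbT.
    by split; [exact: le_trans h1|exact: le_trans h2|];
      apply: (le_lt_trans (le_trans dmu h3)); rewrite ltr_pdivrMr// ltr_pMr// ltr1n.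
  have cell_in (i : nat) (x : R) : (i < m)%N -> c + i%:R * delta <= x <= c + i%:R * delta + delta -> c <= x <= c + L.
    move=> im /andP[x1 x2]; apply/andP; split.
      by apply: le_trans x1; rewrite lerDl; apply: mulr_ge0 => //; exact: ltW.
    apply: (le_trans x2); rewrite -addrA lerD2l -md -[X in _ + X]mul1r -mulrDl natr1.
    by apply: ler_wpM2r; [exact: ltW|rewrite ler_nat].
  have cell_lt (i : nat) (x : R) : (i < m)%N -> c + i%:R * delta <= x < c + i%:R * delta + delta -> c <= x < c + L.
    move=> im /andP[x1 x2]; apply/andP; split.
      by apply: le_trans x1; rewrite lerDl; apply: mulr_ge0 => //; exact: ltW.
    apply: (lt_le_trans x2); rewrite -addrA lerD2l -md -[X in _ + X]mul1r -mulrDl natr1.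
    by apply: ler_wpM2r; [exact: ltW|rewrite ler_nat].
  have left_in (j : nat) : c + j%:R * delta <= c + j%:R * delta <= c + j%:R * delta + delta.
    by rewrite lexx lerDl ltW.
  have osc (i : nat) (x : R) : (i < m)%N -> c + i%:R * delta <= x <= c + i%:R * delta + delta ->
      `|phi x - phi (c + i%:R * delta)| <= ep.
    move=> im xin; apply: hdu; first exact: (cell_in i _ im (left_in i)).
    by apply: le_trans ddu; move: xin => /andP[? ?]; rewrite ler_norml; apply/andP; split; lra.
  (* A cell meeting the support lies within [rho] of it and can be moved into [I]; nothing is known
     about the zeros in the other cells. *)
  pose act i := exists2 y, c + i%:R * delta <= y < c + i%:R * delta + delta & phi y != 0.
  have nact i : (i < m)%N -> ~ act i -> phi (c + i%:R * delta) = 0.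
    move=> im na; apply: contrapT => /eqP h; apply: na; exists (c + i%:R * delta) => //.
    by rewrite lexx ltrDl.
  pose e1 := ep * delta / (Mphi + 1).
  have e10 : 0 < e1 by apply: divr_gt0; [exact: mulr_gt0|exact: ltr_wpDl].
  have cnt i : exists n0 : nat, (i < m)%N -> act i -> forall r, N r -> n0%:R <= r ->
      exists2 s, enumerates s [set x | c + i%:R * delta <= x < c + i%:R * delta + delta /\
        zeros ell U r (F r) x] & `|(size s)%:R / r - g * delta| <= e1.
    have [[im ai]|h] := pselect ((i < m)%N /\ act i); last first.
      by exists 0%N => im ai; case: h.
    have [y yin /phiK[k0 Ky]] := ai; have [k1 hk1] := hrho _ Ky.
    have [||n0 hn0] := @cell_count (c + i%:R * delta) delta (k0 + k1) d0 dd0 _ _ e1 e10.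
    - move=> z zin; have := hk1 (z + k0%:~R * ell).
      rewrite (_ : z + k0%:~R * ell - (y + k0%:~R * ell) = z - y); last by ring.
      rewrite (_ : z + (k0 + k1)%:~R * ell = z + k0%:~R * ell + k1%:~R * ell); last by rewrite intrD; ring.
      apply; apply: le_trans drho; move: zin yin => /andP[? ?] /andP[? ?].
      by rewrite ler_norml; apply/andP; split; lra.
    - by move=> x /(cell_lt i x im); exact: Dfd.
    by exists n0.
  have [nf hnf] := choice cnt.
  exists (\max_(i < m) nf i)%N => r Nr hr.
  have r0 := N_gt0 Nr.
  have [|||s es bs] := @cells_prefix phi c delta ep Mphi act r m d0 _ Nr M0 osc _ nact _.
  - by rewrite ep0.
  - by move=> i im; apply: hM; exact: (cell_in i _ im (left_in i)).
  - move=> i im ai; apply: hnf => //; apply: le_trans hr; rewrite ler_nat.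
    exact: (leq_bigmax (Ordinal im)).
  (* The periodic function [phi] need not vanish off the fundamental domain. Adding this complement
     to [E] is harmless, since the chosen representatives of zeros all lie in the domain. *)
  pose E : set R := \bigcup_(i in [set i | (i < m)%N /\ act i])
    [set` `[c + i%:R * delta, c + i%:R * delta + delta[] `|` ~` [set x | fundamental_domain ell x].
  have es' : enumerates s (zeros ell U r (F r) `&` E).
    split; first exact: es.1.
    move=> x; split=> [/es.2[[i [im ai xi]] zx]|[zx [[i [im ai] xi]|]]].
    - by split=> //; left; exists i => //=; rewrite in_itv.
    - by apply/es.2; split => //; exists i; split => //; move: xi; rewrite /= in_itv.
    - by have [_ fx _] := zx.
  have phiE x : ~ E x -> phi x = 0.
    move=> nE; apply: contrapT => /eqP ph; apply: nE.
    have [fx|] := pselect (fundamental_domain ell x); last by right.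
    left; have /andP[x1 x2] := phiD x ph fx.
    have y0 : 0 <= (x - c) / delta by apply: divr_ge0; [rewrite subr_ge0|exact: ltW].
    have /andP[i1 i2] := truncn_itv y0.
    move: i1 i2; rewrite ler_pdivlMr// ltr_pdivrMr// => i1 i2.
    have xi : c + (Num.truncn ((x - c) / delta))%:R * delta <= x <
        c + (Num.truncn ((x - c) / delta))%:R * delta + delta.
      by move: i2; rewrite -natr1 => i2; apply/andP; split; lra.
    exists (Num.truncn ((x - c) / delta)); last by rewrite /= in_itv.
    split; last by exists x.
    rewrite -(ltr_nat R) -(ltr_pM2r d0) md; apply: (le_lt_trans i1); lra.
  exists ((\sum_(x <- s) phi x) / r); split.
    by rewrite /zeros_measure (integral_dirac_sum es' mphi phiE) -EFinM mulrC.
  have [_ hR] := @riemann_sum R phi c delta ep m cphi d0 osc.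
  move: hR; rewrite md -/D -/Iphi.
  move: bs; set S := \sum_(i < m) _ => bs hR.
  have -> : (\sum_(x <- s) phi x) / r - g * Iphi =
      ((\sum_(x <- s) phi x) / r - g * S) - g * (Iphi - S) by ring.
  apply: (le_trans (ler_normB _ _)); apply: le_trans epC.
  have -> : ep * C = m%:R * (ep * delta * (g + 2)) + g * (m%:R * (ep * delta)).
    by rewrite /C -md; ring.
  by apply: lerD => //; rewrite normrM (ger0_norm g_ge0); apply: ler_wpM2l.
have near_of (n0 : nat) (Q : R -> Prop) : (forall r, N r -> n0%:R <= r -> Q r) ->
    \forall n \near within N (pinfty_nbhs R), Q n.
  by move=> h; exists n0%:R; split=> // x /ltW hx Nx; exact: h.
rewrite IDE -EFinM; apply/fine_cvgP; split.
  have [n0 h] := key 1 ltr01; apply: (near_of n0) => r Nr hr.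
  by have [v [-> _]] := h r Nr hr.
apply/cvgrPdist_le => e e0; have [n0 h] := key e e0; apply: (near_of n0) => r Nr hr.
by have [v [e1 hv]] := h r Nr hr; rewrite /= e1 distrC.
Qed.

End zero_shifts.

(** * All rational intervals at once, and the conclusion *)

Section rational_counts.
Context {R : realType} {d : measure_display} {Omega : measurableType d}.
Variables (P : probability Omega R) (ell : R) (I N : set R) (f : \bar R -> R -> Omega -> R).
Let U := saturate ell I.
Hypothesis ell_ge0 : 0 <= ell.
Hypothesis oI : open I.
Hypothesis N_nat : forall k : nat, (0 < k)%N -> N k%:R.
Hypothesis gP : forall n, add_infty N n ->
  centered_gaussian_process P (dilated_period n ell) (dilate n U) (f n).
Hypothesis stat : stationary P (f +oo%E).
Hypothesis nz : non_zero P (f +oo%E).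
Hypothesis h1 : H1 P ell U N f 82.
Hypothesis h2 : H2 P ell U N f 82.

(** At most [1] for the bounds on path suprema, and on a circle at most half a period for the
    quotient distance. *)
Definition short_length : R := if ell == 0 then 1 else Num.min 1 (ell / 2).

Lemma short_length_gt0 : 0 < short_length.
Proof.
rewrite /short_length; case: ifPn => // e0.
by rewrite lt_min ltr01 divr_gt0// lt0r e0.
Qed.

Lemma rational_lln : \forall w \ae P, forall p q : rat, ratr p < ratr q :> R ->
  (forall x : R, ratr p <= x <= ratr q -> I x) -> ratr q - ratr p <= short_length ->
  forall e : R, 0 < e -> exists n0, forall n : nat, (n0 <= n)%N -> (0 < n)%N ->
  exists2 s, enumerates s [set t | n%:R * ratr p <= t < n%:R * ratr q /\ f n%:R%:E t w = 0] &
    `|(size s)%:R / n%:R - gamma1 P (f +oo%E) * (ratr q - ratr p)| <= e.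
Proof.
pose Q (pq : rat * rat) w := ratr pq.1 < ratr pq.2 :> R ->
  (forall x : R, ratr pq.1 <= x <= ratr pq.2 -> I x) -> ratr pq.2 - ratr pq.1 <= short_length ->
  forall e : R, 0 < e -> exists n0, forall n : nat, (n0 <= n)%N -> (0 < n)%N ->
  exists2 s, enumerates s [set t | n%:R * ratr pq.1 <= t < n%:R * ratr pq.2 /\ f n%:R%:E t w = 0] &
    `|(size s)%:R / n%:R - gamma1 P (f +oo%E) * (ratr pq.2 - ratr pq.1)| <= e.
(* Rational pairs are enumerated by [unpickle], so countably many null events are united; the
   conditions on a pair are not random and are decided before an exceptional event is taken. *)
suff : \forall w \ae P, forall n, if unpickle n is Some pq then Q pq w else True.
  by apply: filterS => w h p q; have := h (pickle (p, q)); rewrite pickleK.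
apply: ae_foralln => n; case: (unpickle n) => [[p q]|]; last exact: nearW.
have [pq|pq] := pselect (ratr p < ratr q :> R); last by apply: nearW => w /pq.
have [pqI|pqI] := pselect (forall x : R, ratr p <= x <= ratr q -> I x); last first.
  by apply: nearW => w _ /pqI.
have [pqs|pqs] := pselect (ratr q - ratr p <= short_length :> R); last first.
  by apply: nearW => w _ _ /pqs.
have [s1 s2] : ratr q - ratr p <= 1 :> R /\ (ell = 0 \/ ratr q - ratr p <= ell / 2).
  move: pqs; rewrite /short_length; have [->|e0] := eqVneq ell 0; first by split=> //; left.
  by rewrite le_min => /andP[]; split=> //; right.
have := process_lln ell_ge0 oI N_nat gP stat nz h1 h2 pq s1 pqI s2.
by apply: filterS => w hw _ _ _.
Qed.

End rational_counts.

Theorem corollary1p7 (R : realType) (d : measure_display)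
    (Omega : measurableType d) (P : probability Omega R)
    (ell : R) (I N : set R) (f : \bar R -> R -> Omega -> R) :
  let U := saturate ell I in
  0 <= ell ->
  open I -> is_interval I -> I !=set0 ->
  (forall n, N n -> 0 < n) -> ~ has_ubound N ->
  (forall n, add_infty N n ->
    centered_gaussian_process P (dilated_period n ell) (dilate n U) (f n)) ->
  stationary P (f +oo%E) -> non_zero P (f +oo%E) ->
  (forall q, (1 <= q)%N -> H1 P ell U N f q) ->
  (forall q, (1 <= q)%N -> H2 P ell U N f q) ->
  N = [set k%:R | k in [set k : nat | (1 <= k)%N]] \/
  N = [set n | 0 < n] /\
    (forall n s, 0 < n -> dilate n%:E I s -> f n%:E s = f +oo%E s) ->
  \forall w \ae P, forall phi : R -> R, test_function ell U phi ->
    ((n^-1)%:E * \int[zeros_measure ell U n ((f n%:E)^~ w)]_x (phi x)%:E)%E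
      @[n --> within N (pinfty_nbhs R)]
    --> ((gamma1 P (f +oo%E))%:E * lebesgue_integral_on ell U phi)%E.
Proof.
move=> U ell0 oI _ _ Npos _ gP st nz h1 h2 hN.
have N_nat (k : nat) : (0 < k)%N -> N k%:R.
  by move=> k0; case: hN => [->|[-> _]]; [exists k|rewrite /= ltr0n].
have g0 : 0 <= gamma1 P (f +oo%E) by rewrite mulr_ge0 ?sqrtr_ge0// invr_ge0 pi_ge0.
(* The order [82] is one more than the Rolle order [81], because bounding a derivative uniformly
   along a path requires the next one. *)
have := rational_lln ell0 oI N_nat gP st nz (h1 82%N isT) (h2 82%N isT).
apply: filterS => w hw phi hphi.
pose F r t := f r%:E t w.
(* In the first alternative [r] equals its integer part; in the second both processes coincide with
   [f +oo] at [t]. *)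
have F_trunc r t : N r -> 1 <= r -> dilate r%:E I t -> dilate (Num.truncn r)%:R%:E I t ->
    F r t = F (Num.truncn r)%:R t.
  move=> Nr r1 It Ikt; case: hN => [eN|[eN ef]].
    by move: Nr; rewrite eN => -[k _ <-]; rewrite natrK.
  have r0 : 0 < r by exact: lt_le_trans r1.
  rewrite /F (ef r t r0 It) (ef _ t _ Ikt)//.
  by rewrite ltr0n (truncn_ge_nat _ (ltW r0)).
have F_per r x : N r -> U x -> F r (r * (x + ell)) = F r (r * x).
  move=> Nr Ux; have rN : add_infty N r%:E by left; exists r.
  have [_ per _] := gP _ rN; rewrite /F mulrDr.
  by apply: per; exists x.
apply: (vague_convergence ell0 oI g0 (short_length_gt0 ell0) Npos F_per _ hphi).
move=> a b ab abI bad e e0.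
exact: (real_counts oI g0 F_trunc hw ab abI bad e0).
Qed.
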